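(* Let $n \geq 6$ and let $G$ be a connected Lie group with finite center, locally isomorphic to $O(2,n)$. Suppose that $G$ acts nontrivially on a connected manifold $M$ preserving a Lorentz metric. Then all noncompact stabilizers have a Lie algebra isomorphic to $\mathfrak{o}(1,n)$.
   Context: Two Lie groups are locally isomorphic if their Lie algebras are isomorphic. Stabilizers are those of points of $M$. *)

(* Defs.v *)
From HB Require Import structures.
From mathcomp Require Import all_boot all_order all_algebra.
From mathcomp Require Import all_classical all_reals all_analysis.
Import GRing.Theory Num.Theory.
Import numFieldNormedType.Exports.

Set Implicit Arguments.
Unset Strict Implicit.
Unset Printing Implicit Defensive.

Local Open Scope classical_set_scope.
Local Open Scope ring_scope.

Section smooth_on.
Context {R : realType} {V W : normedModType R}.

Definition continuous_at_all (U : set V) (f : V -> W) :=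
  forall x, U x -> {for x, continuous f}.

(* [U] is always open below, so that derivability at a point of [U] depends
   only on [f] restricted to [U]. *)
Fixpoint Ck_on (k : nat) (U : set V) (f : V -> W) : Prop :=
  if k is k'.+1 then
    [/\ continuous_at_all U f,
        forall x v, U x -> derivable f x v &
        forall v, Ck_on k' U ('D_v f)]
  else continuous_at_all U f.

Definition smooth_on (U : set V) (f : V -> W) := forall k, Ck_on k U f.

End smooth_on.

(* A chart with values in R^d: a homeomorphism from the open set [cdom] onto
   the open set [cimg], with inverse [cinv] (only meaningful on [cimg]). *)
Record chart (R : realType) (d : nat) (M : topologicalType) := Chart {
  cdom : set M;
  cimg : set 'rV[R]_d;
  cmap : M -> 'rV[R]_d;
  cinv : 'rV[R]_d -> M;
  cdom_open : open cdom;
  cimg_open : open cimg;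
  cmap_img : forall x, cdom x -> cimg (cmap x);
  cinv_dom : forall u, cimg u -> cdom (cinv u);
  cmapK : forall x, cdom x -> cinv (cmap x) = x;
  cinvK : forall u, cimg u -> cmap (cinv u) = u;
  cmap_cont : forall x, cdom x -> {for x, continuous cmap};
  cinv_cont : forall u, cimg u -> {for u, continuous cinv} }.

(* The atlas need not be maximal. *)
HB.mixin Record isSmoothManifold (R : realType) (d : nat) M
    of Topological M := {
  atlas : set (chart R d M);
  manifold_hausdorff : hausdorff_space M;
  manifold_second_countable : @second_countable M;
  atlas_cover : forall x : M, exists2 c, atlas c & cdom c x;
  atlas_compat : forall c c', atlas c -> atlas c' ->
    smooth_on (cimg c `&` cinv c @^-1` cdom c') (cmap c' \o cinv c) }.

#[short(type="manifoldType")]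
HB.structure Definition SmoothManifold (R : realType) (d : nat) :=
  {M of isSmoothManifold R d M & Topological M}.

Section smooth_maps.
Context {R : realType}.

Definition smooth_fun {d} {M : manifoldType R d} (f : M -> R) :=
  forall c : chart R d M, atlas c -> smooth_on (cimg c) (f \o cinv c : _ -> R^o).

Definition smooth_curve {d} {M : manifoldType R d} (f : R -> M) :=
  continuous f /\
  forall c : chart R d M, atlas c ->
    smooth_on (f @^-1` cdom c : set R^o) (cmap c \o f).

Definition smooth_map {d e} {M : manifoldType R d} {N : manifoldType R e}
    (f : M -> N) :=
  continuous f /\
  forall (c : chart R d M) (c' : chart R e N), atlas c -> atlas c' ->
    smooth_on (cimg c `&` cinv c @^-1` (f @^-1` cdom c'))
              (cmap c' \o f \o cinv c).

(* Smoothness of a map defined on the product manifold [M * N], expressed in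
   the product charts, which take values in R^(d + e). *)
Definition smooth_map2 {d e k} {M : manifoldType R d} {N : manifoldType R e}
    {P : manifoldType R k} (f : M -> N -> P) :=
  continuous (fun z : M * N => f z.1 z.2) /\
  forall (c : chart R d M) (c' : chart R e N) (c'' : chart R k P),
    atlas c -> atlas c' -> atlas c'' ->
    let F (w : 'rV[R]_(d + e)) := f (cinv c (lsubmx w)) (cinv c' (rsubmx w)) in
    smooth_on [set w | [/\ cimg c (lsubmx w), cimg c' (rsubmx w) &
                           cdom c'' (F w)]]
              (cmap c'' \o F).

End smooth_maps.

#[short(type="groupManifoldType")]
HB.structure Definition GroupManifold (R : realType) (d : nat) :=
  {G of SmoothManifold R d G & Group G}.

HB.mixin Record isLieGroup (R : realType) (d : nat) G
    of GroupManifold R d G := {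
  lie_mul_smooth : smooth_map2 (fun x y : G => (x * y)%g);
  lie_inv_smooth : smooth_map (fun x : G => (x^-1)%g) }.

#[short(type="lieGroupType")]
HB.structure Definition LieGroup (R : realType) (d : nat) :=
  {G of isLieGroup R d G & GroupManifold R d G}.

Definition center_set (G : groupType) : set G :=
  [set z | forall x, (z * x = x * z)%g].

(* Lie algebras are presented as subspaces of an ambient vector space, closed
   under a bracket operation of that space. All brackets below are commutators,
   so that alternation and the Jacobi identity are automatic. *)
Definition lie_subalgebra {R : realType} {V : lmodType R}
    (br : V -> V -> V) (g : set V) :=
  [/\ g 0,
      forall (a : R) x y, g x -> g y -> g (a *: x + y)
    & forall x y, g x -> g y -> g (br x y)].

Section lie_isomorphic.
Context {R : realType} {V W : lmodType R}.

Definition lie_isomorphic (brV : V -> V -> V) (g : set V)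
    (brW : W -> W -> W) (h : set W) :=
  lie_subalgebra brV g /\ lie_subalgebra brW h /\
  exists phi : V -> W,
    [/\ set_bij g h phi,
        forall (a : R) x y, g x -> g y -> phi (a *: x + y) = a *: phi x + phi y
      & forall x y, g x -> g y -> phi (brV x y) = brW (phi x) (phi y)].

End lie_isomorphic.

Section lie_algebra.
Context {R : realType} {d : nat}.

(* Vector fields on [M] are the derivations of the algebra of smooth real
   functions. They are encoded as operators on all functions [M -> R], with the
   value 0 on the functions which are not smooth, so that equality of operators
   is equality of vector fields. *)
Definition vector_field {M : manifoldType R d}
    (X : (M -> R^o) -> (M -> R^o)) :=
  [/\ forall f, smooth_fun f -> smooth_fun (X f),
      forall (a : R) f h, smooth_fun f -> smooth_fun h ->
        X (fun p => a * f p + h p) = (fun p => a * X f p + X h p),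
      forall f h, smooth_fun f -> smooth_fun h ->
        X (fun p => f p * h p) = (fun p => f p * X h p + X f p * h p)
    & forall f, ~ smooth_fun f -> X f = (fun=> 0)].

Definition field_bracket {M : manifoldType R d}
    (X Y : (M -> R^o) -> (M -> R^o)) : (M -> R^o) -> (M -> R^o) :=
  fun f p => X (Y f) p - Y (X f) p.

Definition left_invariant {G : lieGroupType R d}
    (X : (G -> R^o) -> (G -> R^o)) :=
  forall (a : G) f, smooth_fun f ->
    X (fun x => f (a * x)%g) = (fun x => X f (a * x)%g).

Definition lie_algebra (G : lieGroupType R d) :
    set ((G -> R^o) -> (G -> R^o)) :=
  [set X | vector_field X /\ left_invariant X].

(* [gamma] is t |-> exp (t X). *)
Definition one_parameter_subgroup {G : lieGroupType R d}
    (X : (G -> R^o) -> (G -> R^o)) (gamma : R -> G) :=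
  [/\ smooth_curve gamma,
      forall s t, gamma (s + t) = (gamma s * gamma t)%g
    & forall f, smooth_fun f ->
        forall t : R^o, is_derive t 1 (f \o gamma : R^o -> R^o)
                                      (X f (gamma t))].

(* The Lie algebra of a closed subgroup [H] of [G], as a subalgebra of that of
   [G]: the X such that exp (t X) lies in [H] for all t. *)
Definition subgroup_lie_algebra (G : lieGroupType R d) (H : set G) :
    set ((G -> R^o) -> (G -> R^o)) :=
  [set X | lie_algebra X /\
           exists2 gamma, one_parameter_subgroup X gamma &
                          forall t, H (gamma t)].

End lie_algebra.

Section indefinite_orthogonal.
Context {R : realType}.

(* diag(-1, ..., -1, 1, ..., 1) with [p] negative entries. *)
Definition signature_mx (p N : nat) : 'M[R]_N :=
  diag_mx (\row_(i < N) if (i < p)%N then -1 else 1).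

Definition indefinite_orthogonal_group (p q : nat) : set 'M[R]_(p + q) :=
  [set A | A^T *m signature_mx p (p + q) *m A = signature_mx p (p + q)].

(* The Lie algebra of a closed group [H] of invertible matrices: the A such that
   exp (t A), here [gamma t], lies in [H] for all t. *)
Definition mx_lie_algebra (N : nat) (H : set 'M[R]_N) : set 'M[R]_N :=
  [set A | exists gamma : R -> 'M[R]_N,
     [/\ gamma 0 = 1%:M,
         forall s t, gamma (s + t) = gamma s *m gamma t,
         is_derive (0 : R^o) 1 gamma A
       & forall t, H (gamma t)]].

Definition mx_bracket (N : nat) (A B : 'M[R]_N) := A *m B - B *m A.

(* Equivalently, the space of A with A^T J + J A = 0, where
   J = signature_mx p (p + q). *)
Definition lie_o (p q : nat) : set 'M[R]_(p + q) :=
  mx_lie_algebra (@indefinite_orthogonal_group p q).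

End indefinite_orthogonal.

Definition locally_isomorphic_to_O (R : realType) (d : nat)
    (G : lieGroupType R d) (p q : nat) :=
  lie_isomorphic field_bracket (lie_algebra (G := G))
                 (@mx_bracket R _) (@lie_o R p q).

Section lorentz.
Context {R : realType} {d : nat} {M : manifoldType R d}.

(* Gram matrices of a field of bilinear forms in the coordinates of each
   chart. *)
Definition gram_field := chart R d M -> 'rV[R]_d -> 'M[R]_d.

(* [f] pulls the field of bilinear forms [g] back to itself. Tangent vectors
   are rows: ['d F u v = v *m jacobian F u]. *)
Definition preserves_gram (g : gram_field) (f : M -> M) :=
  forall c c' : chart R d M, atlas c -> atlas c' ->
  forall u, cimg c u -> cdom c' (f (cinv c u)) ->
    let F := cmap c' \o f \o cinv c in
    jacobian F u *m g c' (F u) *m (jacobian F u)^T = g c u.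

Definition lorentz_form (S : 'M[R]_d) :=
  S^T = S /\
  exists2 P : 'M[R]_d, P \in unitmx & P *m S *m P^T = signature_mx 1 d.

(* The last condition is the compatibility of the Gram matrices under changes of
   charts. *)
Definition lorentz_metric (g : gram_field) :=
  [/\ (2 <= d)%N,
      forall c, atlas c -> smooth_on (cimg c) (g c),
      forall c u, atlas c -> cimg c u -> lorentz_form (g c u)
    & preserves_gram g idfun].

End lorentz.

Section actions.
Context {R : realType} {d m : nat} {G : lieGroupType R d} {M : manifoldType R m}.

Definition smooth_action (act : G -> M -> M) :=
  [/\ forall x, act 1%g x = x,
      forall a b x, act (a * b)%g x = act a (act b x)
    & smooth_map2 act].

Definition stabilizer (act : G -> M -> M) (x : M) : set G :=
  [set a | act a x = x].

End actions.

(* Main.v *)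
(* Let H be a noncompact stabilizer, tau : g -> T_x M the differential at 1 of the orbit map at x
   and q the pull-back by tau of the Lorentz form of T_x M. The kernel of tau is the Lie algebra of
   H, and q is invariant under Ad H.
   - Newton's method along one-parameter subgroups, started at the nondegeneracy of the Killing form,
     shows that Ad G is conjugation by elements of O(2,n). The center being finite, H is compact as
     soon as the corresponding elements of O(2,n) are bounded. So there are c_k in O(2,n), unbounded,
     preserving q. A cluster point of c_k / |c_k| has rank at most 2 and provides an isotropic vector
     p such that q vanishes on the p ^ f, for f in a subspace of codimension at most 2 contained in
     the orthogonal of p.
   - A Lorentz form has no isotropic plane. Using only this, brackets of decomposable bivectors and
     n >= 6, one finds that ker tau is either o(2,n) or the stabilizer of a negative vector, which
     is o(1,n) by a reflection.
   - In the first case G fixes x. The isotropy representation maps each p ^ f (p isotropic, f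
     orthogonal to p) to a nilpotent matrix. Orbit maps of this representation are again subject to
     the classification, and it follows that the representation is trivial. Hence the Killing fields of
     the action vanish to first order at x. The Killing equation bounds their second derivatives by
     their 1-jet, so they vanish near x, and everywhere by connectedness: the action is trivial. *)

Require Import Defs.
From HB Require Import structures.
From mathcomp Require Import all_boot all_order all_algebra.
From mathcomp Require Import all_classical all_reals all_analysis.
From mathcomp Require Import ring lra zify.
Import Order.TTheory GRing.Theory Num.Theory.
Import numFieldNormedType.Exports.

Set Implicit Arguments.
Unset Strict Implicit.
Unset Printing Implicit Defensive.

Local Open Scope classical_set_scope.
Local Open Scope ring_scope.

(** * Differential calculus of C^k maps *)

(** The bound n >= 6 is a dimension count. A subspace of R^(2+n) cut out by fewer than n linear
    equations contains a positive vector f, and up to five equations are imposed on f at once. Such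
    an f is an intermediary: if f is orthogonal to e and l, the bracket of e ^ f and f ^ l is <f,f>
    e ^ l. The absence of isotropic planes is used in one recurring way: a totally isotropic family
    of values of [tau] lies on a line, so that being in its kernel costs only one more equation.
    One-parameter subgroups of G are needed both for the invariance of q and for the stabilizer
    algebra. In O(2,n), polynomial ones exist for nilpotent generators, and the others follow from
    the linearity of [lie_o], which is part of the hypothesis of local isomorphism. They are lifted
    to G through Ad: the finite center makes a small compact neighbourhood of 1 meet the kernel of
    Ad only in 1, and a minimisation argument makes Ad locally onto the automorphisms. Vectors are
    rows, so matrices act on the right and compositions appear in reversed order. *)

Section Ck_general.
Context {R : realType} {V W : normedModType R}.
Implicit Types (U : set V) (f g : V -> W).

Lemma Ck_on_sub k U U' f : U' `<=` U -> Ck_on k U f -> Ck_on k U' f.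
Proof.
elim: k f => [|k IH] f UU' /=; first by move=> cf x /UU'; exact: cf.
by move=> [cf df Df]; split=> [x /UU'|x v /UU'|v]; [exact: cf|exact: df|exact: IH].
Qed.

Lemma Ck_on_cont k U f : Ck_on k U f -> continuous_at_all U f.
Proof. by case: k => [|k] // []. Qed.

Lemma Ck_onW k U f : Ck_on k.+1 U f -> Ck_on k U f.
Proof.
elim: k f => [|k IH] f [cf df Df] //.
by split => // v; apply: IH; exact: Df.
Qed.

(** Openness of [U] turns equality on [U] into equality near each of its points, which is all that
    limits of difference quotients see. *)
Lemma Ck_on_eq k U f g : open U -> (forall x, U x -> f x = g x) ->
  Ck_on k U f -> Ck_on k U g.
Proof.
move=> oU; elim: k f g => [|k IH] f g fg.
  move=> cf x Ux; have nE : \forall y \near x, f y = g y.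
    by apply: filterS (open_nbhs_nbhs (conj oU Ux)) => y; exact: fg.
  rewrite /prop_for /continuous_at -(fg _ Ux).
  by apply: cvg_trans (cf x Ux); apply: near_eq_cvg.
move=> [cf df Df].
have nE x : U x -> \forall y \near x, f y = g y.
  by move=> Ux; apply: filterS (open_nbhs_nbhs (conj oU Ux)) => y; exact: fg.
split=> [x Ux|x v Ux|v].
- rewrite /prop_for /continuous_at -(fg _ Ux).
  by apply: cvg_trans (cf x Ux); apply: near_eq_cvg; exact: nE.
- exact: near_eq_derivable (nE _ Ux) (df _ _ Ux).
- apply: IH (Df v) => x Ux; exact: near_eq_derive (nE _ Ux).
Qed.

(** Every condition in [Ck_on] concerns one point of [U] and a function defined everywhere, so any
    cover will do, with open pieces or not. *)
Lemma Ck_on_cover k U f :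
  (forall x, U x -> exists2 U', U' x & Ck_on k U' f) -> Ck_on k U f.
Proof.
elim: k f => [|k IH] f H /=.
  by move=> x /H[U' U'x]; apply.
split=> [x /H[U' U'x [cf _ _]]|x v /H[U' U'x [_ df _]]|v].
- exact: cf.
- exact: df.
- apply: IH => x Ux; have [U' U'x [_ _ Df]] := H x Ux.
  by exists U' => //; exact: Df.
Qed.

Lemma Ck_on_cst k U (a : W) : Ck_on k U (cst a).
Proof.
elim: k a => [|k IH] a /=; first by move=> x _; exact: cst_continuous.
split=> [x _|x v _|v]; [exact: cst_continuous|exact: derivable_cst|].
have -> : 'D_v (cst a) = cst 0 :> (V -> W) by apply/funext => x; exact: derive_cst.
exact: IH.
Qed.

Lemma Ck_onD k U f g : open U -> Ck_on k U f -> Ck_on k U g -> Ck_on k U (f + g).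
Proof.
move=> oU; elim: k f g => [|k IH] f g.
  by move=> cf cg x Ux; apply: continuousD; [exact: cf|exact: cg].
move=> [cf df Df] [cg dg Dg]; split=> [x Ux|x v Ux|v].
- by apply: continuousD; [exact: cf|exact: cg].
- by apply: derivableD; [exact: df|exact: dg].
- apply: (Ck_on_eq oU _ (IH _ _ (Df v) (Dg v))) => x Ux.
  by rewrite deriveD //; [exact: df|exact: dg].
Qed.

Lemma Ck_onZ k U (a : R) f : open U -> Ck_on k U f -> Ck_on k U (a \*: f).
Proof.
move=> oU; elim: k f => [|k IH] f.
  by move=> cf x Ux; apply: continuousZr; exact: cf.
move=> [cf df Df]; split=> [x Ux|x v Ux|v].
- by apply: continuousZr; exact: cf.
- by apply: derivableZ; exact: df.
- apply: (Ck_on_eq oU _ (IH _ (Df v))) => x Ux.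
  by rewrite deriveZ //; exact: df.
Qed.

Lemma Ck_on_sum k U (I : Type) (s : seq I) (P : pred I) (F : I -> V -> W) : open U ->
  (forall i, P i -> Ck_on k U (F i)) ->
  Ck_on k U (fun x => \sum_(i <- s | P i) F i x).
Proof.
move=> oU H; rewrite -fct_sumE; elim/big_ind: _ => //.
- exact: Ck_on_cst.
- by move=> f g; exact: Ck_onD.
Qed.

(** The difference quotients of [f \o A] in direction [v] are literally those of [f] in direction
    [L v]. Hence no chain rule is involved, and the target may be any normed space. *)
Lemma Ck_on_affine (V' : normedModType R) (A L : V' -> V) k U f :
  (forall h v x, A (h *: v + x) = h *: L v + A x) -> continuous A ->
  Ck_on k U f -> Ck_on k (A @^-1` U) (f \o A).
Proof.
move=> HA cA; elim: k f => [|k IH] f.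
  by move=> cf x Ux; apply: continuous_comp; [exact: cA|exact: cf].
have E (v x : V') : (fun h => h^-1 *: (((f \o A) \o shift x) (h *: v) - (f \o A) x))
    = (fun h => h^-1 *: ((f \o shift (A x)) (h *: L v) - f (A x))).
  by apply/funext => h /=; rewrite HA.
move=> [cf df Df]; split=> [x Ux|x v Ux|v].
- by apply: continuous_comp; [exact: cA|exact: cf].
- by rewrite /derivable E; exact: df.
- have -> : 'D_v (f \o A) = ('D_(L v) f) \o A.
    by apply/funext => x; rewrite /derive E.
  exact: IH (Df (L v)).
Qed.

End Ck_general.

Section Ck_scalar.
Context {R : realType} {V : normedModType R}.

Lemma Ck_onM k (U : set V) (f g : V -> R) : open U ->
  Ck_on k U f -> Ck_on k U g -> Ck_on k U (f * g).
Proof.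
move=> oU; elim: k f g => [|k IH] f g.
  by move=> cf cg x Ux; apply: continuousM; [exact: cf|exact: cg].
move=> Hf Hg; have [cf df Df] := Hf; have [cg dg Dg] := Hg.
split=> [x Ux|x v Ux|v].
- by apply: continuousM; [exact: cf|exact: cg].
- by apply: derivableM; [exact: df|exact: dg].
- apply: (Ck_on_eq oU _ (Ck_onD oU (IH _ _ (Ck_onW Hf) (Dg v)) (IH _ _ (Ck_onW Hg) (Df v)))).
  by move=> x Ux; rewrite deriveM //; [exact: df|exact: dg].
Qed.

Lemma Ck_on_prod k (U : set V) (I : Type) (s : seq I) (P : pred I) (F : I -> V -> R) :
  open U -> (forall i, P i -> Ck_on k U (F i)) ->
  Ck_on k U (fun x => \prod_(i <- s | P i) F i x).
Proof.
move=> oU H; elim: s => [|i s IH].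
  under eq_fun do rewrite big_nil; exact: (Ck_on_cst _ _ (1 : R)).
under eq_fun do rewrite big_cons.
case: (boolP (P i)) => Pi //; apply: Ck_onM => //; exact: H.
Qed.

Lemma continuous_mx p q (f : V -> 'M[R]_(p, q)) x :
  (forall i j, {for x, continuous (fun y => f y i j)}) -> {for x, continuous f}.
Proof.
move=> H; apply/cvgrPdist_le => /= e e0; near=> y.
rewrite /Num.Def.normr/= mx_normrE (bigmax_le _ (ltW e0))//= => -[i j] _ /=.
rewrite !mxE; move: i j; near: y.
apply: filter_forall => i; apply: filter_forall => j.
by have /cvgrPdist_le := H i j; apply.
Unshelve. all: by end_near. Qed.

Lemma continuous_mx_coord p q (f : V -> 'M[R]_(p, q)) x i j :
  {for x, continuous f} -> {for x, continuous (fun y => f y i j)}.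
Proof.
move=> H; apply: (@continuous_comp _ _ _ f (fun M : 'M[R]_(p, q) => M i j)) => //.
exact: coord_continuous.
Qed.

Lemma Ck_on_mxP k (U : set V) p q (f : V -> 'M[R]_(p, q)) : open U ->
  Ck_on k U f <-> (forall i j, Ck_on k U (fun x => f x i j : R)).
Proof.
move=> oU; split; elim: k f => [|k IH] f.
- by move=> cf i j x Ux; apply: continuous_mx_coord; exact: cf.
- move=> [cf df Df] i j; split=> [x Ux|x v Ux|v].
  + by apply: continuous_mx_coord; exact: cf.
  + by have /derivable_mxP := df x v Ux; apply.
  + apply: (Ck_on_eq oU _ (IH _ (Df v) i j)) => x Ux.
    by rewrite derive_mx ?mxE //; exact: df.
- by move=> H x Ux; apply: continuous_mx => i j; exact: H.
- move=> H.
  have df x v : U x -> derivable f x v.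
    by move=> Ux; apply/derivable_mxP => i j; case: (H i j) => _ + _; exact.
  split=> [x Ux|//|v].
  + by apply: continuous_mx => i j; case: (H i j) => + _ _; exact.
  + apply: IH => i j; have [_ _ /(_ v)] := H i j.
    by apply: Ck_on_eq => // x Ux; rewrite derive_mx ?mxE //; exact: df.
Qed.

End Ck_scalar.

(** * Directional derivatives: linearity, total differentiability, chain rule, symmetry *)

Section directional.
Context {R : realType} {V : normedModType R}.
Implicit Types (f : V -> R) (U : set V).

Lemma near_line2 (P : V -> Prop) (x v w : V) : (\forall y \near x, P y) ->
  \forall h \near (0 : R), forall a b, `|a| <= `|h| -> `|b| <= `|h| ->
    P (a *: v + (b *: w + x)).
Proof.
move=> /nbhs_ballP[r /= r0 Hr].
have M0 : 0 < `|v| + `|w| + 1 by rewrite ltr_wpDl // addr_ge0.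
apply: filterS (nbhs0_lt (divr_gt0 r0 M0)) => h hr a b ah bh.
apply: Hr; rewrite -ball_normE /ball_ /=.
have -> : x - (a *: v + (b *: w + x)) = - (a *: v + b *: w).
  by rewrite addrA opprD addrCA subrr addr0.
rewrite normrN (le_lt_trans (ler_normD _ _)) // !normrZ.
apply: (@le_lt_trans _ _ (`|h| * (`|v| + `|w| + 1))).
  rewrite mulrDr mulr1 mulrDr ler_wpDr // lerD // ler_wpM2r //.
by rewrite -ltr_pdivlMr.
Qed.

Lemma is_derive_line f (x v : V) t : derivable f (t *: v + x) v ->
  is_derive (t : R^o) 1 (fun s : R^o => f (s *: v + x) : R^o) ('D_v f (t *: v + x)).
Proof.
move=> df.
have E : (fun h : R => h^-1 *: (((fun s : R^o => f (s *: v + x)) \o shift t) (h *: 1) - f (t *: v + x)))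
  = (fun h => h^-1 *: ((f \o shift (t *: v + x)) (h *: v) - f (t *: v + x))).
  by apply/funext => h /=; rewrite [h *: 1]mulr1 scalerDl addrA.
by split; rewrite /derivable /derive E.
Qed.

Lemma mvt_line f (x v : V) (h : R) :
  (forall a : R, `|a| <= `|h| -> derivable f (a *: v + x) v) ->
  exists2 a : R, `|a| <= `|h| & f (h *: v + x) - f x = h * 'D_v f (a *: v + x).
Proof.
move=> df; pose g (s : R) := f (s *: v + x).
have ig a : `|a| <= `|h| -> is_derive (a : R) 1 g ('D_v f (a *: v + x)).
  by move=> ah; exact: is_derive_line (df _ ah).
have cg (a b : R) : (forall t, t \in `[a, b] -> `|t| <= `|h|) ->
    {within `[a, b], continuous g}.
  move=> H; apply: derivable_within_continuous => t tab.
  by case: (ig t (H _ tab)).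
have g0 : g 0 = f x by rewrite /g scale0r add0r.
have [h0|/ltW h0] := leP 0 h.
  have Hab t : t \in `[0, h] -> `|t| <= `|h|.
    by rewrite in_itv /= => /andP[t0 th]; rewrite !ger0_norm.
  have [|c c0h E] := @MVT_segment R g (fun a => 'D_v f (a *: v + x)) 0 h h0 _ (cg _ _ Hab).
    by move=> t t0h; apply: ig; apply: Hab; exact: subset_itv_oo_cc.
  by exists c; [exact: Hab|rewrite -/(g h) -g0 E subr0 mulrC].
have Hab t : t \in `[h, 0] -> `|t| <= `|h|.
  by rewrite in_itv /= => /andP[t0 th]; rewrite !ler0_norm // lerN2.
have [|c c0h E] := @MVT_segment R g (fun a => 'D_v f (a *: v + x)) h 0 h0 _ (cg _ _ Hab).
  by move=> t t0h; apply: ig; apply: Hab; exact: subset_itv_oo_cc.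
exists c; [exact: Hab|rewrite -/(g h) -g0].
by rewrite -opprB E sub0r mulrN opprK mulrC.
Qed.

(** The increment along [c *: v + w] is split into a leg along [w] and a leg along [v]. The mean
    value theorem turns the second one into ['D_v f] at a nearby point, and ['D_v f] is
    continuous. *)
Lemma derive_lin2 U f (x v w : V) (c : R) : open U -> U x -> Ck_on 1 U f ->
  'D_(c *: v + w) f x = c * 'D_v f x + 'D_w f x.
Proof.
move=> oU Ux [cf df Df].
apply/cvg_lim => //; apply/cvgrPdist_le => /= e e0.
have nU : \forall y \near x, U y by exact: open_nbhs_nbhs.
have := df x w Ux; move=> /cvgrPdist_le /(_ (e / 2)) /=.
rewrite divr_gt0 // => /(_ isT) Hw.
have c1 : 0 < `|c| + 1 by rewrite ltr_wpDl.
have e2 : 0 < e / 2 / (`|c| + 1) by rewrite !divr_gt0.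
have nv : \forall y \near x, `|'D_v f x - 'D_v f y| <= e / 2 / (`|c| + 1).
  by have /cvgrPdist_le := Df v x Ux; apply.
have nh : \forall h \near (0 : R), forall a b, `|a| <= `|c| * `|h| -> `|b| <= `|h| ->
    U (a *: v + (b *: w + x)) /\ `|'D_v f x - 'D_v f (a *: v + (b *: w + x))| <= e / 2 / (`|c| + 1).
  apply: filterS (near_line2 (c *: v) w (filterI nU nv)) => h Hh a b ah bh.
  (* The neighbourhood was taken for the direction [c *: v], so a coefficient [a] of [v] has to be
     read as [(a / c)] times [c]; for [c = 0] the bound forces [a = 0]. *)
  have [c0|c0] := eqVneq c 0.
    have a0 : a = 0 by apply/eqP; rewrite -normr_le0; move: ah; rewrite c0 normr0 mul0r.
    by have := Hh 0 b; rewrite a0 !scale0r normr0; apply.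
  have := Hh (a / c) b; rewrite scalerA divfK //; apply => //.
  by rewrite normrM normfV ler_pdivrMr ?normr_gt0 // mulrC.
near=> h.
have h0 : h != 0 by near: h; exact: nbhs_dnbhs_neq.
have Hh : forall a b, `|a| <= `|c| * `|h| -> `|b| <= `|h| ->
    U (a *: v + (b *: w + x)) /\ `|'D_v f x - 'D_v f (a *: v + (b *: w + x))| <= e / 2 / (`|c| + 1).
  by near: h; exact: nbhs_dnbhs.
have /= [|a ah E] := @mvt_line f (h *: w + x) v (c * h).
  move=> a; rewrite normrM => ah; apply: df; by case: (Hh a h ah (lexx _)).
have -> : f (h *: (c *: v + w) + x) - f x
    = (c * h) * 'D_v f (a *: v + (h *: w + x)) + (f (h *: w + x) - f x).
  by rewrite -E scalerDr scalerA (mulrC h) addrA addrA subrK.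
rewrite scalerDr.
have -> : h^-1 *: (c * h * 'D_v f (a *: v + (h *: w + x))) = c * 'D_v f (a *: v + (h *: w + x)).
  by rewrite /GRing.scale /=; field.
rewrite opprD addrACA (le_trans (ler_normD _ _)) // [leRHS](splitr e) lerD //; last by near: h.
rewrite -mulrBr normrM.
rewrite normrM in ah.
have [_ Hd] := Hh a h ah (lexx _).
apply: (le_trans (ler_wpM2l (normr_ge0 c) Hd)).
rewrite mulrA ler_pdivrMr // mulrC ler_wpM2l ?lerDl // divr_ge0 // ltW //.
Unshelve. all: by end_near. Qed.

End directional.

Lemma derive_line0 (R : realType) (V W : normedModType R) (f : V -> W) x v :
  'D_v f x = 'D_1 (fun t : R^o => f (t *: v + x)) 0.
Proof.
have E : (fun h : R => h^-1 *: (((fun t : R^o => f (t *: v + x)) \o shift 0) (h *: 1) - f (0 *: v + x)))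
   = (fun h => h^-1 *: ((f \o shift x) (h *: v) - f x)).
  by apply/funext => h /=; rewrite addr0 scale0r add0r [h *: 1]mulr1.
by rewrite /derive E.
Qed.

Section finite_dim.
Context {R : realType} {d : nat}.
Implicit Types (f : 'rV[R]_d -> R) (U : set 'rV[R]_d).

Local Notation e_ i := (delta_mx 0 i : 'rV[R]_d).

Definition lincomb (a : 'I_d -> R) (h : 'rV[R]_d) : R := \sum_i h 0 i * a i.

Lemma lincomb_is_linear a : linear (lincomb a : 'rV[R]_d -> R^o).
Proof.
move=> c u v; rewrite /lincomb scaler_sumr -big_split /=; apply: eq_bigr => i _.
by rewrite !mxE mulrDl /GRing.scale /= mulrA.
Qed.

HB.instance Definition _ (a : 'I_d -> R) :=
  GRing.isLinear.Build R 'rV[R]_d R^o _ (lincomb a) (lincomb_is_linear a).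

Lemma lincomb_continuous a : continuous (lincomb a).
Proof.
move=> x; rewrite /lincomb.
have : Ck_on 0 setT (fun h : 'rV[R]_d => \sum_i h 0 i * a i) by
  apply: Ck_on_sum => [|i _]; [exact: openT|apply: Ck_onM => [|y _|y _]; [exact: openT|exact: coord_continuous|exact: cst_continuous]].
by move/(_ x I).
Qed.

Lemma rV_norm_coord (h : 'rV[R]_d) i : `|h 0 i| <= `|h|.
Proof.
rewrite [leRHS]/Num.Def.normr /= mx_normrE.
exact: (le_bigmax _ (fun i : 'I_1 * 'I_d => `|h i.1 i.2|) (0, i)).
Qed.

Lemma C1_derive_sum U f x v : open U -> U x -> Ck_on 1 U f ->
  'D_v f x = lincomb (fun i => 'D_(e_ i) f x) v.
Proof.
move=> oU Ux cf.
have D0 : 'D_0 f x = 0 by rewrite derive0.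
rewrite {1}(row_sum_delta v) /lincomb.
elim/big_rec2: _ => [//|i y1 y2 _ <-].
by rewrite (derive_lin2 _ _ _ oU Ux cf).
Qed.

(** The mean value theorem along [h] gives ['D_h f] at a point of the segment, and continuity of the
    partial derivatives compares it with the value at [x]. The tolerance [e / (d + 1)] per
    coordinate also covers [d = 0]. *)
Lemma C1_is_diff U f x : open U -> U x -> Ck_on 1 U f ->
  differentiable f x /\ 'd f x = lincomb (fun i => 'D_(e_ i) f x) :> ('rV[R]_d -> R).
Proof.
move=> oU Ux cf; pose a i := 'D_(e_ i) f x.
have E : f \o shift x = cst (f x) + lincomb a +o_ (0 : 'rV[R]_d) id.
  apply/eqaddoP => e e0.
  have d0 : 0 < (d%:R + 1 : R) by rewrite ltr_wpDl.
  have ed : 0 < e / (d%:R + 1) by rewrite divr_gt0.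
  have nx : \forall y \near x, U y /\ forall i, `|a i - 'D_(e_ i) f y| <= e / (d%:R + 1).
    near=> y; split; first by near: y; exact: open_nbhs_nbhs.
    near: y; apply: filter_forall => i.
    by case: cf => _ _ /(_ (e_ i) x Ux) /cvgrPdist_le; apply.
  have /nbhs_ballP[r /= r0 Hr] := nx.
  apply: filterS (nbhs0_lt r0) => h h0.
  have hr t : `|t| <= 1 -> ball x r (t *: h + x).
    move=> t1; rewrite -ball_normE /ball_ /= opprD addrCA subrr addr0 normrN normrZ.
    by rewrite (@le_lt_trans _ _ `|h|) // ?ler_piMl.
  have [|t t1 Et] := @mvt_line _ _ f x h 1.
    move=> t; rewrite normr1 => /hr/Hr[Ut _].
    by case: cf => _ + _; exact.
  rewrite normr1 in t1; have [Ut Ht] := Hr _ (hr _ t1).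
  rewrite scale1r in Et.
  rewrite /= !fctE /cst /= opprD addrA {}Et mul1r (C1_derive_sum h oU Ut cf) /lincomb.
  rewrite -sumrB (le_trans (ler_norm_sum _ _ _)) //.
  apply: (@le_trans _ _ (\sum_(i < d) (`|h| * (e / (d%:R + 1))))).
    apply: ler_sum => i _; rewrite -mulrBr normrM ler_pM ?rV_norm_coord //.
    by rewrite distrC; exact: Ht.
  rewrite sumr_const card_ord -mulrnAr mulrC ler_wpM2r // -mulr_natr mulrAC ler_pdivrMr //.
  by rewrite ler_wpM2l ?(ltW e0) // lerDl.
have D := diff_unique (@lincomb_continuous a) E.
split; last exact: D.
by apply/diff_locallyP; rewrite D; split => //; exact: lincomb_continuous.
Unshelve. all: by end_near. Qed.

(** Only one directional derivative of [phi] is assumed. Restricted to the line through [x], [phi]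
    becomes a differentiable function of a real variable, with which the total differential of [f]
    can be composed. *)
Lemma derive_comp (V : normedModType R) U f (phi : V -> 'rV[R]_d) x v :
  open U -> U (phi x) -> Ck_on 1 U f -> derivable phi x v ->
  is_derive x v (f \o phi) (lincomb (fun i => 'D_(e_ i) f (phi x)) ('D_v phi x)).
Proof.
move=> oU Ux cf dphi.
pose g (t : R) := phi (t *: v + x).
have g0 : g 0 = phi x by rewrite /g scale0r add0r.
have dg : derivable (g : R^o -> _) 0 1 := (derivable1P phi x v).1 dphi.
have dgd : differentiable g 0 by apply/derivable1_diffP.
have [df Ef] := C1_is_diff oU Ux cf.
have dfg : differentiable (f \o g) 0 by apply: differentiable_comp => //; rewrite g0.
have E : 'D_v (f \o phi) x = 'D_1 (f \o g) 0 by rewrite derive_line0.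
have E' : 'D_v phi x = 'D_1 g 0 by rewrite derive_line0.
split; first by apply: (derivable1P _ _ _).2; apply/derivable1_diffP.
rewrite E (deriveE _ dfg) diff_comp //; last by rewrite g0.
by rewrite /= g0 Ef E' (deriveE _ dgd).
Qed.

Lemma Ck_on_comp (V : normedModType R) k (U : set V) U' f (phi : V -> 'rV[R]_d) :
  open U -> open U' -> (forall x, U x -> U' (phi x)) ->
  Ck_on k U phi -> Ck_on k U' f -> Ck_on k U (f \o phi).
Proof.
move=> oU oU' UU'.
elim: k f => [|k IH] f Hphi Hf.
  by move=> x Ux; apply: continuous_comp; [exact: Hphi|apply: Hf; exact: UU'].
have [cphi dphi Dphi] := Hphi; have [cf df Df] := Hf.
have Hf1 : Ck_on 1 U' f.
  by split=> // v; apply: Ck_on_cont (Df v).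
split=> [x Ux|x v Ux|v].
- by apply: continuous_comp; [exact: cphi|apply: cf; exact: UU'].
- by have [] := derive_comp oU' (UU' _ Ux) Hf1 (dphi x v Ux).
- apply: (@Ck_on_eq _ _ _ k U (fun x => \sum_i (('D_v phi x) 0 i * 'D_(e_ i) f (phi x)))) => //.
    by move=> x Ux; have [_ ->] := derive_comp oU' (UU' _ Ux) Hf1 (dphi x v Ux).
  apply: Ck_on_sum => // i _; apply: Ck_onM => //.
    by have /(Ck_on_mxP _ _ oU) := Dphi v; apply.
  by apply: (IH ('D_(e_ i) f)); [exact: Ck_onW|exact: Df].
Qed.

End finite_dim.

Section schwarz.
Context {R : realType} {V : normedModType R}.
Implicit Types (f : V -> R) (U : set V).

Let diff2 f (v w x : V) (h : R) :=
  f (h *: v + (h *: w + x)) - f (h *: v + x) - (f (h *: w + x) - f x).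

(** Two mean values, one for the [w]-increment of [f] moved along [v] and one for ['D_v f] along
    [w], express the second difference as [h ^+ 2] times a mixed derivative at a nearby point. Since
    the second difference is symmetric in [v] and [w], Schwarz's theorem follows. *)
Let diff2_cvg U f (x v w : V) e : open U -> U x -> Ck_on 2 U f -> 0 < e ->
  \forall h \near (0 : R), h != 0 -> `|'D_w ('D_v f) x - diff2 f v w x h / h ^+ 2| <= e.
Proof.
move=> oU Ux Hf e0; have [cf df Df] := Hf.
have nU : \forall y \near x, U y by exact: open_nbhs_nbhs.
have nv : \forall y \near x, `|'D_w ('D_v f) x - 'D_w ('D_v f) y| <= e.
  by have [_ _ /(_ w x Ux) /cvgrPdist_le] := Df v; apply.
apply: filterS (near_line2 v w (filterI nU nv)) => h Hh h0.
pose g y := f (h *: w + y) - f y.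
have Dg a : `|a| <= `|h| -> is_derive (a *: v + x) v g
    ('D_v f (h *: w + (a *: v + x)) - 'D_v f (a *: v + x)).
  move=> ah; have [|Ua _] := Hh a 0 ah; first by rewrite normr0.
  rewrite scale0r add0r in Ua.
  have [Ub _] := Hh a h ah (lexx _).
  apply: is_deriveB; last by split => //; exact: df.
  have dfb : derivable f (h *: w + (a *: v + x)) v by apply: df; rewrite addrCA.
  have E : (fun t => t^-1 *: (((fun y => f (h *: w + y)) \o shift (a *: v + x)) (t *: v) - f (h *: w + (a *: v + x))))
     = (fun t => t^-1 *: ((f \o shift (h *: w + (a *: v + x))) (t *: v) - f (h *: w + (a *: v + x)))).
    by apply/funext => t /=; rewrite addrCA.
  by split; rewrite /derivable /derive /= E.
have [a ah E1] : exists2 a : R, `|a| <= `|h| & g (h *: v + x) - g x = h * 'D_v g (a *: v + x).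
  by apply: mvt_line => a /Dg [].
have [b bh E2] : exists2 b : R, `|b| <= `|h| &
   'D_v f (h *: w + (a *: v + x)) - 'D_v f (a *: v + x) = h * 'D_w ('D_v f) (b *: w + (a *: v + x)).
  apply: (@mvt_line _ _ ('D_v f)) => b bh; have [_ + _] := Df v; apply.
  by rewrite addrCA; have [] := Hh a b ah bh.
have -> : diff2 f v w x h = h ^+ 2 * 'D_w ('D_v f) (b *: w + (a *: v + x)).
  have [_ Dg2] := Dg a ah; rewrite Dg2 E2 in E1.
  by rewrite expr2 -mulrA -E1 /g /diff2 (addrCA (h *: w)).
rewrite mulrC mulKf ?expf_neq0 // addrCA.
by have [] := Hh a b ah bh.
Qed.

Lemma schwarz U f (x v w : V) : open U -> U x -> Ck_on 2 U f ->
  'D_w ('D_v f) x = 'D_v ('D_w f) x.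
Proof.
move=> oU Ux Hf; apply/eqP; rewrite -subr_eq0 -normr_le0.
apply/ler_addgt0Pl => e e0; rewrite addr0.
have e2 : 0 < e / 2 by rewrite divr_gt0.
have H1 := diff2_cvg v w oU Ux Hf e2.
have H2 := diff2_cvg w v oU Ux Hf e2.
near (0 : R)^' => h.
have h0 : h != 0 by near: h; exact: nbhs_dnbhs_neq.
have h1 : `|'D_w ('D_v f) x - diff2 f v w x h / h ^+ 2| <= e / 2.
  by move: h0; near: h; exact: nbhs_dnbhs H1.
have h2 : `|'D_v ('D_w f) x - diff2 f w v x h / h ^+ 2| <= e / 2.
  by move: h0; near: h; exact: nbhs_dnbhs H2.
have E : diff2 f w v x h = diff2 f v w x h.
  by rewrite /diff2 (addrCA (h *: w)) !opprB; lra.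
rewrite E distrC in h2.
rewrite [leRHS](splitr e).
apply: le_trans (lerD h1 h2).
apply: le_trans (ler_normD _ _).
by rewrite addrA subrK.
Unshelve. all: by end_near. Qed.

Lemma ball_line (x y : V) r a : ball x r y -> `|a| <= 1 -> ball x r (a *: (y - x) + x).
Proof.
rewrite -!ball_normE /ball_ /= opprD addrCA subrr addr0 normrN normrZ distrC => yr a1.
by apply: le_lt_trans yr; rewrite ler_piMl.
Qed.

Lemma zero_derive_cst (f : V -> R) (x : V) (r : R) :
  (forall y v, ball x r y -> is_derive y v f 0) -> forall y, ball x r y -> f y = f x.
Proof.
move=> H y yr.
have [a a1 E] : exists2 a : R, `|a| <= `|1 : R| & f (1 *: (y - x) + x) - f x = 1 * 'D_(y - x) f (a *: (y - x) + x).
  apply: mvt_line => a; rewrite normr1 => a1.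
  by have [dd _] := H _ (y - x) (ball_line yr a1).
rewrite scale1r subrK mul1r in E; rewrite normr1 in a1.
have [_ D0] := H _ (y - x) (ball_line yr a1).
by move/eqP: E; rewrite D0 subr_eq0 => /eqP.
Qed.

End schwarz.

(** * Hadamard's lemma by integration along rays *)

Section integral01.
Context {R : realType}.
Implicit Types (f g : R -> R).

Definition cont01 f := forall s, 0 <= s <= 1 -> {for s, continuous f}.

Definition int01 f : R := (\int[@lebesgue_measure R]_(s in `[0%R, 1%R]) f s)%R.

Lemma cont01_within f : cont01 f -> {within `[0, 1], continuous f}.
Proof.
move=> cf; apply: continuous_in_subspaceT => s; rewrite inE /= in_itv /= => s01.
exact: cf.
Qed.

Lemma cont01_integrable f : cont01 f ->
  (@lebesgue_measure R).-integrable `[0%R, 1%R] (EFin \o f).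
Proof.
move=> cf; apply: continuous_compact_integrable; first exact: segment_compact.
exact: cont01_within.
Qed.

Lemma cont01_cst c : cont01 (cst c).
Proof. by move=> s _; exact: cst_continuous. Qed.

Lemma cont01M f g : cont01 f -> cont01 g -> cont01 (fun s => f s * g s).
Proof. by move=> cf cg s s01; apply: continuousM; [exact: cf|exact: cg]. Qed.

Lemma cont01B f g : cont01 f -> cont01 g -> cont01 (fun s => f s - g s).
Proof. by move=> cf cg s s01; apply: continuousB; [exact: cf|exact: cg]. Qed.

Lemma cont01X j : cont01 (fun s => s ^+ j).
Proof. by move=> s _; exact: exprn_continuous. Qed.

Lemma int01_cst c : int01 (cst c) = c.
Proof.
rewrite /int01 (Rintegral_cst _ _ c) //.
rewrite -[RHS]mulr1; congr (_ * _); transitivity (fine (1%:E : \bar R)) => //; congr fine.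
apply: etrans (lebesgue_measure_itv `[0, 1]) _.
by rewrite /= lte_fin ltr01 oppr0 adde0.
Qed.

Lemma int01B f g : cont01 f -> cont01 g ->
  int01 (fun s => f s - g s) = int01 f - int01 g.
Proof. by move=> cf cg; rewrite /int01 RintegralB //; exact: cont01_integrable. Qed.

Lemma int01Z c f : cont01 f -> int01 (fun s => c * f s) = c * int01 f.
Proof. by move=> cf; rewrite /int01 RintegralZl //; exact: cont01_integrable. Qed.

Lemma int01_bound f c : cont01 f -> (forall s, 0 <= s <= 1 -> `|f s| <= c) ->
  `|int01 f| <= c.
Proof.
move=> cf fc; rewrite -[leRHS]int01_cst.
apply: le_trans (le_normr_Rintegral _ _) _ => //; first exact: cont01_integrable.
apply: le_Rintegral => //.
- apply: (@cont01_integrable (fun s => `|f s|)) => s s01.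
  by apply: (@continuous_comp _ _ _ f) => //; [exact: cf|exact: norm_continuous].
- exact: cont01_integrable (@cont01_cst c).
Qed.

Lemma int01_FTC f F : cont01 f ->
  (forall s : R, 0 <= s <= 1 -> is_derive s 1 F (f s)) -> int01 f = F 1 - F 0.
Proof.
move=> cf dF; rewrite /int01 /Rintegral.
have cF s : 0 <= s <= 1 -> {for s, continuous F}.
  by move=> /dF[dFs _]; apply/differentiable_continuous/derivable1_diffP.
rewrite (@continuous_FTC2 _ f F) //.
- exact: cont01_within.
- split.
  + move=> s; rewrite in_itv /= => /andP[s0 s1].
    by case: (dF s); rewrite ?ltW.
  + by apply: cvg_at_right_filter; apply: cF; rewrite lexx ler01.
  + by apply: cvg_at_left_filter; apply: cF; rewrite lexx ler01.
- move=> s; rewrite in_itv /= => /andP[s0 s1].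
  by rewrite derive1E; case: (dF s); rewrite ?ltW.
Qed.

Lemma int01_sum (T : Type) (I : seq T) (a : T -> R) (F : T -> R -> R) :
  (forall i, cont01 (F i)) ->
  cont01 (fun s => \sum_(i <- I) a i * F i s) /\
  int01 (fun s => \sum_(i <- I) a i * F i s) = \sum_(i <- I) a i * int01 (F i).
Proof.
move=> cF; elim: I => [|i I [cI IH]].
  rewrite big_nil (_ : (fun s => _) = cst 0); last by apply/funext => s; rewrite big_nil.
  by rewrite int01_cst; split => //; exact: cont01_cst.
pose g s := - 1 * \sum_(j <- I) a j * F j s.
have cg : cont01 g by apply: (cont01M (@cont01_cst (-1))).
have ci : cont01 (fun s => a i * F i s) by apply: (cont01M (@cont01_cst (a i))).
rewrite (_ : (fun s => _) = (fun s => a i * F i s - g s)); last first.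
  by apply/funext => s; rewrite big_cons /g mulN1r opprK.
split; first exact: cont01B.
by rewrite int01B // int01Z // big_cons -IH /g int01Z // mulN1r opprK.
Qed.

End integral01.

Lemma continuous_lip (R : realType) (V : normedModType R) (f : V -> R) x C : 0 < C ->
  (\forall y \near x, `|f x - f y| <= C * `|x - y|) -> {for x, continuous f}.
Proof.
move=> C0 H; apply/cvgrPdist_le => /= e e0.
have eC : 0 < e / C by rewrite divr_gt0.
have Hb : \forall y \near x, ball x (e / C) y by exact: nbhsx_ballx.
apply: filterS2 Hb H => y; rewrite -ball_normE /ball_ /= => xy /le_trans; apply.
by rewrite mulrC -ler_pdivlMr // ltW.
Qed.

Lemma mvt01 (R : realType) (V : normedModType R) (f : V -> R) (x v : V) :
  (forall a : R, 0 <= a <= 1 -> derivable f (a *: v + x) v) ->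
  exists2 a : R, 0 <= a <= 1 & f (v + x) - f x = 'D_v f (a *: v + x).
Proof.
move=> df; pose g (s : R) := f (s *: v + x).
have Dg a : a \in `[0, 1] -> is_derive (a : R) 1 g ('D_v f (a *: v + x)).
  by rewrite in_itv /= => a01; apply: is_derive_line; exact: df.
have H1 a : a \in `]0, 1[ -> is_derive (a : R) 1 g ('D_v f (a *: v + x)).
  by move=> a01; apply: Dg; exact: subset_itv_oo_cc.
have H2 : {within `[0, 1], continuous g}.
  by apply: derivable_within_continuous => a /Dg[].
have [a a01 E] := MVT_segment ler01 H1 H2.
exists a; first by move: a01; rewrite in_itv.
by move: E; rewrite /g scale1r scale0r add0r subr0 mulr1.
Qed.

Section lipschitz.
Context {R : realType} {d : nat}.
Implicit Types (h : 'rV[R]_d -> R).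

Lemma compact_cball (u0 : 'rV[R]_d) r : compact [set u | `|u0 - u| <= r].
Proof.
apply: bounded_closed_compact.
  exists (`|u0| + r); split; first exact: num_real.
  move=> M hM u /= ur; apply: le_trans (ltW hM).
  rewrite -[u](subrK u0) addrC (le_trans (ler_normD _ _)) // lerD // distrC //.
exact: (@closed_closed_ball_ _ _ u0 r).
Qed.

Lemma continuous_cball_bound (W : normedModType R) (f : 'rV[R]_d -> W) (u0 : 'rV[R]_d) r r' : r' < r ->
  continuous_at_all (ball u0 r) f ->
  exists2 C, 0 < C & forall u, `|u0 - u| <= r' -> `|f u| <= C.
Proof.
move=> r'r cf.
have cg : {within [set u | `|u0 - u| <= r'], continuous f}.
  apply: continuous_in_subspaceT => u; rewrite inE /= => ur; apply: cf.
  by rewrite -ball_normE /ball_ /= (le_lt_trans ur).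
have /compact_bounded[M [_ HM]] : compact (f @` [set u | `|u0 - u| <= r']).
  by apply: continuous_compact => //; exact: compact_cball.
exists (`|M| + 1); first by rewrite ltr_wpDl.
move=> u ur; apply: HM; last by exists u.
by rewrite (le_lt_trans (ler_norm M)) // ltrDl.
Qed.

Lemma sum_le_const (F : 'I_d -> R) c : (forall i, F i <= c) -> \sum_i F i <= d%:R * c.
Proof.
move=> H; apply: (@le_trans _ _ (\sum_(i < d) c)); first by apply: ler_sum => i _.
by rewrite sumr_const card_ord mulr_natl.
Qed.

Lemma cball_lipschitz h (u0 : 'rV[R]_d) r r' : r' < r -> Ck_on 1 (ball u0 r) h ->
  exists2 C, 0 < C & forall u v, `|u0 - u| <= r' -> `|u0 - v| <= r' ->
    `|h u - h v| <= C * `|u - v|.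
Proof.
move=> r'r ch; have [_ dh Dh] := ch.
have oB : open (ball u0 r) by exact: ball_open.
pose f u : 'rV[R]_d := \row_i 'D_(delta_mx 0 i) h u.
have cf : continuous_at_all (ball u0 r) f.
  move=> u ur; apply: continuous_mx => i j.
  have -> : (fun y => f y i j) = 'D_(delta_mx 0 j) h by apply/funext => y; rewrite mxE.
  exact: Dh.
have [C C0 HC] := continuous_cball_bound r'r cf.
exists ((d%:R + 1) * C) => [|u v ur vr].
  by rewrite mulr_gt0 // ltr_wpDl.
have seg a : `|a| <= 1 -> 0 <= a -> `|u0 - (a *: (u - v) + v)| <= r'.
  move=> a1 a0; have -> : u0 - (a *: (u - v) + v) = a *: (u0 - u) + (1 - a) *: (u0 - v).
    by apply/rowP => i; rewrite !mxE; ring.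
  rewrite (le_trans (ler_normD _ _)) // !normrZ.
  rewrite (ger0_norm a0) in a1 *; rewrite ger0_norm ?subr_ge0 //.
  have -> : r' = a * r' + (1 - a) * r' by ring.
  by rewrite lerD // ler_wpM2l // subr_ge0.
have [a a01|a a01 E] := @mvt01 _ _ h v (u - v).
  apply: dh; rewrite -ball_normE /ball_ /= (le_lt_trans (seg a _ _)) //;
    by case/andP: a01 => a0 a1; rewrite ?ger0_norm.
have Ha : `|u0 - (a *: (u - v) + v)| <= r'.
  by case/andP: a01 => a0 a1; apply: seg => //; rewrite ger0_norm.
rewrite subrK in E; rewrite E.
rewrite (C1_derive_sum _ oB) //; last first.
  by rewrite -ball_normE /ball_ /= (le_lt_trans Ha).
rewrite /lincomb (le_trans (ler_norm_sum _ _ _)) //.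
apply: (@le_trans _ _ (d%:R * (C * `|u - v|))).
  apply: sum_le_const => i; rewrite normrM mulrC ler_pM ?rV_norm_coord //.
  by have := rV_norm_coord (f (a *: (u - v) + v)) i; rewrite mxE => /le_trans; apply; exact: HC.
by rewrite mulrA ler_wpM2r // ler_wpM2r ?(ltW C0) // lerDl.
Qed.

End lipschitz.

Section hadamard.
Context {R : realType} {d : nat}.
Variables (u0 : 'rV[R]_d) (r : R).
Local Notation B := (ball u0 r).
Implicit Types (h : 'rV[R]_d -> R) (u v : 'rV[R]_d) (s : R).

(** The weight [s ^+ j] counts derivatives: each differentiation in [u] brings out one factor
    [s]. *)
Definition ray_int j h (u : 'rV[R]_d) : R :=
  int01 (fun s => s ^+ j * h (s *: (u - u0) + u0)).

Let ray_in u s : B u -> 0 <= s <= 1 -> B (s *: (u - u0) + u0).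
Proof. by move=> uB /andP[s0 s1]; apply: ball_line => //; rewrite ger0_norm. Qed.

Let ray_cont h u : continuous_at_all B h -> B u -> cont01 (fun s => h (s *: (u - u0) + u0)).
Proof.
move=> ch uB s s01; apply: (@continuous_comp _ _ _ (fun s : R => s *: (u - u0) + u0)).
  by apply: continuousD; [apply: continuousZl; exact: id|exact: cst_continuous].
by apply: ch; exact: ray_in.
Qed.

Let ray_contX j h u : continuous_at_all B h -> B u ->
  cont01 (fun s => s ^+ j * h (s *: (u - u0) + u0)).
Proof. by move=> ch uB; apply: cont01M; [exact: cont01X|exact: ray_cont]. Qed.

Let radius u : B u -> exists2 r', r' < r & `|u0 - u| < r'.
Proof.
rewrite -ball_normE /ball_ /= => ur; exists ((`|u0 - u| + r) / 2).
  by rewrite midf_lt.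
by rewrite midf_lt.
Qed.

Let ray_close u r' s : `|u0 - u| <= r' -> 0 <= s <= 1 ->
  `|u0 - (s *: (u - u0) + u0)| <= r'.
Proof.
move=> ur /andP[s0 s1]; rewrite opprD addrCA subrr addr0 normrN normrZ distrC.
by apply: le_trans ur; rewrite ler_piMl // ger0_norm.
Qed.

Let near_r' u r' : `|u0 - u| < r' -> \forall y \near u, `|u0 - y| <= r'.
Proof.
move=> ur; have B1 : ball u (r' - `|u0 - u|) u by apply: ballxx; rewrite subr_gt0.
apply: filterS (open_nbhs_nbhs (conj (@ball_open _ _ u _) B1)) => y.
rewrite -ball_normE /ball_ /= ltrBrDr addrC => /ltW /(le_trans _); apply.
have -> : u0 - y = (u0 - u) + (u - y) by rewrite addrA subrK.
exact: ler_normD.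
Qed.

Let B_r' u r' : r' < r -> `|u0 - u| <= r' -> B u.
Proof. by move=> rr ur; rewrite -ball_normE /ball_ /= (le_lt_trans ur). Qed.

Lemma ray_int_cont j h u : Ck_on 1 B h -> B u -> {for u, continuous (ray_int j h)}.
Proof.
move=> ch uB; have [r' r'r ur] := radius uB.
have [C C0 HC] := cball_lipschitz r'r ch.
have Hd y : `|u0 - y| <= r' -> `|ray_int j h u - ray_int j h y| <= C * `|u - y|.
  move=> yr; have c0 := Ck_on_cont ch.
  have yB := B_r' r'r yr.
  rewrite /ray_int -int01B; [|exact: ray_contX|exact: ray_contX].
  apply: int01_bound; first by apply: cont01B; exact: ray_contX.
  move=> s s01; rewrite -mulrBr normrM.
  have {}HC := HC _ _ (ray_close (ltW ur) s01) (ray_close yr s01).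
  move: (s01) => /andP[s0 s1].
  rewrite (@le_trans _ _ `|h (s *: (u - u0) + u0) - h (s *: (y - u0) + u0)|) //.
    by rewrite ler_piMl // normrX exprn_ile1 // ger0_norm.
  apply: (le_trans HC); rewrite ler_wpM2l ?(ltW C0) //.
  have -> : s *: (u - u0) + u0 - (s *: (y - u0) + u0) = s *: (u - y).
    by apply/rowP => i; rewrite !mxE; ring.
  by rewrite normrZ ler_piMl // ger0_norm.
apply: (continuous_lip C0); apply: filterS (near_r' ur); exact: Hd.
Qed.

(** Differentiation under the integral sign. By the mean value theorem the difference quotient of
    the integrand is [s ^+ j.+1] times ['D_v h] at a shifted point, and a Lipschitz bound for
    ['D_v h] on a slightly smaller ball makes the convergence uniform in [s]. *)
Lemma ray_int_derive j h u v : Ck_on 2 B h -> B u ->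
  is_derive u v (ray_int j h) (ray_int j.+1 ('D_v h) u).
Proof.
move=> ch uB; have [r' r'r ur] := radius uB.
have [C C0 HC] : exists2 C, 0 < C & forall u w, `|u0 - u| <= r' -> `|u0 - w| <= r' ->
    `|'D_v h u - 'D_v h w| <= C * `|u - w|.
  by apply: (cball_lipschitz r'r); case: ch => _ _ /(_ v).
have c0 := Ck_on_cont ch.
have dh x w : B x -> derivable h x w by case: ch => _ + _; exact.
have cD : continuous_at_all B ('D_v h) by case: ch => _ _ /(_ v) [].
have key : t^-1 *: ((ray_int j h \o shift u) (t *: v) - ray_int j h u) @[t --> (0 : R)^'] -->
    ray_int j.+1 ('D_v h) u.
  apply/cvgrPdist_le => /= e e0.
  have Cv : 0 < C * `|v| + 1 by rewrite ltr_wpDl // mulr_ge0 // ltW.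
  have eC : 0 < e / (C * `|v| + 1) by rewrite divr_gt0.
  have n1 : \forall t \near (0 : R), `|t| < e / (C * `|v| + 1) by exact: nbhs0_lt.
  have n2 : \forall t \near (0 : R), forall a b : R, `|a| <= `|t| -> `|b| <= `|t| ->
       `|u0 - (a *: v + (b *: 0 + u))| <= r'.
    exact: near_line2 (near_r' ur).
  near=> t.
  have t0 : t != 0 by near: t; exact: nbhs_dnbhs_neq.
  have te : `|t| < e / (C * `|v| + 1) by near: t; exact: nbhs_dnbhs.
  have tu a : `|a| <= `|t| -> `|u0 - (a *: v + u)| <= r'.
    have H : forall a b : R, `|a| <= `|t| -> `|b| <= `|t| ->
      `|u0 - (a *: v + (b *: 0 + u))| <= r' by near: t; exact: nbhs_dnbhs.
    by move=> at0; have := H a 0; rewrite scaler0 add0r normr0; apply.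
  have utB : B (t *: v + u) := B_r' r'r (tu t (lexx _)).
  rewrite /ray_int -int01B; [|exact: ray_contX|exact: ray_contX].
  rewrite [X in _ - X](_ : _ = int01 (fun s => t^-1 * (s ^+ j * h (s *: (t *: v + u - u0) + u0)
       - s ^+ j * h (s *: (u - u0) + u0)))); last first.
    by symmetry; apply: int01Z; apply: cont01B; exact: ray_contX.
  have cq : cont01 (fun s => t^-1 * (s ^+ j * h (s *: (t *: v + u - u0) + u0)
       - s ^+ j * h (s *: (u - u0) + u0))).
    by apply: (cont01M (@cont01_cst _ t^-1)); apply: cont01B; exact: ray_contX.
  have cf1 : cont01 (fun s => s ^+ j.+1 * 'D_v h (s *: (u - u0) + u0)) := @ray_contX j.+1 _ u cD uB.
  rewrite -(int01B cf1 cq).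
  apply: int01_bound => [|s s01].
    exact: cont01B.
  move: (s01) => /andP[s0 s1].
  have Es a : s *: (a *: v + u - u0) + u0 = (s * a) *: v + (s *: (u - u0) + u0).
    by apply/rowP => i; rewrite !mxE; ring.
  have sin a : `|a| <= `|t| -> `|u0 - ((s * a) *: v + (s *: (u - u0) + u0))| <= r'.
    by move=> /tu au; rewrite -Es; exact: ray_close.
  have [a ast E] : exists2 a : R, `|a| <= `|s * t| &
     h ((s * t) *: v + (s *: (u - u0) + u0)) - h (s *: (u - u0) + u0)
       = (s * t) * 'D_v h (a *: v + (s *: (u - u0) + u0)).
    apply: mvt_line => a; rewrite normrM => at1.
    apply: dh; apply: (B_r' r'r).
    have [s00|s00] := eqVneq s 0.
      have -> : a = 0.
        by apply/eqP; rewrite -normr_le0; move: at1; rewrite s00 normr0 mul0r.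
      by have := sin 0; rewrite mulr0 normr0; apply.
    have -> : a = s * (a / s) by rewrite mulrC divfK.
    apply: sin; rewrite normrM normfV ler_pdivrMr ?normr_gt0 //.
    by rewrite mulrC.
  rewrite -mulrBr Es E.
  have -> : t^-1 * (s ^+ j * (s * t * 'D_v h (a *: v + (s *: (u - u0) + u0))))
     = s ^+ j.+1 * 'D_v h (a *: v + (s *: (u - u0) + u0)).
    by rewrite exprS; field.
  rewrite -mulrBr normrM.
  apply: (@le_trans _ _ `|'D_v h (s *: (u - u0) + u0) - 'D_v h (a *: v + (s *: (u - u0) + u0))|).
    by rewrite ler_piMl // normrX exprn_ile1 // ger0_norm.
  have H1 : `|u0 - (s *: (u - u0) + u0)| <= r' by apply: ray_close => //; exact: ltW.
  have H2 : `|u0 - (a *: v + (s *: (u - u0) + u0))| <= r'.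
    have [s00|s00] := eqVneq s 0.
      have -> : a = 0.
        by apply/eqP; rewrite -normr_le0; move: ast; rewrite s00 mul0r normr0.
      by have := sin 0; rewrite mulr0 normr0; apply.
    have -> : a = s * (a / s) by rewrite mulrC divfK.
    apply: sin; rewrite normrM normfV ler_pdivrMr ?normr_gt0 //.
    by rewrite mulrC -normrM.
  apply: le_trans (HC _ _ H1 H2) _.
  rewrite opprD addrCA subrr addr0 normrN normrZ.
  have at1 : `|a| <= `|t|.
    by rewrite (le_trans ast) // normrM ler_piMl // ger0_norm.
  apply: (@le_trans _ _ (`|t| * (C * `|v| + 1))); last by rewrite -ler_pdivlMr // ltW.
  rewrite mulrCA; apply: ler_pM => //; first by rewrite mulr_ge0 // ltW.
  by rewrite lerDl.
split; first by apply: cvgP key.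
exact: cvg_lim key.
Unshelve. all: by end_near. Qed.

(** One order of differentiability is lost because continuity of [ray_int] is drawn from a Lipschitz
    bound, that is from C^1 regularity of the integrand. *)
Lemma ray_int_Ck k j h : Ck_on k.+1 B h -> Ck_on k B (ray_int j h).
Proof.
have oB : open B by exact: ball_open.
elim: k j h => [|k IH] j h Hh.
  by move=> u uB; exact: ray_int_cont.
have H2 : Ck_on 2 B h.
  elim: {IH} k Hh => // k IHk Hh; apply: IHk; exact: Ck_onW.
split=> [u uB|u v uB|v].
- apply: ray_int_cont => //; exact: Ck_onW H2.
- by case: (ray_int_derive j v H2 uB).
- apply: (@Ck_on_eq _ _ _ k B (ray_int j.+1 ('D_v h))) => //.
    by move=> u uB; case: (ray_int_derive j v H2 uB).
  by apply: IH; case: Hh => _ _ /(_ v).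
Qed.

Lemma ray_int_center h : ray_int 0 h u0 = h u0.
Proof.
rewrite -[RHS]int01_cst /ray_int; congr int01; apply/funext => s.
by rewrite expr0 mul1r subrr scaler0 add0r.
Qed.

(** The fundamental theorem of calculus on the ray from [u0] to [u]; the smooth cofactors of the
    coordinates are averages of the partial derivatives. *)
Lemma hadamard h u : smooth_on B h -> B u ->
  h u - h u0 = \sum_i (u - u0) 0 i * ray_int 0 ('D_(delta_mx 0 i) h) u.
Proof.
move=> sh uB; have oB : open B by exact: ball_open.
have c1 := sh 1%N.
have cD i : continuous_at_all B ('D_(delta_mx 0 i) h) by case: c1 => _ _ /(_ (delta_mx 0 i)).
pose F (s : R) := h (s *: (u - u0) + u0).
have dF s : 0 <= s <= 1 -> is_derive (s : R) 1 F ('D_(u - u0) h (s *: (u - u0) + u0)).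
  move=> s01; apply: is_derive_line; case: c1 => _ + _; apply; exact: ray_in.
have E s : 0 <= s <= 1 -> 'D_(u - u0) h (s *: (u - u0) + u0)
    = \sum_i (u - u0) 0 i * 'D_(delta_mx 0 i) h (s *: (u - u0) + u0).
  by move=> s01; rewrite (C1_derive_sum _ oB (ray_in uB s01) c1).
have [cE iE] := int01_sum (index_enum 'I_d) (fun i => (u - u0) 0 i)
  (fun i => ray_cont (cD i) uB).
have dF' s : 0 <= s <= 1 -> is_derive (s : R) 1 F (\sum_i (u - u0) 0 i * 'D_(delta_mx 0 i) h (s *: (u - u0) + u0)).
  by move=> s01; rewrite -E //; exact: dF.
have := int01_FTC cE dF'.
rewrite iE /F scale1r scale0r add0r subrK => <-; apply: eq_bigr => i _.
congr (_ * _); rewrite /ray_int; congr int01; apply/funext => s.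
by rewrite expr0 mul1r.
Qed.

End hadamard.

(** * Flat functions and smooth cut-offs *)

Section bump.
Context {R : realType}.

(** The functions t^-j exp(-1/t), extended by 0. Derivatives of members of this family are
    combinations of members, so the smoothness of exp(-1/t) is proved by one induction for all [j]
    together. *)
Definition flat (j : nat) (t : R) : R :=
  if 0 < t then (t^-1) ^+ j * expR (- t^-1) else 0.

Lemma flat_ge0 j t : 0 <= flat j t.
Proof.
rewrite /flat; case: ifP => // t0; rewrite mulr_ge0 ?expR_ge0 // exprn_ge0 //.
by rewrite invr_ge0 ltW.
Qed.

(** Comes from exp y >= y^(j+2) / (j+2)! at y = 1/t. A quadratic bound is exactly what makes the
    difference quotient at 0 tend to 0. *)
Lemma flat_bound j : exists2 C, 0 < C & forall t, `|flat j t| <= C * t ^+ 2.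
Proof.
exists ((j.+2)`!%:R); first by rewrite ltr0n fact_gt0.
move=> t; rewrite ger0_norm ?flat_ge0 // /flat; case: ifPn => [t0|_]; last first.
  by rewrite mulr_ge0 // ?sqr_ge0 // ler0n.
have y0 : 0 < t^-1 by rewrite invr_gt0.
rewrite expRN ler_pdivrMr ?expR_gt0 //.
have H : (t^-1) ^+ j.+2 / (j.+2)`!%:R <= expR t^-1.
  by have := expR_ge1Dxn j.+1 (ltW y0); apply: le_trans; rewrite lerDr.
have F0 : 0 < (j.+2)`!%:R :> R by rewrite ltr0n fact_gt0.
have := H; rewrite -(ler_pM2l (mulr_gt0 F0 (exprn_gt0 2 t0))).
apply: le_trans; rewrite -addn2 exprD le_eqVlt; apply/orP; left; apply/eqP.
have tn : t != 0 by rewrite gt_eqF.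
have Fn : (j + 2)`!%:R != 0 :> R by rewrite addn2 gt_eqF.
by rewrite -addn2; field; rewrite Fn.
Qed.

Lemma flat0 j : flat j 0 = 0. Proof. by rewrite /flat ltxx. Qed.

Lemma is_derive_flat j (t : R) :
  is_derive (t : R^o) 1 (flat j : R^o -> R^o) (flat j.+2 t - j%:R * flat j.+1 t).
Proof.
have [t0|t0|->] := ltgtP t 0.
- have -> : flat j.+2 t - j%:R * flat j.+1 t = 0.
    by rewrite /flat ltNge (ltW t0) /= mulr0 subrr.
  have nE : \forall s \near t, (0 : R) = flat j s.
    near=> s; rewrite /flat ifF //; apply/negbTE; rewrite -leNgt ltW //.
    by near: s; apply: (cvgr_lt t) => //; exact: cvg_id.
  by apply: (@near_eq_is_derive _ R^o R^o (cst 0) (flat j) t 1 0 nE); exact: is_derive_cst.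
- have tn : t != 0 by rewrite gt_eqF.
  have nE : \forall s \near t, (s^-1) ^+ j * expR (- s^-1) = flat j s.
    near=> s; rewrite /flat ifT //; near: s; apply: (cvgr_gt t) => //; exact: cvg_id.
  apply: (@near_eq_is_derive _ R^o R^o _ (flat j) t 1 _ nE).
  rewrite /flat t0.
  have dV : is_derive (t : R^o) 1 (fun s : R^o => s^-1 : R^o) (- (t ^- 2)).
    split; first exact: derivableV.
    by rewrite deriveV // derive_id /GRing.scale /= mulr1.
  have dE : is_derive (t : R^o) 1 (fun s : R^o => expR (- s^-1) : R^o) (t ^- 2 * expR (- t^-1)).
    have dN : is_derive (t : R^o) 1 (fun s : R^o => - s^-1 : R^o) (t ^- 2).
      by apply: is_derive_eq; rewrite opprK.
    by apply: is_derive_eq; rewrite /GRing.scale /= mulrC.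
  elim: (j) => [|i [dp Dp]].
    rewrite mul0r subr0 (_ : (fun s => _) = (fun s => expR (- s^-1))); last first.
      by apply/funext => s; rewrite expr0 mul1r.
    by rewrite exprVn.
  rewrite (_ : (fun s => _) = (fun s => s^-1) * (fun s => s^-1 ^+ i * expR (- s^-1))); last first.
    by apply/funext => s; rewrite exprS -mulrA.
  have [dv Dv] := dV.
  split; first exact: derivableM.
  by rewrite deriveM // Dp Dv /GRing.scale /= -(natr1 i) !exprS; field.
- rewrite !flat0 mulr0 subr0.
  have [C C0 HC] := flat_bound j.
  have key : h^-1 *: ((flat j \o shift (0 : R)) (h *: 1) - flat j 0) @[h --> (0:R)^'] --> (0 : R).
    apply/cvgrPdist_le => /= e e0.
    near=> h.
    have h0 : h != 0 by near: h; exact: nbhs_dnbhs_neq.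
    have hC : `|h| < e / C by near: h; apply: dnbhs0_lt; rewrite divr_gt0.
    rewrite flat0 subr0 addr0 sub0r normrN [h *: 1]mulr1 normrZ normfV.
    rewrite ler_pdivrMl ?normr_gt0 //.
    apply: le_trans (HC h) _.
    rewrite -[h ^+ 2]ger0_norm ?sqr_ge0 // normrX expr2 mulrCA ler_wpM2l //.
    by rewrite mulrC -ler_pdivlMr // ltW.
  split; first exact: cvgP key.
  exact: cvg_lim key.
Unshelve. all: by end_near. Qed.

Lemma Ck_flat k j : Ck_on k setT (flat j : R -> R).
Proof.
elim: k j => [|k IH] j.
  by move=> t _; have [dt _] := is_derive_flat j t; apply/differentiable_continuous/derivable1_diffP.
have df t : differentiable (flat j : R -> R) t.
  by have [dt _] := is_derive_flat j t; apply/derivable1_diffP.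
split=> [t _|t v _|v].
- exact/differentiable_continuous/df.
- exact/diff_derivable/df.
- have -> : 'D_v (flat j : R -> R) = v \*: (flat j.+2 + (- j%:R) \*: flat j.+1).
    apply/funext => t; rewrite (deriveE _ (df t)) -[in LHS](mulr1 v) [v * 1]/(v *: (1 : R^o)) linearZ /=.
    rewrite -(deriveE _ (df t)); have [_ ->] := is_derive_flat j t.
    change (v *: (flat j.+2 t - j%:R * flat j.+1 t) = v *: (flat j.+2 t + (- j%:R) * flat j.+1 t)).
    by rewrite mulNr.
  have oT : open (setT : set R) by exact: openT.
  by apply: Ck_onZ => //; apply: Ck_onD => //; apply: Ck_onZ.
Qed.

End bump.

(** * Smooth functions on manifolds *)

Lemma Ck_on_id (R : realType) (V : normedModType R) k (U : set V) : Ck_on k U id.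
Proof.
case: k => [|k]; first by move=> x _; exact: id.
split=> [x _|x v _|v]; [exact: id|exact: derivable_id|].
have -> : 'D_v (id : V -> V) = cst v by apply/funext => x; exact: derive_id.
exact: Ck_on_cst.
Qed.

Section smooth_on_closure.
Context {R : realType} {V : normedModType R}.
Implicit Types (U : set V) (f g : V -> R).

Lemma smooth_on_derive (W : normedModType R) U (f : V -> W) v :
  smooth_on U f -> smooth_on U ('D_v f).
Proof. by move=> sf k; case: (sf k.+1) => _ _ /(_ v). Qed.

Lemma smooth_on_derivable (W : normedModType R) U (f : V -> W) x v :
  smooth_on U f -> U x -> derivable f x v.
Proof. by move=> sf Ux; case: (sf 1%N) => _ + _; exact. Qed.

Lemma smooth_on_sub (W : normedModType R) U U' (f : V -> W) :
  U' `<=` U -> smooth_on U f -> smooth_on U' f.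
Proof. by move=> UU' sf k; apply: Ck_on_sub UU' (sf k). Qed.

Lemma smooth_on_eq (W : normedModType R) U (f g : V -> W) : open U ->
  (forall x, U x -> f x = g x) -> smooth_on U f -> smooth_on U g.
Proof. by move=> oU fg sf k; apply: Ck_on_eq oU fg (sf k). Qed.

Lemma smooth_on_cover (W : normedModType R) U (f : V -> W) :
  (forall x, U x -> exists2 U', U' x & smooth_on U' f) -> smooth_on U f.
Proof.
by move=> H k; apply: Ck_on_cover => x /H[U' U'x sf]; exists U'.
Qed.

Lemma smooth_on_cst (W : normedModType R) U (a : W) : smooth_on U (cst a).
Proof. by move=> k; exact: Ck_on_cst. Qed.

Lemma smooth_onD U f g : open U ->
  smooth_on U f -> smooth_on U g -> smooth_on U (fun x => f x + g x).
Proof. by move=> oU sf sg k; exact: Ck_onD. Qed.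

Lemma smooth_onM U f g : open U ->
  smooth_on U f -> smooth_on U g -> smooth_on U (fun x => f x * g x).
Proof. by move=> oU sf sg k; exact: Ck_onM. Qed.

Lemma smooth_on_affine (V' W : normedModType R) (A L : V' -> V) U (f : V -> W) :
  (forall h v x, A (h *: v + x) = h *: L v + A x) -> continuous A ->
  smooth_on U f -> smooth_on (A @^-1` U) (f \o A).
Proof. by move=> HA cA sf k; apply: Ck_on_affine HA cA (sf k). Qed.

Lemma derive_affine (V' W : normedModType R) (A L : V' -> V) (f : V -> W) x v :
  (forall h v x, A (h *: v + x) = h *: L v + A x) ->
  'D_v (f \o A) x = 'D_(L v) f (A x).
Proof.
move=> HA.
have E : (fun h => h^-1 *: (((f \o A) \o shift x) (h *: v) - (f \o A) x))
    = (fun h => h^-1 *: ((f \o shift (A x)) (h *: L v) - f (A x))).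
  by apply/funext => h /=; rewrite HA.
by rewrite /derive E.
Qed.

Lemma smooth_on_mxP U p q (f : V -> 'M[R]_(p, q)) : open U ->
  smooth_on U f <-> (forall i j, smooth_on U (fun x => f x i j : R)).
Proof.
move=> oU; split=> [sf i j k|sf k].
  by have /(Ck_on_mxP _ _ oU) := sf k; apply.
by apply/(Ck_on_mxP _ _ oU) => i j; exact: sf.
Qed.

Lemma smooth_on_comp d U (U' : set 'rV[R]_d) (f : 'rV[R]_d -> R) (phi : V -> 'rV[R]_d) :
  open U -> open U' -> (forall x, U x -> U' (phi x)) ->
  smooth_on U phi -> smooth_on U' f -> smooth_on U (f \o phi).
Proof. by move=> oU oU' UU' sp sf k; apply: Ck_on_comp oU oU' UU' (sp k) (sf k). Qed.

End smooth_on_closure.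

Section row_pairs.
Context {R : realType} {d e : nat}.

Lemma row_mx_linl (b : 'rV[R]_e) h (v x : 'rV[R]_d) :
  row_mx (h *: v + x) b = h *: row_mx v 0 + row_mx x b.
Proof. by rewrite scale_row_mx scaler0 add_row_mx add0r. Qed.

Lemma row_mx_linr (a : 'rV[R]_d) h (v x : 'rV[R]_e) :
  row_mx a (h *: v + x) = h *: row_mx 0 v + row_mx a x.
Proof. by rewrite scale_row_mx scaler0 add_row_mx add0r. Qed.

Lemma row_mx_contl (b : 'rV[R]_e) : continuous (fun x : 'rV[R]_d => row_mx x b).
Proof.
move=> x; apply: continuous_mx => i j.
case: (split_ordP j) => k ->.
  by rewrite (_ : (fun _ => _) = (fun y : 'rV[R]_d => y i k)); [exact: coord_continuous|apply/funext => y; rewrite row_mxEl].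
by rewrite (_ : (fun _ => _) = cst (b i k)); [exact: cst_continuous|apply/funext => y; rewrite row_mxEr].
Qed.

Lemma row_mx_contr (a : 'rV[R]_d) : continuous (fun x : 'rV[R]_e => row_mx a x).
Proof.
move=> x; apply: continuous_mx => i j.
case: (split_ordP j) => k ->.
  by rewrite (_ : (fun _ => _) = cst (a i k)); [exact: cst_continuous|apply/funext => y; rewrite row_mxEl].
by rewrite (_ : (fun _ => _) = (fun y : 'rV[R]_e => y i k)); [exact: coord_continuous|apply/funext => y; rewrite row_mxEr].
Qed.

Lemma lsubmx_cont : continuous (fun w : 'rV[R]_(d + e) => lsubmx w).
Proof.
move=> w; apply: continuous_mx => i j.
rewrite (_ : (fun _ => _) = (fun y : 'rV[R]_(d + e) => y i (lshift e j))).
  exact: coord_continuous.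
by apply/funext => y; rewrite mxE.
Qed.

Lemma rsubmx_cont : continuous (fun w : 'rV[R]_(d + e) => rsubmx w).
Proof.
move=> w; apply: continuous_mx => i j.
rewrite (_ : (fun _ => _) = (fun y : 'rV[R]_(d + e) => y i (rshift d j))).
  exact: coord_continuous.
by apply/funext => y; rewrite mxE.
Qed.

End row_pairs.

Section charts.
Context {R : realType} {d : nat}.

Lemma open_preimage_on (T S : topologicalType) (U : set T) (O : set S) (f : T -> S) :
  open U -> open O -> (forall x, U x -> {for x, continuous f}) ->
  open (U `&` f @^-1` O).
Proof.
move=> oU oO cf; rewrite openE => x [Ux Ofx].
apply: filterI; first exact: open_nbhs_nbhs.
by apply: (cf x Ux); apply: open_nbhs_nbhs.
Qed.

Lemma cinv_preimage_open (M : topologicalType) (c : chart R d M) (O : set M) :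
  open O -> open (cimg c `&` cinv c @^-1` O).
Proof. by move=> oO; apply: open_preimage_on => //; [exact: cimg_open|exact: cinv_cont]. Qed.

Lemma cmap_preimage_open (M : topologicalType) (c : chart R d M) (O : set 'rV[R]_d) :
  open O -> open (cdom c `&` cmap c @^-1` O).
Proof. by move=> oO; apply: open_preimage_on => //; [exact: cdom_open|exact: cmap_cont]. Qed.

Context {M : manifoldType R d}.

(** A parametrised form of smoothness whose source is a region of a normed space. Inverse charts and
    pairs of them are of this kind, and group products and actions preserve it, which replaces most
    computations in charts. *)
Definition smooth_into (V : normedModType R) (U : set V) (phi : V -> M) :=
  (forall x, U x -> {for x, continuous phi}) /\
  forall c : chart R d M, atlas c ->
    smooth_on (U `&` phi @^-1` cdom c) (cmap c \o phi).

Lemma smooth_into_open (V : normedModType R) (U : set V) (phi : V -> M) (O : set M) :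
  open U -> open O -> smooth_into U phi -> open (U `&` phi @^-1` O).
Proof. by move=> oU oO [cphi _]; apply: open_preimage_on. Qed.

Lemma smooth_into_fun (V : normedModType R) (U : set V) (phi : V -> M) (f : M -> R) :
  open U -> smooth_into U phi -> smooth_fun f -> smooth_on U (f \o phi).
Proof.
move=> oU sphi sf; have [cphi sc] := sphi.
apply: smooth_on_cover => x Ux.
have [c ac cx] := atlas_cover (phi x).
have oU' := smooth_into_open oU (@cdom_open _ _ _ c) sphi.
exists (U `&` phi @^-1` cdom c) => //.
apply: (@smooth_on_eq _ _ _ _ ((f \o cinv c) \o (cmap c \o phi))) => //.
  by move=> y [Uy cy] /=; rewrite cmapK.
apply: smooth_on_comp (sc c ac) (sf c ac) => //; first exact: cimg_open.
by move=> y [Uy cy] /=; exact: cmap_img.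
Qed.

Lemma smooth_into_cinv (c : chart R d M) : atlas c -> smooth_into (cimg c) (cinv c).
Proof.
by move=> ac; split=> [u cu|c' ac']; [exact: cinv_cont|exact: atlas_compat].
Qed.

Lemma smooth_fun_cst (a : R) : smooth_fun (fun _ : M => a).
Proof. by move=> c ac; exact: smooth_on_cst. Qed.

Lemma smooth_funD (f g : M -> R) : smooth_fun f -> smooth_fun g -> smooth_fun (fun p => f p + g p).
Proof. by move=> sf sg c ac; apply: (smooth_onD (@cimg_open _ _ _ c) (sf c ac) (sg c ac)). Qed.

Lemma smooth_funM (f g : M -> R) : smooth_fun f -> smooth_fun g -> smooth_fun (fun p => f p * g p).
Proof. by move=> sf sg c ac; apply: (smooth_onM (@cimg_open _ _ _ c) (sf c ac) (sg c ac)). Qed.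

End charts.

Lemma continuous_pair_comp (T A B C : topologicalType) (f : T -> A) (g : T -> B)
    (h : A * B -> C) x :
  {for x, continuous f} -> {for x, continuous g} -> {for (f x, g x), continuous h} ->
  {for x, continuous (fun y => h (f y, g y))}.
Proof.
move=> cf cg ch; apply: (@continuous_comp _ _ _ (fun y => (f y, g y)) h) => //.
exact: cvg_pair.
Qed.

Section smooth_map2_lemmas.
Context {R : realType} {d e k : nat} {M : manifoldType R d} {N : manifoldType R e}
  {P : manifoldType R k}.

Definition pair_fun (T : Type) (f : M -> N -> T) (c : chart R d M) (c' : chart R e N)
  (w : 'rV[R]_(d + e)) : T := f (cinv c (lsubmx w)) (cinv c' (rsubmx w)).

Definition pair_dom (c : chart R d M) (c' : chart R e N) : set 'rV[R]_(d + e) :=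
  [set w | cimg c (lsubmx w) /\ cimg c' (rsubmx w)].

Lemma pair_dom_open c c' : open (pair_dom c c').
Proof.
have -> : pair_dom c c' = ((fun w => lsubmx w) @^-1` cimg c) `&` ((fun w => rsubmx w) @^-1` cimg c') by [].
apply: openI; apply: open_comp => [w _|].
- exact: lsubmx_cont.
- exact: cimg_open.
- exact: rsubmx_cont.
- exact: cimg_open.
Qed.

Lemma smooth_map2_into (f : M -> N -> P) c c' : smooth_map2 f -> atlas c -> atlas c' ->
  smooth_into (pair_dom c c') (pair_fun f c c').
Proof.
move=> [cf sf] ac ac'; split=> [w [cw cw']|c'' ac''].
  apply: (@continuous_pair_comp _ _ _ _ (fun w => cinv c (lsubmx w)) (fun w => cinv c' (rsubmx w)) (fun z : M * N => f z.1 z.2)); last exact: cf.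
    by apply: continuous_comp; [exact: lsubmx_cont|exact: cinv_cont].
  by apply: continuous_comp; [exact: rsubmx_cont|exact: cinv_cont].
apply: smooth_on_sub (sf c c' c'' ac ac' ac'').
by move=> w [[cw cw'] c''w].
Qed.

Lemma pair_fun_row (T : Type) (f : M -> N -> T) c c' u y :
  pair_fun f c c' (row_mx u y) = f (cinv c u) (cinv c' y).
Proof. by rewrite /pair_fun row_mxKl row_mxKr. Qed.

End smooth_map2_lemmas.

Section bump_functions.
Context {R : realType} {d : nat} {M : manifoldType R d}.
Variables (c : chart R d M) (u0 : 'rV[R]_d) (r r' : R).

(** The norm on rows is the maximum norm, so a product over coordinates vanishes outside the ball of
    radius [r]. *)
Definition bump (u : 'rV[R]_d) : R :=
  \prod_(i < d) (flat 0 (r - (u - u0) 0 i) * flat 0 (r + (u - u0) 0 i)).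

Lemma bump_out u : 0 <= r -> r < `|u - u0| -> bump u = 0.
Proof.
move=> r0 ru.
have [[i j] /= E] : exists i, mx_norm (u - u0) = `|(u - u0) i.1 i.2|.
  by apply: mx_norm_neq0; rewrite gt_eqF // (le_lt_trans r0).
rewrite ord1 in E.
rewrite /bump (bigD1 j) //= [X in X * _](_ : _ = 0) ?mul0r //.
have : r < `|(u - u0) 0 j| by rewrite -E.
rewrite lter_normr => /orP[H|H].
  by rewrite {1}/flat ifF ?mul0r //; apply/negbTE; rewrite -leNgt subr_le0 ltW.
rewrite [X in _ * X](_ : _ = 0) ?mulr0 // /flat ifF //.
by apply/negbTE; rewrite -leNgt -lerBrDr sub0r ltW.
Qed.

Lemma bump_smooth : smooth_on setT bump.
Proof.
have oT : open (setT : set 'rV[R]_d) := openT.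
move=> k; apply: Ck_on_prod => // i _.
apply: Ck_onM => //.
  apply: (@Ck_on_affine _ _ _ _ (fun u : 'rV[R]_d => r - (u - u0) 0 i) (fun v => - v 0 i) k setT).
  - by move=> h v x; rewrite !mxE /GRing.scale /=; ring.
  - move=> x; apply: continuousB; first exact: cst_continuous.
    rewrite (_ : (fun _ => _) = (fun u : 'rV[R]_d => u 0 i - u0 0 i)); last by apply/funext => u; rewrite !mxE.
    by apply: continuousB; [exact: coord_continuous|exact: cst_continuous].
  - exact: Ck_flat.
apply: (@Ck_on_affine _ _ _ _ (fun u : 'rV[R]_d => r + (u - u0) 0 i) (fun v => v 0 i) k setT).
- by move=> h v x; rewrite !mxE /GRing.scale /=; ring.
- move=> x; apply: continuousD; first exact: cst_continuous.
  rewrite (_ : (fun _ => _) = (fun u : 'rV[R]_d => u 0 i - u0 0 i)); last by apply/funext => u; rewrite !mxE.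
  by apply: continuousB; [exact: coord_continuous|exact: cst_continuous].
- exact: Ck_flat.
Qed.

Lemma bump_center : 0 < r -> 0 < bump u0.
Proof.
move=> r0; apply: prodr_gt0 => i _; rewrite subrr !mxE subr0 addr0.
have fr : 0 < flat 0 r by rewrite /flat r0 expr0 mul1r expR_gt0.
exact: mulr_gt0.
Qed.

Definition extend (h : 'rV[R]_d -> R) (p : M) : R :=
  if `[< cdom c p >] then h (cmap c p) * bump (cmap c p) else 0.

Hypotheses (r0 : 0 < r) (rr' : r < r') (Br' : ball u0 r' `<=` cimg c) (ac : atlas c).

(** The delicate points are those outside the domain of [c]. The image in [M] of the closed ball of
    radius [r] is compact, hence closed by the Hausdorff property, and off this closed set the
    extension is identically zero. *)
Lemma extend_smooth h : smooth_on (ball u0 r') h -> smooth_fun (extend h).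
Proof.
move=> sh.
have sk : smooth_on setT (fun u => h u * bump u).
  apply: smooth_on_cover => u _.
  have [ur|ur] := ltP `|u - u0| r'.
    exists (ball u0 r'); first by rewrite -ball_normE /ball_ /= distrC.
    apply: smooth_onM => //; first exact: ball_open.
    exact: smooth_on_sub bump_smooth.
  exists (~` [set u | `|u0 - u| <= r]).
    by apply/negP; rewrite -ltNge distrC (lt_le_trans rr').
  apply: (@smooth_on_eq _ _ _ _ (cst 0)); last exact: smooth_on_cst.
  - by rewrite openC; exact: (@closed_closed_ball_ _ _ u0 r).
  - move=> x /negP; rewrite -ltNge distrC => rx.
    by rewrite bump_out ?mulr0 // ltW.
move=> c' ac'; apply: smooth_on_cover => u c'u.
have [cu|ncu] := pselect (cdom c (cinv c' u)).
  exists (cimg c' `&` cinv c' @^-1` cdom c) => //.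
  have oU := @cinv_preimage_open _ _ _ c' _ (@cdom_open _ _ _ c).
  apply: (@smooth_on_eq _ _ _ _ ((fun u => h u * bump u) \o (cmap c \o cinv c'))) => //.
    by move=> x [_ cx] /=; rewrite /extend asboolT.
  apply: smooth_on_comp sk => //; first exact: openT.
  exact: atlas_compat.
pose K := cinv c @` [set u | `|u0 - u| <= r].
have Kc : [set u | `|u0 - u| <= r] `<=` cimg c.
  by move=> x /= xr; apply: Br'; rewrite -ball_normE /ball_ /= (le_lt_trans xr).
have cK : closed K.
  apply: compact_closed; first exact: manifold_hausdorff.
  apply: continuous_compact; last exact: compact_cball.
  apply: continuous_in_subspaceT => x; rewrite inE => /Kc; exact: cinv_cont.
exists (cimg c' `&` cinv c' @^-1` (~` K)).
  split=> //= -[x xr E]; apply: ncu; rewrite -E; apply: cinv_dom; exact: Kc.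
apply: (@smooth_on_eq _ _ _ _ (cst 0)); last exact: smooth_on_cst.
  by apply: cinv_preimage_open; rewrite openC.
move=> x [cx nK] /=; rewrite /extend; case: asboolP => // cdx.
rewrite bump_out ?mulr0 ?(ltW r0) // ltNge; apply/negP => xr; apply: nK.
by exists (cmap c (cinv c' x)); [rewrite /= distrC|rewrite cmapK].
Qed.

End bump_functions.

Lemma ball_in_cimg (R : realType) d (M : topologicalType) (c : chart R d M) u0 : cimg c u0 ->
  exists2 r, 0 < r & ball u0 r `<=` cimg c.
Proof.
move=> cu; have /nbhs_ballP[r /= r0 Hr] := open_nbhs_nbhs (conj (@cimg_open _ _ _ c) cu).
by exists r.
Qed.

(** * Tangent vectors as derivations at a point *)

Section derivations.
Context {R : realType} {d : nat} {M : manifoldType R d}.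
Variables (c : chart R d M) (p0 : M).
Hypotheses (ac : atlas c) (cp : cdom c p0).
Local Notation u0 := (cmap c p0).

Definition der_at (v : 'rV[R]_d) (f : M -> R) : R := 'D_v (f \o cinv c) u0.

Let u0c : cimg c u0. Proof. exact: cmap_img. Qed.
Let cu0 : cinv c u0 = p0. Proof. exact: cmapK. Qed.

Lemma der_at_derivable f v : smooth_fun f -> derivable (f \o cinv c) u0 v.
Proof. by move=> sf; apply: smooth_on_derivable (sf c ac) u0c. Qed.

Lemma der_atD (a : R) f g v : smooth_fun f -> smooth_fun g ->
  der_at v (fun p => a * f p + g p) = a * der_at v f + der_at v g.
Proof.
move=> sf sg; rewrite /der_at.
have -> : (fun p => a * f p + g p) \o cinv c = a \*: (f \o cinv c : _ -> R^o) + (g \o cinv c) by [].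
have df := @der_at_derivable f v sf.
by rewrite deriveD ?deriveZ //; [exact: derivableZ|exact: der_at_derivable].
Qed.

Lemma der_atM f g v : smooth_fun f -> smooth_fun g ->
  der_at v (fun p => f p * g p) = f p0 * der_at v g + der_at v f * g p0.
Proof.
move=> sf sg; rewrite /der_at.
have -> : (fun p => f p * g p) \o cinv c = (f \o cinv c) * (g \o cinv c) by [].
rewrite deriveM; [|exact: der_at_derivable|exact: der_at_derivable].
by rewrite /= cu0 /GRing.scale /= [X in _ + X]mulrC.
Qed.

Lemma der_at_lin f v : smooth_fun f ->
  der_at v f = \sum_i v 0 i * der_at (delta_mx 0 i) f.
Proof. by move=> sf; rewrite /der_at (C1_derive_sum v (@cimg_open _ _ _ c) u0c (sf c ac 1%N)). Qed.

Definition point_derivation (D : (M -> R) -> R) :=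
  (forall (a : R) f g, smooth_fun f -> smooth_fun g ->
    D (fun p => a * f p + g p) = a * D f + D g) /\
  (forall f g, smooth_fun f -> smooth_fun g ->
    D (fun p => f p * g p) = f p0 * D g + D f * g p0).

Variables (r r' : R).
Hypotheses (r0 : 0 < r) (rr' : r < r') (Br : ball u0 r' `<=` cimg c).

(** Dividing by the central value of the bump makes the differential at [p0] exactly the [i]-th
    coordinate: the factor [u - u0] vanishes there, so the derivative of the bump does not
    contribute. *)
Definition coord_fun (i : 'I_d) : M -> R :=
  extend c u0 r (fun u => (u - u0) 0 i / bump u0 r u0).

Let smooth_coord U a i : open U -> smooth_on U (fun u : 'rV[R]_d => (u - u0) 0 i / a).
Proof.
move=> oU k; apply: (@Ck_on_eq _ _ _ k U (fun u => u 0 i * a^-1 + (- u0 0 i / a))) => //.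
  by move=> u _; rewrite !mxE mulrBl mulNr.
apply: Ck_onD => //; last exact: Ck_on_cst.
apply: Ck_onM => //; last exact: Ck_on_cst.
by have /(Ck_on_mxP _ _ oU) := @Ck_on_id _ _ k U; apply.
Qed.

Lemma coord_fun_smooth i : smooth_fun (coord_fun i).
Proof.
by apply: extend_smooth rr' Br _ _ _ => //; apply: smooth_coord; exact: ball_open.
Qed.

Lemma der_at_coord v i : der_at v (coord_fun i) = v 0 i.
Proof.
rewrite /der_at /coord_fun.
have b0 := bump_center u0 r0.
have nE : \forall u \near u0, ((fun u => (u - u0) 0 i / bump u0 r u0) * bump u0 r) u =
    (extend c u0 r (fun u => (u - u0) 0 i / bump u0 r u0) \o cinv c) u.
  apply: filterS (open_nbhs_nbhs (conj (@cimg_open _ _ _ c) u0c)) => u cu /=.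
  by rewrite /extend asboolT ?cinvK //; exact: cinv_dom.
rewrite -(near_eq_derive v nE).
have oT : open (setT : set 'rV[R]_d) := openT.
rewrite deriveM; last 2 first.
- exact: smooth_on_derivable (smooth_coord (U := setT) _ i oT) _.
- exact: smooth_on_derivable (@bump_smooth _ _ u0 r) _.
rewrite subrr mxE mul0r scale0r add0r.
rewrite (_ : 'D_v _ u0 = v 0 i / bump u0 r u0); last first.
  have := @derive_affine _ _ _ _ (fun u : 'rV[R]_d => (u - u0) 0 i / bump u0 r u0)
    (fun v => v 0 i / bump u0 r u0) id u0 v.
  move=> -> ; first exact: derive_id.
  by move=> h w x; rewrite !mxE /GRing.scale /=; ring.
by rewrite /GRing.scale /= mulrC divfK // gt_eqF.
Qed.

(** Hadamard's lemma writes f - f(p0) as a sum of coordinates times g_i. To make sense of it on all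
    of [M] the identity is multiplied by the cut-off twice, one factor going into [coord_fun] and
    the other into the extension of g_i. After applying [D] the terms containing D(chi) cancel, and
    the g_i enter only through their values at the centre, the partial derivatives of [f]. *)
Lemma point_derivationE D f : point_derivation D -> smooth_fun f ->
  D f = der_at (\row_i D (coord_fun i)) f.
Proof.
move=> [Dlin DM] sf.
have b0 := bump_center u0 r0.
pose b := bump u0 r u0.
have bn : b != 0 by rewrite gt_eqF.
pose ext h := extend c u0 r h.
have sB : smooth_on (ball u0 r') (f \o cinv c) by apply: smooth_on_sub (sf c ac).
have sext h : smooth_on (ball u0 r') h -> smooth_fun (ext h).
  by move=> sh; apply: extend_smooth rr' Br _ _ sh.
pose g i := ray_int u0 0 ('D_(delta_mx 0 i) (f \o cinv c)).
have sg i : smooth_on (ball u0 r') (g i).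
  by move=> k; apply: ray_int_Ck; case: (sB k.+2) => _ _ /(_ (delta_mx 0 i)).
pose chi := ext (cst 1).
have schi : smooth_fun chi by apply: sext; exact: smooth_on_cst.
have D0 : D (fun=> 0) = 0.
  have := Dlin 1 _ _ (smooth_fun_cst 0) (smooth_fun_cst 0).
  rewrite (_ : (fun _ => _) = (fun=> 0)); last by apply/funext => p; rewrite mul1r addr0.
  by rewrite mul1r => /eqP; rewrite addrC -subr_eq subrr => /eqP.
have Dsum (I : seq 'I_d) F : (forall i, smooth_fun (F i)) ->
    smooth_fun (fun p => \sum_(i <- I) F i p) /\
    D (fun p => \sum_(i <- I) F i p) = \sum_(i <- I) D (F i).
  move=> sF; elim: I => [|i I [IH1 IH2]].
    rewrite big_nil (_ : (fun _ => _) = (fun=> 0)); last by apply/funext => p; rewrite big_nil.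
    by split=> //; exact: smooth_fun_cst.
  rewrite (_ : (fun _ => _) = (fun p => 1 * F i p + \sum_(i <- I) F i p)); last first.
    by apply/funext => p; rewrite big_cons mul1r.
  rewrite big_cons Dlin // mul1r IH2; split => //.
  apply: smooth_funD => //; apply: smooth_funM => //; exact: smooth_fun_cst.
have ext1 h : ext h p0 = h u0 * b by rewrite /ext /extend asboolT.
have key : (fun p => (f p * chi p) * chi p) =
    (fun p => f p0 * (chi p * chi p) + \sum_i (coord_fun i p * ext (fun u => b * g i u) p)).
  apply/funext => p; rewrite /chi /coord_fun /ext /extend.
  case: asboolP => cpp; last first.
    by rewrite !mulr0 big1 ?addr0 // => i _; rewrite mulr0.
  have [pr|pr] := ltP `|cmap c p - u0| r'; last first.
    have rp : r < `|cmap c p - u0| by exact: lt_le_trans rr' pr.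
    have B0 : bump u0 r (cmap c p) = 0 := bump_out (ltW r0) rp.
    by rewrite B0 !mulr0 big1 ?addr0 // => i _; rewrite !mulr0.
  have pB : ball u0 r' (cmap c p) by rewrite -ball_normE /ball_ /= distrC.
  have := hadamard sB pB; rewrite /= cmapK // cu0 => /eqP.
  rewrite subr_eq => /eqP Hf; rewrite {1}Hf.
  rewrite /cst !mul1r -mulrA mulrDl addrC; congr (_ + _).
  by rewrite mulr_suml; apply: eq_bigr => i _; rewrite -/b /g; field.
have := congr1 D key; rewrite !DM //; last exact: smooth_funM.
have sgi i : smooth_fun (ext (fun u => b * g i u)).
  by apply: sext; apply: smooth_onM; [exact: ball_open|exact: smooth_on_cst|exact: sg].
have [Ds1 Ds2] := Dsum (index_enum _) (fun i p => coord_fun i p * ext (fun u => b * g i u) p)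
   (fun i => smooth_funM (coord_fun_smooth i) (sgi i)).
rewrite Dlin //; last exact: smooth_funM.
have chi1 : chi p0 = b by rewrite /chi ext1 mul1r.
rewrite Ds2 DM // chi1.
rewrite (eq_bigr (fun i => D (coord_fun i) * (b * g i u0 * b))); last first.
  move=> i _; rewrite DM //; last exact: coord_fun_smooth.
  by rewrite ext1 [X in X * _](_ : _ = 0) ?mul0r ?add0r // /coord_fun /extend asboolT // subrr mxE !mul0r.
move=> H.
have {}H : D f * (b * b) = \sum_i D (coord_fun i) * (b * g i u0 * b).
  apply: (addrI (f p0 * (b * D chi + D chi * b))).
  by rewrite -H; ring.
rewrite der_at_lin //; apply: (mulIf (mulf_neq0 bn bn)); rewrite H mulr_suml.
apply: eq_bigr => i _; rewrite mxE /g ray_int_center /der_at; ring.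
Qed.

End derivations.

(** These three properties are all that later sections use of the cut-off coordinates: tangent
    vectors are rows whose entries are read off on [psi], and a derivation is determined by its
    values on [psi]. *)
Lemma ex_coord_fun (R : realType) d (M : manifoldType R d) (c : chart R d M) p0 :
  atlas c -> cdom c p0 ->
  exists psi : 'I_d -> M -> R,
    [/\ forall i, smooth_fun (psi i), forall v i, der_at c p0 v (psi i) = v 0 i &
     forall D f, point_derivation p0 D -> smooth_fun f ->
       D f = der_at c p0 (\row_i D (psi i)) f].
Proof.
move=> ac cp.
have [r' r'0 Hr'] := ball_in_cimg (cmap_img cp).
have r0 : 0 < r' / 2 by rewrite divr_gt0.
have rr : r' / 2 < r' by rewrite ltr_pdivrMr // ltr_pMr // ltr1n.
exists (coord_fun c p0 (r' / 2)); split.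
- move=> i; exact: coord_fun_smooth rr Hr' _.
- move=> v i; exact: der_at_coord.
- move=> D f; exact: point_derivationE rr Hr' _ _.
Qed.

Section smooth_into_calculus.
Context {R : realType}.

Lemma smooth_into_sub d (M : manifoldType R d) (V : normedModType R) (U U' : set V) (phi : V -> M) :
  U' `<=` U -> smooth_into U phi -> smooth_into U' phi.
Proof.
move=> UU' [cphi sphi]; split=> [x /UU'|c ac]; first exact: cphi.
by apply: smooth_on_sub (sphi c ac) => x [/UU' Ux cx].
Qed.

Lemma smooth_into_cst d (M : manifoldType R d) (V : normedModType R) (U : set V) (p : M) :
  smooth_into U (fun=> p).
Proof. by split=> [x _|c ac]; [exact: cst_continuous|exact: smooth_on_cst]. Qed.

Lemma smooth_into_affine d (M : manifoldType R d) (V V' : normedModType R) (A L : V' -> V)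
    (U : set V) (phi : V -> M) :
  (forall h v x, A (h *: v + x) = h *: L v + A x) -> continuous A ->
  smooth_into U phi -> smooth_into (A @^-1` U) (phi \o A).
Proof.
move=> HA cA [cphi sphi]; split=> [x Ux|c ac].
  by apply: continuous_comp; [exact: cA|exact: cphi].
exact: (smooth_on_affine HA cA (sphi c ac)).
Qed.

Lemma smooth_into_map d e (M : manifoldType R d) (N : manifoldType R e) (V : normedModType R)
    (U : set V) (phi : V -> M) (f : M -> N) : open U ->
  smooth_map f -> smooth_into U phi -> smooth_into U (f \o phi).
Proof.
move=> oU [cf sf] [cphi sphi].
have co x : U x -> {for x, continuous (f \o phi)}.
  by move=> Ux; apply: continuous_comp; [exact: cphi|exact: cf].
split=> // c' ac'.
apply: smooth_on_cover => x [Ux cx].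
have [c ac cx'] := atlas_cover (phi x).
pose U' := (U `&` phi @^-1` cdom c) `&` (U `&` (f \o phi) @^-1` cdom c').
have oU' : open U'.
  by apply: openI; apply: open_preimage_on => //; exact: cdom_open.
exists U' => //.
have oD : open (cimg c `&` cinv c @^-1` (f @^-1` cdom c')).
  apply: cinv_preimage_open; apply: open_comp => [p _|]; [exact: cf|exact: cdom_open].
apply/(smooth_on_mxP _ oU') => i j.
apply: (@smooth_on_eq _ _ _ _ ((fun u => (cmap c' \o f \o cinv c) u i j) \o (cmap c \o phi))) => //.
  by move=> y [[_ cy] _] /=; rewrite cmapK.
apply: (@smooth_on_comp _ _ _ _ (cimg c `&` cinv c @^-1` (f @^-1` cdom c'))) => //.
- by move=> y [[Uy cy] [_ c'y]]; split; [exact: cmap_img|rewrite /= cmapK].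
- by apply: smooth_on_sub (sphi c ac) => y [].
- by have /(smooth_on_mxP _ oD) := sf c c' ac ac'; apply.
Qed.

Lemma smooth_row_mx (V : normedModType R) d e (U : set V) (f : V -> 'rV[R]_d) (g : V -> 'rV[R]_e) :
  open U -> smooth_on U f -> smooth_on U g -> smooth_on U (fun x => row_mx (f x) (g x)).
Proof.
move=> oU sf sg; apply/(smooth_on_mxP _ oU) => i j.
case: (split_ordP j) => k ->.
  rewrite (_ : (fun _ => _) = (fun y => f y i k)); last by apply/funext => y; rewrite row_mxEl.
  by have /(smooth_on_mxP _ oU) := sf; apply.
rewrite (_ : (fun _ => _) = (fun y => g y i k)); last by apply/funext => y; rewrite row_mxEr.
by have /(smooth_on_mxP _ oU) := sg; apply.
Qed.

Lemma smooth_into_map2 d e k (M : manifoldType R d) (N : manifoldType R e) (P : manifoldType R k)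
    (V : normedModType R) (U : set V) (phi : V -> M) (psi : V -> N) (f : M -> N -> P) : open U ->
  smooth_map2 f -> smooth_into U phi -> smooth_into U psi ->
  smooth_into U (fun x => f (phi x) (psi x)).
Proof.
move=> oU sf [cphi sphi] [cpsi spsi]; have [cf _] := sf.
have co x : U x -> {for x, continuous (fun x => f (phi x) (psi x))}.
  move=> Ux; apply: (@continuous_pair_comp _ _ _ _ phi psi (fun z => f z.1 z.2)).
  - exact: cphi.
  - exact: cpsi.
  - exact: cf.
split=> // c'' ac''.
apply: smooth_on_cover => x [Ux cx].
have [c ac cx1] := atlas_cover (phi x).
have [c' ac' cx2] := atlas_cover (psi x).
pose U' := (U `&` phi @^-1` cdom c) `&` (U `&` psi @^-1` cdom c')
  `&` (U `&` (fun x => f (phi x) (psi x)) @^-1` cdom c'').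
have oU' : open U'.
  by apply: openI; [apply: openI|]; apply: open_preimage_on => //; exact: cdom_open.
exists U' => //.
have [_ sF] := smooth_map2_into sf ac ac'.
have oD : open (pair_dom c c' `&` pair_fun f c c' @^-1` cdom c'').
  apply: (smooth_into_open _ _ (smooth_map2_into sf ac ac')); [exact: pair_dom_open|exact: cdom_open].
apply/(smooth_on_mxP _ oU') => i j.
pose q x := row_mx (cmap c (phi x)) (cmap c' (psi x)).
apply: (@smooth_on_eq _ _ _ _ ((fun w => (cmap c'' \o pair_fun f c c') w i j) \o q)) => //.
  by move=> y [[[_ cy] [_ cy']] _] /=; rewrite /q pair_fun_row !cmapK.
apply: (@smooth_on_comp _ _ _ _ (pair_dom c c' `&` pair_fun f c c' @^-1` cdom c'')) => //.
- move=> y [[[Uy cy] [_ cy']] [_ cy'']]; split.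
    by rewrite /pair_dom /q /= row_mxKl row_mxKr; split; exact: cmap_img.
  by rewrite /= /q pair_fun_row !cmapK.
- apply: smooth_row_mx => //.
    by apply: smooth_on_sub (sphi c ac) => y [[]].
  by apply: smooth_on_sub (spsi c' ac') => y [[]].
- by have /(smooth_on_mxP _ oD) := sF c'' ac''; apply.
Qed.

Lemma der_chain d (M : manifoldType R d) (V : normedModType R) (U : set V) (phi : V -> M)
    (c : chart R d M) (f : M -> R) x v : open U -> U x -> smooth_into U phi -> atlas c ->
  cdom c (phi x) -> smooth_fun f ->
  'D_v (f \o phi) x = der_at c (phi x) ('D_v (cmap c \o phi) x) f.
Proof.
move=> oU Ux sphi ac cx sf; have [_ sc] := sphi.
have oU' := smooth_into_open oU (@cdom_open _ _ _ c) sphi.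
rewrite /der_at.
have nE : \forall y \near x, ((f \o cinv c) \o (cmap c \o phi)) y = (f \o phi) y.
  by apply: filterS (open_nbhs_nbhs (conj oU' (conj Ux cx))) => y [Uy cy] /=; rewrite cmapK.
rewrite -(near_eq_derive v nE).
have cu : cimg c ((cmap c \o phi) x) by exact: cmap_img.
have dphi : derivable (cmap c \o phi) x v by apply: smooth_on_derivable (sc c ac) _.
have [_ ->] := derive_comp (@cimg_open _ _ _ c) cu (sf c ac 1%N) dphi.
by rewrite (C1_derive_sum _ (@cimg_open _ _ _ c) cu (sf c ac 1%N)).
Qed.

(** A partial derivative in the second block is a directional derivative of [K] restricted to an
    affine slice, hence it is smooth in the remaining variables. *)
Lemma smooth_partial d e (W : set 'rV[R]_(d + e)) (K : 'rV[R]_(d + e) -> R) y0 v : open W ->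
  smooth_on W K ->
  smooth_on ((fun u => row_mx u y0) @^-1` W) (fun u => 'D_v (fun y => K (row_mx u y)) y0).
Proof.
move=> oW sK.
have -> : (fun u => 'D_v (fun y => K (row_mx u y)) y0) = ('D_(row_mx 0 v) K) \o (fun u => row_mx u y0).
  apply/funext => u /=.
  exact: (@derive_affine _ _ _ _ (fun y => row_mx u y) (fun v => row_mx 0 v) K y0 v (@row_mx_linr _ _ _ u)).
apply: (smooth_on_affine (@row_mx_linl _ _ _ y0) (@row_mx_contl _ _ _ y0)).
exact: smooth_on_derive.
Qed.

Lemma partial_swap d e (W : set 'rV[R]_(d + e)) (K : 'rV[R]_(d + e) -> R) u0 y0 w v : open W ->
  smooth_on W K -> W (row_mx u0 y0) ->
  'D_w (fun u => 'D_v (fun y => K (row_mx u y)) y0) u0 =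
  'D_v (fun y => 'D_w (fun u => K (row_mx u y)) u0) y0.
Proof.
move=> oW sK Wu.
have -> : (fun u => 'D_v (fun y => K (row_mx u y)) y0) = ('D_(row_mx 0 v) K) \o (fun u => row_mx u y0).
  apply/funext => u /=.
  exact: (@derive_affine _ _ _ _ (fun y => row_mx u y) (fun v => row_mx 0 v) K y0 v (@row_mx_linr _ _ _ u)).
have -> : (fun y => 'D_w (fun u => K (row_mx u y)) u0) = ('D_(row_mx w 0) K) \o (fun y => row_mx u0 y).
  apply/funext => y /=.
  exact: (@derive_affine _ _ _ _ (fun u => row_mx u y) (fun w => row_mx w 0) K u0 w (@row_mx_linl _ _ _ y)).
rewrite (derive_affine _ _ _ (@row_mx_linl _ _ _ y0)) (derive_affine _ _ _ (@row_mx_linr _ _ _ u0)).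
exact: (schwarz _ _ oW Wu (sK 2)).
Qed.

Lemma derive_diag d (W : set 'rV[R]_(d + d)) (K : 'rV[R]_(d + d) -> R) u w : open W ->
  smooth_on W K -> W (row_mx u u) ->
  'D_w (fun x => K (row_mx x x)) u =
  'D_w (fun x => K (row_mx x u)) u + 'D_w (fun y => K (row_mx u y)) u.
Proof.
move=> oW sK Wu.
rewrite (@derive_affine _ _ _ _ (fun x => row_mx x x) (fun v => row_mx v v) K u w); last first.
  by move=> h v x; rewrite scale_row_mx add_row_mx.
rewrite (@derive_affine _ _ _ _ (fun x => row_mx x u) (fun v => row_mx v 0) K u w (@row_mx_linl _ _ _ u)).
rewrite (@derive_affine _ _ _ _ (fun x => row_mx u x) (fun v => row_mx 0 v) K u w (@row_mx_linr _ _ _ u)).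
have -> : row_mx w w = 1 *: row_mx w 0 + row_mx 0 w by rewrite scale1r add_row_mx addr0 add0r.
by rewrite (derive_lin2 _ _ _ oW Wu (sK 1%N)) mul1r.
Qed.

(** The fibre of [Phi] through [y] is closed, and it is open because the coordinates of [Phi] have
    zero derivative on small balls. The hypothesis is tested on scalar functions [h], among which
    are cut-off coordinates at any point of the target. *)
Lemma zero_der_cst d e (M : manifoldType R d) (N : manifoldType R e) (Phi : M -> N) :
  connected [set: M] -> (forall c : chart R d M, atlas c -> smooth_into (cimg c) (Phi \o cinv c)) ->
  (forall (c : chart R d M) u v h, atlas c -> cimg c u -> smooth_fun h ->
     'D_v (h \o (Phi \o cinv c)) u = 0) ->
  forall x y, Phi x = Phi y.
Proof.
move=> cM sPhi dPhi x y.
have cPhi : continuous Phi.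
  move=> p; have [c ac cp] := atlas_cover p.
  have nE : \forall q \near p, ((Phi \o cinv c) \o cmap c) q = Phi q.
    by apply: filterS (open_nbhs_nbhs (conj (@cdom_open _ _ _ c) cp)) => q cq /=; rewrite cmapK.
  have H : {for p, continuous ((Phi \o cinv c) \o cmap c)}.
    apply: continuous_comp; first exact: cmap_cont.
    by have [H _] := sPhi c ac; apply: H; exact: cmap_img.
  rewrite /continuous_at -(nbhs_singleton nE).
  by apply: cvg_trans H; apply: near_eq_cvg; apply: filterS nE => q ->.
pose S := [set p | Phi p = Phi y].
suff ST : S = setT by have : S x by rewrite ST.
apply: cM; first by exists y.
  exists S; last by rewrite setTI.
  rewrite openE => p Sp.
  have [c ac cp] := atlas_cover p.
  have [c' ac' cp'] := atlas_cover (Phi p).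
  have oU := smooth_into_open (@cimg_open _ _ _ c) (@cdom_open _ _ _ c') (sPhi c ac).
  have Up : (cimg c `&` (Phi \o cinv c) @^-1` cdom c') (cmap c p).
    by split; [exact: cmap_img|rewrite /= cmapK].
  have /nbhs_ballP[r /= r0 Br] := open_nbhs_nbhs (conj oU Up).
  have [_ /(_ c' ac') sc'] := sPhi c ac.
  have zero i u v : ball (cmap c p) r u ->
      is_derive u v (fun u => (cmap c' \o (Phi \o cinv c)) u 0 i : R) 0.
    move=> /Br Uu; have [cu c'u] := Uu.
    have sci : smooth_on (cimg c `&` (Phi \o cinv c) @^-1` cdom c') (fun u => (cmap c' \o (Phi \o cinv c)) u 0 i : R).
      by have /(smooth_on_mxP _ oU) := sc'; apply.
    split; first exact: smooth_on_derivable sci Uu.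
    have [psi [spsi dpsi _]] := ex_coord_fun ac' c'u.
    have := dPhi c u v (psi i) ac cu (spsi i).
    rewrite (der_chain v (@cimg_open _ _ _ c) cu (sPhi c ac) ac' c'u (spsi i)).
    rewrite dpsi derive_mx ?mxE //.
    exact: smooth_on_derivable sc' Uu.
  have E u : ball (cmap c p) r u -> Phi (cinv c u) = Phi p.
    move=> ru.
    have [_ c'u] := Br _ ru.
    rewrite -[LHS](cmapK c'u) -[RHS](cmapK cp'); congr cinv.
    apply/rowP => i.
    have := @zero_derive_cst _ _ _ (cmap c p) r (zero i) u ru.
    by rewrite /= cmapK.
  have oV := @cmap_preimage_open _ _ _ c _ (@ball_open _ _ (cmap c p) r).
  apply: filterS (open_nbhs_nbhs (conj oV _)); last by split=> //; exact: ballxx.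
  by move=> q [cq rq]; rewrite /S /= -Sp -(E _ rq) cmapK.
exists S; last by rewrite setTI.
have -> : S = Phi @^-1` [set Phi y] by [].
apply: closed_comp => [p _|]; first exact: cPhi.
apply: accessible_closed_set1; apply: hausdorff_accessible; exact: manifold_hausdorff.
Qed.

End smooth_into_calculus.

(** * Lie groups and their Lie algebras *)

Section der_lemmas.
Context {R : realType} {d : nat} {M : manifoldType R d} (c : chart R d M).

Lemma der_ext (p : M) v (f g : M -> R) : f =1 g -> der_at c p v f = der_at c p v g.
Proof. by move=> /funext ->. Qed.

Lemma der_atE (p : M) v (f : M -> R) (F : 'rV[R]_d -> R) : (forall y, F y = f (cinv c y)) ->
  'D_v F (cmap c p) = der_at c p v f.
Proof. by move=> H; rewrite /der_at (_ : F = f \o cinv c) //; apply/funext. Qed.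

Lemma derive_ext (V W : normedModType R) (f g : V -> W) x v : f =1 g -> 'D_v f x = 'D_v g x.
Proof. by move=> /funext ->. Qed.

Lemma smooth_on_ext (V W : normedModType R) (U U' : set V) (f g : V -> W) : U = U' -> f =1 g ->
  smooth_on U f -> smooth_on U' g.
Proof. by move=> -> /funext ->. Qed.

End der_lemmas.

Lemma pair_dom_rowl (R : realType) d e (M : manifoldType R d) (N : manifoldType R e)
    (c : chart R d M) (c' : chart R e N) y : cimg c' y ->
  (fun u => row_mx u y) @^-1` pair_dom c c' = cimg c.
Proof.
by move=> cy; apply/seteqP; split=> [u []|u cu] /=; rewrite /pair_dom /= ?row_mxKl ?row_mxKr.
Qed.

Section pair_into.
Context {R : realType} {d e : nat} {M : manifoldType R d} {N : manifoldType R e}.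
Variables (c : chart R d M) (c' : chart R e N).

Lemma pair_into_l : atlas c -> smooth_into (pair_dom c c') (fun w => cinv c (lsubmx w)).
Proof.
move=> ac.
have H := @smooth_into_affine R d M _ _ (fun w : 'rV[R]_(d + e) => lsubmx w) (fun w => lsubmx w) (cimg c) (cinv c) _ _ (smooth_into_cinv ac).
have {}H := H (fun (k : R) (s x : 'rV[R]_(d + e)) => linearP (@lsubmx R 1 d e) k s x) (@lsubmx_cont R d e).
by apply: smooth_into_sub H => w [].
Qed.

Lemma pair_into_r : atlas c' -> smooth_into (pair_dom c c') (fun w => cinv c' (rsubmx w)).
Proof.
move=> ac.
have H := @smooth_into_affine R e N _ _ (fun w : 'rV[R]_(d + e) => rsubmx w) (fun w => rsubmx w) (cimg c') (cinv c') _ _ (smooth_into_cinv ac).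
have {}H := H (fun (k : R) (s x : 'rV[R]_(d + e)) => linearP (@rsubmx R 1 d e) k s x) (@rsubmx_cont R d e).
by apply: smooth_into_sub H => w [].
Qed.

End pair_into.

Section lie_group.
Context {R : realType} {d : nat} {G : lieGroupType R d}.
Variable (c0 : chart R d G).
Hypotheses (ac0 : atlas c0) (c01 : cdom c0 (1%g : G)).
Local Notation u0 := (cmap c0 (1%g : G)).
Local Notation e_ i := (delta_mx 0 i : 'rV[R]_d).
Implicit Types (a b : G) (f h : G -> R) (v : 'rV[R]_d).

Let u0c : cimg c0 u0. Proof. exact: cmap_img. Qed.
Let cu0 : cinv c0 u0 = (1%g : G). Proof. exact: cmapK. Qed.
Let oc : open (cimg c0). Proof. exact: cimg_open. Qed.

Lemma smooth_into_mul (V : normedModType R) (U : set V) (phi psi : V -> G) : open U ->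
  smooth_into U phi -> smooth_into U psi -> smooth_into U (fun x => (phi x * psi x)%g).
Proof. by move=> oU; apply: smooth_into_map2 => //; exact: lie_mul_smooth. Qed.

Lemma smooth_into_inv (V : normedModType R) (U : set V) (phi : V -> G) : open U ->
  smooth_into U phi -> smooth_into U (fun x => (phi x)^-1%g).
Proof. by move=> oU; apply: (smooth_into_map oU); exact: lie_inv_smooth. Qed.

Lemma smooth_fun_into (f : G -> R) :
  (forall c : chart R d G, atlas c -> exists2 phi : 'rV[R]_d -> G, smooth_into (cimg c) phi &
      exists2 h, smooth_fun h & forall u, cimg c u -> f (cinv c u) = h (phi u)) -> smooth_fun f.
Proof.
move=> H c ac; have [phi sphi [h sh E]] := H c ac.
have oU := @cimg_open _ _ _ c.
apply: (smooth_on_eq oU _ (smooth_into_fun oU sphi sh)) => u cu /=.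
by rewrite E.
Qed.

Lemma smooth_mulL f a : smooth_fun f -> smooth_fun (fun y => f (a * y)%g).
Proof.
move=> sf; apply: smooth_fun_into => c ac; exists (fun u => (a * cinv c u)%g); last by exists f.
apply: smooth_into_mul; [exact: cimg_open|exact: smooth_into_cst|exact: smooth_into_cinv].
Qed.

Lemma smooth_mulR f a : smooth_fun f -> smooth_fun (fun y => f (y * a)%g).
Proof.
move=> sf; apply: smooth_fun_into => c ac; exists (fun u => (cinv c u * a)%g); last by exists f.
apply: smooth_into_mul; [exact: cimg_open|exact: smooth_into_cinv|exact: smooth_into_cst].
Qed.

Lemma smooth_conj f a : smooth_fun f -> smooth_fun (fun y => f (a * y * a^-1)%g).
Proof.
by move=> sf; apply: (@smooth_mulL (fun y => f (y * a^-1)%g)); exact: smooth_mulR.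
Qed.

Local Notation der := (der_at c0 (1%g : G)).

(** The left-invariant vector field with value [v] at 1, applied to [f] at the point [a]. *)
Definition lder v f a : R := der v (fun y => f (a * y)%g).

Lemma lderE v f a : lder v f a = der v (fun y => f (a * y)%g). Proof. by []. Qed.

Lemma lderD v (k : R) f h a : smooth_fun f -> smooth_fun h ->
  lder v (fun p => k * f p + h p) a = k * lder v f a + lder v h a.
Proof. by move=> sf sh; apply: (der_atD ac0 c01) => //; exact: smooth_mulL. Qed.

Lemma lderM v f h a : smooth_fun f -> smooth_fun h ->
  lder v (fun p => f p * h p) a = f a * lder v h a + lder v f a * h a.
Proof.
move=> sf sh; rewrite /lder (der_atM ac0 c01); [|exact: smooth_mulL|exact: smooth_mulL].
by rewrite mulg1.
Qed.

Lemma lder_lin k v w f a : smooth_fun f ->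
  lder (k *: v + w) f a = k * lder v f a + lder w f a.
Proof.
move=> sf; have sm := smooth_mulL a sf.
exact: (derive_lin2 v w k oc u0c (sm c0 ac0 1%N)).
Qed.

Lemma lder1 v f : lder v f 1%g = der v f.
Proof. by rewrite /lder; apply: der_ext => y; rewrite mul1g. Qed.

Lemma lder_mulL v f a b : lder v (fun x => f (a * x)%g) b = lder v f (a * b)%g.
Proof. by rewrite /lder; apply: der_ext => y; rewrite mulgA. Qed.

Lemma lder_smooth v f : smooth_fun f -> smooth_fun (lder v f).
Proof.
move=> sf c ac.
pose K (w : 'rV[R]_(d + d)) := f (cinv c (lsubmx w) * cinv c0 (rsubmx w))%g.
have sK : smooth_on (pair_dom c c0) K.
  apply: (smooth_into_fun (pair_dom_open (c := c) (c' := c0)) _ sf).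
  by apply: smooth_into_mul; [exact: pair_dom_open|exact: pair_into_l|exact: pair_into_r].
apply: smooth_on_ext (smooth_partial u0 v (pair_dom_open (c := c) (c' := c0)) sK).
  exact: pair_dom_rowl.
by move=> u; apply: der_atE => y; rewrite /K row_mxKl row_mxKr.
Qed.

(** The value 0 on functions that are not smooth is the normalisation required by [vector_field]; it
    makes equality of fields an equality of operators. *)
Definition Lop v (f : G -> R^o) : G -> R^o :=
  if `[< smooth_fun f >] then lder v f else fun=> 0.

Lemma Lop_smooth v f : smooth_fun f -> Lop v f = lder v f.
Proof. by move=> sf; rewrite /Lop asboolT. Qed.

Lemma Lop_lie_algebra v : lie_algebra (Lop v).
Proof.
split; first split.
- by move=> f sf; rewrite Lop_smooth //; exact: lder_smooth.
- move=> k f h sf sh; rewrite !Lop_smooth //; last first.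
    by apply: smooth_funD => //; apply: smooth_funM => //; exact: smooth_fun_cst.
  by apply/funext => a; exact: lderD.
- move=> f h sf sh; rewrite !Lop_smooth //; last exact: smooth_funM.
  by apply/funext => a; exact: lderM.
- by move=> f nsf; rewrite /Lop asboolF.
move=> a f sf; rewrite !Lop_smooth //; last exact: smooth_mulL.
by apply/funext => x; exact: lder_mulL.
Qed.

Lemma Lop_lin k v w : Lop (k *: v + w) = k *: Lop v + Lop w.
Proof.
apply/funext => f; apply/funext => a.
change (Lop (k *: v + w) f a = k * Lop v f a + Lop w f a).
have [sf|nsf] := pselect (smooth_fun f); first by rewrite !Lop_smooth // lder_lin.
by rewrite /Lop asboolF // mulr0 addr0.
Qed.

Variables (psi : 'I_d -> G -> R).
Hypotheses (spsi : forall i, smooth_fun (psi i)) (dpsi : forall v i, der v (psi i) = v 0 i).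
Hypothesis psiE : forall D f, point_derivation (1%g : G) D -> smooth_fun f ->
  D f = der (\row_i D (psi i)) f.

Lemma Lop_inj v w : Lop v = Lop w -> v = w.
Proof.
move=> E; apply/rowP => i; rewrite -!dpsi -!lder1 -!Lop_smooth //.
by rewrite E.
Qed.

Lemma lie_algebra_Lop (X : (G -> R^o) -> (G -> R^o)) : lie_algebra X -> exists v, X = Lop v.
Proof.
move=> [[Xs XD XM X0] Xl].
exists (\row_i X (psi i) 1%g); apply/funext => f.
have [sf|nsf] := pselect (smooth_fun f); last by rewrite X0 // /Lop asboolF.
apply/funext => a; rewrite Lop_smooth // /lder.
have -> : X f a = X (fun y => f (a * y)%g) 1%g by rewrite Xl // mulg1.
apply: (psiE (D := fun h => X h 1%g)); last exact: smooth_mulL.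
split=> [k h1 h2 s1 s2|h1 h2 s1 s2]; first by rewrite XD.
by rewrite XM.
Qed.

Definition lbr v w : 'rV[R]_d :=
  \row_i (lder v (lder w (psi i)) 1%g - lder w (lder v (psi i)) 1%g).

(** At 1 the commutator is a derivation, the products of first derivatives cancelling, so its values
    on [psi] determine it. Left invariance carries the identity from 1 to [a]. *)
Lemma lbrE v w f a : smooth_fun f ->
  lder (lbr v w) f a = lder v (lder w f) a - lder w (lder v f) a.
Proof.
move=> sf.
have E0 v' w' : lder v' (lder w' f) a = lder v' (lder w' (fun y => f (a * y)%g)) 1%g.
  transitivity (lder v' (fun b => lder w' f (a * b)%g) 1%g); first by rewrite lder_mulL mulg1.
  by apply: der_ext => y; rewrite lder_mulL mul1g.
rewrite !E0 [lder (lbr v w) f a]lderE.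
have sg := smooth_mulL a sf.
symmetry.
apply: (psiE (D := fun h => lder v (lder w h) 1%g - lder w (lder v h) 1%g)) => //.
split=> [k h1 h2 s1 s2|h1 h2 s1 s2].
  have E v' : lder v' (fun p => k * h1 p + h2 p) = (fun p => k * lder v' h1 p + lder v' h2 p).
    by apply/funext => b; exact: lderD.
  rewrite !E !lderD; try exact: lder_smooth.
  by move: (lder _ _ _) (lder _ _ _) (lder _ _ _) (lder _ _ _) => A1 A2 A3 A4; ring.
have E v' : lder v' (fun p => h1 p * h2 p) = (fun p => 1 * (h1 p * lder v' h2 p) + lder v' h1 p * h2 p).
  by apply/funext => b; rewrite mul1r; exact: lderM.
have sl v' h : smooth_fun h -> smooth_fun (lder v' h) := @lder_smooth v' h.
rewrite !E !lderD; try by apply: smooth_funM => //; exact: sl.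
rewrite !lderM //; try exact: sl.
move: (lder v (lder w h1) _) (lder v (lder w h2) _) (lder w (lder v h1) _) (lder w (lder v h2) _).
by move: (lder v h1 _) (lder v h2 _) (lder w h1 _) (lder w h2 _) (h1 _) (h2 _) => *; ring.
Qed.

Lemma Lop_lbr v w : Lop (lbr v w) = field_bracket (Lop v) (Lop w).
Proof.
apply/funext => f; apply/funext => a; rewrite /field_bracket.
have [sf|nsf] := pselect (smooth_fun f).
  by rewrite !Lop_smooth //; [exact: lbrE|exact: lder_smooth|exact: lder_smooth].
have z v' : lder v' (fun=> 0) a = 0.
  have := lderD v' 1 a (smooth_fun_cst 0) (smooth_fun_cst 0).
  rewrite (_ : (fun _ => _) = (fun=> 0)); last by apply/funext => p; rewrite mul1r addr0.
  by rewrite mul1r => /eqP; rewrite addrC -subr_eq subrr => /eqP.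
rewrite /Lop !(asboolF nsf) !asboolT; try exact: smooth_fun_cst.
by rewrite !z subrr.
Qed.

Definition Ad a v : 'rV[R]_d := \row_i der v (fun y => psi i (a * y * a^-1)%g).

Lemma AdE a v f : smooth_fun f -> der (Ad a v) f = der v (fun y => f (a * y * a^-1)%g).
Proof.
move=> sf; symmetry.
apply: (psiE (D := fun f => der v (fun y => f (a * y * a^-1)%g))) => //.
split=> [k h1 h2 s1 s2|h1 h2 s1 s2].
  by apply: (der_atD ac0 c01); exact: smooth_conj.
rewrite (der_atM ac0 c01); [|exact: smooth_conj|exact: smooth_conj].
by rewrite mulg1 mulgV.
Qed.

Lemma der_inj v w : (forall i, der v (psi i) = der w (psi i)) -> v = w.
Proof. by move=> E; apply/rowP => i; rewrite -!dpsi. Qed.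

Lemma AdM a b v : Ad (a * b)%g v = Ad a (Ad b v).
Proof.
apply: der_inj => i; rewrite !AdE //; last exact: smooth_conj.
by apply: der_ext => y; rewrite invgM !mulgA.
Qed.

Lemma Ad1 v : Ad 1%g v = v.
Proof.
apply: der_inj => i; rewrite AdE //.
by apply: der_ext => y; rewrite mul1g invg1 mulg1.
Qed.

Lemma Ad_lin a k v w : Ad a (k *: v + w) = k *: Ad a v + Ad a w.
Proof.
apply/rowP => i; rewrite !mxE.
exact: (derive_lin2 v w k oc u0c (smooth_conj a (spsi i) ac0 1%N)).
Qed.

(** Since b (a y a^-1) = (b a) y a^-1, the operator [Ad a] is traded for a right translation of the
    function. Right translations commute with left-invariant differentiation, and [Ad_lbr] follows
    by iterating. *)
Lemma lder_Ad a v f b : smooth_fun f ->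
  lder (Ad a v) f b = lder v (fun z => f (z * a^-1)%g) (b * a)%g.
Proof.
move=> sf; rewrite /lder AdE; last exact: smooth_mulL.
by apply: der_ext => y; rewrite !mulgA.
Qed.

Lemma Ad_lbr a v w : Ad a (lbr v w) = lbr (Ad a v) (Ad a w).
Proof.
apply: der_inj => i; rewrite -[LHS]lder1 -[RHS]lder1.
have [F [sF HF]] : exists F : G -> R, smooth_fun F /\ (forall z, psi i (z * a^-1)%g = F z).
  by exists (fun z => psi i (z * a^-1)%g); split => //; exact: smooth_mulR.
have E0 v' : lder (Ad a v') (psi i) =1 (fun y => lder v' F (y * a)%g).
  by move=> y; rewrite lder_Ad //; apply: der_ext => z; rewrite HF.
have E v' w' : lder (Ad a v') (lder (Ad a w') (psi i)) 1%g = lder v' (lder w' F) a.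
  rewrite lder_Ad ?mul1g; last exact: lder_smooth.
  by apply: der_ext => y; rewrite E0 mulgVK.
have L1 := lbrE v w a sF.
have L2 := lbrE (Ad a v) (Ad a w) 1%g (spsi i).
have L3 := f_equal2 (fun s t : R => s - t) (E v w) (E w v).
have L4 := etrans (E0 (lbr v w) 1%g) (congr1 (lder (lbr v w) F) (mul1g a)).
exact: etrans L4 (etrans L1 (esym (etrans L2 L3))).
Qed.

Lemma Ad_smooth v i (c : chart R d G) : atlas c ->
  smooth_on (cimg c) (fun u => Ad (cinv c u) v 0 i).
Proof.
move=> ac.
pose K (w : 'rV[R]_(d + d)) := psi i (cinv c (lsubmx w) * cinv c0 (rsubmx w) * (cinv c (lsubmx w))^-1)%g.
have oP := pair_dom_open (c := c) (c' := c0).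
have sK : smooth_on (pair_dom c c0) K.
  apply: (smooth_into_fun oP _ (spsi i)).
  apply: smooth_into_mul => //; last by apply: smooth_into_inv => //; exact: pair_into_l.
  by apply: smooth_into_mul => //; [exact: pair_into_l|exact: pair_into_r].
apply: smooth_on_ext (smooth_partial u0 v oP sK); first exact: pair_dom_rowl.
by move=> u; rewrite mxE; apply: der_atE => y; rewrite /K row_mxKl row_mxKr.
Qed.

(** At the point with coordinates u, the function [lder v (psi i)] equals the sum of A_j(u) H_j(u),
    where A is the row Ad(u) v and H_j is the derivative in direction e_j of y |-> psi_i(y u).
    Differentiating in direction w at 1, where H_j is a Kronecker symbol, the derivative of H gives
    the term v(w psi_i) after exchanging partial derivatives, and what remains is D_w A_i = w(v
    psi_i) - v(w psi_i). *)
Lemma Ad_derive v w i : 'D_w (fun u => Ad (cinv c0 u) v 0 i) u0 = lbr w v 0 i.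
Proof.
pose A u j := Ad (cinv c0 u) v 0 j.
pose H u j := der (e_ j) (fun y => psi i (y * cinv c0 u)%g).
have E u : cimg c0 u -> \sum_j A u j * H u j = (lder v (psi i) \o cinv c0) u.
  move=> cu; rewrite /= -[RHS](_ : der (Ad (cinv c0 u) v) (fun y => psi i (y * cinv c0 u)%g) = _).
    rewrite (der_at_lin ac0 c01) //; exact: smooth_mulR.
  rewrite AdE; last exact: smooth_mulR.
  by apply: der_ext => y; rewrite -mulgA mulVg mulg1.
pose K (z : 'rV[R]_(d + d)) := psi i (cinv c0 (rsubmx z) * cinv c0 (lsubmx z))%g.
have oP := pair_dom_open (c := c0) (c' := c0).
have sK : smooth_on (pair_dom c0 c0) K.
  apply: (smooth_into_fun oP _ (spsi i)).
  by apply: smooth_into_mul => //; [exact: pair_into_r|exact: pair_into_l].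
have Pu : pair_dom c0 c0 (row_mx u0 u0) by split; rewrite ?row_mxKl ?row_mxKr.
have sH j : smooth_on (cimg c0) (fun u => H u j).
  apply: smooth_on_ext (smooth_partial u0 (e_ j) oP sK); first exact: pair_dom_rowl.
  by move=> u; apply: der_atE => y; rewrite /K row_mxKl row_mxKr.
have sA j : smooth_on (cimg c0) (fun u => A u j) by exact: Ad_smooth.
have H1 j : H u0 j = (i == j)%:R.
  rewrite /H cu0 (_ : (fun y => _) = psi i); last by apply/funext => y; rewrite mulg1.
  by rewrite dpsi mxE eqxx /=.
have DH j : 'D_w (fun u => H u j) u0 = der (e_ j) (lder w (psi i)).
  transitivity ('D_w (fun u => 'D_(e_ j) (fun y => K (row_mx u y)) u0) u0).
    apply: derive_ext => u; symmetry.
    by apply: der_atE => y; rewrite /K row_mxKl row_mxKr.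
  rewrite (partial_swap w (e_ j) oP sK Pu).
  apply: der_atE => y; apply: der_atE => u; by rewrite /K row_mxKl row_mxKr.
have dA j : derivable (fun u => A u j) u0 w by apply: smooth_on_derivable (sA j) u0c.
have dH j : derivable (fun u => H u j) u0 w by apply: smooth_on_derivable (sH j) u0c.
have nE : \forall u \near u0, \sum_j A u j * H u j = (lder v (psi i) \o cinv c0) u.
  by apply: filterS (open_nbhs_nbhs (conj oc u0c)) => u; exact: E.
have := near_eq_derive w nE.
have -> : (fun u => \sum_j A u j * H u j) = \sum_j ((fun u => A u j) * (fun u => H u j)).
  by apply/funext => u; rewrite fct_sumE.
rewrite derive_sum; last by move=> j; exact: derivableM.
rewrite (eq_bigr (fun j => v 0 j * der (e_ j) (lder w (psi i)) + (i == j)%:R * 'D_w (fun u => A u j) u0)); last first.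
  move=> j _; rewrite deriveM // DH H1 /A cu0 Ad1 //.
rewrite big_split /= -(der_at_lin ac0 c01 v (lder_smooth w (spsi i))).
rewrite (bigD1 i) //= eqxx mul1r big1 ?addr0; last by move=> j; rewrite eq_sym => /negbTE ->; rewrite mul0r.
move=> EQ; rewrite mxE !lder1; apply/esym/eqP; rewrite subr_eq addrC eq_sym; apply/eqP.
exact: EQ.
Qed.

Lemma zero_lder_cst e (N : manifoldType R e) (Phi : G -> N) : connected [set: G] ->
  (forall c : chart R d G, atlas c -> smooth_into (cimg c) (Phi \o cinv c)) ->
  (forall (k : N -> R) z w, smooth_fun k -> der w (fun y => k (Phi (z * y)%g)) = 0) ->
  forall x y, Phi x = Phi y.
Proof.
move=> cG sPhi H; apply: (zero_der_cst cG sPhi) => c u v h ac cu sh.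
have oU := @cimg_open _ _ _ c.
pose z := cinv c u.
have sphi : smooth_into (cimg c) (fun u => (z^-1 * cinv c u)%g).
  by apply: smooth_into_mul; [|exact: smooth_into_cst|exact: smooth_into_cinv].
have shP : smooth_fun (fun y => h (Phi (z * y)%g)).
  have sh1 : smooth_fun (h \o Phi).
    by move=> c' ac'; apply: (smooth_into_fun (@cimg_open _ _ _ c') (sPhi c' ac') sh).
  exact: (smooth_mulL z sh1).
have z1 : (z^-1 * cinv c u)%g = 1%g by rewrite mulVg.
have c1 : cdom c0 (z^-1 * cinv c u)%g by rewrite z1.
have := der_chain v oU cu sphi ac0 c1 shP.
rewrite z1 (H h z _ sh) => <-; apply: derive_ext => y /=.
by rewrite mulgA mulgV mul1g.
Qed.

(** The commutator map y |-> a y a^-1 y^-1 is shown to be constant. Its derivative splits into a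
    contribution of a y a^-1, which only sees [Ad a], and one of y^-1. As [Ad a] is the identity,
    the sum is the same as for a = 1, where the map is constant. *)
Lemma Ad_center a : connected [set: G] -> (forall v, Ad a v = v) -> center_set a.
Proof.
move=> cG Aa x.
pose Phi y := (a * y * a^-1 * y^-1)%g.
suff H : Phi x = Phi 1%g.
  move: H; rewrite /Phi mulg1 mulgV invg1 mulg1 => H.
  have : (a * x * a^-1 * x^-1 * x * a)%g = (1 * x * a)%g by rewrite H.
  by rewrite !mulgVK mul1g.
apply: zero_lder_cst => // [c ac|h z w sh].
  have oU := @cimg_open _ _ _ c.
  have sc := smooth_into_cinv ac.
  apply: smooth_into_mul => //; last exact: smooth_into_inv.
  apply: smooth_into_mul => //; last exact: smooth_into_cst.
  by apply: smooth_into_mul => //; exact: smooth_into_cst.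
pose k g := h (a * z * a^-1 * g * z^-1)%g.
have sk : smooth_fun k.
  exact: (@smooth_mulL (fun g => h (g * z^-1)%g)) (smooth_mulR _ sh).
have gen b : der w (fun y => k (b * y * b^-1 * y^-1)%g) =
   der w (fun y => k (b * y * b^-1)%g) + der w (fun y => k (y^-1)%g).
  pose K (t : 'rV[R]_(d + d)) := k (b * cinv c0 (lsubmx t) * b^-1 * (cinv c0 (rsubmx t))^-1)%g.
  have oP := pair_dom_open (c := c0) (c' := c0).
  have sK : smooth_on (pair_dom c0 c0) K.
    apply: (smooth_into_fun oP _ sk).
    apply: smooth_into_mul => //; last by apply: smooth_into_inv => //; exact: pair_into_r.
    apply: smooth_into_mul => //; last exact: smooth_into_cst.
    apply: smooth_into_mul => //; [exact: smooth_into_cst|exact: pair_into_l].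
  have Pu : pair_dom c0 c0 (row_mx u0 u0) by split; rewrite ?row_mxKl ?row_mxKr.
  have D1 : 'D_w (fun x => K (row_mx x x)) u0 = der w (fun y => k (b * y * b^-1 * y^-1)%g).
    by apply: der_atE => y; rewrite /K row_mxKl row_mxKr.
  have D2 : 'D_w (fun x => K (row_mx x u0)) u0 = der w (fun y => k (b * y * b^-1)%g).
    by apply: der_atE => y; rewrite /K row_mxKl row_mxKr cu0 invg1 mulg1.
  have D3 : 'D_w (fun y => K (row_mx u0 y)) u0 = der w (fun y => k (y^-1)%g).
    by apply: der_atE => y; rewrite /K row_mxKl row_mxKr cu0 mulg1 mulgV mul1g.
  by rewrite -D1 -D2 -D3; exact: derive_diag oP sK Pu.
rewrite (_ : (fun y => h (Phi (z * y)%g)) = (fun y => k (a * y * a^-1 * y^-1)%g)); last first.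
  by apply/funext => y; rewrite /k /Phi invgM !mulgA mulgVK.
rewrite gen -AdE // Aa.
have := gen 1%g.
rewrite (_ : (fun y => k (1 * y * 1^-1)%g) = k); last by apply/funext => y; rewrite mul1g invg1 mulg1.
move=> <-.
rewrite (_ : (fun y => _) = cst (k 1%g)); last by apply/funext => y; rewrite mul1g invg1 mulg1 mulgV.
exact: derive_cst.
Qed.

End lie_group.

(** * Newton's method for automorphisms of a Lie algebra *)

Section matrix_norm.
Context {R : realType}.

Lemma mx_norm_entry p q (A : 'M[R]_(p, q)) i j : `|A i j| <= `|A|.
Proof.
rewrite [leRHS]/Num.Def.normr /= mx_normrE.
exact: (le_bigmax _ (fun i : 'I_p * 'I_q => `|A i.1 i.2|) (i, j)).
Qed.

Lemma mx_norm_le p q (A : 'M[R]_(p, q)) c : 0 <= c -> (forall i j, `|A i j| <= c) -> `|A| <= c.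
Proof.
move=> c0 H; rewrite [leLHS]/Num.Def.normr /= mx_normrE.
by apply: bigmax_le => // -[i j] _; exact: H.
Qed.

Lemma norm_sum_le p (F : 'I_p -> R) c : (forall i, `|F i| <= c) -> `|\sum_i F i| <= p%:R * c.
Proof.
move=> H; apply: le_trans (ler_norm_sum _ _ _) _.
apply: (@le_trans _ _ (\sum_(i < p) c)); first by apply: ler_sum => i _.
by rewrite sumr_const card_ord mulr_natl.
Qed.

Lemma norm_mulmx p q r (A : 'M[R]_(p, q)) (B : 'M[R]_(q, r)) :
  `|A *m B| <= q%:R * (`|A| * `|B|).
Proof.
apply: mx_norm_le => [|i j]; first by rewrite mulr_ge0 // ?mulr_ge0.
rewrite mxE; apply: norm_sum_le => k.
by rewrite normrM ler_pM // mx_norm_entry.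
Qed.

Lemma norm_mxtrace p (A : 'M[R]_p) : `|\tr A| <= p%:R * `|A|.
Proof. by apply: norm_sum_le => i; exact: mx_norm_entry. Qed.

Lemma continuous_sum (T : topologicalType) p (F : 'I_p -> T -> R) x :
  (forall i, {for x, continuous (F i)}) -> {for x, continuous (fun t => \sum_i F i t)}.
Proof.
move=> H; elim: (index_enum _) => [|i I IH].
  rewrite (_ : (fun t => _) = cst 0); first exact: cst_continuous.
  by apply/funext => t; rewrite big_nil.
rewrite (_ : (fun t => _) = (fun t => F i t + \sum_(j <- I) F j t)); last first.
  by apply/funext => t; rewrite big_cons.
by apply: continuousD => //; exact: H.
Qed.

Lemma is_derive_mxP p q (E : R -> 'M[R]_(p, q)) D (t : R) :
  is_derive (t : R^o) 1 (E : R^o -> _) D <->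
  forall i j, is_derive (t : R^o) 1 (fun s : R^o => E s i j : R^o) (D i j).
Proof.
split=> [[dE DE] i j|H].
  split; first by have /derivable_mxP := dE; apply.
  by rewrite -DE derive_mx // mxE.
have dE : derivable (E : R^o -> _) (t : R^o) 1.
  by apply/derivable_mxP => i j; case: (H i j).
split=> //; rewrite derive_mx //; apply/matrixP => i j; rewrite mxE.
by case: (H i j).
Qed.

Lemma is_derive_bigsum p (F : 'I_p -> R -> R) (D : 'I_p -> R) (t : R) :
  (forall i, is_derive (t : R^o) 1 (F i : R^o -> R^o) (D i)) ->
  is_derive (t : R^o) 1 (fun s : R^o => \sum_i F i s : R^o) (\sum_i D i).
Proof.
move=> H; rewrite (_ : (fun s => _) = \sum_i (F i : R^o -> R^o)); last first.
  by apply/funext => s; rewrite fct_sumE.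
exact: is_derive_sum.
Qed.

Lemma is_derive_mul (f g : R -> R) (df dg : R) (t : R) :
  is_derive (t : R^o) 1 (f : R^o -> R^o) df -> is_derive (t : R^o) 1 (g : R^o -> R^o) dg ->
  is_derive (t : R^o) 1 (fun s : R^o => f s * g s : R^o) (df * g t + f t * dg).
Proof.
move=> [d1 D1] [d2 D2]; split; first exact: derivableM.
by rewrite (deriveM d1 d2) D1 D2 /GRing.scale /= addrC mulrC.
Qed.

Lemma is_derive_mulmx p q r (E : R -> 'M[R]_(p, q)) (F : R -> 'M[R]_(q, r)) D D' (t : R) :
  is_derive (t : R^o) 1 (E : R^o -> _) D -> is_derive (t : R^o) 1 (F : R^o -> _) D' ->
  is_derive (t : R^o) 1 (fun s : R^o => E s *m F s) (D *m F t + E t *m D').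
Proof.
move=> /is_derive_mxP HE /is_derive_mxP HF; apply/is_derive_mxP => i j.
rewrite !mxE -big_split /= (_ : (fun s => _) = (fun s => \sum_k E s i k * F s k j)); last first.
  by apply/funext => s; rewrite mxE.
by apply: is_derive_bigsum => k; exact: is_derive_mul.
Qed.

Lemma is_derive_mulmxl p q r (B : 'M[R]_(p, q)) (F : R -> 'M[R]_(q, r)) D (t : R) :
  is_derive (t : R^o) 1 (F : R^o -> _) D ->
  is_derive (t : R^o) 1 (fun s : R^o => B *m F s) (B *m D).
Proof.
move=> HF; have := is_derive_mulmx (is_derive_cst B (t : R^o) 1) HF.
by rewrite mul0mx add0r.
Qed.

Definition fro p q (A B : 'M[R]_(p, q)) : R := \sum_i \sum_j A i j * B i j.

Lemma fro_entry p q (A : 'M[R]_(p, q)) : `|A| ^+ 2 <= fro A A.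
Proof.
have H i j : `|A i j| ^+ 2 <= fro A A.
  rewrite real_normK ?num_real // /fro (bigD1 i) //= (bigD1 j) //= -!expr2.
  rewrite -addrA lerDl addr_ge0 // sumr_ge0 // => k _; rewrite -?expr2 ?sqr_ge0 //.
  by rewrite sumr_ge0 // => l _; rewrite -expr2 sqr_ge0.
have F0 : 0 <= fro A A.
  by rewrite sumr_ge0 // => i _; rewrite sumr_ge0 // => j _; rewrite -expr2 sqr_ge0.
rewrite -[fro A A]sqr_sqrtr // lerXn2r ?nnegrE ?sqrtr_ge0 //.
apply: mx_norm_le => [|i j]; first exact: sqrtr_ge0.
by rewrite -(ler_pXn2r (n := 2)) ?nnegrE ?sqrtr_ge0 // sqr_sqrtr.
Qed.

Lemma fro_le p q (A B : 'M[R]_(p, q)) : `|fro A B| <= p%:R * (q%:R * (`|A| * `|B|)).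
Proof.
apply: norm_sum_le => i; apply: norm_sum_le => j.
by rewrite normrM ler_pM // mx_norm_entry.
Qed.

Lemma froDr p q (A B C : 'M[R]_(p, q)) : fro A (B + C) = fro A B + fro A C.
Proof.
rewrite /fro -big_split; apply: eq_bigr => i _; rewrite -big_split; apply: eq_bigr => j _.
by rewrite mxE mulrDr.
Qed.

Lemma mx_continuous_mul (T : topologicalType) p q r (A : T -> 'M[R]_(p, q)) (B : T -> 'M[R]_(q, r)) x :
  {for x, continuous A} -> {for x, continuous B} -> {for x, continuous (fun t => A t *m B t)}.
Proof.
move=> cA cB; apply/cvgrPdist_le => /= e e0.
pose a := `|A x| + 1; pose bb := `|B x| + 1.
have a0 : 0 < a by rewrite ltr_wpDl.
have b0 : 0 < bb by rewrite ltr_wpDl.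
have q0 : 0 < (q%:R + 1 : R) by rewrite ltr_wpDl.
have p1 : 0 < e / 2 / (bb * (q%:R + 1)) by rewrite !divr_gt0 // mulr_gt0.
have p2 : 0 < e / 2 / (a * (q%:R + 1)) by rewrite !divr_gt0 // mulr_gt0.
move/cvgrPdist_le: cA => cA; move/cvgrPdist_le: cB => cB.
apply: filterS3 (cA _ p1) (cB _ p2) (cA _ ltr01) => t H1 H2 H0.
rewrite -[_ - _](_ : (A x - A t) *m B x + A t *m (B x - B t) = _); last first.
  by rewrite mulmxBl mulmxBr addrA subrK.
have H3 : `|A t| <= a.
  have -> : A t = A x - (A x - A t) by rewrite subKr.
  by rewrite (le_trans (ler_normB _ _)) // lerD.
rewrite (le_trans (ler_normD _ _)) // [leRHS](splitr e) lerD //.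
  apply: le_trans (norm_mulmx _ _) _.
  apply: (@le_trans _ _ ((q%:R + 1) * (e / 2 / (bb * (q%:R + 1)) * bb))).
    by rewrite ler_pM ?mulr_ge0 ?lerDl // ler_pM // lerDl.
  by rewrite le_eqVlt; apply/orP; left; apply/eqP; field; rewrite gt_eqF // gt_eqF.
apply: le_trans (norm_mulmx _ _) _.
apply: (@le_trans _ _ ((q%:R + 1) * (a * (e / 2 / (a * (q%:R + 1)))))).
  by rewrite ler_pM ?mulr_ge0 ?lerDl // ler_pM.
by rewrite le_eqVlt; apply/orP; left; apply/eqP; field; rewrite gt_eqF // gt_eqF.
Qed.

End matrix_norm.

Section newton.
Context {R : realType} {d : nat}.
Variable ad : {linear 'rV[R]_d -> 'M[R]_d}.
Local Notation e_ i := (delta_mx 0 i : 'rV[R]_d).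
Implicit Types (A B : 'M[R]_d) (v w : 'rV[R]_d).

Hypothesis jacobi : forall v w, ad (w *m ad v) = ad w *m ad v - ad v *m ad w.

Definition killing_mx : 'M[R]_d := \matrix_(i, j) \tr (ad (e_ i) *m ad (e_ j)).
Hypothesis killing_unit : killing_mx \in unitmx.

(** With [w *m ad v] standing for [v, w], this is the identity [v, u] A = [v A, u A] in matrix
    form. *)
Definition lie_auto A := forall v, ad v *m A = A *m ad (v *m A).

Lemma lie_autoM A B : lie_auto A -> lie_auto B -> lie_auto (A *m B).
Proof. by move=> hA hB v; rewrite mulmxA hA -mulmxA hB mulmxA mulmxA. Qed.

Lemma trace_lin (B : 'M[R]_d) v : \tr (ad v *m B) = \sum_i v 0 i * \tr (ad (e_ i) *m B).
Proof.
rewrite {1}(row_sum_delta v) linear_sum mulmx_suml raddf_sum; apply: eq_bigr => i _ /=.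
by rewrite linearZ /= -scalemxAl mxtraceZ.
Qed.

Lemma ad_bound : exists2 C, 0 < C & forall v, `|ad v| <= C * `|v|.
Proof.
exists (\sum_i `|ad (e_ i)| + 1).
  by rewrite ltr_wpDl // sumr_ge0.
move=> v; rewrite {1}(row_sum_delta v) linear_sum.
apply: le_trans (ler_norm_sum _ _ _) _.
apply: (@le_trans _ _ (\sum_i `|ad (e_ i)| * `|v|)).
  by apply: ler_sum => i _; rewrite linearZ /= normrZ mulrC ler_wpM2l // rV_norm_coord.
by rewrite -mulr_suml ler_wpM2r // lerDl.
Qed.

(** A quantitative version of the proof that derivations of an algebra with nondegenerate Killing
    form are inner. [delta] is a derivation up to a quadratic error. [Z] is the element whose
    Killing pairings are the traces of [ad v *m delta], so [D' = delta - ad Z] is trace-orthogonal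
    to all [ad v]. The Killing pairing of [v *m D'] with [w] is then the trace against an ad-matrix,
    which is zero, plus the quadratic error. *)
Lemma newton_step (delta : 'M[R]_d) : lie_auto (1%:M + delta) ->
  exists Z, (delta - ad Z) *m killing_mx =
     - \matrix_(i, j) \tr (delta *m ad (e_ i *m delta) *m ad (e_ j)).
Proof.
move=> hA.
pose z := \row_j \tr (ad (e_ j) *m delta).
pose Z := z *m invmx killing_mx.
exists Z.
have H1 v : ad (v *m delta) = ad v *m delta - delta *m ad v - delta *m ad (v *m delta).
  have := hA v; rewrite mulmxDr mulmx1 mulmxDl mul1mx mulmxDr mulmx1 linearD /= mulmxDr.
  move: (ad v *m delta) (delta *m ad v) (delta *m ad (v *m delta)) (ad (v *m delta)) (ad v).
  move=> X1 X2 X3 X4 X0 /matrixP H; apply/matrixP => i j.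
  by have := H i j; rewrite !mxE; lra.
have tZ v : \tr (ad v *m ad Z) = \tr (ad v *m delta).
  have EZ : Z *m killing_mx = z by rewrite /Z mulmxKV.
  have K1 i : \tr (ad (e_ i) *m delta) = \sum_j Z 0 j * \tr (ad (e_ j) *m ad (e_ i)).
    transitivity (z 0 i); first by rewrite mxE.
    have := congr1 (fun M : 'rV[R]_d => M 0 i) EZ; rewrite mxE => <-.
    by apply: eq_bigr => j _; congr (_ * _); rewrite mxE.
  rewrite (trace_lin (ad Z) v) (trace_lin delta v); apply: eq_bigr => i _.
  by rewrite K1 mxtrace_mulC (trace_lin (ad (e_ i)) Z).
pose D' := delta - ad Z.
have tD v : \tr (ad v *m D') = 0 by rewrite mulmxBr linearB /= tZ subrr.
have adD v : ad (v *m D') = ad v *m D' - D' *m ad v - delta *m ad (v *m delta).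
  rewrite mulmxBr linearB /= jacobi {1}H1 /D' mulmxBr mulmxBl.
  move: (ad v *m delta) (delta *m ad v) (delta *m ad (v *m delta)) (ad v *m ad Z) (ad Z *m ad v).
  by move=> X1 X2 X3 X4 X5; apply/matrixP => i j; rewrite !mxE; ring.
have KD v w : \tr (ad (v *m D') *m ad w) = - \tr (delta *m ad (v *m delta) *m ad w).
  rewrite adD mulmxBl linearB /= mulmxBl linearB /=.
  have -> : \tr (ad v *m D' *m ad w) = \tr (ad w *m ad v *m D').
    by rewrite mxtrace_mulC mulmxA.
  have -> : \tr (D' *m ad v *m ad w) = \tr (ad v *m ad w *m D').
    by rewrite -mulmxA mxtrace_mulC.
  by rewrite -linearB /= -mulmxBl -jacobi tD sub0r.
apply/matrixP => i j; rewrite !mxE -KD.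
rewrite trace_lin; apply: eq_bigr => k _; rewrite mxE -rowE !mxE //.
Qed.

Lemma newton_bound : exists2 C, 0 < C & forall delta, lie_auto (1%:M + delta) ->
  exists Z, `|delta - ad Z| <= C * `|delta| ^+ 2.
Proof.
have [Ca Ca0 HCa] := ad_bound.
pose ki := `|invmx killing_mx|.
pose c1 := (d%:R + 1 : R).
have c10 : 0 < c1 by rewrite ltr_wpDl.
have dc : d%:R <= c1 by rewrite lerDl.
pose C := c1 * (c1 * (c1 * (c1 * (c1 * Ca) * Ca)) * (ki + 1)).
have ki0 : 0 < ki + 1 by rewrite /ki ltr_wpDl.
exists C; first by rewrite /C; do !apply: mulr_gt0 => //.
move=> delta /newton_step[Z HZ]; exists Z.
have e1 i : `|e_ i| <= 1.
  by apply: mx_norm_le => // a b; rewrite mxE; case: (_ && _); rewrite ?normr1 ?normr0.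
have HM : `|(delta - ad Z) *m killing_mx| <= c1 * (c1 * (c1 * (c1 * Ca) * Ca)) * `|delta| ^+ 2.
  rewrite HZ normrN; apply: mx_norm_le => [|i j].
    by rewrite mulr_ge0 ?sqr_ge0 //; do !apply: mulr_ge0 => //; exact: ltW.
  rewrite mxE; apply: le_trans (norm_mxtrace _) _.
  have s1 : `|e_ i *m delta| <= c1 * `|delta|.
    apply: le_trans (norm_mulmx _ _) _; rewrite ler_pM // ?mulr_ge0 //.
    by rewrite ler_piMl.
  have s2 : `|ad (e_ i *m delta)| <= Ca * (c1 * `|delta|).
    by apply: le_trans (HCa _) _; rewrite ler_wpM2l // ltW.
  have s3 : `|ad (e_ j)| <= Ca by apply: le_trans (HCa _) _; rewrite ler_piMr // ltW.
  have s4 : `|delta *m ad (e_ i *m delta)| <= c1 * (`|delta| * (Ca * (c1 * `|delta|))).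
    apply: le_trans (norm_mulmx _ _) _; rewrite ler_pM // ?mulr_ge0 //.
    by rewrite ler_wpM2l.
  have s5 : `|delta *m ad (e_ i *m delta) *m ad (e_ j)| <= c1 * (c1 * (`|delta| * (Ca * (c1 * `|delta|))) * Ca).
    apply: le_trans (norm_mulmx _ _) _; rewrite ler_pM // ?mulr_ge0 //.
    by rewrite ler_pM.
  apply: (@le_trans _ _ (c1 * (c1 * (c1 * (`|delta| * (Ca * (c1 * `|delta|))) * Ca)))).
    by rewrite ler_pM.
  by rewrite le_eqVlt; apply/orP; left; apply/eqP; ring.
have -> : delta - ad Z = (delta - ad Z) *m killing_mx *m invmx killing_mx by rewrite mulmxK.
apply: le_trans (norm_mulmx _ _) _.
rewrite /C -[leRHS]mulrA; apply: ler_pM => //.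
rewrite mulrAC; apply: ler_pM => //.
by rewrite lerDl.
Qed.

Lemma local_min_derive (phi : R -> R) l : is_derive (0 : R) 1 phi l ->
  (\forall s \near (0 : R), phi 0 <= phi s) -> l = 0.
Proof.
move=> [dphi Dphi] H.
have cv : h^-1 *: (phi (h + 0) - phi 0) @[h --> (0:R)^'] --> l.
  rewrite -Dphi; have := dphi; rewrite /derivable /derive.
  rewrite (_ : (fun h => _) = (fun h => h^-1 *: (phi (h + 0) - phi 0))) //.
  by apply/funext => h /=; rewrite [h *: 1]mulr1.
apply/eqP; rewrite eq_le; apply/andP; split; rewrite leNgt; apply/negP => l0.
- have /cvgrPdist_lt /(_ l l0) Hl := cv.
  have /nbhs_ballP[r1 /= r10 H1] := H.
  have /nbhs_ballP[r2 /= r20 H2] := Hl.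
  pose r := Num.min r1 r2 / 2.
  have r0 : 0 < r by rewrite divr_gt0 // lt_min r10.
  have rm : r < Num.min r1 r2 by rewrite ltr_pdivrMr // ltr_pMr ?ltr1n // lt_min r10.
  move: rm; rewrite lt_min => /andP[rr1 rr2].
  have B r' : r < r' -> ball (0 : R) r' (- r).
    by rewrite -ball_normE /ball_ /= sub0r normrN normrN ger0_norm // ltW.
  have := H1 _ (B _ rr1); have := H2 _ (B _ rr2) => /(_ (ltr0_neq0 _)).
  rewrite oppr_lt0 r0 => /(_ isT) /= + h1.
  rewrite addr0 ltr_norml => /andP[_]; rewrite ltrBlDr ltrDl => h2.
  have : 0 < (- r)^-1 * (phi (- r) - phi 0) by exact: h2.
  by rewrite nmulr_rgt0 ?invr_lt0 ?oppr_lt0 // subr_lt0 ltNge h1.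
- have l0' : 0 < - l by rewrite oppr_gt0.
  have /cvgrPdist_lt /(_ _ l0') Hl := cv.
  have /nbhs_ballP[r1 /= r10 H1] := H.
  have /nbhs_ballP[r2 /= r20 H2] := Hl.
  pose r := Num.min r1 r2 / 2.
  have r0 : 0 < r by rewrite divr_gt0 // lt_min r10.
  have rm : r < Num.min r1 r2 by rewrite ltr_pdivrMr // ltr_pMr ?ltr1n // lt_min r10.
  move: rm; rewrite lt_min => /andP[rr1 rr2].
  have B r' : r < r' -> ball (0 : R) r' r.
    by rewrite -ball_normE /ball_ /= sub0r normrN ger0_norm // ltW.
  have := H1 _ (B _ rr1); have := H2 _ (B _ rr2) => /(_ (lt0r_neq0 r0)) /= + h1.
  rewrite addr0 ltr_norml => /andP[+ _]; rewrite opprK ltrBrDr gtrDl => h2.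
  have : r^-1 * (phi r - phi 0) < 0 by exact: h2.
  by rewrite pmulr_rlt0 ?invr_gt0 // subr_lt0 ltNge h1.
Qed.

(** The squared Frobenius distance of [B *m nu b] to the identity is minimised over the compact [K].
    At a minimum, [delta] is orthogonal to every [(1 + delta) *m ad Z], because [nu b] can be moved
    in the direction [ad Z]. Taking for [Z] the Newton correction of [newton_bound] gives |delta|^2
    <= m |delta|^3, and a small [delta] must vanish. *)
Lemma newton_surj (T : topologicalType) (K : set T) (b0 : T) (nu : T -> 'M[R]_d) (r : R) :
  compact K -> K b0 -> {within K, continuous nu} -> nu b0 = 1%:M -> 0 < r ->
  (forall b, K b -> lie_auto (nu b)) ->
  (forall b, K b -> `|nu b - 1%:M| < r -> forall Z, exists beta : R -> T,
     [/\ \forall s \near (0 : R), K (beta s), nu (beta 0) = nu b &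
       is_derive (0 : R^o) 1 (fun s : R^o => nu (beta s)) (nu b *m ad Z)]) ->
  exists2 eps, 0 < eps & forall B, lie_auto B -> `|B - 1%:M| < eps ->
    exists2 b, K b & B *m nu b = 1%:M.
Proof.
move=> cK Kb0 cnu nub0 r0 autoK move_K.
have [C C0 HC] := newton_bound.
pose c1 := (d%:R + 1 : R).
have c10 : 0 < c1 by rewrite ltr_wpDl.
have dc : d%:R <= c1 by rewrite lerDl.
have c11 : 1 <= c1 by rewrite lerDr.
(* Constant of the final cubic estimate. Of the three bounds on [e1], the first keeps [delta] and
   [B - 1] small, the second gives m |delta| <= 1/2, and the third keeps [nu b] within distance [r]
   of the identity, where moves are available. *)
pose m := c1 * c1 * (C + c1 * (1 + C)).
have m0 : 0 < m by rewrite /m !mulr_gt0 // addr_gt0 // mulr_gt0 // addr_gt0.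
pose e1 := Num.min (1 / 2) (Num.min (1 / (2 * m)) (r / 8)).
have e10 : 0 < e1 by rewrite !lt_min !divr_gt0 // mulr_gt0.
(* The divisor absorbs the passage from the maximum norm to the Frobenius norm of a square matrix of
   size d. *)
pose eps := e1 / (c1 * c1).
have ep0 : 0 < eps by rewrite divr_gt0 // mulr_gt0.
exists eps => // B aB Be.
pose F b := fro (B *m nu b - 1%:M) (B *m nu b - 1%:M).
have cF : {within K, continuous F}.
  move=> x; apply: (@continuous_comp (subspace K) _ _ nu (fun M => fro (B *m M - 1%:M) (B *m M - 1%:M))).
    exact: cnu.
  have cM : {for nu x, continuous (fun M : 'M[R]_d => B *m M - 1%:M)}.
    apply: continuousB; last exact: cst_continuous.
    by apply: mx_continuous_mul; [exact: cst_continuous|exact: id].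
  rewrite /fro /prop_for /continuous_at.
  apply: (@continuous_sum R _ _ (fun i M => \sum_j (B *m M - 1%:M) i j * (B *m M - 1%:M) i j)) => i.
  apply: (@continuous_sum R _ _ (fun j M => (B *m M - 1%:M) i j * (B *m M - 1%:M) i j)) => j.
  by apply: continuousM; exact: continuous_mx_coord cM.
have [b bK bmin] : exists2 c, c \in K & forall t, t \in K -> F c <= F t.
  by apply: compact_EVT_min => //; exists b0.
rewrite inE in bK; exists b => //.
pose delta := B *m nu b - 1%:M.
have Eb : B *m nu b = 1%:M + delta by rewrite /delta addrC subrK.
have F0 : `|delta| ^+ 2 <= e1 ^+ 2.
  apply: le_trans (fro_entry _) _; apply: le_trans (bmin b0 (mem_set Kb0)) _.
  rewrite /F nub0 mulmx1; apply: le_trans (ler_norm _) _; apply: le_trans (fro_le _ _) _.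
  apply: (@le_trans _ _ (c1 * (c1 * (eps * eps)))).
    by rewrite ler_pM ?mulr_ge0 // ler_pM ?mulr_ge0 // ler_pM // ltW.
  rewrite expr2 /eps.
  have -> : c1 * (c1 * (e1 / (c1 * c1) * (e1 / (c1 * c1)))) = e1 * e1 / (c1 * c1).
    by field; rewrite gt_eqF.
  by rewrite ler_pdivrMr ?mulr_gt0 // ler_peMr ?mulr_ge0 ?(ltW e10) // mulr_ege1.
have de : `|delta| <= e1.
  by rewrite -(ler_pXn2r (n := 2)) ?nnegrE // ltW.
have e1h : e1 <= 1 / 2 by rewrite ge_min lexx.
have e1m : e1 <= 1 / (2 * m) by rewrite !ge_min lexx orbT.
have e1r : e1 <= r / 8 by rewrite !ge_min lexx !orbT.
have nur : `|nu b - 1%:M| < r.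
  have E : nu b - 1%:M = delta - (B - 1%:M) *m (nu b - 1%:M) - (B - 1%:M).
    rewrite mulmxBr mulmx1 mulmxBl mul1mx Eb.
    by apply/matrixP => i j; rewrite !mxE; ring.
  have H1 : `|(B - 1%:M) *m (nu b - 1%:M)| <= 1 / 2 * `|nu b - 1%:M|.
    apply: le_trans (norm_mulmx _ _) _; rewrite mulrA ler_wpM2r //.
    apply: (@le_trans _ _ (c1 * eps)); first by rewrite ler_pM // ltW.
    rewrite /eps; have -> : c1 * (e1 / (c1 * c1)) = e1 / c1 by field; rewrite gt_eqF.
    by rewrite ler_pdivrMr // (le_trans e1h) // ler_peMr // divr_ge0.
  have H2 : `|nu b - 1%:M| <= e1 + 1 / 2 * `|nu b - 1%:M| + e1.
    rewrite {1}E; apply: le_trans (ler_normB _ _) _; apply: lerD.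
      apply: le_trans (ler_normB _ _) _; exact: lerD.
    apply: (le_trans (ltW Be)).
    by rewrite /eps ler_pdivrMr ?mulr_gt0 // ler_peMr ?(ltW e10) // mulr_ege1.
  by move: H2 e1r e10 r0; lra.
have crit Z : fro delta ((1%:M + delta) *m ad Z) = 0.
  have [beta [bK' b0' db]] := move_K b bK nur Z.
  have dE : is_derive (0 : R^o) 1 (fun s : R^o => B *m nu (beta s) - 1%:M) ((1%:M + delta) *m ad Z).
    have := is_derive_mulmxl B db; rewrite mulmxA Eb => dE.
    have := is_deriveB dE (is_derive_cst 1%:M (0 : R^o) 1).
    by rewrite subr0.
  have E0 : B *m nu (beta 0) - 1%:M = delta by rewrite b0'.
  have dF : is_derive (0 : R^o) 1 (fun s : R^o => F (beta s) : R^o)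
      (2 * fro delta ((1%:M + delta) *m ad Z)).
    rewrite /F /fro; have /is_derive_mxP dE' := dE.
    rewrite mulr_sumr; apply: is_derive_bigsum => i.
    rewrite mulr_sumr; apply: is_derive_bigsum => j.
    have := is_derive_mul (dE' i j) (dE' i j); rewrite E0.
    by move/is_derive_eq; apply; ring.
  have H0 : 2 * fro delta ((1%:M + delta) *m ad Z) = 0.
    apply: (local_min_derive dF); apply: filterS bK' => s Ks.
    by rewrite [leLHS](_ : _ = F b) ?bmin ?inE // /F b0'.
  by move/eqP: H0; rewrite mulf_eq0 pnatr_eq0 /= => /eqP.
have [|Z HZ] := HC delta.
  by rewrite -Eb; apply: lie_autoM => //; exact: autoK.
have H := crit Z; rewrite mulmxDl mul1mx froDr in H.
have E : fro delta delta = fro delta (delta - ad Z) - fro delta (delta *m ad Z).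
  have -> : fro delta delta = fro delta (delta - ad Z) + fro delta (ad Z).
    by rewrite -froDr subrK.
  by congr (_ + _); apply/eqP; rewrite -addr_eq0; apply/eqP.
pose x := `|delta|.
have x0 : 0 <= x by exact: normr_ge0.
have x1 : x <= 1 by apply: le_trans de _; apply: le_trans e1h _; lra.
have adZ : `|ad Z| <= (1 + C) * x.
  have -> : ad Z = delta - (delta - ad Z) by rewrite subKr.
  apply: le_trans (ler_normB _ _) _; rewrite mulrDl mul1r lerD // (le_trans HZ) //.
  by rewrite ler_wpM2l ?(ltW C0) // expr2 ler_piMl.
have h1 : `|fro delta (delta - ad Z)| <= c1 * (c1 * (x * (C * x ^+ 2))).
  apply: le_trans (fro_le _ _) _.
  by rewrite ler_pM ?mulr_ge0 // ler_pM ?mulr_ge0 // ler_wpM2l.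
have h2 : `|fro delta (delta *m ad Z)| <= c1 * (c1 * (x * (c1 * (x * ((1 + C) * x))))).
  apply: le_trans (fro_le _ _) _.
  rewrite ler_pM ?mulr_ge0 // ler_pM ?mulr_ge0 // ler_wpM2l //.
  apply: le_trans (norm_mulmx _ _) _.
  by rewrite ler_pM ?mulr_ge0 // ler_wpM2l.
have h3 : x ^+ 2 <= m * x * x ^+ 2.
  apply: le_trans (fro_entry _) _; rewrite E.
  apply: le_trans (ler_norm _) _; apply: le_trans (ler_normB _ _) _.
  apply: le_trans (lerD h1 h2) _.
  by rewrite le_eqVlt; apply/orP; left; apply/eqP; rewrite /m; ring.
have mx : m * x <= 1 / 2.
  apply: le_trans (ler_wpM2l (ltW m0) (le_trans de e1m)) _.
  by rewrite le_eqVlt; apply/orP; left; apply/eqP; field; rewrite gt_eqF.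
have x20 : x ^+ 2 <= 1 / 2 * x ^+ 2.
  by apply: le_trans h3 _; rewrite ler_wpM2r // sqr_ge0.
have : x ^+ 2 <= 0 by lra.
move=> x2.
have /eqP : x ^+ 2 = 0 by apply/eqP; rewrite eq_le sqr_ge0 andbT.
rewrite sqrf_eq0 normr_eq0 => /eqP d0.
by rewrite Eb d0 addr0.
Qed.

End newton.

(** * The Lie algebra of an orthogonal group *)

Section form.
Context {R : realType} {k : nat}.
Implicit Types (S A : 'M[R]_k) (a b c : 'rV[R]_k).

Definition bf S a b : R := (a *m S *m b^T) 0 0.

Lemma bfDl S a b c : bf S (a + b) c = bf S a c + bf S b c.
Proof. by rewrite /bf !mulmxDl mxE. Qed.

Lemma bfZl S x a b : bf S (x *: a) b = x * bf S a b.
Proof. by rewrite /bf -!scalemxAl mxE. Qed.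

Lemma bfDr S a b c : bf S c (a + b) = bf S c a + bf S c b.
Proof. by rewrite /bf linearD /= mulmxDr mxE. Qed.

Lemma bfZr S x a b : bf S a (x *: b) = x * bf S a b.
Proof. by rewrite /bf linearZ /= -scalemxAr mxE. Qed.

Lemma bfNl S a b : bf S (- a) b = - bf S a b.
Proof. by rewrite -scaleN1r bfZl mulN1r. Qed.

Lemma bfNr S a b : bf S a (- b) = - bf S a b.
Proof. by rewrite -scaleN1r bfZr mulN1r. Qed.

Lemma bf0l S b : bf S 0 b = 0.
Proof. by rewrite -(scale0r 0) bfZl mul0r. Qed.

Lemma bf0r S b : bf S b 0 = 0.
Proof. by rewrite -(scale0r 0) bfZr mul0r. Qed.

Lemma bfC S a b : S^T = S -> bf S a b = bf S b a.
Proof.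
move=> sS; rewrite /bf -[in LHS](trmxK (a *m S *m b^T)) mxE.
by rewrite !trmx_mul trmxK sS mulmxA.
Qed.

Definition bfE := (bfDl, bfDr, bfZl, bfZr, bfNl, bfNr, bf0l, bf0r).

Lemma bf_nondeg S a : S \in unitmx -> (forall b, bf S a b = 0) -> a = 0.
Proof.
move=> uS H; rewrite -[a](mulmxK uS); have -> : a *m S = 0; last by rewrite mul0mx.
by apply/rowP => j; have := H (delta_mx 0 j); rewrite /bf trmx_delta -colE !mxE => ->.
Qed.

End form.

Lemma mx_bracketDr (R : realType) N (X Y Z : 'M[R]_N) k : mx_bracket X (k *: Y + Z) = k *: mx_bracket X Y + mx_bracket X Z.
Proof.
rewrite /mx_bracket mulmxDr mulmxDl -scalemxAr -scalemxAl scalerBr.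
by rewrite opprD addrACA.
Qed.

Section wedge.
Context {R : realType} {N : nat}.
Variable J : 'M[R]_N.
Hypotheses (JJ : J *m J = 1%:M) (Jt : J^T = J).
Implicit Types (a b c : 'rV[R]_N) (A B X : 'M[R]_N).
Local Notation "<< a , b >>" := (bf J a b) (a at level 10, b at level 10).

Definition so_set : set 'M[R]_N := [set A | A^T *m J + J *m A = 0].

(** The bivector a ^ b, turned into a skew endomorphism by the form; the transpose in [wdgE] comes
    from letting it act on rows. *)
Definition wdg a b : 'M[R]_N := (a^T *m b - b^T *m a) *m J.

Lemma soP A : so_set A -> A^T *m J = - (J *m A).
Proof. by move/eqP; rewrite addr_eq0 => /eqP. Qed.

Lemma so_lin x A B : so_set A -> so_set B -> so_set (x *: A + B).
Proof.
move=> /soP hA /soP hB; rewrite /so_set /= linearD linearZ /= mulmxDl mulmxDr.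
by rewrite -scalemxAl -scalemxAr hA hB scalerN -opprD addNr.
Qed.

Lemma so_br A B : so_set A -> so_set B -> so_set (mx_bracket A B).
Proof.
move=> /soP hA /soP hB; rewrite /so_set /mx_bracket /= linearB /= !trmx_mul mulmxBl mulmxBr.
rewrite -!mulmxA hA hB !mulmxN !mulmxA hA hB !mulNmx !opprK.
by rewrite addrA subrK subrr.
Qed.

Lemma mulmx_rc a b c : a *m b^T *m c = ((a *m b^T) 0 0) *: c.
Proof. by rewrite {1}[a *m b^T]mx11_scalar mul_scalar_mx. Qed.

Lemma wdgE a b c : c *m (wdg a b)^T = << b, c >> *: a - << a, c >> *: b.
Proof.
rewrite /wdg trmx_mul linearB /= !trmx_mul !trmxK Jt mulmxBr mulmxBr !mulmxA.
by rewrite !mulmx_rc !(bfC _ c Jt).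
Qed.

Lemma wdgDl a b c : wdg (a + b) c = wdg a c + wdg b c.
Proof.
rewrite /wdg [(a + b)^T]linearD /= [(a^T + b^T) *m c]mulmxDl [c^T *m (a + b)]mulmxDr opprD addrACA.
exact: mulmxDl. Qed.

Lemma wdgZl x a b : wdg (x *: a) b = x *: wdg a b.
Proof. by rewrite /wdg linearZ /= -scalemxAl -scalemxAr -scalerBr -scalemxAl. Qed.

Lemma wdgC a b : wdg a b = - wdg b a.
Proof. by rewrite /wdg -[in RHS]opprB mulNmx opprK. Qed.

Lemma wdgDr a b c : wdg c (a + b) = wdg c a + wdg c b.
Proof. by rewrite wdgC wdgDl opprD -!wdgC. Qed.

Lemma wdgZr x a b : wdg a (x *: b) = x *: wdg a b.
Proof. by rewrite wdgC wdgZl -scalerN -wdgC. Qed.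

Lemma wdg_so a b : so_set (wdg a b).
Proof.
rewrite /so_set /= /wdg trmx_mul linearB /= !trmx_mul !trmxK Jt -!mulmxA -mulmxDr -mulmxDl.
by rewrite addrC subrKA subrr mul0mx mulmx0.
Qed.

Lemma br_wdg A a b : so_set A ->
  mx_bracket A (wdg a b) = wdg (a *m A^T) b + wdg a (b *m A^T).
Proof.
move=> /soP hA.
have hA' : J *m A = - (A^T *m J) by rewrite hA opprK.
rewrite /mx_bracket /wdg !trmx_mul !trmxK !mulmxA -[_ *m J *m A]mulmxA hA' mulmxN opprK.
rewrite -mulmxDl mulmxA -!mulmxDl; congr (_ *m _).
rewrite mulmxBr mulmxBl !mulmxA.
move: (A *m a^T *m b) (A *m b^T *m a) (a^T *m b *m A^T) (b^T *m a *m A^T) => x1 x2 x3 x4.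
by apply/matrixP => i j; rewrite !mxE; ring.
Qed.

Lemma conj_wdg (M : 'M[R]_N) a b :
  M *m wdg a b *m (J *m M^T *m J) = wdg (a *m M^T) (b *m M^T).
Proof.
rewrite /wdg !trmx_mul !trmxK !mulmxA -[_ *m J *m J]mulmxA JJ mulmx1.
by rewrite mulmxBr mulmxBl !mulmxA.
Qed.

Local Notation e_ i := (delta_mx 0 i : 'rV[R]_N).

(** [A *m J] is antisymmetric, so its entries are coefficients of [A] on bivectors of basis vectors;
    each unordered pair occurs twice, whence the factor 1/2. *)
Lemma so_span A : so_set A -> A = \sum_i \sum_j ((A *m J) i j / 2) *: wdg (e_ i) (e_ j).
Proof.
move=> hA; have anti : (A *m J)^T = - (A *m J).
  have /(congr1 (mulmx J)) /(congr1 (mulmx^~ J)) := soP hA.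
  by rewrite mulmxN mulNmx !mulmxA JJ mul1mx -!mulmxA JJ mulmx1 trmx_mul Jt.
have anti' i j : (A *m J) j i = - (A *m J) i j.
  by have := congr1 (fun M : 'M[R]_N => M i j) anti; rewrite !mxE.
rewrite -[LHS](_ : A *m J *m J = A); last by rewrite -mulmxA JJ mulmx1.
under eq_bigr do under eq_bigr do rewrite /wdg scalemxAl.
under eq_bigr do rewrite -mulmx_suml.
rewrite -mulmx_suml; congr (_ *m _).
rewrite [LHS]matrix_sum_delta.
have -> : \sum_i \sum_j ((A *m J) i j / 2) *: ((e_ i)^T *m e_ j - (e_ j)^T *m e_ i) =
   \sum_i \sum_j ((A *m J) i j / 2) *: delta_mx i j - \sum_i \sum_j ((A *m J) i j / 2) *: delta_mx j i.
  rewrite -sumrB; apply: eq_bigr => i _; rewrite -sumrB; apply: eq_bigr => j _.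
  by rewrite !trmx_delta !mul_delta_mx scalerBr.
rewrite [X in _ - X]exchange_big /= -sumrB; apply: eq_bigr => i _.
rewrite -sumrB; apply: eq_bigr => j _.
by rewrite anti' -scalerBl; congr (_ *: _); field.
Qed.

Lemma so_span_ind (P : 'M[R]_N -> Prop) : P 0 -> (forall x A B, P A -> P B -> P (x *: A + B)) ->
  (forall i j, P (wdg (e_ i) (e_ j))) -> forall A, so_set A -> P A.
Proof.
move=> P0 PD Pe A /so_span ->.
have PS I (r : seq I) (F : I -> 'M[R]_N) : (forall i, P (F i)) -> P (\sum_(i <- r) F i).
  move=> H; elim: r => [|i r IH]; first by rewrite big_nil.
  by rewrite big_cons -[F i]scale1r; exact: PD.
apply: (PS 'I_N) => i; apply: (PS 'I_N) => j; rewrite -[_ *: _]addr0; exact: PD.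
Qed.

(** [M] is the orthogonal projection along [v]. Since [A] annihilates [v], it is unchanged when
    conjugated by [M] in the sense of [conj_wdg]; doing this to the expansion of [so_span] pushes
    each bivector into the orthogonal of [v]. *)
Lemma so_span_perp v A : << v, v >> != 0 -> so_set A -> v *m A^T = 0 ->
  A = \sum_i \sum_j ((A *m J) i j / 2) *:
     wdg (e_ i - (<< e_ i, v >> / << v, v >>) *: v) (e_ j - (<< e_ j, v >> / << v, v >>) *: v).
Proof.
move=> v0 hA vA; pose x := (<< v, v >>)^-1.
pose M := 1%:M - x *: (v^T *m v *m J).
have ME i : e_ i - (<< e_ i, v >> / << v, v >>) *: v = e_ i *m M^T.
  rewrite /M linearB /= [(x *: _)^T]linearZ /= trmx1 mulmxBr mulmx1 -scalemxAr !trmx_mul Jt trmxK !mulmxA.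
  by rewrite mulmx_rc scalerA mulrC.
have Av : A *m v^T = 0 by rewrite -[LHS]trmxK trmx_mul trmxK vA trmx0.
have vJA : v *m J *m A = 0.
  by rewrite -mulmxA -[J *m A]opprK -(soP hA) mulmxN mulmxA vA mul0mx oppr0.
have E : M *m A *m (J *m M^T *m J) = A.
  have -> : M *m A = A.
    by rewrite /M mulmxBl mul1mx -scalemxAl -!mulmxA (mulmxA v) vJA mulmx0 scaler0 subr0.
  have -> : J *m M^T *m J = 1%:M - x *: (v^T *m v *m J).
    rewrite /M linearB /= [(x *: _)^T]linearZ /= trmx1 mulmxBr mulmxBl mulmx1 JJ; congr (_ - _).
    by rewrite -scalemxAr -scalemxAl !trmx_mul Jt trmxK !mulmxA JJ mul1mx.
  by rewrite mulmxBr mulmx1 -scalemxAr !mulmxA Av !mul0mx scaler0 subr0.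
rewrite -{1}E {1}(so_span hA) mulmx_sumr mulmx_suml; apply: eq_bigr => i _.
rewrite mulmx_sumr mulmx_suml; apply: eq_bigr => j _.
by rewrite -scalemxAr -scalemxAl conj_wdg !ME.
Qed.

End wedge.

(** * Vectors of prescribed sign in signature (2,n) *)

Section signature.
Context {R : realType} {n : nat}.
Local Notation N := (2 + n)%N.
Local Notation J := (signature_mx 2 N : 'M[R]_N).
Local Notation "<< a , b >>" := (bf J a b) (a at level 10, b at level 10).
Implicit Types (a b c f v : 'rV[R]_N).

Lemma sigJJ p (k : nat) : (signature_mx p k : 'M[R]_k) *m signature_mx p k = 1%:M.
Proof.
rewrite /signature_mx mulmx_diag; apply/matrixP => i j; rewrite !mxE.
by case: (i < p)%N; rewrite ?mulrNN mulr1 /= ?mulr1n.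
Qed.

Lemma sigT p (k : nat) : (signature_mx p k : 'M[R]_k)^T = signature_mx p k.
Proof. exact: tr_diag_mx. Qed.

Lemma sig_unit p (k : nat) : (signature_mx p k : 'M[R]_k) \in unitmx.
Proof. by case: (mulmx1_unit (sigJJ p k)). Qed.

Lemma bf_sig p k (a b : 'rV[R]_k) :
  bf (signature_mx p k) a b = \sum_(i < k) (if (i < p)%N then -1 else 1) * (a 0 i * b 0 i).
Proof.
rewrite /bf /signature_mx mul_mx_diag mxE; apply: eq_bigr => i _; rewrite !mxE.
by case: (i < p)%N; rewrite ?mulrN1 ?mulN1r ?mulNr ?mulr1 ?mul1r.
Qed.

Lemma rank_lt_ker k l (A : 'M[R]_(k, l)) : (\rank A < k)%N -> exists2 f : 'rV_k, f != 0 & f *m A = 0.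
Proof.
move=> rA; have : kermx A != 0 by rewrite kermx_eq0 -row_leq_rank -ltnNge.
by case/rowV0Pn => f /sub_kermxP fA f0; exists f.
Qed.

Lemma rank_row_mx_le k l l' (A : 'M[R]_(k, l)) (B : 'M[R]_(k, l')) :
  (\rank (row_mx A B) <= \rank A + \rank B)%N.
Proof.
rewrite -mxrank_tr tr_row_mx -addsmxE -(mxrank_tr A) -(mxrank_tr B).
exact: leq_of_leqif (mxrank_adds_leqif _ _).
Qed.

(** Encodes orthogonality to [b] as a linear equation [x *m co b = 0], so that it can stand in a
    list beside other linear equations. *)
Definition co b : 'cV[R]_N := J *m b^T.

Lemma coE a b : a *m co b = 0 -> << a, b >> = 0.
Proof. by rewrite /bf -mulmxA => ->; rewrite mxE. Qed.

Lemma pos_of_coord f : f != 0 -> f *m (\matrix_(i, j) (i == j :> nat)%:R : 'M[R]_(N, 2)) = 0 ->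
  0 < << f, f >>.
Proof.
move=> f0 fP.
have fi (i : 'I_N) : (i < 2)%N -> f 0 i = 0.
  move=> i2; have := congr1 (fun M : 'rV[R]_2 => M 0 (Ordinal i2)) fP; rewrite !mxE => <-.
  rewrite (bigD1 i) //= mxE /= eqxx mulr1 big1 ?addr0 // => k ki.
  by rewrite mxE /= [_ == _](negbTE ki) mulr0.
rewrite bf_sig lt_neqAle; apply/andP; split; last first.
  apply: sumr_ge0 => i _; case: ifP => [/fi ->|_]; first by rewrite mulr0 mulr0.
  by rewrite mul1r -expr2 sqr_ge0.
apply: contra f0; rewrite eq_sym psumr_eq0; last first.
  move=> i _; case: ifP => [/fi ->|_]; first by rewrite mulr0 mulr0.
  by rewrite mul1r -expr2 sqr_ge0.
move/allP => H; apply/eqP/rowP => i; rewrite mxE.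
have := H i (mem_index_enum _) => /=; case: ifP => [/fi //|_].
by rewrite mul1r mulf_eq0 orbb => /eqP.
Qed.

(** The vanishing of the two negative coordinates is added to the equations. Fewer than N conditions
    in total leave a nonzero solution, which lies in the positive definite coordinate subspace. *)
Lemma pos_orth l (C : 'M[R]_(N, l)) (s : seq 'cV[R]_N) : (\rank C + size s < n)%N ->
  exists f, [/\ f *m C = 0, forall x, x \in s -> f *m x = 0 & 0 < << f, f >>].
Proof.
move=> rC; pose B : 'M[R]_(N, size s) := \matrix_(i, j) (nth 0 s j) i 0.
pose P : 'M[R]_(N, 2) := \matrix_(i, j) (i == j :> nat)%:R.
have : (\rank (row_mx C (row_mx B P)) < N)%N.
  apply: leq_ltn_trans (rank_row_mx_le _ _) _.
  apply: (@leq_ltn_trans (\rank C + (size s + 2))).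
    rewrite leq_add2l; apply: leq_trans (rank_row_mx_le _ _) _.
    by rewrite leq_add // rank_leq_col.
  by rewrite addnA addnC ltn_add2l.
case/rank_lt_ker => f f0 E.
have [fC E2] := eq_row_mx (etrans (esym (mul_mx_row f C _)) (etrans E (esym (row_mx0 _ _ _ _)))).
have [fB fP] := eq_row_mx (etrans (esym (mul_mx_row f B _)) (etrans E2 (esym (row_mx0 _ _ _ _)))).
exists f; split => //.
  move=> x xs; apply/matrixP => i j; rewrite !ord1.
  have lt : (index x s < size s)%N by rewrite index_mem.
  have := congr1 (fun M : 'rV[R]_(size s) => M 0 (Ordinal lt)) fB; rewrite !mxE => fB'.
  rewrite -[RHS]fB'.
  by apply: eq_bigr => k _; rewrite mxE /= nth_index.
exact: pos_of_coord.
Qed.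

(** Completes [p] to a hyperbolic pair: nondegeneracy gives a vector with product 1, and subtracting
    half its square times [p] makes it isotropic. *)
Lemma partner (p : 'rV[R]_N) : p != 0 -> << p, p >> = 0 ->
  exists2 p', << p, p' >> = 1 & << p', p' >> = 0.
Proof.
move=> p0 pp; have [b pb] : exists b, << p, b >> != 0.
  apply: contrapT => H; case/eqP: p0; apply: (bf_nondeg (sig_unit 2 N)) => b.
  by apply/eqP/negPn/negP => pb; apply: H; exists b.
have [b' pb'] : exists b', << p, b' >> = 1.
  by exists ((<< p, b >>)^-1 *: b); rewrite bfZr mulVf.
exists (b' - (<< b', b' >> / 2) *: p); rewrite !bfE pp ?(bfC b' p (sigT _ _)) pb'.
  by rewrite mulr0 oppr0 addr0.
by field.
Qed.

(* The orthogonal projection of a negative definite plane to a hyperplane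
   normal to a positive vector stays negative definite. *)
Lemma neg_orth v x : 0 < << v, v >> -> << x, v >> = 0 ->
  exists2 y, << y, v >> = 0 /\ << y, x >> = 0 & << y, y >> < 0.
Proof.
move=> v0 xv.
pose P : 'M[R]_(2, N) := \matrix_(i, j) (i == j :> nat)%:R.
have : (\rank (P *m co x) < 2)%N by rewrite ltnS rank_leq_col.
case/rank_lt_ker => w w0; rewrite mulmxA => /coE ex.
set e := w *m P in ex.
have ei (i : 'I_N) (i2 : (i < 2)%N) : e 0 i = w 0 (Ordinal i2).
  rewrite /e mxE (bigD1 (Ordinal i2)) //= mxE /= eqxx mulr1 big1 ?addr0 // => k ki.
  rewrite mxE (_ : (k == i :> nat) = false) ?mulr0 //.
  by apply: contraNF ki => /eqP H; apply/eqP/val_inj.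
have ei0 (i : 'I_N) : (i < 2)%N = false -> e 0 i = 0.
  move=> i2; rewrite /e mxE big1 // => k _; rewrite mxE (_ : (k == i :> nat) = false) ?mulr0 //.
  by apply/eqP => H; rewrite -H ltn_ord in i2.
have ee : << e, e >> < 0.
  rewrite bf_sig -oppr_gt0 -sumrN.
  have pos (i : 'I_N) : 0 <= - ((if (i < 2)%N then -1 else 1) * (e 0 i * e 0 i)).
    case: ifP => [_|/ei0 ->]; last by rewrite !mulr0 oppr0.
    by rewrite mulN1r opprK -expr2 sqr_ge0.
  rewrite lt_neqAle sumr_ge0 // andbT eq_sym psumr_eq0 //.
  apply: contra w0 => /allP H; apply/eqP/rowP => i; rewrite mxE.
  have i2 : (lshift n i < 2)%N := ltn_ord i.
  have := H (lshift n i) (mem_index_enum _) => /=; rewrite i2 mulN1r opprK mulf_eq0 orbb ei.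
  by move/eqP; rewrite (_ : Ordinal i2 = i) //; exact: val_inj.
exists (e - (<< e, v >> / << v, v >>) *: v).
  by split; rewrite !bfE ?(bfC v x (sigT _ _)) ?xv ?ex; field; rewrite gt_eqF.
rewrite !bfE (bfC v e (sigT _ _)).
set u := << v, v >>; set z := << e, v >>.
rewrite [ltLHS](_ : _ = << e, e >> - z ^+ 2 / u); last by field; rewrite gt_eqF.
by rewrite ltr_wnDr // oppr_le0 divr_ge0 ?sqr_ge0 // ltW.
Qed.

(** With [x] and [f] scaled to squares -1 and 1, the pair is x + f and (f - x)/2. *)
Lemma null_pair x f : << x, x >> < 0 -> 0 < << f, f >> -> << x, f >> = 0 ->
  exists al be, [/\ << al *: x + be *: f, al *: x + be *: f >> = 0,
    << al *: x + be *: f, (- al / 2) *: x + (be / 2) *: f >> = 1 & al != 0].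
Proof.
move=> x0 f0 xf; pose a := Num.sqrt (- << x, x >>); pose b := Num.sqrt << f, f >>.
have a2 : a ^+ 2 = - << x, x >> by rewrite sqr_sqrtr // oppr_ge0 ltW.
have b2 : b ^+ 2 = << f, f >> by rewrite sqr_sqrtr // ltW.
have a0 : a != 0 by rewrite sqrtr_eq0 -ltNge oppr_gt0.
have b0 : b != 0 by rewrite sqrtr_eq0 -ltNge.
exists a^-1, b^-1; rewrite invr_eq0 a0 !bfE (bfC f x (sigT _ _)) xf -b2.
rewrite (_ : << x, x >> = - a ^+ 2); last by rewrite a2 opprK.
by split => //; field; rewrite ?a0 ?b0.
Qed.

End signature.

(** * Subalgebras of o(2,n) with a Lorentz form on the quotient *)

Section classify.
Context {R : realType} {n m : nat}.
Hypothesis n6 : (6 <= n)%N.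
Local Notation N := (2 + n)%N.
Local Notation J := (signature_mx 2 N : 'M[R]_N).
Local Notation "<< a , b >>" := (bf J a b) (a at level 10, b at level 10).
Local Notation e_ i := (delta_mx 0 i : 'rV[R]_N).
Local Notation so := (so_set J).
Variable S : 'M[R]_m.
Hypothesis St : S^T = S.
Local Notation Q := (bf S).
Hypothesis iso1 : forall s u, s != 0 -> Q s s = 0 -> Q s u = 0 -> Q u u = 0 -> exists c, u = c *: s.
Variable tau : {linear 'M[R]_N -> 'rV[R]_m}.
Hypothesis sub : forall X Y, so X -> so Y -> tau X = 0 -> tau Y = 0 -> tau (mx_bracket X Y) = 0.
Hypothesis inv : forall X Y Z, so X -> so Y -> so Z -> tau X = 0 ->
  Q (tau (mx_bracket X Y)) (tau Z) + Q (tau Y) (tau (mx_bracket X Z)) = 0.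
Implicit Types (a b c e f p v x y : 'rV[R]_N).

Let JJ := @sigJJ R 2 N.
Let Jt := @sigT R 2 N.
Let fC a b : << a, b >> = << b, a >>. Proof. exact: bfC. Qed.
Let QC s u : Q s u = Q u s. Proof. exact: bfC. Qed.

Definition wtau a b : 'rV[R]_m := tau (wdg J a b).
Local Notation t := wtau.

Let tDl a b c : t (a + b) c = t a c + t b c.
Proof. by rewrite /wtau wdgDl linearD. Qed.
Let tZl k a b : t (k *: a) b = k *: t a b.
Proof. by rewrite /wtau wdgZl linearZ. Qed.
Let tC a b : t a b = - t b a.
Proof. by rewrite /wtau wdgC linearN. Qed.
Let tDr a b c : t c (a + b) = t c a + t c b.
Proof. by rewrite /wtau wdgDr linearD. Qed.
Let tZr k a b : t a (k *: b) = k *: t a b.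
Proof. by rewrite /wtau wdgZr linearZ. Qed.
Let tt a : t a a = 0.
Proof.
have /eqP := tC a a; rewrite -addr_eq0 -mulr2n -scaler_nat scaler_eq0 pnatr_eq0 /=.
by move/eqP.
Qed.
Let tNl a b : t (- a) b = - t a b. Proof. by rewrite -scaleN1r tZl scaleN1r. Qed.
Let tNr a b : t a (- b) = - t a b. Proof. by rewrite -scaleN1r tZr scaleN1r. Qed.
Let tE := (tDl, tDr, tZl, tZr, tNl, tNr, tt).

Ltac simp0 := rewrite ?(scale0r, scaler0, scale1r, subr0, sub0r, add0r, addr0, oppr0, mulr0, mul0r, mul1r, bf0l, bf0r).

Ltac tsimp := repeat (match goal with
  | H : bf _ ?a ?b = _ |- context [bf _ ?a ?b] => rewrite H
  | H : bf _ ?a ?b = _ |- context [bf _ ?b ?a] => rewrite (fC b a) H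
  | H : t ?a ?b = _ |- context [t ?a ?b] => rewrite H
  | H : t ?a ?b = _ |- context [t ?b ?a] => rewrite (tC b a) H
  end); rewrite ?tt; simp0.

Definition br p e a b : 'rV[R]_m :=
  << e, a >> *: t p b - << p, a >> *: t e b + << e, b >> *: t a p - << p, b >> *: t a e.

Lemma bracket_wdg p e a b : mx_bracket (wdg J p e) (wdg J a b) =
  << e, a >> *: wdg J p b - << p, a >> *: wdg J e b + << e, b >> *: wdg J a p - << p, b >> *: wdg J a e.
Proof.
have wl k l x y z : wdg J (k *: x - l *: y) z = k *: wdg J x z - l *: wdg J y z.
  by rewrite -scaleNr wdgDl !wdgZl scaleNr.
have wr k l x y z : wdg J z (k *: x - l *: y) = k *: wdg J z x - l *: wdg J z y.
  by rewrite -scaleNr wdgDr !wdgZr scaleNr.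
by rewrite (br_wdg _ _ (wdg_so Jt p e)) !(wdgE Jt) wl wr addrA.
Qed.

Lemma tau_br p e a b : tau (mx_bracket (wdg J p e) (wdg J a b)) = br p e a b.
Proof. by rewrite bracket_wdg raddfB raddfD raddfB /= !linearZ /= !scalerN. Qed.

Lemma sub_br p e a b : t p e = 0 -> t a b = 0 -> br p e a b = 0.
Proof. by move=> h1 h2; rewrite -tau_br; apply: sub => //; exact: wdg_so. Qed.

Lemma inv_br p e a b c d : t p e = 0 -> Q (br p e a b) (t c d) + Q (t a b) (br p e c d) = 0.
Proof. by move=> h1; rewrite -!tau_br; apply: inv => //; exact: wdg_so. Qed.

Lemma sub_br2 p e k a b c d : t p e = 0 -> k *: t a b + t c d = 0 -> k *: br p e a b + br p e c d = 0.
Proof.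
move=> h1 h2; rewrite -!tau_br -linearZ -linearD -mx_bracketDr; apply: sub => //.
- exact: wdg_so.
- by apply: so_lin; exact: wdg_so.
- by rewrite linearD linearZ.
Qed.

Definition tmx p : 'M[R]_(N, m) := \matrix_i t p (e_ i).

Lemma tmxE p f : f *m tmx p = t p f.
Proof.
rewrite mulmx_sum_row {2}(row_sum_delta f) /wtau.
have -> : wdg J p (\sum_i f 0 i *: e_ i) = \sum_i f 0 i *: wdg J p (e_ i).
  elim: (index_enum _) => [|i r IH]; last by rewrite !big_cons wdgDr wdgZr IH.
  by rewrite !big_nil -(scale0r 0) wdgZr scale0r.
rewrite linear_sum; apply: eq_bigr => i _ /=; rewrite linearZ rowK //.
Qed.

(** By [iso1] all rows are multiples of one nonzero row; the coefficients along it form the single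
    equation [phi]. *)
Lemma iso_kernel k (M : 'M[R]_(k, m)) : (forall i j, Q (row i M) (row j M) = 0) ->
  exists phi : 'cV[R]_k, forall u : 'rV_k, u *m phi = 0 -> u *m M = 0.
Proof.
move=> H; case: (pselect (exists i, row i M != 0)) => [[i0 Mi]|Hn]; last first.
  exists 0 => u _; have -> : M = 0; last by rewrite mulmx0.
  apply/row_matrixP => i; rewrite row0; apply/eqP/negPn/negP => Mi; apply: Hn; by exists i.
have /choice[phi Hphi] i : exists c : R, row i M = c *: row i0 M by exact: iso1.
exists (\col_i phi i) => u uphi.
rewrite mulmx_sum_row (eq_bigr (fun i => (u 0 i * phi i) *: row i0 M)); last first.
  by move=> i _; rewrite -scalerA -Hphi.
rewrite -scaler_suml; move/matrixP: uphi => /(_ 0 0); rewrite !mxE => uphi.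
rewrite (_ : \sum_i _ = 0) ?scale0r // -[RHS]uphi.
by apply: eq_bigr => i _; rewrite mxE.
Qed.

Definition prj p p' : 'M[R]_N := 1%:M - co p' *m p - co p *m p'.

Lemma prjE p p' f : f *m prj p p' = f - << f, p' >> *: p - << f, p >> *: p'.
Proof.
rewrite /prj !mulmxBr mulmx1 !mulmxA /bf.
by rewrite !mulmx_rc.
Qed.

Lemma prj_perp p p' f : << p, p >> = 0 -> << p, p' >> = 1 -> << p', p' >> = 0 ->
  << f *m prj p p', p >> = 0 /\ << f *m prj p p', p' >> = 0.
Proof.
by move=> h1 h2 h3; rewrite prjE !bfE (fC p' p) h1 h2 h3; split; ring.
Qed.

Lemma prj_id p p' f : << f, p >> = 0 -> << f, p' >> = 0 -> f *m prj p p' = f.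
Proof. by move=> h1 h2; rewrite prjE h1 h2 !scale0r !subr0. Qed.

Lemma ker_t p p' r : << p, p >> = 0 -> << p, p' >> = 1 -> << p', p' >> = 0 ->
  (forall k l, << k, p >> = 0 -> << k, p' >> = 0 -> << l, p >> = 0 -> << l, p' >> = 0 ->
     Q (t r k) (t r l) = 0) ->
  exists phi : 'cV[R]_N, forall k, << k, p >> = 0 -> << k, p' >> = 0 -> k *m phi = 0 -> t r k = 0.
Proof.
move=> pp pp' p'p' H.
have [i j|phi Hphi] := @iso_kernel _ (prj p p' *m tmx r).
  have [h1 h2] := prj_perp (e_ i) pp pp' p'p'; have [h3 h4] := prj_perp (e_ j) pp pp' p'p'.
  by rewrite !rowE !mulmxA !tmxE; exact: H.
exists phi => k kp kp' /Hphi; by rewrite mulmxA prj_id // tmxE.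
Qed.

(** Five conditions are the largest number imposed at once in what follows; this is where n >= 6 is
    consumed. *)
Lemma pos3 (s : seq 'cV[R]_N) : (size s <= 5)%N ->
  exists2 f, (forall z, z \in s -> f *m z = 0) & 0 < << f, f >>.
Proof.
move=> h; have [|f [_ h1 h2]] := @pos_orth R n 1 (0 : 'M[R]_(N, 1)) s; last by exists f.
by rewrite mxrank0 add0n (leq_ltn_trans h).
Qed.

(* The hypothesis says that [p ^ p^perp] is isotropic for the pull-back of [S]. *)
Section isotropic_line.
Variable p : 'rV[R]_N.
Hypotheses (p0 : p != 0) (pp : << p, p >> = 0).
Hypothesis isop : forall f f', << f, p >> = 0 -> << f', p >> = 0 -> Q (t p f) (t p f') = 0.

(** Up to sign, the value of [tau] on the bracket of p ^ e and p' ^ f; see [G_br]. *)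
Definition gcomb p' e f := t e f + << e, f >> *: t p p'.

Section partner.
Variable p' : 'rV[R]_N.
Hypotheses (pp' : << p, p' >> = 1) (p'p' : << p', p' >> = 0).
Local Notation inE f := (<< f, p >> = 0) (only parsing).

Lemma G_br e f : << e, p >> = 0 -> << e, p' >> = 0 -> << f, p >> = 0 -> br p e p' f = - gcomb p' e f.
Proof. by move=> h1 h2 h3; rewrite /br /gcomb; tsimp; rewrite (tC p' p) scalerN opprD. Qed.

(** Invariance of [Q] under the kernel element p ^ e. Transferred to the other argument of [Q], its
    bracket produces only p ^ f', p ^ e' and p ^ e, which [tau] kills. *)
Lemma G_iso e f e' f' : << e, p >> = 0 -> << e, p' >> = 0 -> << f, p >> = 0 ->
  << e', p >> = 0 -> << f', p >> = 0 ->
  t p e = 0 -> t p e' = 0 -> t p f' = 0 -> Q (gcomb p' e f) (gcomb p' e' f') = 0.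
Proof.
move=> h1 h2 h3 h4 h5 t1 t2 t3.
have H1 := inv_br p' f e' f' t1; have H2 := inv_br p' f p p' t1.
move: H1 H2; rewrite G_br // /br; tsimp => H1 H2.
rewrite [gcomb p' e' f']/gcomb bfDr bfZr.
move: H1 H2; rewrite !bfNl => /eqP; rewrite oppr_eq0 => /eqP -> /eqP.
by rewrite oppr_eq0 => /eqP ->; rewrite mulr0 addr0.
Qed.

Lemma G_s e f f0 : << e, p >> = 0 -> << e, p' >> = 0 -> << f, p >> = 0 -> << f0, p >> = 0 ->
  t p e = 0 -> Q (t p f0) (gcomb p' e f) = 0.
Proof.
move=> h1 h2 h3 h4 t1; have := inv_br p f0 p' f t1.
by rewrite G_br // /br; tsimp; rewrite bfNr => /eqP; rewrite oppr_eq0 => /eqP.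
Qed.

End partner.
(** For a positive [e] with p ^ e in the kernel, [gcomb p' e e] is a nonzero multiple of t p p'. By
    [G_iso] and [G_s] this vector is isotropic and orthogonal to the isotropic t p f0, hence
    proportional to it, and a change of partner cancels it. *)
Lemma partner_t f0 : << f0, p >> = 0 -> t p f0 != 0 ->
  exists p', [/\ << p, p' >> = 1, << p', p' >> = 0 & t p p' = 0].
Proof.
move=> f0p s0; have [p' pp' p'p'] := partner p0 pp.
have [k l h1 h2 h3 h4|phi Hphi] := @ker_t p p' p pp pp' p'p'; first exact: isop.
have [e He ee] := @pos3 [:: co p; co p'; phi] isT.
have ep : << e, p >> = 0 by apply/coE/He; rewrite !inE eqxx.
have ep' : << e, p' >> = 0 by apply/coE/He; rewrite !inE eqxx orbT.
have te : t p e = 0 by apply: Hphi => //; apply: He; rewrite !inE eqxx !orbT.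
have GE : gcomb p' e e = << e, e >> *: t p p' by rewrite /gcomb tt add0r.
have [|||ka Hka] := iso1 s0 (u := t p p').
- exact: isop.
- have := G_s pp' ep ep' ep f0p te; rewrite GE bfZr => /eqP.
  by rewrite mulf_eq0 (gt_eqF ee) /= => /eqP.
- have := G_iso pp' ep ep' ep ep ep te te te; rewrite GE bfZl bfZr => /eqP.
  by rewrite !mulf_eq0 (gt_eqF ee) /= => /eqP.
(* [u] is orthogonal to both p and p', and replacing p' by p' + u - (<u,u>/2) p keeps the pair
   hyperbolic; [tau] of p ^ p' changes by -ka times t p f0, as desired. *)
pose u := - ka *: (f0 - << f0, p' >> *: p).
exists (p' + u - (<< u, u >> / 2) *: p); split.
- rewrite /u; move: (<< _, _ >> / 2) => z; rewrite !bfE; tsimp; ring.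
- have up : << u, p >> = 0 by rewrite /u !bfE; tsimp; ring.
  have up' : << u, p' >> = 0 by rewrite /u !bfE; tsimp; ring.
  by move: up up' => + +; clearbody u => up up'; rewrite !bfE; tsimp; field.
- rewrite /u; move: (<< _, _ >> / 2) => z; rewrite !tE Hka; simp0.
  by rewrite scaleNr subrr.
Qed.

(** The kernel element p ^ p' multiplies p' ^ k and p' ^ l by -1, so invariance reads -2 Q = 0. *)
Lemma iso_p' p' k l : << p, p' >> = 1 -> << p', p' >> = 0 -> t p p' = 0 ->
  << k, p >> = 0 -> << k, p' >> = 0 -> << l, p >> = 0 -> << l, p' >> = 0 -> Q (t p' k) (t p' l) = 0.
Proof.
move=> pp' p'p' tpp' h1 h2 h3 h4.
have := inv_br p' k p' l tpp'; rewrite /br; tsimp; rewrite bfNl bfNr => /eqP.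
by rewrite -opprD oppr_eq0 -mulr2n mulrn_eq0 /= => /eqP.
Qed.

Lemma prj_dec p' x : x = << x, p' >> *: p + << x, p >> *: p' + x *m prj p p'.
Proof. by apply/rowP => i; rewrite prjE !mxE; ring. Qed.

(** [v] represents the linear form cutting out the [k], orthogonal to p and p', with t p k = 0. Its
    orthogonal hyperplane consists of combinations of p, p' and such [k], so besides t p p' = 0 it
    remains to kill t e f and t p' e for [e] and [f] in this set. *)
Lemma hyperplane_of_line f0 : << f0, p >> = 0 -> t p f0 != 0 ->
  exists2 v, v != 0 & forall x y, << x, v >> = 0 -> << y, v >> = 0 -> t x y = 0.
Proof.
move=> f00 s00; have [p' [pp' p'p' tpp']] := partner_t f00 s00.
have [f1 [f0p f0p' s0]] : exists f1, [/\ << f1, p >> = 0, << f1, p' >> = 0 & t p f1 != 0].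
  exists (f0 - << f0, p' >> *: p); rewrite !bfE !tE; tsimp; split => //; ring.
move: f1 f0p f0p' s0 {f00 s00 f0} => f0 f0p f0p' s0.
have [k l h1 h2 h3 h4|phi Hphi] := @ker_t p p' p pp pp' p'p'; first exact: isop.
have [k l h1 h2 h3 h4|phi' Hphi'] := @ker_t p p' p' pp pp' p'p'.
  exact: iso_p'.
have tef e f : << e, p >> = 0 -> << e, p' >> = 0 -> << f, p >> = 0 -> << f, p' >> = 0 ->
    t p e = 0 -> t p f = 0 -> t e f = 0.
  move=> h1 h2 h3 h4 t1 t2.
  have GE : gcomb p' e f = t e f by rewrite /gcomb tpp' scaler0 addr0.
  have [|||mu Hmu] := iso1 s0 (u := t e f).
  - exact: isop.
  - by rewrite -GE; apply: (G_s pp').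
  - by rewrite -GE; apply: (G_iso pp').
  (* Under p ^ p' the bivector p ^ f0 has weight 1 and e ^ f has weight 0, so bracketing the
     relation t e f = mu t p f0 with p ^ p' isolates mu t p f0. *)
  have := @sub_br2 p p' (- mu) p f0 e f tpp'; rewrite Hmu scaleNr addNr => /(_ erefl).
  by rewrite /br; tsimp; rewrite scaleNr => /eqP; rewrite oppr_eq0 => /eqP.
have tp'e e : << e, p >> = 0 -> << e, p' >> = 0 -> t p e = 0 -> t p' e = 0.
  move=> h1 h2 t1.
  (* [k] is chosen so that e ^ k and p' ^ k both lie in the kernel; their bracket is <k,k> p' ^
     e. *)
  have [k Hk kk] := @pos3 [:: co p; co p'; phi; phi'; co e] isT.
  have kp : << k, p >> = 0 by apply/coE/Hk; rewrite !inE eqxx.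
  have kp' : << k, p' >> = 0 by apply/coE/Hk; rewrite !inE eqxx orbT.
  have ke : << k, e >> = 0 by apply/coE/Hk; rewrite !inE eqxx !orbT.
  have tk : t p k = 0 by apply: Hphi => //; apply: Hk; rewrite !inE eqxx !orbT.
  have tk' : t p' k = 0 by apply: Hphi' => //; apply: Hk; rewrite !inE eqxx !orbT.
  have := sub_br (tef e k h1 h2 kp kp' t1 tk) tk'; rewrite /br; tsimp => /eqP.
  by rewrite scaler_eq0 (gt_eqF kk) /= => /eqP.
have Jco (w : 'cV[R]_N) x : << x, (J *m w)^T >> = (x *m w) 0 0.
  by rewrite /bf trmxK -!mulmxA (mulmxA J) JJ mul1mx.
exists (J *m (prj p p' *m phi))^T.
  apply/eqP => v0; move: s0; rewrite Hphi ?eqxx //.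
  apply/matrixP => i j; rewrite !ord1 [RHS]mxE.
  by rewrite -{1}(prj_id (p := p) (p' := p') f0p f0p') -mulmxA -Jco v0 bf0r.
have dec x : << x, (J *m (prj p p' *m phi))^T >> = 0 -> exists2 e,
    [/\ << e, p >> = 0, << e, p' >> = 0 & t p e = 0] & x = << x, p' >> *: p + << x, p >> *: p' + e.
  rewrite Jco => xv; exists (x *m prj p p').
    have [h1 h2] := prj_perp x pp pp' p'p'; split => //; apply: Hphi => //.
    by apply/matrixP => i j; rewrite !ord1 -mulmxA xv mxE.
  exact: prj_dec.
move=> x y /dec[e [e1 e2 e3] ->] /dec[f [f1 f2 f3] ->].
by rewrite !tE tpp' (tC p' p) tpp' f3 (tp'e f) // (tC e p) e3 (tC e p') (tp'e e) // (tef e f) // !(oppr0, scaler0, addr0).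
Qed.

Lemma sub_br4 k k' a b c d c' d' : k *: t a b + t c d = 0 -> k' *: t a b + t c' d' = 0 ->
  br a b a b = 0 -> k *: br a b c' d' + k' *: br c d a b + br c d c' d' = 0.
Proof.
move=> h1 h2 h3; pose X := k *: wdg J a b + wdg J c d; pose Y := k' *: wdg J a b + wdg J c' d'.
have : tau (mx_bracket X Y) = 0.
  apply: sub; try (by apply: so_lin; exact: wdg_so); by rewrite linearD linearZ.
have brl k0 (A B Z : 'M[R]_N) : mx_bracket (k0 *: A + B) Z = k0 *: mx_bracket A Z + mx_bracket B Z.
  by rewrite /mx_bracket mulmxDr mulmxDl -scalemxAr -scalemxAl scalerBr opprD addrACA.
have tl k0 (A B : 'M[R]_N) : tau (k0 *: A + B) = k0 *: tau A + tau B by exact: linearP.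
rewrite mx_bracketDr !brl !tl !tau_br h3 scaler0 add0r.
by rewrite addrCA addrA.
Qed.

(** If p ^ p' is in the kernel, brackets of p ^ e with suitable p' ^ k, and intermediary positive
    vectors, produce all remaining bivectors. If it is not, all t e f with [e], [f] orthogonal to p
    and p' are multiples of the isotropic t p p', then vanish, and a hyperbolic pair [k], [k']
    orthogonal to p and p' leads back to t p p' = 0. That pair uses the second negative
    direction. *)
Lemma full_of_line : (forall f, << f, p >> = 0 -> t p f = 0) -> forall a b, t a b = 0.
Proof.
move=> tp; have [p' pp' p'p'] := partner p0 pp.
suff H : t p p' = 0 /\ forall e, << e, p >> = 0 -> << e, p' >> = 0 -> t p' e = 0 /\
    forall f, << f, p >> = 0 -> << f, p' >> = 0 -> t e f = 0.
  case: H => tpp' H a b; rewrite (prj_dec p' a) (prj_dec p' b).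
  have [a1 a2] := prj_perp a pp pp' p'p'; have [b1 b2] := prj_perp b pp pp' p'p'.
  have [ta tab] := H _ a1 a2; have [tb _] := H _ b1 b2; have tab' := tab _ b1 b2.
  have tpa := tp _ a1; have tpb := tp _ b1.
  move: (_ *m _) (_ *m _) ta tb tab' tpa tpb => a' b' ta tb tab' tpa tpb.
  by rewrite !tE; tsimp.
have [e0 He0 e00] := @pos3 [:: co p; co p'] isT.
have e0p : << e0, p >> = 0 by apply/coE/He0; rewrite !inE eqxx.
have e0p' : << e0, p' >> = 0 by apply/coE/He0; rewrite !inE eqxx orbT.
case: (eqVneq (t p p') 0) => [tpp'|s0].
  split=> //; have [k l h1 h2 h3 h4|phi' Hphi'] := @ker_t p p' p' pp pp' p'p'.
    exact: iso_p'.
  have tk e k : << e, p >> = 0 -> << e, p' >> = 0 -> << k, p >> = 0 -> t p' k = 0 -> t e k = 0.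
    move=> h1 h2 h3 tk; have := sub_br (tp e h1) tk.
    by rewrite (G_br pp') // /gcomb tpp' scaler0 addr0 => /eqP; rewrite oppr_eq0 => /eqP.
  have tef e l : << e, p >> = 0 -> << e, p' >> = 0 -> << l, p >> = 0 -> << l, p' >> = 0 -> t e l = 0.
    move=> h1 h2 h3 h4.
    have [f Hf ff] := @pos3 [:: co p; co p'; phi'; co e; co l] isT.
    have fp : << f, p >> = 0 by apply/coE/Hf; rewrite !inE eqxx.
    have fp' : << f, p' >> = 0 by apply/coE/Hf; rewrite !inE eqxx orbT.
    have fe : << f, e >> = 0 by apply/coE/Hf; rewrite !inE eqxx !orbT.
    have fl : << f, l >> = 0 by apply/coE/Hf; rewrite !inE eqxx !orbT.
    have tf : t p' f = 0 by apply: Hphi' => //; apply: Hf; rewrite !inE eqxx !orbT.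
    have te1 : t e f = 0 by exact: tk.
    have te2 : t f l = 0 by rewrite tC tk ?oppr0.
    have := sub_br te1 te2; rewrite /br; tsimp => /eqP.
    by rewrite scaler_eq0 (gt_eqF ff) /= => /eqP.
  move=> e h1 h2; split; last by move=> f; exact: tef.
  have [f Hf ff] := @pos3 [:: co p; co p'; phi'; co e] isT.
  have fp : << f, p >> = 0 by apply/coE/Hf; rewrite !inE eqxx.
  have fp' : << f, p' >> = 0 by apply/coE/Hf; rewrite !inE eqxx orbT.
  have fe : << f, e >> = 0 by apply/coE/Hf; rewrite !inE eqxx !orbT.
  have tf : t p' f = 0 by apply: Hphi' => //; apply: Hf; rewrite !inE eqxx !orbT.
  have te1 : t e f = 0 by exact: tk.
  have := sub_br te1 tf; rewrite /br; tsimp => /eqP.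
  by rewrite scaler_eq0 (gt_eqF ff) /= => /eqP.
exfalso.
have ge := gt_eqF e00.
have G0 : gcomb p' e0 e0 = << e0, e0 >> *: t p p' by rewrite /gcomb tt add0r.
have ss : Q (t p p') (t p p') = 0.
  have := G_iso pp' e0p e0p' e0p e0p e0p (tp _ e0p) (tp _ e0p) (tp _ e0p).
  by rewrite G0 bfZl bfZr => /eqP; rewrite !mulf_eq0 ge /= => /eqP.
have mu e f : << e, p >> = 0 -> << e, p' >> = 0 -> << f, p >> = 0 -> << f, p' >> = 0 ->
    exists k, k *: t p p' + t e f = 0.
  move=> h1 h2 h3 h4; have [|||k Hk] := iso1 s0 (u := gcomb p' e f) => //.
  - have := G_iso pp' e0p e0p' e0p h1 h3 (tp _ e0p) (tp _ h1) (tp _ h3).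
    by rewrite G0 bfZl => /eqP; rewrite mulf_eq0 ge /= => /eqP.
  - by apply: (G_iso pp') => //; exact: tp.
  exists (<< e, f >> - k); rewrite scalerBl -Hk /gcomb.
  by move: (t e f) (_ *: t p p') => z1 z2; apply/rowP => i; rewrite !mxE; ring.
have tel e l : << e, p >> = 0 -> << e, p' >> = 0 -> << l, p >> = 0 -> << l, p' >> = 0 -> t e l = 0.
  move=> h1 h2 h3 h4.
  have [f Hf ff] := @pos3 [:: co p; co p'; co e; co l] isT.
  have fp : << f, p >> = 0 by apply/coE/Hf; rewrite !inE eqxx.
  have fp' : << f, p' >> = 0 by apply/coE/Hf; rewrite !inE eqxx orbT.
  have fe : << f, e >> = 0 by apply/coE/Hf; rewrite !inE eqxx !orbT.
  have fl : << f, l >> = 0 by apply/coE/Hf; rewrite !inE eqxx !orbT.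
  have [k Hk] := mu e f h1 h2 fp fp'; have [k' Hk'] := mu f l fp fp' h3 h4.
  have := sub_br4 Hk Hk'; rewrite /br; tsimp; rewrite subrr => /(_ erefl).
  by move=> /eqP; rewrite scaler_eq0 (gt_eqF ff) /= => /eqP.
(* p + p' is positive and p - p' is negative, so [neg_orth] provides a negative vector orthogonal to
   the whole hyperbolic plane. *)
have [y [yv yx] yy] : exists2 y, << y, p + p' >> = 0 /\ << y, p - p' >> = 0 & << y, y >> < 0.
  by apply: neg_orth; rewrite !bfE; tsimp; rewrite ?oppr0 ?addr0 ?add0r ?addrN ?addr_gt0 ?subrr.
have [yp yp'] : << y, p >> = 0 /\ << y, p' >> = 0.
  by move: yv yx; rewrite !bfE; split; lra.
have [f Hf ff] := @pos3 [:: co p; co p'; co y] isT.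
have fp : << f, p >> = 0 by apply/coE/Hf; rewrite !inE eqxx.
have fp' : << f, p' >> = 0 by apply/coE/Hf; rewrite !inE eqxx orbT.
have fy : << f, y >> = 0 by apply/coE/Hf; rewrite !inE eqxx !orbT.
have yf : << y, f >> = 0 by rewrite fC.
have [al [be []]] := null_pair yy ff yf.
set k := _ + _; set k' := _ + _ => kk kk' _.
have kp : << k, p >> = 0 by rewrite /k !bfE; tsimp.
have kp' : << k, p' >> = 0 by rewrite /k !bfE; tsimp.
have k'p : << k', p >> = 0 by rewrite /k' !bfE; tsimp.
have k'p' : << k', p' >> = 0 by rewrite /k' !bfE; tsimp.
clearbody k k'.
have tkk' := tel k k' kp kp' k'p k'p'.
have tpk' := tp k' k'p.
have psi : Q (t p p') (t p' k) = 0.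
  have := inv_br p' k p' k tpk'; rewrite (G_br pp') // /gcomb; tsimp.
  rewrite bfNl bfNr (QC (t p' k)) => /eqP.
  by rewrite -opprD oppr_eq0 -mulr2n mulrn_eq0 /= => /eqP.
have kQ : Q (t p' k) (t p' k) = 0.
  have := inv_br p' k p' k tkk'; rewrite /br; tsimp => /eqP.
  by rewrite -mulr2n mulrn_eq0 /= => /eqP.
have [la Hla] : exists la, t p' k = la *: t p p' by exact: iso1.
have tp'k : t p' k = 0.
  have := @sub_br2 k k' (- la) p p' p' k tkk'; rewrite Hla scaleNr addNr => /(_ erefl).
  by rewrite -Hla /br; tsimp.
(* The bracket of p ^ k' and p' ^ k is minus the sum of k' ^ k and p ^ p', and k' ^ k is already in
   the kernel. *)
have := sub_br tpk' tp'k; rewrite (G_br pp') // /gcomb; tsimp => /eqP.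
by rewrite oppr_eq0; apply/negP.
Qed.

End isotropic_line.

Lemma so_skew X a b : so X -> << a *m X^T, b >> = - << a, b *m X^T >>.
Proof.
move=> /soP hX; rewrite /bf trmx_mul trmxK mulmxA -(mulmxA a) hX mulmxN mulNmx.
by rewrite !mulmxA mxE.
Qed.

(** Subtracting the bivector of [v *m X^T] and [v], divided by <v,v>, leaves an element annihilating
    [v]. By [so_span_perp] it is a combination of bivectors orthogonal to [v], where [tau]
    vanishes. *)
Lemma tau_nonnull v X : << v, v >> != 0 ->
  (forall x y, << x, v >> = 0 -> << y, v >> = 0 -> t x y = 0) -> so X ->
  tau X = (<< v, v >>)^-1 *: t (v *m X^T) v /\ << v *m X^T, v >> = 0.
Proof.
move=> v0 tv sX.
have yv : << v *m X^T, v >> = 0.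
  have /eqP := so_skew v v sX; rewrite (fC v (v *m X^T)) -addr_eq0 -mulr2n mulrn_eq0 /=.
  by move/eqP.
split=> //; pose z := (<< v, v >>)^-1; pose X0 := - z *: wdg J (v *m X^T) v + X.
have sX0 : so X0 by apply: so_lin => //; exact: wdg_so.
have vX0 : v *m X0^T = 0.
  rewrite /X0 [(_ + X)^T]linearD /= [(_ *: _)^T]linearZ /= mulmxDr -scalemxAr (wdgE Jt) yv scale0r subr0.
  by rewrite scalerA mulNr mulVf // scaleN1r addNr.
have t0 : tau X0 = 0.
  rewrite (so_span_perp JJ Jt v0 sX0 vX0) linear_sum big1 // => i _.
  rewrite linear_sum big1 // => j _; rewrite linearZ /=.
  have pv k : << e_ k - (<< e_ k, v >> / << v, v >>) *: v, v >> = 0.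
    by rewrite !bfE; field.
  by have := tv _ _ (pv i) (pv j); rewrite /wtau => ->; rewrite scaler0.
by move/eqP: t0; rewrite linearD linearZ /= addrC scaleNr subr_eq0 => /eqP.
Qed.

(** The x orthogonal to [v] with t x v = 0 form a space stable under the bivectors of the orthogonal
    of [v], which act irreducibly. Concretely, one bivector carries y to any x orthogonal to y, and
    a positive [y2] orthogonal to both serves as relay in general. *)
Lemma theta_zero v y x : << v, v >> != 0 ->
  (forall x y, << x, v >> = 0 -> << y, v >> = 0 -> t x y = 0) ->
  y != 0 -> << y, v >> = 0 -> t y v = 0 -> << x, v >> = 0 -> t x v = 0.
Proof.
move=> v0 tv.
have step y' x' : y' != 0 -> << y', v >> = 0 -> t y' v = 0 -> << x', v >> = 0 -> << x', y' >> = 0 ->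
    t x' v = 0.
  move=> y0 yv ty xv xy; have [b yb] : exists b, << y', b >> != 0.
    apply: contrapT => H; case/eqP: y0; apply: (bf_nondeg (sig_unit 2 N)) => b.
    by apply/eqP/negPn/negP => pb; apply: H; exists b.
  pose b' := b - (<< b, v >> / << v, v >>) *: v.
  have bv : << b', v >> = 0 by rewrite /b' !bfE; field.
  have by' : << b', y' >> = << y', b >> by rewrite /b' !bfE; tsimp; rewrite fC; ring.
  have := sub_br (tv _ _ xv bv) ty; rewrite /br; tsimp => /eqP.
  by rewrite scaler_eq0 (negbTE yb) /= => /eqP.
move=> y0 yv ty xv; have [y2 Hy2 yy] := @pos3 [:: co v; co x; co y] isT.
have y2v : << y2, v >> = 0 by apply/coE/Hy2; rewrite !inE eqxx.
have y2x : << y2, x >> = 0 by apply/coE/Hy2; rewrite !inE eqxx orbT.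
have y2y : << y2, y >> = 0 by apply/coE/Hy2; rewrite !inE eqxx !orbT.
have y20 : y2 != 0 by apply: contraTneq yy => ->; rewrite bf0l ltxx.
by apply: (step y2) => //; [exact: (step y)|rewrite fC].
Qed.

(** When x |-> t x v is injective on the orthogonal of [v], a positive [v] is impossible: its
    orthogonal would still have two negative directions and contain an isotropic plane spanned by
    [a] and [b]. Invariance under the kernel elements a ^ a' and b ^ b' then makes t a v and t b v
    span an isotropic plane for [Q], against [iso1]. *)
Lemma stab_or_full v : << v, v >> != 0 ->
  (forall x y, << x, v >> = 0 -> << y, v >> = 0 -> t x y = 0) ->
  (forall X, so X -> tau X = 0) \/
  << v, v >> < 0 /\ forall X, so X -> (tau X = 0 <-> v *m X^T = 0).
Proof.
move=> v0 tv; case: (pselect (exists y, [/\ y != 0, << y, v >> = 0 & t y v = 0])).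
  move=> [y [y0 yv ty]]; left=> X sX; have [-> h] := tau_nonnull v0 tv sX.
  by rewrite (theta_zero v0 tv y0 yv ty h) scaler0.
move=> Hn; right.
have inj y : << y, v >> = 0 -> t y v = 0 -> y = 0.
  by move=> yv ty; apply: contrapT => /eqP y0; apply: Hn; exists y.
split; last first.
  move=> X sX; have [-> h] := tau_nonnull v0 tv sX; split=> [/eqP|->].
    by rewrite scaler_eq0 invr_eq0 (negbTE v0) /= => /eqP; exact: inj.
  by rewrite /wtau -(scale0r 0) wdgZl scale0r linear0 scaler0.
case: ltgtP v0 => // vv _; exfalso.
have [y0 [y0v _] y00] := neg_orth vv (bf0l J v).
have [y1 [y1v y1y0] y11] := neg_orth vv y0v.
have [f0 Hf0 f00] := @pos3 [:: co v; co y0; co y1] isT.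
have f0v : << f0, v >> = 0 by apply/coE/Hf0; rewrite !inE eqxx.
have f0y0 : << f0, y0 >> = 0 by apply/coE/Hf0; rewrite !inE eqxx orbT.
have f0y1 : << f0, y1 >> = 0 by apply/coE/Hf0; rewrite !inE eqxx !orbT.
have [f1 Hf1 f11] := @pos3 [:: co v; co y0; co y1; co f0] isT.
have f1v : << f1, v >> = 0 by apply/coE/Hf1; rewrite !inE eqxx.
have f1y0 : << f1, y0 >> = 0 by apply/coE/Hf1; rewrite !inE eqxx orbT.
have f1y1 : << f1, y1 >> = 0 by apply/coE/Hf1; rewrite !inE eqxx !orbT.
have f1f0 : << f1, f0 >> = 0 by apply/coE/Hf1; rewrite !inE eqxx !orbT.
have [al [be [aa aa' _]]] := null_pair y00 f00 (etrans (fC _ _) f0y0).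
have [al1 [be1 [bb bb' _]]] := null_pair y11 f11 (etrans (fC _ _) f1y1).
move: aa aa' bb bb'; set a := _ + _; set a' := _ + _; set b := _ + _; set b' := _ + _ => aa aa' bb bb'.
have av : << a, v >> = 0 by rewrite /a !bfE; tsimp.
have a'v : << a', v >> = 0 by rewrite /a' !bfE; tsimp.
have bv : << b, v >> = 0 by rewrite /b !bfE; tsimp.
have b'v : << b', v >> = 0 by rewrite /b' !bfE; tsimp.
have ab : << a, b >> = 0 by rewrite /a /b !bfE; tsimp.
have a'b : << a', b >> = 0 by rewrite /a' /b !bfE; tsimp.
have ab' : << a, b' >> = 0 by rewrite /a /b' !bfE; tsimp.
clearbody a a' b b'.
have taa' := tv _ _ av a'v; have tbb' := tv _ _ bv b'v.
have Qaa : Q (t a v) (t a v) = 0.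
  have := inv_br a v a v taa'; rewrite /br; tsimp => /eqP.
  by rewrite -mulr2n mulrn_eq0 /= => /eqP.
have Qbb : Q (t b v) (t b v) = 0.
  have := inv_br b v b v tbb'; rewrite /br; tsimp => /eqP.
  by rewrite -mulr2n mulrn_eq0 /= => /eqP.
have Qab : Q (t a v) (t b v) = 0.
  by have := inv_br a v b v taa'; rewrite /br; tsimp.
have a0 : t a v != 0.
  apply/eqP => /inj ha; move: aa'; rewrite ha // bf0l => /eqP.
  by rewrite eq_sym oner_eq0.
have [c Hc] := iso1 a0 Qaa Qab Qbb.
have /inj : << b - c *: a, v >> = 0 by rewrite !bfE; tsimp.
rewrite tDl tNl tZl Hc subrr => /(_ erefl) /eqP; rewrite subr_eq0 => /eqP hb.
by move: bb'; rewrite hb bfZl ab' mulr0 => /eqP; rewrite eq_sym oner_eq0.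
Qed.

(** Once p ^ p^perp is known to be isotropic, either [tau] vanishes on it and [full_of_line]
    applies, or [tau] vanishes on the bivectors of a hyperplane with normal [v]. An isotropic [v]
    plays the part of [p] in [full_of_line]; the other case is [stab_or_full]. *)
Theorem so_classification (C : 'M[R]_N) p : (\rank C <= 2)%N -> p != 0 -> << p, p >> = 0 ->
  (forall f, f *m C = 0 -> << f, p >> = 0) ->
  (forall f f', f *m C = 0 -> f' *m C = 0 -> Q (t p f) (t p f') = 0) ->
  (forall X, so X -> tau X = 0) \/
  exists2 v, << v, v >> < 0 & forall X, so X -> (tau X = 0 <-> v *m X^T = 0).
Proof.
move=> rC p0 pp Cp HC.
pose P := pinvmx (kermx C) *m kermx C.
have PC0 : P *m C = 0 by rewrite /P -mulmxA mulmx_ker mulmx0.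
have PC f : f *m P *m C = 0 by rewrite -mulmxA PC0 mulmx0.
have Pid f : f *m C = 0 -> f *m P = f by move=> /sub_kermxP fK; rewrite /P mulmxA mulmxKpV.
have [i j|phi Hphi] := @iso_kernel _ (P *m tmx p).
  by rewrite !rowE !(mulmxA _ P) !tmxE; apply: HC; exact: PC.
have isop f f' : << f, p >> = 0 -> << f', p >> = 0 -> Q (t p f) (t p f') = 0.
  (* Isotropy is extended from the kernel of [C] to all of p^perp. With p ^ y in the kernel, its
     bracket with f ^ y is -<y,y> p ^ f while it commutes with p ^ f', and invariance concludes. The
     rank of [C] and the two further equations make four conditions. *)
  move=> fp f'p; have [|y [yC Hy yy]] := @pos_orth R n _ C [:: co f; phi].
    apply: (@leq_ltn_trans 4); last exact: leq_trans n6.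
    exact: (leq_add rC (leqnn 2)).
  have yf : << y, f >> = 0 by apply/coE/Hy; rewrite !inE eqxx.
  have yp := Cp _ yC.
  have ty : t p y = 0.
    by rewrite -tmxE -(Pid y yC) -mulmxA Hphi // Hy // !inE eqxx orbT.
  have := inv_br f y p f' ty; rewrite /br; tsimp; rewrite bfZl => /eqP.
  rewrite mulf_eq0 (gt_eqF yy) /= tC bfNl oppr_eq0 => /eqP //.
have full : (forall a b, t a b = 0) -> forall X, so X -> tau X = 0.
  move=> H; apply: (so_span_ind JJ Jt) => [|k A B hA hB|i j]; first exact: linear0.
    by rewrite linearD linearZ /= hA hB scaler0 addr0.
  exact: H.
case: (pselect (exists2 f0, << f0, p >> = 0 & t p f0 != 0)) => [[f0 f0p s0]|Hn]; last first.
  left; apply: full; apply: (full_of_line p0 pp) => f fp.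
  by apply/eqP/negPn/negP => s0; apply: Hn; exists f.
have [v v0 tv] := hyperplane_of_line p0 pp isop f0p s0.
have [vv|vv] := eqVneq << v, v >> 0.
  left; apply: full; by apply: (full_of_line v0 vv) => f; exact: tv.
by case: (stab_or_full vv tv) => [|[h1 h2]]; [left|right; exists v].
Qed.

End classify.

(** * The group O(2,n) and its Lie algebra *)

Section lie_o.
Context {R : realType} {p q : nat}.
Local Notation N := (p + q)%N.
Local Notation J := (signature_mx p N : 'M[R]_N).
Local Notation so := (so_set J).
Local Notation e_ i := (delta_mx 0 i : 'rV[R]_N).
Implicit Types (A : 'M[R]_N) (gamma : R -> 'M[R]_N).

Lemma is_derive_trmx k l (E : R -> 'M[R]_(k, l)) D (t : R) :
  is_derive (t : R^o) 1 (E : R^o -> _) D -> is_derive (t : R^o) 1 (fun s : R^o => (E s)^T) D^T.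
Proof.
move=> /is_derive_mxP H; apply/is_derive_mxP => i j; rewrite mxE.
by rewrite (_ : (fun s => _) = (fun s => E s j i)) //; apply/funext => s; rewrite mxE.
Qed.

Lemma is_derive_unique (V : normedModType R) (f : R -> V) (a b : V) (t : R) :
  is_derive (t : R^o) 1 (f : R^o -> V) a -> is_derive (t : R^o) 1 (f : R^o -> V) b -> a = b.
Proof. by move=> [_ <-] [_ <-]. Qed.

Lemma lie_o_so A : @lie_o R p q A -> so A.
Proof.
move=> [gamma [g0 _ dg gO]].
have := is_derive_mulmx (is_derive_mulmx (is_derive_trmx dg) (is_derive_cst J (0 : R^o) 1)) dg.
rewrite g0 !trmx1 !mulmx1 !mul1mx addr0 => H.
apply: (is_derive_unique H).
rewrite (_ : (fun s => _) = cst J); first exact: is_derive_cst.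
by apply/funext => s /=; exact: gO.
Qed.

(** The exponential of s A is a polynomial of degree two in s, whose group law and orthogonality are
    checked directly. *)
Lemma nilpotent_lie_o A : so A -> A *m A *m A = 0 -> @lie_o R p q A.
Proof.
move=> /soP sA A3; pose g (s : R) := 1%:M + s *: A + (s ^+ 2 / 2) *: (A *m A).
have g0 : g 0 = 1%:M by rewrite /g expr0n /= mul0r !scale0r !addr0.
have gM s t : g (s + t) = g s *m g t.
  rewrite /g !mulmxDl !mulmxDr !mul1mx !mulmx1 -!scalemxAl -!scalemxAr !scalerA !mulmxA A3 mul0mx !scaler0.
  by rewrite !addr0; move: (A *m A) => B; apply/matrixP => i j; rewrite !mxE; field.
exists g; split => //.
  apply/is_derive_mxP => i j.
  rewrite (_ : (fun s => _) = (fun s => (1%:M : 'M[R]_N) i j + s * A i j + s * s * ((A *m A) i j / 2))); last first.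
    by apply/funext => s; rewrite /g !mxE; field.
  have id1 := is_derive_id (0 : R^o) 1.
  have c1 (k : R) := is_derive_cst (k : R^o) (0 : R^o) 1.
  have := is_deriveD (is_deriveD (c1 ((1%:M : 'M[R]_N) i j)) (is_derive_mul id1 (c1 (A i j))))
    (is_derive_mul (is_derive_mul id1 id1) (c1 ((A *m A) i j / 2))).
  by move/is_derive_eq; apply; rewrite /=; field.
move=> s; rewrite /indefinite_orthogonal_group /=.
have -> : (g s)^T *m J = J *m g (- s).
  rewrite /g [(_ + _)^T]linearD /= [(1%:M + _)^T]linearD /= ![(_ *: _)^T]linearZ /= trmx1 trmx_mul !mulmxDl !mulmxDr mul1mx mulmx1.
  rewrite -!scalemxAl -!scalemxAr -mulmxA sA mulmxN mulmxA sA mulNmx opprK sqrrN scalerN scaleNr.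
  by rewrite mulmxA.
by rewrite -mulmxA -gM addNr g0 mulmx1.
Qed.

Lemma wdg_nilpotent (a e : 'rV[R]_N) : bf J a a = 0 -> bf J e a = 0 ->
  wdg J a e *m wdg J a e *m wdg J a e = 0.
Proof.
move=> aa ea; have Jt := @sigT R p N.
have ae : bf J a e = 0 by rewrite bfC.
have WE c := wdgE Jt a e c; move: (wdg J a e) WE => W WE.
apply/trmx_inj; rewrite !trmx_mul trmx0; apply/row_matrixP => i; rewrite row0 rowE.
have W1 : a *m W^T = 0 by rewrite WE aa ea !scale0r subr0.
have W2 : e *m W^T = bf J e e *: a by rewrite WE ae scale0r subr0.
rewrite !mulmxA (WE (e_ i)) mulmxBl -!scalemxAl W1 W2 scaler0 sub0r mulNmx -!scalemxAl W1.
by rewrite !scaler0 oppr0.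
Qed.

Lemma bf_delta i j : bf J (e_ i) (e_ j) = (if (i < p)%N then -1 else 1) * (i == j)%:R.
Proof.
rewrite bf_sig (bigD1 i) //= big1 => [|k ki]; last first.
  by rewrite !mxE eqxx (negbTE ki) mul0r mulr0.
by rewrite !mxE !eqxx mul1r addr0 eq_sym.
Qed.

(** For [j] of sign opposite to [i], the vectors e_i + e_j and e_i - e_j are isotropic, so their
    bivectors with e_k are nilpotent and have polynomial one-parameter groups; e_i ^ e_k is their
    half-sum. Having p, q >= 2 leaves a choice of [j] different from [k]. *)
Lemma so_sub_lie_o : (2 <= p)%N -> (2 <= q)%N -> @lie_o R p q 0 ->
  (forall x A B, @lie_o R p q A -> @lie_o R p q B -> @lie_o R p q (x *: A + B)) ->
  forall A, so A -> @lie_o R p q A.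
Proof.
move=> p2 q2 L0 LD; have JJ := @sigJJ R p N; have Jt := @sigT R p N.
apply: (so_span_ind JJ Jt) => // i k.
have [->|ik] := eqVneq i k; first by rewrite /wdg subrr mul0mx.
have [j [jk ij ji]] : exists j : 'I_N, [/\ j != k, i != j & (j < p)%N != (i < p)%N].
  have H (x y : 'I_N) : x != y -> (x < p)%N != (i < p)%N -> (y < p)%N != (i < p)%N ->
      exists j : 'I_N, [/\ j != k, i != j & (j < p)%N != (i < p)%N].
    move=> xy hx hy; have ne (z : 'I_N) : (z < p)%N != (i < p)%N -> i != z.
      by apply: contraNneq => ->.
    have [xk|xk] := eqVneq x k; last by exists x; split => //; exact: ne.
    by exists y; split; [rewrite -xk eq_sym|exact: ne|].
  have l0 : (0 < p)%N by exact: ltn_trans p2.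
  have m0 : (0 < q)%N by exact: ltn_trans q2.
  have [ip|ip] : (i < p)%N = true \/ (i < p)%N = false by case: (i < p)%N; [left|right].
    apply: (H (rshift p (Ordinal m0)) (rshift p (Ordinal q2))); rewrite /= ?addn0 ?ltnn ?ip //.
      by rewrite -val_eqE /= eqn_add2l.
    by rewrite ltnNge leq_addr.
  by apply: (H (lshift q (Ordinal l0)) (lshift q (Ordinal p2))); rewrite -?val_eqE /= ?ip ?l0 ?p2.
have jk' : (j == k) = false by exact: negbTE.
have ij' : (i == j) = false by exact: negbTE.
have ik' : (i == k) = false by exact: negbTE.
have nil (s : R) : s ^+ 2 = 1 -> @lie_o R p q (wdg J (e_ i + s *: e_ j) (e_ k)).
  move=> s2; apply: nilpotent_lie_o; first exact: wdg_so.
  apply: wdg_nilpotent; rewrite !bfE !bf_delta ?eqxx ?(eq_sym k) ?(eq_sym j i) ?jk' ?ij' ?ik' /=; last by ring.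
  by move: s2; rewrite expr2; move: ji; case: (j < p)%N; case: (i < p)%N => // _ s2; lra.
have h1 := nil 1 (expr1n _ _); have h2 := nil (-1) (etrans (sqrrN _) (expr1n _ _)).
have -> : wdg J (e_ i) (e_ k) = 2^-1 *: wdg J (e_ i + 1 *: e_ j) (e_ k) +
    (2^-1 *: wdg J (e_ i + -1 *: e_ j) (e_ k) + 0).
  by rewrite !wdgDl !wdgZl; apply/matrixP => u v; rewrite !mxE; field.
by apply: (LD) => //; exact: (LD).
Qed.

End lie_o.

Lemma lin_sum (R : pzRingType) (V W : lmodType R) (f : V -> W) I (r : seq I) (c : I -> R) (x : I -> V) :
  linear f -> f (\sum_(i <- r) c i *: x i) = \sum_(i <- r) c i *: f (x i).
Proof.
move=> lf; elim: r => [|i r IH]; last by rewrite !big_cons lf IH.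
rewrite !big_nil; have := lf 1 0 0; rewrite !scale1r addr0 => /eqP.
by rewrite -subr_eq0 opprD addrA subrr sub0r oppr_eq0 => /eqP.
Qed.

Section rowmx.
Context {R : realType} {d k : nat}.

Definition rowmx (f : 'rV[R]_d -> 'rV[R]_k) : 'M[R]_(d, k) := \matrix_i f (delta_mx 0 i).

Lemma rowmxE f u : linear f -> u *m rowmx f = f u.
Proof.
move=> lf; rewrite mulmx_sum_row {2}(row_sum_delta u) lin_sum //.
by apply: eq_bigr => i _; rewrite rowK.
Qed.

Lemma mulmx_ext (A B : 'M[R]_(d, k)) : (forall u : 'rV_d, u *m A = u *m B) -> A = B.
Proof. by move=> H; apply/row_matrixP => i; rewrite !rowE. Qed.

End rowmx.

Lemma unitmx_inj (R : fieldType) d (A : 'M[R]_d) :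
  (forall u : 'rV_d, u *m A = 0 -> u = 0) -> A \in unitmx.
Proof.
move=> H; rewrite -row_free_unit -kermx_eq0; apply/eqP/row_matrixP => i; rewrite row0.
by apply: H; rewrite -row_mul mulmx_ker row0.
Qed.

Lemma is_derive_mulmxr (R : realType) p q r (B : 'M[R]_(q, r)) (F : R -> 'M[R]_(p, q)) D (t : R) :
  is_derive (t : R^o) 1 (F : R^o -> _) D ->
  is_derive (t : R^o) 1 (fun s : R^o => F s *m B) (D *m B).
Proof.
move=> HF; have := is_derive_mulmx HF (is_derive_cst B (t : R^o) 1).
by rewrite mulmx0 addr0.
Qed.

Lemma is_derive_linmx (R : realType) p q r s (L : 'M[R]_(p, q) -> 'M[R]_(r, s)) (F : R -> 'M[R]_(p, q)) D (t : R) :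
  linear L -> is_derive (t : R^o) 1 (F : R^o -> _) D ->
  is_derive (t : R^o) 1 (fun s : R^o => L (F s)) (L D).
Proof.
move=> lL /is_derive_mxP HF; apply/is_derive_mxP => i j.
have E M : L M i j = \sum_k \sum_l M k l * L (delta_mx k l) i j.
  rewrite {1}[M]matrix_sum_delta pair_big lin_sum // summxE pair_big /=.
  by apply: eq_bigr => kl _; rewrite mxE.
rewrite E (_ : (fun u => _) = (fun u => \sum_k \sum_l F u k l * L (delta_mx k l) i j)); last first.
  by apply/funext => u; rewrite E.
apply: is_derive_bigsum => k; apply: is_derive_bigsum => l.
have := is_derive_mul (HF k l) (is_derive_cst (L (delta_mx k l) i j : R^o) (t : R^o) 1).
by rewrite mulr0 addr0.
Qed.

Section trace.
Context {R : realType} {N d : nat}.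
Local Notation E_ jk := (delta_mx jk.1 jk.2 : 'M[R]_N).

(** The identity tr(g f) = tr(f g). It moves a trace over coordinates of the Lie algebra to the
    space of all matrices, where elementary matrices are a basis. *)
Lemma tr_swap (f : 'rV[R]_d -> 'M[R]_N) (g : 'M[R]_N -> 'rV[R]_d) : linear f -> linear g ->
  \sum_i g (f (delta_mx 0 i)) 0 i = \sum_(jk : 'I_N * 'I_N) f (g (E_ jk)) jk.1 jk.2.
Proof.
move=> lf lg.
have H1 i : g (f (delta_mx 0 i)) 0 i =
    \sum_(jk : 'I_N * 'I_N) f (delta_mx 0 i) jk.1 jk.2 * g (E_ jk) 0 i.
  have -> : f (delta_mx 0 i) = \sum_(jk : 'I_N * 'I_N) f (delta_mx 0 i) jk.1 jk.2 *: E_ jk.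
    by rewrite {1}[f _]matrix_sum_delta pair_big.
  rewrite lin_sum // summxE; apply: eq_bigr => jk _; rewrite mxE; congr (_ * _).
  rewrite summxE (bigD1 jk) //= big1 ?addr0 ?mxE ?eqxx ?mulr1 // => kl klj.
  rewrite !mxE; case: eqP => [h1|]; last by rewrite mulr0.
  case: eqP => [h2|]; last by rewrite mulr0.
  by case/eqP: klj; case: kl h1 h2 => a b /= <- <-; case: (jk).
have H2 (jk : 'I_N * 'I_N) : f (g (E_ jk)) jk.1 jk.2 =
    \sum_i f (delta_mx 0 i) jk.1 jk.2 * g (E_ jk) 0 i.
  rewrite {1}(row_sum_delta (g _)) lin_sum // summxE; apply: eq_bigr => i _.
  by rewrite mxE mulrC.
by rewrite (eq_bigr _ (fun i _ => H1 i)) exchange_big (eq_bigr _ (fun jk _ => H2 jk)).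
Qed.

Lemma mul_delta (U V : 'M[R]_N) j k a b : (U *m delta_mx j k *m V) a b = U a j * V k b.
Proof.
rewrite mxE (bigD1 k) //= big1 ?addr0 => [|l lk].
  rewrite mxE (bigD1 j) //= big1 ?addr0 ?mxE ?eqxx ?mulr1 // => i ij.
  by rewrite mxE (negbTE ij) mulr0.
rewrite mxE big1 ?mul0r // => i _; by rewrite mxE (negbTE lk) andbF mulr0.
Qed.

Lemma sum_mul_delta (U V : 'M[R]_N) :
  \sum_(jk : 'I_N * 'I_N) (U *m E_ jk *m V) jk.1 jk.2 = \tr U * \tr V.
Proof.
rewrite /mxtrace mulr_suml -(pair_big xpredT xpredT (fun j k => (U *m delta_mx j k *m V) j k)) /=.
apply: eq_bigr => j _; rewrite mulr_sumr; apply: eq_bigr => k _; exact: mul_delta.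
Qed.

Lemma sum_mul_deltaT (U V : 'M[R]_N) :
  \sum_(jk : 'I_N * 'I_N) (U *m (E_ jk)^T *m V) jk.1 jk.2 = \tr (U *m V^T).
Proof.
rewrite /mxtrace -(pair_big xpredT xpredT (fun j k => (U *m (delta_mx j k)^T *m V) j k)) /=.
apply: eq_bigr => j _; rewrite mxE; apply: eq_bigr => k _.
by rewrite trmx_delta mul_delta mxE.
Qed.

End trace.

(** * The Killing form of o(2,n) and conjugation by O(2,n) *)

Section transport.
Context {R : realType} {n d : nat}.
Hypothesis n0 : (0 < n)%N.
Local Notation N := (2 + n)%N.
Local Notation J := (signature_mx 2 N : 'M[R]_N).
Local Notation so := (so_set J).
Variable om : {linear 'rV[R]_d -> 'M[R]_N}.
Variable omi : {linear 'M[R]_N -> 'rV[R]_d}.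
Hypothesis omK : cancel om omi.
Hypothesis om_so : forall v, so (om v).
Hypothesis omiK : forall A, so A -> om (omi A) = A.
Implicit Types (v w : 'rV[R]_d) (A X Y c : 'M[R]_N).

Let JJ := @sigJJ R 2 N.
Let Jt := @sigT R 2 N.
Let JJr k (A : 'M[R]_(k, N)) : A *m J *m J = A. Proof. by rewrite -mulmxA JJ mulmx1. Qed.

Definition omad v := rowmx (fun w => omi (mx_bracket (om v) (om w))).

Lemma omadE v w : w *m omad v = omi (mx_bracket (om v) (om w)).
Proof. by apply: rowmxE => k x y; rewrite !linearP mx_bracketDr linearP. Qed.

Lemma omad_is_linear : linear omad.
Proof.
move=> k v w; apply: mulmx_ext => u; rewrite mulmxDr -scalemxAr !omadE -linearP; congr (omi _).
by rewrite linearP /mx_bracket mulmxDr mulmxDl -scalemxAr -scalemxAl scalerBr opprD addrACA.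
Qed.

HB.instance Definition _ := GRing.isLinear.Build R 'rV[R]_d 'M[R]_d _ omad omad_is_linear.

Lemma om_br v w : om (omi (mx_bracket (om v) (om w))) = mx_bracket (om v) (om w).
Proof. by apply/omiK/so_br. Qed.

Lemma omad_jacobi v w : omad (w *m omad v) = omad w *m omad v - omad v *m omad w.
Proof.
apply: mulmx_ext => u; rewrite mulmxBr !mulmxA !omadE !om_br -linearB; congr (omi _).
rewrite /mx_bracket !mulmxBr !mulmxBl !mulmxA.
move: (om v *m om w *m om u) (om w *m om v *m om u) (om u *m om v *m om w) (om u *m om w *m om v)
  (om v *m om u *m om w) (om w *m om u *m om v) => x1 x2 x3 x4 x5 x6.
by apply/matrixP => i j; rewrite !mxE; ring.
Qed.

Lemma so_tr A : so A -> A^T = - (J *m A *m J).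
Proof. by move=> /soP sA; rewrite -mulNmx -sA -mulmxA JJ mulmx1. Qed.

Lemma so_tr0 A : so A -> \tr A = 0.
Proof.
move=> /so_tr sA; have : \tr A = - \tr A.
  by rewrite -{1}mxtrace_tr sA linearN /= mxtrace_mulC mulmxA JJ mul1mx.
by move=> /eqP; rewrite -addr_eq0 -mulr2n mulrn_eq0 /= => /eqP.
Qed.

(** The trace of Z |-> [X, [Y, Z]] on [so] is computed on all matrices after composing with the
    projection [pr]. The terms in Z contribute N times the trace of X Y, those in the transpose of Z
    contribute -2 times it; hence the factor N - 2 = n. *)
Lemma omad_trace v w : \tr (omad v *m omad w) = n%:R * \tr (om v *m om w).
Proof.
pose pr A := 2^-1 *: (A - J *m A^T *m J).
have lpr : linear pr.
  move=> k A B; rewrite /pr linearP /= mulmxDr mulmxDl -scalemxAr -scalemxAl opprD addrACA -scalerBr.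
  by rewrite scalerDr !scalerA mulrC.
have spr A : so (pr A).
  rewrite /so_set /= /pr [(_ *: _)^T]linearZ /= -scalemxAl -scalemxAr -scalerDr.
  rewrite linearB /= !trmx_mul Jt trmxK mulmxBl mulmxBr -!mulmxA JJ mulmx1 !mulmxA JJ mul1mx.
  by rewrite addrC subrKA subrr scaler0.
have prid A : so A -> pr A = A.
  move=> sA; rewrite /pr so_tr // mulmxN mulNmx opprK !mulmxA JJ mul1mx -mulmxA JJ mulmx1.
  by apply/matrixP => i j; rewrite !mxE; field.
pose X := om w; pose Y := om v; pose Phi Z := mx_bracket X (mx_bracket Y Z).
have lPhi : linear Phi by move=> k A B; rewrite /Phi !mx_bracketDr.
have sX : so X by exact: om_so.
have sY : so Y by exact: om_so.
transitivity (\sum_i (omi \o pr) ((Phi \o om) (delta_mx 0 i)) 0 i).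
  rewrite /mxtrace; apply: eq_bigr => i _.
  rewrite -[LHS](_ : row i (omad v *m omad w) 0 i = _); last by rewrite mxE.
  rewrite rowE mulmxA !omadE om_br /= prid //.
  by apply: so_br => //; apply: so_br.
rewrite (tr_swap (f := Phi \o om) (g := omi \o pr)) /=; last 2 first.
- by move=> k A B /=; rewrite linearP lPhi.
- by move=> k A B /=; rewrite lpr linearP.
have PE Z : Phi (pr Z) = 2^-1 *: (X *m Y *m Z *m 1%:M - X *m Z *m Y - Y *m Z *m X + 1%:M *m Z *m (Y *m X)
    - ((X *m Y *m J) *m Z^T *m J - (X *m J) *m Z^T *m (J *m Y) - (Y *m J) *m Z^T *m (J *m X)
     + J *m Z^T *m (J *m Y *m X))).
  have -> : Phi (pr Z) = 2^-1 *: (Phi Z - Phi (J *m Z^T *m J)).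
    have PhiB A B k : Phi (k *: (A - B)) = k *: (Phi A - Phi B).
      have P0 : Phi 0 = 0 by rewrite /Phi /mx_bracket !(mulmx0, mul0mx, subrr).
      have := lPhi k (A - B) 0; rewrite addr0 P0 addr0 => ->.
      by have := lPhi (-1) B A; rewrite !scaleN1r => H; rewrite (addrC A) H addrC.
    by rewrite -PhiB.
  congr (_ *: _); rewrite /Phi /mx_bracket !mulmxBr !mulmxBl !mulmxA mulmx1 mul1mx; congr (_ - _).
    by rewrite opprB addrA addrAC.
  by rewrite opprB addrA addrAC.
under eq_bigr => jk _.
  rewrite omiK // PE mxE; over.
rewrite -mulr_sumr.
have evB A B (jk : 'I_N * 'I_N) : (A - B) jk.1 jk.2 = A jk.1 jk.2 - B jk.1 jk.2 by rewrite !mxE.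
have evD A B (jk : 'I_N * 'I_N) : (A + B) jk.1 jk.2 = A jk.1 jk.2 + B jk.1 jk.2 by rewrite mxE.
under eq_bigr => jk _ do rewrite !(evB, evD).
rewrite !(sumrB, big_split) /= !sum_mul_delta !sum_mul_deltaT.
have Jt' : J *m J^T = 1%:M by rewrite Jt.
have K1 A : A *m J *m J^T = A by rewrite -mulmxA Jt' mulmx1.
have K2 A B : so B -> A *m J *m (J *m B)^T = - (A *m B).
  by move=> sB; rewrite trmx_mul Jt so_tr // mulNmx mulmxN !mulmxA !JJr.
have K3 : J *m (J *m Y *m X)^T = X *m Y.
  by rewrite !trmx_mul Jt (so_tr sX) (so_tr sY) !(mulNmx, mulmxN) opprK !mulmxA JJ mul1mx !JJr.
have trN A : \tr (- A) = - \tr A by exact: linearN.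
rewrite K1 !K2 // K3 !trN !(so_tr0 sX) !(so_tr0 sY) mxtrace1 natrD.
rewrite -/X -/Y (mxtrace_mulC Y X).
by field.
Qed.

(** The transpose of an element of [so] is again in [so], and pairing the two gives n times the sum
    of the squares of the entries. *)
Lemma killing_unit : killing_mx omad \in unitmx.
Proof.
apply: unitmx_inj => v Kv.
have K w : \tr (omad v *m omad w) = 0.
  transitivity ((v *m killing_mx omad *m w^T) 0 0); last by rewrite Kv mul0mx mxE.
  rewrite trace_lin -mulmxA mxE; apply: eq_bigr => i _; congr (_ * _).
  rewrite mxtrace_mulC trace_lin mxE; apply: eq_bigr => j _.
  by rewrite !mxE mulrC mxtrace_mulC.
have sT : so (om v)^T.
  have := om_so v; rewrite /so_set /= trmxK => sA.
  have h := so_tr (om_so v); by rewrite h mulmxN !mulmxA JJ mul1mx subrr.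
have := K (omi (om v)^T); rewrite omad_trace omiK // => /eqP.
rewrite mulf_eq0 pnatr_eq0 -leqn0 leqNgt n0 /= => /eqP t0.
rewrite -[v]omK (_ : om v = 0) ?linear0 //; apply/matrixP => i j; rewrite mxE.
have : \sum_i \sum_j (om v i j) ^+ 2 = 0.
  rewrite -[RHS]t0; apply: eq_bigr => k _; rewrite mxE; apply: eq_bigr => l _.
  by rewrite mxE expr2.
move/eqP; rewrite psumr_eq0 => [/allP/(_ i (mem_index_enum _))|k _]; last first.
  by apply: sumr_ge0 => l _; exact: sqr_ge0.
rewrite /= psumr_eq0 => [/allP/(_ j (mem_index_enum _))|k _]; last exact: sqr_ge0.
by rewrite /= sqrf_eq0 => /eqP.
Qed.

Definition Ogrp : set 'M[R]_N := @indefinite_orthogonal_group R 2 n.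
Local Notation cinv c := (J *m c^T *m J).

Lemma OP c : Ogrp c -> [/\ cinv c *m c = 1%:M, c *m cinv c = 1%:M & c *m J *m c^T = J].
Proof.
move=> cO; have h1 : cinv c *m c = 1%:M by rewrite -!mulmxA (mulmxA c^T) cO JJ.
have h2 : c *m cinv c = 1%:M by exact: mulmx1C.
split=> //; have := congr1 (mulmx^~ J) h2.
by rewrite !mulmxA -[_ *m J *m J]mulmxA JJ mulmx1 mul1mx.
Qed.

Lemma O1 : Ogrp 1%:M.
Proof. by rewrite /Ogrp /indefinite_orthogonal_group /= trmx1 mul1mx mulmx1. Qed.

Lemma OM c c' : Ogrp c -> Ogrp c' -> Ogrp (c *m c').
Proof.
rewrite /Ogrp /indefinite_orthogonal_group /= => h1 h2.
by rewrite trmx_mul !mulmxA -(mulmxA c'^T) -(mulmxA c'^T) h1 h2.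
Qed.

Lemma OV c : Ogrp c -> Ogrp (cinv c).
Proof.
move=> /OP[h1 h2 h3]; rewrite /Ogrp /indefinite_orthogonal_group /= !trmx_mul trmxK Jt.
by rewrite !mulmxA !JJr -(mulmxA J c) -(mulmxA J) h3 JJ mul1mx.
Qed.

Definition mconj c A : 'M[R]_N := c *m A *m cinv c.

Lemma conj_lin c : linear (mconj c).
Proof. by move=> k A B; rewrite /mconj mulmxDr mulmxDl -scalemxAr -scalemxAl. Qed.

Lemma conj_so c A : Ogrp c -> so A -> so (mconj c A).
Proof.
move=> cO sA; have [h1 h2 h3] := OP cO.
rewrite /so_set /= /mconj !trmx_mul trmxK Jt (so_tr sA) !mulNmx !mulmxN !mulNmx addrC; apply/eqP.
rewrite subr_eq0; apply/eqP; rewrite !mulmxA.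
by rewrite !JJr.
Qed.

Lemma conj_br c A B : Ogrp c -> mconj c (mx_bracket A B) = mx_bracket (mconj c A) (mconj c B).
Proof.
move=> cO; have [h1 h2 h3] := OP cO.
have H X Y : mconj c X *m mconj c Y = mconj c (X *m Y).
  by rewrite /mconj -!(mulmxA c) -(mulmxA _ (cinv c)) (mulmxA (cinv c)) h1 mul1mx !mulmxA.
by rewrite /mx_bracket !H /mconj mulmxBr mulmxBl.
Qed.

(** Conjugation by [c] read in the coordinates of the Lie algebra. Because it acts on rows, products
    are reversed in [nuM]. *)
Definition nu c := rowmx (fun v => omi (mconj c (om v))).

Lemma nuE c v : v *m nu c = omi (mconj c (om v)).
Proof. by apply: rowmxE => k x y; rewrite linearP conj_lin linearP. Qed.

Lemma om_nu c v : Ogrp c -> om (v *m nu c) = mconj c (om v).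
Proof. by move=> cO; rewrite nuE omiK //; apply: conj_so. Qed.

Lemma nu_auto c : Ogrp c -> lie_auto omad (nu c).
Proof.
move=> cO v; apply: mulmx_ext => w.
by rewrite !mulmxA nuE !omadE om_br conj_br // !om_nu.
Qed.

Lemma nuM c c' : Ogrp c -> Ogrp c' -> nu (c *m c') = nu c' *m nu c.
Proof.
move=> cO cO'; apply: mulmx_ext => v; rewrite mulmxA !nuE omiK; last exact: conj_so.
by rewrite /mconj trmx_mul !mulmxA -[_ *m J *m J]mulmxA JJ mulmx1.
Qed.

Lemma nu1 : nu 1%:M = 1%:M.
Proof.
by apply: mulmx_ext => v; rewrite nuE mulmx1 /mconj trmx1 mul1mx !mulmx1 JJ mulmx1 omK.
Qed.

Lemma nu_one_parameter Z gamma : gamma 0 = 1%:M -> is_derive (0 : R^o) 1 (gamma : R^o -> _) (om Z) ->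
  is_derive (0 : R^o) 1 (fun s : R^o => nu (gamma s)) (omad Z).
Proof.
move=> g0 dg.
apply/is_derive_mxP => i j.
have dc : is_derive (0 : R^o) 1 (fun s : R^o => mconj (gamma s) (om (delta_mx 0 i)))
    (mx_bracket (om Z) (om (delta_mx 0 i))).
  have := is_derive_mulmx (is_derive_mulmxr (om (delta_mx 0 i)) dg)
     (is_derive_mulmxr J (is_derive_mulmxl J (is_derive_trmx dg))).
  move/is_derive_eq; apply.
  rewrite g0 trmx1 !mul1mx mulmx1 JJ mulmx1 (so_tr (om_so Z)) mulmxN mulNmx !mulmxA JJ mul1mx JJr.
  by rewrite mulmxN.
have lo : linear (omi : 'M[R]_N -> 'rV[R]_d) by exact: linearP.
have := is_derive_linmx lo dc; move/is_derive_mxP => /(_ 0 j).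
rewrite (_ : omi _ 0 j = omad Z i j); last by rewrite /omad mxE.
rewrite (_ : (fun s : R^o => nu (gamma s) i j) = (fun s => omi (mconj (gamma s) (om (delta_mx 0 i))) 0 j)) //.
by apply/funext => s; rewrite /nu mxE.
Qed.

End transport.

(** * Local surjectivity of the adjoint representation of O(2,n) *)

Lemma closed_le_fun (R : realType) (T : topologicalType) (g : T -> R) r :
  continuous g -> closed [set x | g x <= r].
Proof.
move=> cg; apply: (@preimage_closed _ _ g [set y | y <= r]); last exact: closed_le.
by move=> x _; exact: cg.
Qed.

Section matrix_topology.
Context {R : realType}.

Lemma vec_mx_continuous p q : continuous (fun u : 'rV[R]_(p * q) => vec_mx u : 'M[R]_(p, q)).
Proof.
move=> x; apply: continuous_mx => i j.
rewrite (_ : (fun _ => _) = (fun u : 'rV[R]_(p * q) => u 0 (mxvec_index i j))); last first.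
  by apply/funext => u; rewrite mxE.
exact: coord_continuous.
Qed.

Lemma compact_mx p q (A : set 'M[R]_(p, q)) r : closed A -> (forall M, A M -> `|M| <= r) -> compact A.
Proof.
move=> cA bA.
have -> : A = (fun u : 'rV[R]_(p * q) => vec_mx u : 'M[R]_(p, q)) @`
    ([set u | `|0 - u| <= r] `&` (fun u => vec_mx u) @^-1` A).
  apply/seteqP; split=> [M AM|_ [u [_ uA] <-] //].
  exists (mxvec M); last exact: mxvecK.
  split=> /=; last by rewrite mxvecK.
  rewrite sub0r normrN; apply: mx_norm_le => [|i k].
    by apply: le_trans (bA _ AM).
  rewrite !ord1; case/mxvec_indexP: k => a b; rewrite mxvecE.
  by apply: le_trans (mx_norm_entry _ _ _) (bA _ AM).
apply: continuous_compact; first exact/continuous_subspaceT/vec_mx_continuous.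
apply: compact_closedI; first exact: compact_cball.
by apply: preimage_closed => // x _; exact: vec_mx_continuous.
Qed.

Lemma continuous_linmx (T : topologicalType) p q r s (L : 'M[R]_(p, q) -> 'M[R]_(r, s))
    (F : T -> 'M[R]_(p, q)) x : linear L -> {for x, continuous F} ->
  {for x, continuous (fun t => L (F t))}.
Proof.
move=> lL cF; apply: (@continuous_comp T _ _ F L) => //.
apply: (@continuous_mx R 'M[R]_(p, q)) => i j.
rewrite (_ : (fun M : 'M[R]_(p, q) => L M i j) = (fun M => \sum_k \sum_l M k l * L (delta_mx k l) i j)); last first.
  apply/funext => M; rewrite {1}[M]matrix_sum_delta pair_big lin_sum // summxE pair_big /=.
  by apply: eq_bigr => kl _; rewrite mxE.
rewrite /prop_for /continuous_at.
apply: (@continuous_sum R 'M[R]_(p, q) _ (fun k (M : 'M[R]_(p, q)) => \sum_l M k l * L (delta_mx k l) i j)) => k.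
apply: (@continuous_sum R 'M[R]_(p, q) _ (fun l (M : 'M[R]_(p, q)) => M k l * L (delta_mx k l) i j)) => l.
by apply: continuousM; [exact: coord_continuous|exact: cst_continuous].
Qed.

Lemma continuous_trmx (T : topologicalType) p q (F : T -> 'M[R]_(p, q)) x :
  {for x, continuous F} -> {for x, continuous (fun t => (F t)^T)}.
Proof. by apply: continuous_linmx => k A B; rewrite linearP. Qed.

End matrix_topology.

(** On the compact part of [K] outside [U] the distance of [nu b] to the identity attains a minimum,
    which is positive. *)
Lemma compact_separation (R : realType) d (T : topologicalType) (K U : set T) (nu : T -> 'M[R]_d) :
  compact K -> open U -> {within K, continuous nu} -> (forall b, K b -> nu b = 1%:M -> U b) ->
  exists2 r, 0 < r & forall b, K b -> `|nu b - 1%:M| < r -> U b.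
Proof.
move=> cK oU cnu kerU.
  pose F := K `&` ~` U.
  have cF : compact F by apply: compact_closedI => //; exact: open_closedC.
  have [F0|/set0P/negP] := pselect (F !=set0); last first.
    rewrite negbK => /eqP F0; exists 1 => // b Kb _; apply: contrapT => Ub.
    by have : F b by []; rewrite F0.
  have cg : {within F, continuous (fun b => `|nu b - 1%:M|)}.
    move=> x; apply: (@continuous_comp (subspace F) _ _ nu (fun M => `|M - 1%:M|)).
      by apply: (continuous_subspaceW _ cnu) => y [].
    apply: (@continuous_comp _ _ _ (fun M : 'M[R]_d => M - 1%:M) (fun M => `|M|)).
      by apply: continuousB; [exact: id|exact: cst_continuous].
    exact: norm_continuous.
  have [b bF bmin] := compact_EVT_min F0 cF cg.
  move: bF; rewrite inE => -[Kb Ub].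
  exists `|nu b - 1%:M|.
    rewrite normr_gt0 subr_eq0; apply/eqP => /(kerU _ Kb); exact: Ub.
  move=> c Kc; apply: contraPP => Uc /=; apply/negP; rewrite -leNgt bmin // inE.
  by [].
Qed.

Section newton_local.
Context {R : realType} {d : nat}.
Variable ad : {linear 'rV[R]_d -> 'M[R]_d}.
Hypothesis jacobi : forall v w, ad (w *m ad v) = ad w *m ad v - ad v *m ad w.
Hypothesis killing_unit : killing_mx ad \in unitmx.

Lemma newton_local (T : topologicalType) (K U : set T) (b0 : T) (nu : T -> 'M[R]_d) :
  compact K -> K b0 -> open U -> {within K, continuous nu} -> nu b0 = 1%:M ->
  (forall b, K b -> lie_auto ad (nu b)) ->
  (forall b, K b -> nu b = 1%:M -> U b) ->
  (forall b, K b -> U b -> forall Z, exists beta : R -> T,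
     [/\ \forall s \near (0 : R), K (beta s), nu (beta 0) = nu b &
       is_derive (0 : R^o) 1 (fun s : R^o => nu (beta s)) (nu b *m ad Z)]) ->
  exists2 eps, 0 < eps & forall B, lie_auto ad B -> `|B - 1%:M| < eps ->
    exists2 b, K b & B *m nu b = 1%:M.
Proof.
move=> cK Kb0 oU cnu nub0 autoK kerU moveK.
have [r r0 Hr] := compact_separation cK oU cnu kerU.
apply: (newton_surj jacobi killing_unit cK Kb0 cnu nub0 r0 autoK) => b Kb br.
by apply: moveK => //; exact: Hr.
Qed.

End newton_local.

Section orthogonal.
Context {R : realType} {n d : nat}.
Hypothesis n0 : (0 < n)%N.
Local Notation N := (2 + n)%N.
Local Notation J := (signature_mx 2 N : 'M[R]_N).
Local Notation so := (so_set J).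
Variable om : {linear 'rV[R]_d -> 'M[R]_N}.
Variable omi : {linear 'M[R]_N -> 'rV[R]_d}.
Hypothesis omK : cancel om omi.
Hypothesis om_so : forall v, so (om v).
Hypothesis omiK : forall A, so A -> om (omi A) = A.
Hypothesis so_lie_o : forall A, so A -> @lie_o R 2 n A.
Local Notation nu := (nu om omi).
Local Notation O := (@Ogrp R n).
Local Notation cinv c := (J *m c^T *m J).
Implicit Types (c : 'M[R]_N).

Let JJ := @sigJJ R 2 N.
Let Jt := @sigT R 2 N.

Lemma conj_continuous A (T : topologicalType) (F : T -> 'M[R]_N) x : {for x, continuous F} ->
  {for x, continuous (fun t => mconj (F t) A)}.
Proof.
move=> cF; apply: mx_continuous_mul.
  by apply: mx_continuous_mul => //; exact: cst_continuous.
apply: mx_continuous_mul; last exact: cst_continuous.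
by apply: mx_continuous_mul; [exact: cst_continuous|exact: continuous_trmx].
Qed.

Lemma nu_continuous : continuous (nu : 'M[R]_N -> _).
Proof.
move=> x; apply: continuous_mx => i j.
rewrite (_ : (fun _ => _) = (fun c => omi (mconj c (om (delta_mx 0 i))) 0 j)); last first.
  by apply/funext => c; rewrite mxE.
apply: continuous_mx_coord.
apply: (@continuous_linmx R _ _ _ _ _ (fun A => omi A)) => [k A B|]; first exact: linearP.
by apply: conj_continuous; exact: id.
Qed.

Lemma O_closed : closed O.
Proof.
rewrite (_ : O = [set c | `|c^T *m J *m c - J| <= 0]).
  apply: closed_le_fun => x.
  apply: (@continuous_comp _ _ _ (fun c : 'M[R]_N => c^T *m J *m c - J) (fun M => `|M|)); last exact: norm_continuous.
  apply: continuousB; last exact: cst_continuous.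
  apply: mx_continuous_mul; last exact: id.
  apply: mx_continuous_mul; last exact: cst_continuous.
  by apply: continuous_trmx; exact: id.
apply/seteqP; split=> c /=; rewrite normr_le0 subr_eq0; first by move=> ->.
by move/eqP.
Qed.

(** Such a [c] commutes with all e_i ^ e_j. Comparing entries, with a third index for the
    off-diagonal ones, shows that it is scalar, and the form leaves only the scalars 1 and -1. *)
Lemma nu_ker c : O c -> nu c = 1%:M -> c = 1%:M \/ c = - 1%:M.
Proof.
move=> cO nuc; have [h1 h2 h3] := OP cO.
have comm A : so A -> c *m A = A *m c.
  move=> sA; have : omi A *m nu c = omi A by rewrite nuc mulmx1.
  rewrite nuE => /(congr1 om); rewrite !omiK //; last by apply: conj_so => //; rewrite omiK.
  rewrite /mconj => /(congr1 (mulmx^~ c));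
  by rewrite -mulmxA h1 mulmx1.
pose s (i : 'I_N) : R := if (i < 2)%N then -1 else 1.
have s0 i : s i != 0 by rewrite /s; case: ifP => _; rewrite ?oppr_eq0 oner_eq0.
have sE i j : delta_mx i j *m J = s j *: delta_mx i j :> 'M[R]_N.
  rewrite /signature_mx mul_mx_diag; apply/matrixP => a b; rewrite !mxE mulrC.
  by case: (eqVneq b j) => [->|]; rewrite ?andbF ?mulr0.
have wE i j : wdg J (delta_mx 0 i) (delta_mx 0 j) = s j *: delta_mx i j - s i *: delta_mx j i.
  by rewrite /wdg mulmxBl !trmx_delta !mul_delta_mx !sE.
have E i j k l : s j * (c k i * (j == l)%:R) - s i * (c k j * (i == l)%:R) =
    s j * ((k == i)%:R * c j l) - s i * ((k == j)%:R * c i l).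
  have := comm _ (wdg_so Jt (delta_mx 0 i) (delta_mx 0 j)); rewrite wE mulmxBr mulmxBl -!scalemxAr -!scalemxAl.
  move/matrixP => /(_ k l).
  have H1 a b : (c *m delta_mx a b) k l = c k a * (b == l)%:R.
    by rewrite -[_ *m _]mulmx1 mul_delta !mxE.
  have H2 a b : (delta_mx a b *m c) k l = (k == a)%:R * c b l.
    by rewrite -[delta_mx a b]mul1mx mul_delta !mxE.
  by rewrite !mxE; move: (H1 i j) (H1 j i) (H2 i j) (H2 j i); rewrite !mxE => -> -> -> ->.
have ex3 (i k : 'I_N) : exists j : 'I_N, j != i /\ j != k.
  have : (2 < #|'I_N|)%N by rewrite card_ord -addn1 leq_add2l.
  move=> h; have [j] : exists j, j \in ~: [set i; k].
    apply/card_gt0P; rewrite cardsCs finset.setCK; rewrite subn_gt0.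
    by apply: leq_ltn_trans h; rewrite cards2; case: (_ != _).
  by rewrite !inE negb_or => /andP[]; exists j.
have off k i : k != i -> c k i = 0.
  move=> ki; have [j [ji jk]] := ex3 i k; have := E i j k j.
  rewrite eqxx (negbTE ki) (eq_sym k) (negbTE jk) (eq_sym i) (negbTE ji) !(mul0r, mulr0) subrr subr0 mulr1 => /eqP.
  by rewrite mulf_eq0 (negbTE (s0 _)) /= => /eqP.
have diag i j : c i i = c j j.
  have [->//|ij] := eqVneq i j; have := E i j i j.
  rewrite !eqxx (negbTE ij) !(mul0r, mulr0) !subr0 mulr1 mul1r; exact: mulfI.
pose z : 'I_N := ord0; pose la := c z z.
have cE : c = la%:M.
  apply/matrixP => i j; rewrite !mxE; have [->|ij] := eqVneq i j; last by rewrite off.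
  by rewrite mulr1n; exact: diag.
have : la ^+ 2 = 1.
  have := cO; rewrite /Ogrp /indefinite_orthogonal_group /= cE tr_scalar_mx mul_scalar_mx -scalemxAl mul_mx_scalar scalerA.
  move/matrixP => /(_ z z); rewrite !mxE eqxx mulr1n expr2 => /eqP.
  by rewrite mulrN1 eqr_opp => /eqP.
move=> /eqP; rewrite sqrf_eq1 => /orP[/eqP la1|/eqP la1]; rewrite cE la1; [left|right] => //.
by rewrite raddfN.
Qed.

Lemma O_surj : exists2 eps : R, 0 < eps & forall B, lie_auto (omad om omi) B -> `|B - 1%:M| < eps ->
  exists2 c, O c & B = nu c.
Proof.
(* Radius 1/2 excludes -1, the only other element acting trivially, while leaving room around 1 for
   the moves. *)
pose K := [set c | `|1%:M - c| <= 2^-1] `&` O.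
have cK : compact K.
  apply: (@compact_mx _ _ _ _ (1 + 2^-1)).
    apply: closedI; last exact: O_closed.
    apply: closed_le_fun => x.
    apply: (@continuous_comp _ _ _ (fun c : 'M[R]_N => 1%:M - c) (fun M => `|M|)); last exact: norm_continuous.
    by apply: continuousB; [exact: cst_continuous|exact: id].
  move=> M [M1 _]; rewrite -[M](subKr 1%:M) (le_trans (ler_normB _ _)) // lerD //.
  by apply: mx_norm_le => // i j; rewrite !mxE; case: (i == j); rewrite ?normr1 ?normr0.
have jac v w : omad om omi (w *m omad om omi v) = omad om omi w *m omad om omi v - omad om omi v *m omad om omi w.
  exact: omad_jacobi.
have kil : killing_mx (omad om omi) \in unitmx by exact: killing_unit.
have [||||b Kb|b Kb nub|b Kb Ub Z|eps e0 H] := @newton_local R d (omad om omi : {linear _ -> _}) jac kil _ K (ball (1%:M : 'M[R]_N) 2^-1) 1%:M nu cK.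
- by split; [rewrite /= subrr normr0|exact: O1].
- exact: ball_open.
- exact/continuous_subspaceT/nu_continuous.
- exact: nu1.
- by apply: nu_auto => //; case: Kb.
- case: Kb => /= b1 bO; have [b1'|b1'] := nu_ker bO nub.
    by rewrite b1'; exact: ballxx.
  have := le_trans (mx_norm_entry (1%:M - b) ord0 ord0) b1; rewrite b1' !mxE eqxx /= opprK.
  by rewrite ger0_norm //; lra.
- have [gamma [g0 gM dg gO]] := so_lie_o (om_so Z).
  case: Kb => _ bO; exists (fun s => gamma s *m b); split.
  + have cg : {for (0 : R), continuous (fun s : R => gamma s *m b)}.
      have [dg1 _] := dg; have /derivable1_diffP/differentiable_continuous cg := dg1.
      by apply: mx_continuous_mul => //; exact: cst_continuous.
    have : \forall s \near (0 : R), ball (1%:M : 'M[R]_N) 2^-1 (gamma s *m b).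
      apply: cg; rewrite g0 mul1mx; apply: open_nbhs_nbhs; split=> //; exact: ball_open.
    apply: filterS => s; rewrite -ball_normE /= => h; split; first exact: ltW.
    by apply: OM => //; exact: gO.
  + by rewrite g0 mul1mx.
  + rewrite (_ : (fun s : R^o => _) = (fun s : R^o => nu b *m nu (gamma s))); last first.
      by apply/funext => s; rewrite (nuM om_so omiK) //; exact: gO.
    by apply: is_derive_mulmxl; exact: nu_one_parameter.
- exists eps => // B aB Be; have [b [_ bO] Bb] := H B aB Be.
  have h2 : nu (cinv b) *m nu b = 1%:M.
    rewrite -(nuM om_so omiK) //; last exact: OV.
    by have [_ -> _] := OP bO; exact: nu1.
  exists (cinv b); first exact: OV.
  have h3 := mulmx1C Bb.
  by rewrite -[LHS]mul1mx -h2 -mulmxA h3 mulmx1.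
Qed.

End orthogonal.

(** * The adjoint representation *)

Lemma connected_clopen (T : topologicalType) (A : set T) : connected [set: T] ->
  A !=set0 -> open A -> open (~` A) -> A = setT.
Proof.
move=> cT A0 oA oC; apply: cT => //; [exists A|exists A]; rewrite ?setTI //.
by rewrite -(setCK A); exact: open_closedC.
Qed.

Lemma near_dist (R : realType) (T : topologicalType) (V : normedModType R) (f : T -> V) x e :
  {for x, continuous f} -> 0 < e -> \forall y \near x, `|f x - f y| < e.
Proof. by move=> cf e0; move/cvgrPdist_lt: cf; apply. Qed.

Section first_order.
Context {R : realType}.

Lemma C1_first_order d U (f : 'rV[R]_d -> R) x e : open U -> U x -> Ck_on 1 U f -> 0 < e ->
  \forall h \near (0 : 'rV[R]_d), `|f (h + x) - f x - 'D_h f x| <= e * `|h|.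
Proof.
move=> oU Ux cf e0; have [df _] := C1_is_diff oU Ux cf.
have /diff_locallyP[_ /eqaddoP H] := df.
apply: filterS (H e e0) => h /=; rewrite !fctE /cst /= (deriveE _ df).
by rewrite opprD addrA.
Qed.

Lemma is_derive_first_order (V : normedModType R) (u : R -> V) v t e :
  is_derive (t : R^o) 1 (u : R^o -> V) v -> 0 < e ->
  \forall h \near (0 : R), `|u (h + t) - u t - h *: v| <= e * `|h|.
Proof.
move=> [du Du] e0; have dd : differentiable (u : R^o -> V) (t : R^o) by apply/derivable1_diffP.
have /diff_locallyP[_ /eqaddoP H] := dd.
apply: filterS (H e e0) => h /=; rewrite !fctE /cst /=.
have -> : 'd (u : R^o -> V) (t : R^o) h = h *: v.
  by rewrite -{1}[h]mulr1 [h * 1](_ : _ = h *: (1 : R^o)) // linearZ -deriveE // Du.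
by rewrite opprD addrA.
Qed.

Lemma first_order_is_derive (V : normedModType R) (u : R -> V) v t :
  (forall e, 0 < e -> \forall h \near (0 : R), `|u (h + t) - u t - h *: v| <= e * `|h|) ->
  is_derive (t : R^o) 1 (u : R^o -> V) v.
Proof.
move=> H.
have cv : (fun h : R => h^-1 *: ((u \o shift t) (h *: (1 : R^o)) - u t)) @ 0^' --> v.
  apply/cvgrPdist_le => e e0.
  have H1 := H e e0.
  have nz : \forall h \near (0 : R)^', h != 0 by exact: nbhs_dnbhs_neq.
  apply: filterS2 nz (nbhs_dnbhs H1) => h h0 Hh.
  rewrite /= [h *: 1]mulr1.
  rewrite -[v](_ : h^-1 *: (h *: v) = v); last by rewrite scalerA mulVf // scale1r.
  rewrite -scalerBr normrZ distrC normfV mulrC ler_pdivrMr ?normr_gt0 //.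
by split; [apply/cvg_ex; exists v|exact: cvg_lim cv].
Qed.

Lemma is_derive_scaled (V : normedModType R) (u : R -> V) v t : is_derive (t : R^o) 1 (u : R^o -> V) v ->
  forall w : R^o, derivable (u : R^o -> V) (t : R^o) w /\ 'D_w (u : R^o -> V) (t : R^o) = w *: v.
Proof.
move=> [du Du] w; have dd : differentiable (u : R^o -> V) (t : R^o) by apply/derivable1_diffP.
split; first exact: diff_derivable.
rewrite deriveE // -{1}[w]mulr1 [w * 1](_ : _ = w *: (1 : R^o)) // linearZ -deriveE // Du //.
Qed.

Lemma is_derive_curve d U (f : 'rV[R]_d -> R) (u : R -> 'rV[R]_d) v t : open U -> U (u t) -> Ck_on 1 U f ->
  is_derive (t : R^o) 1 (u : R^o -> _) v -> is_derive (t : R^o) 1 (f \o u : R^o -> R^o) ('D_v f (u t)).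
Proof.
move=> oU Ut cf [du Du]; have := derive_comp oU Ut cf du.
by rewrite Du (C1_derive_sum _ oU Ut cf).
Qed.

End first_order.

Lemma near_entries (T : topologicalType) p q (P : 'I_p -> 'I_q -> T -> Prop) (x : T) :
  (forall i j, \forall y \near x, P i j y) -> \forall y \near x, forall i j, P i j y.
Proof. by move=> H; apply: filter_forall => i; apply: filter_forall => j; exact: H. Qed.

Section group_topology.
Context {R : realType} {d : nat} {G : lieGroupType R d}.

Lemma mulg_continuous (T : topologicalType) (f g : T -> G) x :
  {for x, continuous f} -> {for x, continuous g} -> {for x, continuous (fun t => f t * g t)%g}.
Proof. by have [cm _] := @lie_mul_smooth R d G; move=> cf cg; apply: (@continuous_pair_comp T G G G f g (fun z => z.1 * z.2)%g) => //; exact: cm. Qed.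

Lemma invg_continuous (T : topologicalType) (f : T -> G) x :
  {for x, continuous f} -> {for x, continuous (fun t => (f t)^-1)%g}.
Proof.
have [cm _] := @lie_inv_smooth R d G => cf.
by apply: (@continuous_comp T G G f (fun x => x^-1)%g) => //; exact: cm.
Qed.

End group_topology.

Section adjoint.
Context {R : realType} {n d : nat} {G : lieGroupType R d}.
Hypothesis n0 : (0 < n)%N.
Hypothesis G_connected : connected [set: G].
Hypothesis G_finite_center : finite_set (center_set (G := G)).
Local Notation N := (2 + n)%N.
Local Notation J := (signature_mx 2 N : 'M[R]_N).
Local Notation so := (so_set J).
Variable c0 : chart R d G.
Hypotheses (ac0 : atlas c0) (c01 : cdom c0 (1%g : G)).
Local Notation u0 := (cmap c0 (1%g : G)).
Local Notation e_ i := (delta_mx 0 i : 'rV[R]_d).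
Variable psi : 'I_d -> G -> R.
Hypothesis spsi : forall i, smooth_fun (psi i).
Hypothesis dpsi : forall v i, der_at c0 1%g v (psi i) = v 0 i.
Hypothesis psiE : forall D f, point_derivation (1%g : G) D -> smooth_fun f ->
  D f = der_at c0 1%g (\row_i D (psi i)) f.
Local Notation lbr := (lbr c0 psi).
Local Notation Ad := (Ad c0 psi).
Local Notation Z := (center_set (G := G) : set G).
Variable om : {linear 'rV[R]_d -> 'M[R]_N}.
Variable omi : {linear 'M[R]_N -> 'rV[R]_d}.
Hypothesis omK : cancel om omi.
Hypothesis om_so : forall v, so (om v).
Hypothesis omiK : forall A, so A -> om (omi A) = A.
Hypothesis om_lbr : forall v w, om (lbr v w) = mx_bracket (om v) (om w).
Hypothesis so_lie_o : forall A, so A -> @lie_o R 2 n A.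
Local Notation nu := (nu om omi).
Local Notation O := (@Ogrp R n).
Local Notation ad := (omad om omi).
Local Notation lie_auto := (lie_auto ad).
Implicit Types (a b : G) (v w : 'rV[R]_d).

Let u0c : cimg c0 u0. Proof. exact: cmap_img. Qed.
Let cu0 : cinv c0 u0 = (1%g : G). Proof. exact: cmapK. Qed.
Let oc : open (cimg c0). Proof. exact: cimg_open. Qed.

Lemma adjoint_jacobi v w : ad (w *m ad v) = ad w *m ad v - ad v *m ad w.
Proof. exact: omad_jacobi. Qed.

Lemma adjoint_killing_unit : killing_mx ad \in unitmx.
Proof. exact: killing_unit. Qed.

Lemma ad_lbr v w : w *m ad v = lbr v w.
Proof. by rewrite omadE -om_lbr omK. Qed.

Definition Adm a : 'M[R]_d := rowmx (Ad a).

Lemma AdmE a v : v *m Adm a = Ad a v.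
Proof. by apply: rowmxE => k x y; exact: (Ad_lin ac0 c01 spsi). Qed.

Lemma AdmM a b : Adm (a * b)%g = Adm b *m Adm a.
Proof. by apply: mulmx_ext => v; rewrite mulmxA !AdmE; exact: (AdM ac0 c01 spsi dpsi psiE). Qed.

Lemma Adm1 : Adm 1%g = 1%:M.
Proof. by apply: mulmx_ext => v; rewrite AdmE mulmx1; exact: (Ad1 ac0 c01 spsi dpsi psiE). Qed.

Lemma AdmV a : Adm (a^-1)%g *m Adm a = 1%:M.
Proof. by rewrite -AdmM mulgV Adm1. Qed.

Lemma Adm_auto a : lie_auto (Adm a).
Proof.
move=> v; apply: mulmx_ext => w; rewrite !mulmxA ad_lbr !AdmE ad_lbr.
exact: (Ad_lbr ac0 c01 spsi dpsi psiE).
Qed.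

Lemma Adm_continuous : continuous Adm.
Proof.
move=> a; have [c ac ca] := atlas_cover a.
have nE : \forall b \near a, ((fun u => Adm (cinv c u)) \o cmap c) b = Adm b.
  by apply: filterS (open_nbhs_nbhs (conj (@cdom_open _ _ _ c) ca)) => b cb /=; rewrite cmapK.
have H : {for a, continuous ((fun u => Adm (cinv c u)) \o cmap c)}.
  apply: continuous_comp; first exact: cmap_cont.
  apply: continuous_mx => i j.
  rewrite (_ : (fun _ => _) = (fun u => Ad (cinv c u) (e_ i) 0 j)); last first.
    by apply/funext => u; rewrite mxE.
  apply: (Ck_on_cont (Ad_smooth ac0 c01 spsi (e_ i) j ac 0%N)).
  exact: cmap_img.
rewrite /continuous_at -(nbhs_singleton nE).
by apply: cvg_trans H; apply: near_eq_cvg; apply: filterS nE => b ->.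
Qed.

Lemma Adm_ker a : Adm a = 1%:M -> Z a.
Proof.
move=> Aa; apply: (Ad_center ac0 c01 psiE G_connected) => v.
by rewrite -AdmE Aa mulmx1.
Qed.

Lemma Adm_derive w : is_derive (0 : R^o) 1 (fun s : R^o => Adm (cinv c0 (s *: w + u0))) (ad w).
Proof.
apply/is_derive_mxP => i j.
have sA := Ad_smooth ac0 c01 spsi (e_ i) j ac0.
have dA : derivable (fun u => Ad (cinv c0 u) (e_ i) 0 j) (0 *: w + u0) w.
  by rewrite scale0r add0r; exact: (smooth_on_derivable sA).
have := is_derive_line dA; rewrite scale0r add0r (Ad_derive ac0 c01 spsi dpsi psiE) -ad_lbr -rowE mxE.
rewrite (_ : (fun s : R^o => Adm (cinv c0 (s *: w + u0)) i j) =
  (fun s : R^o => Ad (cinv c0 (s *: w + u0)) (e_ i) 0 j)) //.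
by apply/funext => s; rewrite mxE.
Qed.

(** As the center is finite, some compact chart ball [K] around 1 contains no other central element,
    so [Adm] takes the identity value on [K] only at 1. Multiplying on the left by chart lines
    through 1 provides the moves required by [newton_local]. *)
Lemma Adm_surj : exists K : set G, [/\ compact K, K 1%g, forall a, K a -> Z a -> a = 1%g,
   exists2 U, open U /\ U 1%g & U `<=` K /\ K `<=` cdom c0 &
   exists2 eps : R, 0 < eps & forall B, lie_auto B -> `|B - 1%:M| < eps ->
     exists2 b, K b & B *m Adm b = 1%:M].
Proof.
have nZ : \forall u \near u0, cimg c0 u /\ (Z (cinv c0 u) -> cinv c0 u = 1%g).
  have oW : open (~` (Z `\ 1%g)).
    have H := (@accessible_finite_set_closed G).1 (hausdorff_accessible (@manifold_hausdorff R d G)).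
    by apply: closed_openC; apply: H; exact: finite_setD.
  have nW : nbhs (cinv c0 u0) (~` (Z `\ 1%g)).
    by apply: open_nbhs_nbhs; split => //; rewrite cu0 => -[_ h]; exact: h.
  have H2 := cinv_cont u0c nW.
  apply: filterS2 (open_nbhs_nbhs (conj oc u0c)) H2 => u cu Wu; split => // Zu.
  by apply: contrapT => u1; apply: Wu.
have /nbhs_ballP[r' /= r'0 Br'] := nZ.
pose r := r' / 2; have r0 : 0 < r by rewrite divr_gt0.
have Br u : `|u0 - u| <= r -> cimg c0 u /\ (Z (cinv c0 u) -> cinv c0 u = 1%g).
  move=> ur; apply: Br'; rewrite -ball_normE /=; apply: (le_lt_trans ur).
  by rewrite /r ltr_pdivrMr // ltr_pMr // ltr1n.
pose K := cinv c0 @` [set u | `|u0 - u| <= r].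
have cK : compact K.
  apply: continuous_compact; last exact: compact_cball.
  apply: continuous_in_subspaceT => u; rewrite inE => /Br[cu _]; exact: cinv_cont.
have K1 : K 1%g by exists u0 => //=; rewrite subrr normr0 ltW.
have KZ a : K a -> Z a -> a = 1%g by move=> [u /Br[_ +] <-].
pose U := cdom c0 `&` cmap c0 @^-1` ball u0 r.
have oU : open U by apply: cmap_preimage_open; exact: ball_open.
have UK : U `<=` K.
  move=> a [ca]; rewrite /= -ball_normE /= => ar; exists (cmap c0 a) => /=; last exact: cmapK.
  exact: ltW.
exists K; split => //.
  exists U; first by split=> //; split=> //; exact: ballxx.
  by split=> // _ [u /Br[cu _] <-]; exact: cinv_dom.
have [||b Kb|b Kb Ab|b Kb Ub W|eps e0 H] := @newton_local R d (ad : {linear _ -> _}) adjoint_jacobi adjoint_killing_unit G K U 1%g Adm cK K1 oU.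
- exact/continuous_subspaceT/Adm_continuous.
- exact: Adm1.
- exact: Adm_auto.
- rewrite (KZ _ Kb (Adm_ker Ab)); split=> //; exact: ballxx.
- exists (fun s => cinv c0 (s *: W + u0) * b)%g; split.
  + have cb : {for (0 : R), continuous (fun s : R => cinv c0 (s *: W + u0) * b)%g}.
      apply: mulg_continuous; last exact: cst_continuous.
      apply: (@continuous_comp _ _ _ (fun s : R => s *: W + u0) (cinv c0)).
        by apply: continuousD; [exact: scalel_continuous|exact: cst_continuous].
      by rewrite scale0r add0r; exact: cinv_cont.
    have hb : nbhs (cinv c0 ((0 : R) *: W + u0) * b)%g U.
      by rewrite scale0r add0r cu0 mul1g; exact: open_nbhs_nbhs.
    by apply: filterS (cb _ hb) => s; exact: UK.
  + by rewrite scale0r add0r cu0 mul1g.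
  + rewrite (_ : (fun s : R^o => _) = (fun s : R^o => Adm b *m Adm (cinv c0 (s *: W + u0)))); last first.
      by apply/funext => s; rewrite AdmM.
    by apply: is_derive_mulmxl; exact: Adm_derive.
- by exists eps.
Qed.

(** The set of such [a] is open and closed in the connected group: an element near [b] differs from
    it by a factor whose adjoint matrix is an automorphism near the identity, and this is a
    conjugation by [O_surj]. *)
Lemma Adm_conj a : exists2 c, O c & Adm a = nu c.
Proof.
have [eps e0 H] := O_surj n0 omK om_so omiK so_lie_o.
pose A := [set b | exists2 c, O c & Adm b = nu c].
suff AT : A = setT by have : A a by rewrite AT.
have near1 b : \forall b' \near b, exists2 c, O c & Adm (b' * b^-1)%g = nu c.
  have cA : {for b, continuous (fun b' : G => Adm (b' * b^-1)%g)}.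
    apply: (@continuous_comp _ _ _ (fun b' : G => b' * b^-1)%g Adm); last exact: Adm_continuous.
    by apply: mulg_continuous; [exact: id|exact: cst_continuous].
  apply: filterS (near_dist cA e0) => b'; rewrite mulgV Adm1 distrC => h.
  by apply: H => //; exact: Adm_auto.
apply: connected_clopen => //.
- by exists 1%g; exists 1%:M; [exact: O1|rewrite Adm1 nu1].
- rewrite openE => b [c cO Ab]; apply: filterS (near1 b) => b' [c' cO' Ab'].
  exists (c' *m c); first exact: OM.
  by rewrite (nuM om_so omiK) // -Ab -Ab' -AdmM mulgVK.
- rewrite openE => b Ab; apply: filterS (near1 b) => b' [c' cO' Ab'] [c cO Ac]; apply: Ab.
  exists (J *m c'^T *m J *m c); first by apply: OM => //; exact: OV.
  rewrite (nuM om_so omiK) //; last exact: OV.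
  rewrite -Ac; have E : Adm b *m Adm (b' * b^-1)%g = Adm b' by rewrite -AdmM mulgVK.
  rewrite -E -mulmxA Ab' -(nuM om_so omiK) //; last exact: OV.
  by have [-> _ _] := OP cO'; rewrite nu1 ?mulmx1.
Qed.

(** Properness of Ad. Along a proper filter the bounded matrices [c a] cluster at some [c1]. Each
    [a] with [c a] close to [c1] is corrected by an element of [K] so that its adjoint matrix
    becomes [nu c1]; it then lies in the set of all b^-1 z a1 with b in [K] and z central. This set
    is compact because the center is finite, and the filter clusters in it. *)
Lemma compact_of_bounded (H : set G) B : closed H ->
  (forall a c, H a -> O c -> Adm a = nu c -> `|c| <= B) -> compact H.
Proof.
move=> clH bH F PF FH.
have [K [cK K1 KZ _ [eps e0 HK]]] := Adm_surj.
have /choice[c Hc] a : exists c, O c /\ Adm a = nu c by have [c cO Ac] := Adm_conj a; exists c.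
have cC : compact (O `&` [set X : 'M[R]_N | `|X| <= B]).
  apply: (@compact_mx _ _ _ _ B) => [|X []//].
  by apply: closedI; [exact: O_closed|apply: closed_le_fun; exact: norm_continuous].
have FC : F (c @^-1` (O `&` [set X : 'M[R]_N | `|X| <= B])).
  by apply: filterS FH => a Ha; have [cO Ac] := Hc a; split => //; exact: bH Ac.
have [c1 [[c1O _] clc1]] := cC (c @ F) _ FC.
pose P' := nu (J *m c1^T *m J).
have [h1 h2 h3] := OP c1O.
have PP : P' *m nu c1 = 1%:M.
  by rewrite /P' -(nuM om_so omiK) ?h2 ?nu1 //; exact: OV.
have aP : lie_auto P' by apply: nu_auto => //; exact: OV.
have corr a : `|P' *m Adm a - 1%:M| < eps -> exists2 b, K b & Adm (b * a)%g = nu c1.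
  move=> /(HK _ (lie_autoM aP (Adm_auto a))) [b Kb E]; exists b => //.
  have h4 := mulmx1C PP.
  by rewrite -[LHS]mul1mx -h4 -mulmxA AdmM (mulmxA P') E mulmx1.
have cg : {for c1, continuous (fun c : 'M[R]_N => P' *m nu c)}.
  have cn : {for c1, continuous (nu : 'M[R]_N -> 'M[R]_d)} by exact: nu_continuous.
  exact: (mx_continuous_mul (@cst_continuous _ _ P' c1) cn).
pose V := [set c : 'M[R]_N | `|P' *m nu c - 1%:M| < eps].
have nV : nbhs c1 V.
  by apply: filterS (near_dist cg e0) => X; rewrite PP distrC.
have freq A : F A -> exists2 a, A a & V (c a).
  move=> FA; have [X [[a Aa <-] VX]] : c @` A `&` V !=set0.
    apply: clc1 => //; have : F (c @^-1` (c @` A)) by apply: filterS FA => a Aa; exists a.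
    by [].
  by exists a.
have [a0 _ Va0] := freq setT filterT.
have [b0 Kb0 E0] : exists2 b, K b & Adm (b * a0)%g = nu c1.
  by apply: corr; rewrite (Hc a0).2.
have [a1 E1] : exists a1, Adm a1 = nu c1 by exists (b0 * a0)%g.
pose Qs := (fun bz : G * G => bz.1^-1 * bz.2 * a1)%g @` (K `*` Z).
have cQ : compact Qs.
  apply: continuous_compact; last by apply: compact_setX => //; exact: finite_compact.
  apply: continuous_subspaceT => x.
  apply: (@mulg_continuous R d G (G * G)%type (fun bz => bz.1^-1 * bz.2)%g (fun _ => a1)); last exact: cst_continuous.
  apply: (@mulg_continuous R d G (G * G)%type (fun bz => bz.1^-1)%g (fun bz => bz.2)); last exact: cvg_snd.
  by apply: invg_continuous; exact: cvg_fst.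
have VQ a : V (c a) -> Qs a.
  move=> Va; have [b Kb Eb] : exists2 b, K b & Adm (b * a)%g = nu c1.
    by apply: corr; rewrite (Hc a).2.
  exists (b, (b * a * a1^-1)%g); last by rewrite /= !mulgA mulVg mul1g mulgVK.
  split=> //=; apply: Adm_ker; rewrite AdmM Eb -E1; exact: AdmV.
pose F' := within Qs F.
have PF' : ProperFilter F'.
  apply: Build_ProperFilter_ex => A FA; have [a Aa Va] := freq _ FA.
  by exists a; apply: Aa; exact: VQ.
have [|q [Qq clq]] := cQ F' PF'; first by apply: filterS (@filterT _ F _) => y _.
exists q; split.
  rewrite (closure_id H).1 // => W Wq.
  have [y [Hy Wy]] : H `&` W !=set0 by apply: clq => //; apply: filterS FH.
  by exists y.
by move=> A W FA Wq; apply: clq => //; apply: filterS FA.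
Qed.

Lemma noncompact_unbounded (H : set G) B : closed H -> ~ compact H ->
  exists a c, [/\ H a, O c, Adm a = nu c & B < `|c|].
Proof.
move=> clH ncH; apply: contrapT => Hn; apply: ncH; apply: (@compact_of_bounded H B) => // a c Ha cO Ac.
by rewrite leNgt; apply/negP => Bc; apply: Hn; exists a, c.
Qed.

(** The traces of [ad w *m ad (e_ j)] are the entries of [w *m killing_mx ad], from which [w] is
    recovered by inverting the Killing matrix. *)
Lemma ad_lower_bound : exists2 C, 0 < C & forall w, `|w| <= C * `|ad w|.
Proof.
have [Ca Ca0 HCa] := ad_bound (ad : {linear 'rV[R]_d -> 'M[R]_d}).
pose Ki := killing_mx ad; pose d1 : R := d%:R + 1.
have d10 : 0 < d1 by rewrite ltr_wpDl.
have dd : d%:R <= d1 by rewrite lerDl.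
exists (d1 * (d1 * (d1 * Ca)) * (`|invmx Ki| + 1)).
  by rewrite !mulr_gt0 // ltr_wpDl.
move=> w; have wK : `|w *m Ki| <= d1 * (d1 * (`|ad w| * Ca)).
  apply: mx_norm_le => [|i j]; first by rewrite !mulr_ge0 // ltW.
  rewrite !ord1 mxE (_ : \sum_k _ = \tr (ad w *m ad (e_ j))); last first.
    by rewrite trace_lin; apply: eq_bigr => k _; rewrite mxE.
  apply: le_trans (norm_mxtrace _) _; rewrite ler_pM //.
  apply: le_trans (norm_mulmx _ _) _; rewrite ler_pM ?mulr_ge0 // ler_wpM2l //.
  apply: le_trans (HCa _) _; rewrite ler_piMr ?(ltW Ca0) //.
  by apply: mx_norm_le => // k l; rewrite mxE; case: (_ && _); rewrite ?normr1 ?normr0.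
rewrite -{1}[w](mulmxK adjoint_killing_unit); apply: le_trans (norm_mulmx _ _) _.
apply: (@le_trans _ _ (d1 * (d1 * (d1 * (`|ad w| * Ca)) * (`|invmx Ki| + 1)))).
  by rewrite ler_pM ?mulr_ge0 // ler_pM // lerDl.
rewrite le_eqVlt; apply/orP; left; apply/eqP; rewrite /d1; ring.
Qed.

(** b(t) is an element of [K] whose adjoint matrix is that of gamma(t). The defect b(s) b(t)
    b(s+t)^-1 acts trivially, hence is central, and lies in [K] for small s and t, hence is 1. For
    the derivative, the expansions of the adjoint matrices along the chart and along gamma are
    compared: they agree up to ad(x - h v), and [ad_lower_bound] turns this into a bound on x - h
    v. *)
Lemma one_parameter_lift v : exists (b : R -> G) (e : R), [/\ 0 < e, b 0 = 1%g,
  forall s t, `|s| < e -> `|t| < e -> `|s + t| < e -> b (s + t) = (b s * b t)%g,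
  {for (0 : R), continuous b} &
  (\forall t \near (0 : R), cdom c0 (b t)) /\
  is_derive (0 : R^o) 1 (fun t : R^o => cmap c0 (b t)) v].
Proof.
have [gamma [g0 gM dg gO]] := so_lie_o (om_so v).
pose al t := nu (gamma t).
have alM s t : al (s + t) = al t *m al s by rewrite /al gM (nuM om_so omiK) //; exact: gO.
have al0 : al 0 = 1%:M by rewrite /al g0 nu1.
have dal : is_derive (0 : R^o) 1 (al : R^o -> _) (ad v) by exact: nu_one_parameter.
have cal : {for (0 : R), continuous al}.
  by have [d1 _] := dal; have /derivable1_diffP/differentiable_continuous := d1.
have [K [cK K1 KZ [U [oU U1] [UK Kc0]] [eps e0 HK]]] := Adm_surj.
have near_al r : 0 < r -> exists2 de, 0 < de & forall t, `|t| < de -> `|al t - 1%:M| < r.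
  move=> r0; have /nbhs_ballP[de /= de0 H] := near_dist cal r0.
  exists de => // t td; rewrite distrC -al0; apply: H.
  by rewrite -ball_normE /= sub0r normrN.
have [de1 de10 Hde1] := near_al _ e0.
have /choice[b Hb] t : exists b, `|t| < de1 -> K b /\ Adm b = al t.
  have [td|td] := boolP (`|t| < de1); last by exists 1%g.
  have [b Kb E] : exists2 b, K b & al (- t) *m Adm b = 1%:M.
    by apply: HK; [apply: nu_auto => //; exact: gO|apply: Hde1; rewrite normrN].
  exists b => _; split=> //.
  by rewrite -[LHS]mul1mx -al0 -(addNr t) alM -mulmxA E mulmx1.
have near_b W : open W -> W 1%g -> exists2 de, 0 < de <= de1 & forall t, `|t| < de -> W (b t).
  move=> oW W1.
  have [r r0 Hr] : exists2 r, 0 < r & forall b, K b -> `|Adm b - 1%:M| < r -> W b.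
    apply: (compact_separation cK oW); first exact/continuous_subspaceT/Adm_continuous.
    by move=> a Ka /Adm_ker/(KZ _ Ka) ->.
  have [de de0 Hde] := near_al _ r0.
  exists (Num.min de de1); first by rewrite lt_min de0 de10 ge_min lexx orbT.
  move=> t; rewrite lt_min => /andP[t1 t2]; have [Kb Ab] := Hb t t2.
  by apply: Hr => //; rewrite Ab; exact: Hde.
have b0 : b 0 = 1%g.
  have [Kb Ab] : K (b 0) /\ Adm (b 0) = al 0 by apply: Hb; rewrite normr0.
  by apply: KZ => //; apply: Adm_ker; rewrite Ab al0.
have cb : {for (0 : R), continuous b}.
  move=> W; rewrite b0 nbhsE => -[W' [oW' W'1] W'W].
  have [de /andP[de0 _] Hde] := near_b _ oW' W'1.
  apply/nbhs_ballP; exists de => // t; rewrite -ball_normE /= sub0r normrN => td.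
  exact/W'W/Hde.
have [e2 e20 He2] : exists2 e, 0 < e & forall s t, `|s| < e -> `|t| < e -> U (b s * b t * (b (s + t))^-1)%g.
  have cF : {for (0 : R, 0 : R), continuous (fun st : R * R => b st.1 * b st.2 * (b (st.1 + st.2))^-1)%g}.
    have c1 : {for (0 : R, 0 : R), continuous (fun st : R * R => b st.1)}.
      exact: (@continuous_comp _ _ _ (@fst R R) b (0, 0) cvg_fst cb).
    have c2 : {for (0 : R, 0 : R), continuous (fun st : R * R => b st.2)}.
      exact: (@continuous_comp _ _ _ (@snd R R) b (0, 0) cvg_snd cb).
    have c3 : {for (0 : R, 0 : R), continuous (fun st : R * R => b (st.1 + st.2))}.
      apply: (@continuous_comp _ _ _ (fun st : R * R => st.1 + st.2) b) => /=; last by rewrite addr0.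
      by apply: continuousD; [exact: cvg_fst|exact: cvg_snd].
    exact: (mulg_continuous (mulg_continuous c1 c2) (invg_continuous c3)).
  have nU : nbhs (b 0 * b 0 * (b (0 + 0))^-1)%g U.
    by rewrite addr0 b0 mulg1 mulgV; exact: open_nbhs_nbhs.
  have /nbhs_ballP[e /= ee He] := cF _ nU.
  exists e => // s t se te; apply: (He (s, t)); split; rewrite -ball_normE /= sub0r normrN //.
pose e := Num.min e2 de1.
have ee : 0 < e by rewrite lt_min e20.
have nc : \forall t \near (0 : R), cdom c0 (b t).
  apply: filterS (nbhs0_lt de10) => t td; have [Kb _] := Hb t td; exact: Kc0.
exists b, e; split => //.
  move=> s t; rewrite !lt_min => /andP[s1 s2] /andP[t1 t2] /andP[_ st2].
  have [_ As] := Hb s s2; have [_ At] := Hb t t2; have [_ Ast] := Hb _ st2.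
  have Ux := He2 s t s1 t1.
  have /KZ E : K (b s * b t * (b (s + t))^-1)%g by exact: UK.
  have {E}E : (b s * b t * (b (s + t))^-1 = 1)%g.
    apply: E; apply: Adm_ker; rewrite !AdmM As At -alM -Ast; exact: AdmV.
  by rewrite -[RHS](mulgVK (b (s + t))) E mul1g.
split=> //; apply: first_order_is_derive => e' e'0.
have [C C0 HC] := ad_lower_bound.
(* With C ee1 <= 1/2, the bound |x - h v| <= C ee1 (|x| + |h|) gives |x| <= (2 |v| + 1) |h| = (M -
   1) |h|. Substituting this back, the second bound in [ee1] yields the required e' |h|. *)
pose M : R := 2 * `|v| + 2.
have M0 : 0 < M by rewrite ltr_wpDl // mulr_ge0.
pose ee1 := Num.min (2^-1 / C) (e' / (C * M)).
have ee10 : 0 < ee1 by rewrite lt_min !divr_gt0 ?mulr_gt0.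
pose u t := cmap c0 (b t).
have cu : {for (0 : R), continuous u}.
  apply: (@continuous_comp _ _ _ b (cmap c0)) => //; rewrite b0; exact: cmap_cont.
have u0E : u 0 = u0 by rewrite /u b0.
have H1 : \forall h \near (0 : R), `|al h - 1%:M - h *: ad v| <= ee1 * `|h|.
  by have := is_derive_first_order dal ee10; apply: filterS => h; rewrite addr0 al0.
have H2 : \forall x \near (0 : 'rV[R]_d), `|Adm (cinv c0 (x + u0)) - 1%:M - ad x| <= ee1 * `|x|.
  have H i j : \forall x \near (0 : 'rV[R]_d),
      `|Adm (cinv c0 (x + u0)) i j - (1%:M : 'M[R]_d) i j - (ad x) i j| <= ee1 * `|x|.
    have sA := Ad_smooth ac0 c01 spsi (e_ i) j ac0.
    apply: filterS (C1_first_order oc u0c (sA 1%N) ee10) => x.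
    rewrite (Ad_derive ac0 c01 spsi dpsi psiE) -ad_lbr -rowE cu0 -(AdmE 1%g) Adm1 mulmx1.
    by rewrite /Adm /rowmx !mxE eqxx eq_sym.
  have Hall : \forall x \near (0 : 'rV[R]_d), forall i j,
      `|Adm (cinv c0 (x + u0)) i j - (1%:M : 'M[R]_d) i j - (ad x) i j| <= ee1 * `|x|.
    exact: near_entries.
  apply: filterS Hall => x Hx; apply: mx_norm_le => [|i j]; first by rewrite mulr_ge0 // ltW.
  by have := Hx i j; rewrite !mxE.
have H3 : \forall h \near (0 : R), `|Adm (b h) - 1%:M - ad (u h - u 0)| <= ee1 * `|u h - u 0|.
  have cux : {for (0 : R), continuous (fun h => u h - u 0)}.
    by apply: continuousB => //; exact: cst_continuous.
  have /nbhs_ballP[r /= r0 Hr] := H2.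
  have := near_dist cux r0; rewrite subrr; apply: filterS2 nc => h ch; rewrite sub0r normrN => hr.
  have := Hr (u h - u 0); rewrite -ball_normE /= sub0r normrN => /(_ hr).
  by rewrite u0E subrK /u cmapK.
have H4 : \forall h \near (0 : R), `|h| < de1 by exact: nbhs0_lt.
apply: filterS3 H1 H3 H4 => h h1 h3 hd.
have [_ Ah] := Hb h hd; rewrite Ah in h3.
rewrite addr0 -/(u h) -/(u 0); set x := u h - u 0 in h3 *.
have k1 : `|ad (x - h *: v)| <= ee1 * `|x| + ee1 * `|h|.
  rewrite linearB linearZ /= -[_ - _](_ : (al h - 1%:M - h *: ad v) - (al h - 1%:M - ad x) = _); last first.
    by move: (al h) (ad x) (h *: ad v) => X1 X2 X3; apply/matrixP => i j; rewrite !mxE; ring.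
  by apply: le_trans (ler_normB _ _) _; rewrite addrC lerD.
have k2 : `|x - h *: v| <= C * ee1 * (`|x| + `|h|).
  by apply: le_trans (HC _) _; rewrite -mulrA ler_wpM2l ?(ltW C0) // mulrDr.
have Ce : C * ee1 <= 2^-1.
  by rewrite mulrC -ler_pdivlMr // ge_min lexx.
have xh : 0 <= `|x| + `|h| by rewrite addr_ge0.
have k3 : `|x| <= (M - 1) * `|h|.
  have k4 : `|x| <= `|x - h *: v| + `|h| * `|v|.
    by rewrite -normrZ -{1}(subrK (h *: v) x) ler_normD.
  have k5 := le_trans k2 (ler_wpM2r xh Ce).
  rewrite /M mulrBl mulrDl mul1r; move: k4 k5; lra.
apply: (le_trans k2).
apply: (@le_trans _ _ (C * ee1 * (M * `|h|))).
  apply: ler_wpM2l; first by rewrite mulr_ge0 ?ltW.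
  by move: k3; rewrite mulrBl mul1r -lerBrDr.
rewrite mulrA ler_wpM2r // mulrAC -ler_pdivlMl ?mulr_gt0 // mulrC ge_min lexx orbT //.
Qed.

End adjoint.

(** * Unbounded sequences in O(2,n) *)

Section limit.
Context {R : realType} {n m : nat}.
Local Notation N := (2 + n)%N.
Local Notation J := (signature_mx 2 N : 'M[R]_N).
Local Notation so := (so_set J).
Local Notation O := (@Ogrp R n).
Local Notation "<< a , b >>" := (bf J a b) (a at level 10, b at level 10).
Variable S : 'M[R]_m.
Local Notation Q := (bf S).
Variable tau : {linear 'M[R]_N -> 'rV[R]_m}.
Local Notation t := (wtau tau).

Let JJ := @sigJJ R 2 N.
Let Jt := @sigT R 2 N.

(** An isotropic subspace meets the positive definite space of vectors with vanishing negative
    coordinates only in 0, so the two negative coordinates are injective on it. *)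
Lemma isotropic_rank k (A : 'M[R]_(k, N)) : A *m J *m A^T = 0 -> (\rank A <= 2)%N.
Proof.
move=> iA; pose P : 'M[R]_(N, 2) := \matrix_(i, j) (i == j :> nat)%:R.
rewrite -(mxrank_mul_ker A P) (_ : (A :&: kermx P)%MS = 0) ?mxrank0 ?addn0 ?rank_leq_col //.
apply/eqP; rewrite -submx0; apply/rV_subP => u; rewrite sub_capmx => /andP[/submxP[x uA] /sub_kermxP uP].
rewrite submx0; apply/negPn/negP => u0; have := pos_of_coord u0 uP.
by rewrite /bf uA trmx_mul -!mulmxA (mulmxA J) (mulmxA A) (mulmxA A) iA mul0mx mulmx0 mxE ltxx.
Qed.

Lemma cluster_zero (V : normedModType R) (g : 'M[R]_N -> V) (T : 'M[R]_N) :
  {for T, continuous g} -> (forall e, 0 < e -> exists2 M, `|T - M| < e & `|g M| <= e) -> g T = 0.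
Proof.
move=> cg H; apply: contrapT => /eqP g0.
have e0 : 0 < `|g T| / 2 by rewrite divr_gt0 // normr_gt0.
have /nbhs_ballP[r /= r0 Hr] := near_dist cg e0.
pose e := Num.min r (`|g T| / 2).
have e10 : 0 < e by rewrite lt_min r0.
have [M M1 M2] := H e e10.
have h1 : `|g T - g M| < `|g T| / 2.
  by apply: Hr; rewrite -ball_normE /=; apply: (lt_le_trans M1); rewrite ge_min lexx.
have h2 : `|g M| <= `|g T| / 2 by apply: (le_trans M2); rewrite ge_min lexx orbT.
have : `|g T| <= `|g T - g M| + `|g M| by rewrite -{1}(subrK (g M) (g T)) ler_normD.
by lra.
Qed.

Hypothesis unbounded : forall B : R, exists c, [/\ O c, B < `|c| &
  forall A A', so A -> so A' -> Q (tau (mconj c A)) (tau (mconj c A')) = Q (tau A) (tau A')].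

(** Dividing c^T J c = J by |c|^2 shows T^T J T = 0 in the limit, which bounds the rank. Moreover (a
    c^T) ^ f is the conjugate by c of a ^ (f J c J), so invariance of q shifts c from one factor of
    the bivector to the other. After division by |c|^2 both sides converge, and the right-hand limit
    vanishes for f J T = 0; hence C = J T and p = a T^T. *)
Lemma unbounded_limit : exists (C : 'M[R]_N) p, [/\ (\rank C <= 2)%N, p != 0, << p, p >> = 0,
  forall f, f *m C = 0 -> << f, p >> = 0 &
  forall f f', f *m C = 0 -> f' *m C = 0 -> Q (t p f) (t p f') = 0].
Proof.
pose inv c := forall A A', so A -> so A' -> Q (tau (mconj c A)) (tau (mconj c A')) = Q (tau A) (tau A').
have [T T1 HT] : exists2 T : 'M[R]_N, `|T| = 1 & forall e, 0 < e -> exists c,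
    [/\ O c, e^-1 < `|c|, inv c & `|T - `|c|^-1 *: c| < e].
  have /choice[c Hc] (k : nat) : exists c, [/\ O c, k%:R < `|c| & inv c] by exact: unbounded.
  pose M k := `|c k|^-1 *: c k.
  have c0 k : 0 < `|c k| by have [_ h _] := Hc k; apply: le_lt_trans h.
  have M1 k : `|M k| = 1.
    by rewrite /M normrZ ger0_norm ?invr_ge0 // mulVf // gt_eqF.
  have cS : compact [set X : 'M[R]_N | `|X| = 1].
    apply: (@compact_mx _ _ _ _ 1); last by move=> X /= ->.
    have -> : [set X : 'M[R]_N | `|X| = 1] = [set X | `|X| <= 1] `&` [set X | - `|X| <= -1].
      by apply/seteqP; split=> X /=; rewrite lerN2; [move=> ->|move=> [h1 h2]; apply/eqP; rewrite eq_le h1].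
    apply: closedI; apply: closed_le_fun => x; last apply: continuousN; exact: norm_continuous.
  have [|T [T1 clT]] := cS (M @ \oo) _.
    by exists 0%N => // k _; exact: M1.
  exists T => // e e0.
  have [k0 Hk0] : exists k0 : nat, e^-1 < k0%:R.
    by exists (Num.bound e^-1); apply: archi_boundP; rewrite invr_ge0 ltW.
  have [X [[k /= kk0 <-] Bk]] : [set M k | k in [set k | (k0 <= k)%N]] `&` ball T e !=set0.
    apply: clT; last exact: nbhsx_ballx.
    by exists k0 => // k /= kk; exists k.
  have [cO ck ci] := Hc k; exists (c k); split => //; last by move: Bk; rewrite -ball_normE.
  by apply: (lt_trans Hk0); apply: le_lt_trans ck; rewrite ler_nat.
have J1 : `|J| <= 1.
  apply: mx_norm_le => // i j; rewrite !mxE; case: (i == j); rewrite ?mulr0n ?normr0 //.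
  by case: ifP => _; rewrite mulr1n ?normrN normr1.
have small c e : 0 < e -> e^-1 < `|c : 'M[R]_N| -> `|c|^-1 * `|c|^-1 <= e * e.
  move=> e0 ec; have c0 : 0 < `|c| by apply: lt_trans ec; rewrite invr_gt0.
  have h : `|c|^-1 <= e by rewrite -[e]invrK lef_pV2 ?posrE ?invr_gt0 // ltW.
  by rewrite ler_pM // invr_ge0 ltW.
have tJ : T^T *m J *m T = 0.
  apply: (@cluster_zero _ (fun M : 'M[R]_N => M^T *m J *m M)).
    apply: mx_continuous_mul; last exact: id.
    by apply: mx_continuous_mul; [apply: continuous_trmx; exact: id|exact: cst_continuous].
  move=> e e0; pose e' := Num.min e 1.
  have e'0 : 0 < e' by rewrite lt_min e0 ltr01.
  have [c [cO ce _ Tc]] := HT _ e'0; exists (`|c|^-1 *: c).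
    by apply: (lt_le_trans Tc); rewrite ge_min lexx.
  rewrite [(_ *: c)^T]linearZ /= -!scalemxAl -scalemxAr scalerA cO normrZ ger0_norm ?mulr_ge0 ?invr_ge0 //.
  apply: (@le_trans _ _ (e' * e' * 1)); first by rewrite ler_pM ?mulr_ge0 ?invr_ge0 ?small.
  rewrite mulr1 (@le_trans _ _ (e' * 1)) ?ler_pM2l // ?ge_min ?lexx ?orbT //.
  by rewrite mulr1 ge_min lexx.
have [a p0] : exists a : 'rV[R]_N, a *m T^T != 0.
  apply: contrapT => Hn; have T0 : T = 0.
    apply: trmx_inj; apply/row_matrixP => i; rewrite rowE linear0 row0.
    by apply/eqP/negPn/negP => h; apply: Hn; exists (delta_mx 0 i).
  by move: T1; rewrite T0 normr0 => /eqP; rewrite eq_sym oner_eq0.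
exists (J *m T), (a *m T^T); split => //.
- apply: leq_trans (mxrankM_maxr _ _) _; rewrite -mxrank_tr.
  by apply: isotropic_rank; rewrite trmxK.
- by rewrite /bf trmx_mul trmxK -!mulmxA (mulmxA J) (mulmxA T^T) (mulmxA T^T) tJ mul0mx mulmx0 mxE.
- by move=> f fC; rewrite /bf trmx_mul trmxK !mulmxA -(mulmxA f) fC mul0mx mxE.
move=> f f' fC f'C.
pose G (M : 'M[R]_N) := Q (t (a *m M^T) f) (t (a *m M^T) f').
pose G2 (M : 'M[R]_N) := Q (t a (f *m J *m M *m J)) (t a (f' *m J *m M *m J)).
have ct (u : 'M[R]_N -> 'rV[R]_N) (v : 'M[R]_N -> 'rV[R]_N) x : {for x, continuous u} -> {for x, continuous v} ->
    {for x, continuous (fun M => t (u M) (v M))}.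
  move=> cu cv; apply: (@continuous_linmx R _ _ _ _ _ (fun A => tau A)) => [k A B|]; first exact: linearP.
  apply: mx_continuous_mul; last exact: cst_continuous.
  have h1 := mx_continuous_mul (continuous_trmx cu) cv.
  have h2 := mx_continuous_mul (continuous_trmx cv) cu.
  exact: (continuousB h1 h2).
have cQ (u v : 'M[R]_N -> 'rV[R]_m) x : {for x, continuous u} -> {for x, continuous v} ->
    {for x, continuous (fun M => Q (u M) (v M))}.
  move=> cu cv; apply: continuous_mx_coord.
  have h1 := mx_continuous_mul cu (@cst_continuous _ _ S x).
  exact: (mx_continuous_mul h1 (continuous_trmx cv)).
have ctr : {for T, continuous (fun M : 'M[R]_N => a *m M^T)}.
  by apply: mx_continuous_mul; [exact: cst_continuous|apply: continuous_trmx; exact: id].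
have cst1 (V : normedModType R) (x : V) : {for T, continuous (fun _ : 'M[R]_N => x)} by exact: cst_continuous.
have cf (h : 'rV[R]_N) : {for T, continuous (fun M : 'M[R]_N => h *m J *m M *m J)}.
  apply: mx_continuous_mul; last exact: cst1.
  by apply: mx_continuous_mul; [exact: cst1|exact: id].
have : G T - G2 T = 0.
  apply: (@cluster_zero _ (fun M => G M - G2 M : R^o)).
    have k1 h := ct _ _ _ ctr (cst1 _ h).
    have k2 h := ct _ _ _ (cst1 _ a) (cf h).
    have k3 := cQ _ _ _ (k1 f) (k1 f').
    have k4 := cQ _ _ _ (k2 f) (k2 f').
    exact: (@continuousB R R^o _ G G2 T k3 k4).
  move=> e e0; have [c [cO ce ci Tc]] := HT _ e0; exists (`|c|^-1 *: c) => //.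
  have [h1 h2 h3] := OP cO.
  have c1 : (J *m c *m J) *m c^T = 1%:M by rewrite -!mulmxA (mulmxA c) h3 JJ.
  have E h : `|c|^-1 *: wdg J (a *m c^T) h = `|c|^-1 *: mconj c (wdg J a (h *m (J *m c *m J))).
    by rewrite /mconj (conj_wdg JJ) -(mulmxA h) c1 mulmx1.
  have E1 h : t (a *m (`|c|^-1 *: c)^T) h = `|c|^-1 *: tau (mconj c (wdg J a (h *m (J *m c *m J)))).
    by rewrite /wtau [(_ *: c)^T]linearZ /= -scalemxAr wdgZl E linearZ.
  have E2 h : t a (h *m J *m (`|c|^-1 *: c) *m J) = `|c|^-1 *: tau (wdg J a (h *m (J *m c *m J))).
    by rewrite /wtau -scalemxAr -scalemxAl wdgZr linearZ /= !mulmxA.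
  rewrite /G /G2 !E1 !E2 !bfZl !bfZr ci ?subrr ?normr0 ?ltW //; exact: wdg_so.
move/eqP; rewrite subr_eq0 => /eqP; rewrite /G /G2 => ->.
rewrite -(mulmxA f) fC mul0mx /wtau -[X in wdg _ a X](scale0r 0) wdgZr scale0r linear0 bf0l //.
Qed.

End limit.

(** * One-parameter subgroups *)

(** gamma(t) is b(t / 2^k)^(2^k) for any k bringing t / 2^k into the interval. The choice of k is
    immaterial since b at a point is the square of b at its half, and additivity is checked at a
    common k, where the two factors commute. *)
Lemma globalize (R : realType) (G : groupType) (b : R -> G) (e : R) : 0 < e ->
  (forall s t, `|s| < e -> `|t| < e -> `|s + t| < e -> b (s + t) = (b s * b t)%g) ->
  exists2 gamma : R -> G, (forall s t, gamma (s + t) = (gamma s * gamma t)%g) &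
    forall t, `|t| < e -> gamma t = b t.
Proof.
move=> e0 bM; pose sm k (t : R) := t / 2 ^+ k.
have p2 k : 0 < (2 ^+ k : R) by rewrite exprn_gt0.
have smD j k t : sm j (sm k t) = sm (k + j)%N t.
  by rewrite /sm exprD invfM mulrA.
have sm_small k t : `|t| < e -> `|sm k t| < e.
  move=> te; apply: le_lt_trans te; rewrite /sm normrM normfV (ger0_norm (ltW (p2 k))).
  by rewrite ler_pdivrMr // ler_peMr // exprn_ege1 // ler1n.
have half t : `|t| < e -> b t = (b (sm 1%N t) ^+ 2)%g.
  move=> te; have h := sm_small 1%N t te.
  have E : sm 1%N t + sm 1%N t = t by rewrite /sm expr1; field.
  by rewrite -{1}E bM ?E // expgS expg1.
have step j t : `|t| < e -> b t = (b (sm j t) ^+ (2 ^ j))%g.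
  move=> te; elim: j => [|j IH]; first by rewrite /sm expr0 divr1 expn0 expg1.
  by rewrite IH (half _ (sm_small j t te)) smD addn1 -expgnA expnS.
have /choice[k Hk] t : exists k, `|sm k t| < e.
  exists (Num.bound (`|t| / e)); set k := Num.bound _.
  have h : `|t| / e < k%:R by apply: archi_boundP; rewrite divr_ge0 // ltW.
  rewrite /sm normrM normfV (ger0_norm (ltW (p2 k))) ltr_pdivrMr // mulrC -ltr_pdivrMr //.
  by apply: lt_trans h _; rewrite -natrX ltr_nat ltn_expl.
pose gamma t := (b (sm (k t) t) ^+ (2 ^ k t))%g.
have gE j t : `|sm j t| < e -> gamma t = (b (sm j t) ^+ (2 ^ j))%g.
  move=> jt; rewrite /gamma (step j _ (Hk t)) (step (k t) _ jt) !smD -!expgnA (addnC j).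
  by rewrite (mulnC (2 ^ j)%N).
exists gamma => [s t|t te]; last by rewrite (gE 0%N) /sm expr0 divr1.
pose K := (k s + k t + k (s + t)%R)%N.
have big i t' : (k t' <= i)%N -> `|sm i t'| < e.
  by move=> /subnKC <-; rewrite -smD; apply: sm_small.
have hs : `|sm K s| < e by apply: big; rewrite /K -addnA leq_addr.
have ht : `|sm K t| < e by apply: big; rewrite /K addnAC leq_addl.
have hst : `|sm K (s + t)| < e by apply: big; rewrite /K leq_addl.
have E : sm K (s + t) = sm K s + sm K t by rewrite /sm mulrDl.
rewrite (gE K s) // (gE K t) // (gE K (s + t)) // E bM -?E //.
by apply: expgMn; rewrite /commute -(bM (sm K s)) -?E // -(bM (sm K t)) ?(addrC (sm K t)) -?E.
Qed.

Section derive_shift.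
Context {R : realType} {V : normedModType R}.

Lemma near_shift0 (P : R -> Prop) t : (\forall s \near t, P s) -> \forall h \near (0 : R), P (h + t).
Proof.
move=> H; have c : {for (0 : R), continuous (fun h : R => h + t)}.
  by apply: continuousD; [exact: id|exact: cst_continuous].
by apply: c; rewrite add0r.
Qed.

Lemma is_derive_near (f g : R -> V) D t : (\forall s \near t, f s = g s) ->
  is_derive (t : R^o) 1 (f : R^o -> V) D -> is_derive (t : R^o) 1 (g : R^o -> V) D.
Proof.
move=> fg df; apply: first_order_is_derive => e e0.
apply: filterS2 (near_shift0 fg) (is_derive_first_order df e0) => h <-.
by rewrite (nbhs_singleton fg).
Qed.

Lemma is_derive_translate (g : R -> V) D t : is_derive (0 : R^o) 1 (fun h : R^o => g (h + t)) D ->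
  is_derive (t : R^o) 1 (g : R^o -> V) D.
Proof.
move=> dg; apply: first_order_is_derive => e e0.
by apply: filterS (is_derive_first_order dg e0) => h; rewrite addr0 add0r.
Qed.

End derive_shift.

Section one_parameter.
Context {R : realType} {d : nat} {G : lieGroupType R d}.
Variable c0 : chart R d G.
Hypotheses (ac0 : atlas c0) (c01 : cdom c0 (1%g : G)).
Local Notation u0 := (cmap c0 (1%g : G)).
Local Notation e_ i := (delta_mx 0 i : 'rV[R]_d).

Let u0c : cimg c0 u0. Proof. exact: cmap_img. Qed.
Let cu0 : cinv c0 u0 = (1%g : G). Proof. exact: cmapK. Qed.
Let oc : open (cimg c0). Proof. exact: cimg_open. Qed.

Variables (v : 'rV[R]_d) (gamma : R -> G).
Hypothesis gM : forall s t, gamma (s + t) = (gamma s * gamma t)%g.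
Hypothesis cg0 : {for (0 : R), continuous gamma}.
Hypothesis gc0 : \forall t \near (0 : R), cdom c0 (gamma t).
Hypothesis dg0 : is_derive (0 : R^o) 1 (fun t : R^o => cmap c0 (gamma t)) v.

Let g0 : gamma 0 = 1%g.
Proof.
have := gM 0 0; rewrite addr0 => E.
by apply: (mulgI (gamma 0)); rewrite mulg1 -E.
Qed.

Let cg : continuous gamma.
Proof.
move=> t.
have c1 : {for t, continuous (fun s : R => gamma (s - t))}.
  apply: (@continuous_comp _ _ _ (fun s : R => s - t) gamma); last by rewrite subrr.
  by apply: continuousB; [exact: id|exact: cst_continuous].
have := mulg_continuous (@cst_continuous _ _ (gamma t) t) c1.
rewrite (_ : (fun s => _) = gamma) //.
by apply/funext => s; rewrite -gM addrC subrK.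
Qed.

(* A function of [gamma] is differentiated at [t] through the chart [c0] after translation by
   [gamma t]. *)
Lemma is_derive_one_parameter (F : G -> R) t :
  (exists2 U : set 'rV[R]_d, open U /\ U u0 & Ck_on 1 U (fun y => F (gamma t * cinv c0 y)%g)) ->
  is_derive (t : R^o) 1 (F \o gamma : R^o -> R^o) ('D_v (fun y => F (gamma t * cinv c0 y)%g) u0).
Proof.
move=> [U [oU Uu] cK]; apply: is_derive_translate.
pose u t := cmap c0 (gamma t).
have uE : u 0 = u0 by rewrite /u g0.
have H : is_derive (0 : R^o) 1 ((fun y => F (gamma t * cinv c0 y)%g) \o u : R^o -> R^o)
    ('D_v (fun y => F (gamma t * cinv c0 y)%g) u0).
  by rewrite -uE; apply: (is_derive_curve oU) => //; rewrite uE.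
apply: is_derive_near H; apply: filterS gc0 => h ch.
by rewrite /= /u cmapK // addrC gM.
Qed.

(** In a chart gamma solves x' = Xi(x), where the smooth [Xi] is the left-invariant field. If gamma
    is C^k then so is the right-hand side, so gamma is C^(k+1). *)
Lemma one_parameter_Lop : one_parameter_subgroup (Lop c0 v) gamma.
Proof.
split => //; last first.
  move=> f sf t; rewrite (Lop_smooth _ _ sf) lderE.
  apply: is_derive_one_parameter; exists (cimg c0) => //.
  exact: (smooth_mulL (gamma t) sf ac0 1%N).
split=> // c ac.
pose I := gamma @^-1` cdom c.
have oI : open (I : set R^o) by apply: open_comp; [move=> s _; exact: cg|exact: cdom_open].
pose F (w : 'rV[R]_(d + d)) := (cinv c (lsubmx w) * cinv c0 (rsubmx w))%g.
pose W := pair_dom c c0 `&` F @^-1` cdom c.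
have oP := pair_dom_open (c := c) (c' := c0).
have sF : smooth_into (pair_dom c c0) F.
  by apply: smooth_into_mul; [|exact: pair_into_l|exact: pair_into_r].
have oW : open W by apply: (smooth_into_open oP _ sF); exact: cdom_open.
have sK i : smooth_on W (fun w => cmap c (F w) 0 i : R).
  by have [_ /(_ c ac)] := sF; move/(smooth_on_mxP _ oW); apply.
pose Xi i (u : 'rV[R]_d) : R := 'D_v (fun y => cmap c (F (row_mx u y)) 0 i : R) u0.
have WE : (fun u : 'rV[R]_d => row_mx u u0) @^-1` W = cimg c.
  apply/seteqP; split=> u /=; first by rewrite /W /pair_dom /= row_mxKl => -[[]].
  move=> cu; split; first by split; rewrite ?row_mxKl ?row_mxKr.
  by rewrite /= /F row_mxKl row_mxKr cu0 mulg1; exact: cinv_dom.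
have sXi i : smooth_on (cimg c) (Xi i).
  by have := smooth_partial u0 v oW (sK i); rewrite WE.
have dx i t : I t -> is_derive (t : R^o) 1 (fun s : R^o => cmap c (gamma s) 0 i : R^o) (Xi i (cmap c (gamma t))).
  move=> It.
  have := @is_derive_one_parameter (fun a => cmap c a 0 i) t; rewrite /comp => H.
  have E : (fun y => cmap c (gamma t * cinv c0 y)%g 0 i) = (fun y => cmap c (F (row_mx (cmap c (gamma t)) y)) 0 i).
    by apply/funext => y; rewrite /F row_mxKl row_mxKr cmapK.
  rewrite /Xi -E; apply: H; rewrite E.
  exists ((fun y : 'rV[R]_d => row_mx (cmap c (gamma t)) y) @^-1` W).
    split; last by have : cimg c (cmap c (gamma t)) by [exact: cmap_img]; rewrite -WE.
    by apply: open_comp => // y _; exact: row_mx_contr.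
  apply: (@smooth_on_affine R _ _ _ (fun y : 'rV[R]_d => row_mx (cmap c (gamma t)) y) (fun y => row_mx 0 y) W
     (fun w => cmap c (F w) 0 i : R) _ _ (sK i) 1%N).
    exact: row_mx_linr.
  exact: row_mx_contr.
have dX t : I t -> is_derive (t : R^o) 1 (cmap c \o gamma : R^o -> _) (\row_i Xi i (cmap c (gamma t))).
  by move=> It; apply/is_derive_mxP => i j; rewrite !ord1 mxE; exact: dx.
elim=> [|k IH].
  by move=> t It; apply: continuous_comp; [exact: cg|exact: cmap_cont].
split.
- exact: Ck_on_cont IH.
- by move=> t w It; have [] := is_derive_scaled (dX t It) w.
- move=> w; apply: (@Ck_on_eq _ _ _ _ _ (fun t => w *: \row_i Xi i (cmap c (gamma t)))) => //.
    by move=> t It; have [_ ->] := is_derive_scaled (dX t It) w.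
  apply/Ck_on_mxP => // i j; rewrite ord1.
  apply: (@Ck_on_eq _ _ _ _ _ (w \*: (Xi j \o (cmap c \o gamma)))) => //.
    by move=> t It; rewrite /= !mxE.
  apply: Ck_onZ => //; apply: (Ck_on_comp oI (@cimg_open _ _ _ c)) => //; last exact: sXi.
  by move=> t It; exact: cmap_img.
Qed.

End one_parameter.

(** * Isometric actions *)

Section smooth_misc.
Context {R : realType}.

Lemma rV_differentiable d k (U : set 'rV[R]_d) (F : 'rV[R]_d -> 'rV[R]_k) u : open U -> U u ->
  smooth_on U F -> differentiable F u.
Proof.
move=> oU Uu sF.
have sc i : smooth_on U (fun y => F y 0 i : R) by have /(smooth_on_mxP _ oU) := sF; apply.
have -> : F = \sum_(j < k) (fun y => F y 0 j *: (delta_mx 0 j : 'rV[R]_k)).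
  by apply/funext => y; rewrite fct_sumE -row_sum_delta.
apply: differentiable_sum => j; apply: differentiableZl.
by have [] := C1_is_diff oU Uu (sc j 1%N).
Qed.

Lemma mulmx_jacobian d k (U : set 'rV[R]_d) (F : 'rV[R]_d -> 'rV[R]_k) u v : open U -> U u ->
  smooth_on U F -> v *m jacobian F u = 'D_v F u.
Proof.
move=> oU Uu sF; have dF := rV_differentiable oU Uu sF.
by rewrite /jacobian mul_rV_lin1 deriveE.
Qed.

(** Otherwise a bump function at [x] with support avoiding [y] would take different values at the
    two points. *)
Lemma smooth_separates d (M : manifoldType R d) (x y : M) :
  (forall f, smooth_fun f -> f x = f y) -> x = y.
Proof.
move=> H; have [c ac cx] := atlas_cover x.
apply: contrapT => xy.
have [r r0 Br] := ball_in_cimg (cmap_img cx).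
have [rho [rho0 rr yr]] : exists rho, [/\ 0 < rho, rho < r & cdom c y -> rho < `|cmap c y - cmap c x|].
  have [cy|cy] := pselect (cdom c y); last first.
    by exists (r / 2); split => //; [rewrite divr_gt0|rewrite ltr_pdivrMr // ltr_pMr // ltr1n].
  have n0 : 0 < `|cmap c y - cmap c x|.
    rewrite normr_gt0 subr_eq0; apply/eqP => E; apply: xy.
    by rewrite -(cmapK cx) -(cmapK cy) E.
  exists (Num.min r `|cmap c y - cmap c x| / 2).
  have m0 : 0 < Num.min r `|cmap c y - cmap c x| by rewrite lt_min r0.
  split; first by rewrite divr_gt0.
    rewrite ltr_pdivrMr //; have : Num.min r `|cmap c y - cmap c x| <= r by rewrite ge_min lexx.
    by move=> h; apply: (le_lt_trans h); rewrite ltr_pMr // ltr1n.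
  move=> _; rewrite ltr_pdivrMr //.
  have : Num.min r `|cmap c y - cmap c x| <= `|cmap c y - cmap c x| by rewrite ge_min lexx orbT.
  by move=> h; apply: (le_lt_trans h); rewrite ltr_pMr // ltr1n.
have s1 : smooth_on (ball (cmap c x) r) (fun _ : 'rV[R]_d => 1 : R) by exact: smooth_on_cst.
have := H _ (extend_smooth rho0 rr Br ac s1).
rewrite /extend asboolT // mul1r => E.
have := bump_center (cmap c x) rho0; rewrite E.
have [cy|cy] := pselect (cdom c y); last by rewrite asboolF // ltxx.
by rewrite asboolT // bump_out ?mulr0 ?ltxx // ?(ltW rho0) //; exact: yr.
Qed.

End smooth_misc.

Section lorentz_forms.
Context {R : realType} {k : nat}.

(** Subtracting from [u] the multiple of [s] with the same first coordinate leaves an isotropic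
    vector in the positive definite subspace, hence 0. *)
Lemma sig1_iso1 (s u : 'rV[R]_k) : let Q := bf (signature_mx 1 k) in
  s != 0 -> Q s s = 0 -> Q s u = 0 -> Q u u = 0 -> exists c, u = c *: s.
Proof.
move=> Q; rewrite /Q; case: k s u @Q => [|l] s u Q s0 ss su uu.
  by move: s0; rewrite (_ : s = 0) ?eqxx //; apply/rowP => -[].
have zero (w : 'rV[R]_l.+1) : w 0 0 = 0 -> bf (signature_mx 1 l.+1) w w = 0 -> w = 0.
  move=> w0; rewrite bf_sig big_ord_recl w0 !mulr0 add0r => H.
  have H2 : \sum_(i < l) w 0 (lift ord0 i) ^+ 2 = 0.
    by rewrite -[RHS]H; apply: eq_bigr => i _; rewrite /= mul1r expr2.
  apply/rowP => i; rewrite mxE; case: (unliftP ord0 i) => [j ->|->//].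
  have /psumr_eq0P : forall i, true -> 0 <= w 0 (lift ord0 i) ^+ 2 by move=> i' _; exact: sqr_ge0.
  move=> /(_ H2 j isT) /eqP; rewrite sqrf_eq0 => /eqP.
  by [].
have [sz|sz] := eqVneq (s 0 0) 0; first by move: s0; rewrite (zero s sz ss) eqxx.
exists (u 0 0 / s 0 0); apply/eqP; rewrite -subr_eq0; apply/eqP; apply: zero.
  by rewrite !mxE divfK // subrr.
have C := bfC u s (@sigT R 1 l.+1).
by rewrite !bfE ss C su uu !(mulr0, subr0, oppr0, addr0).
Qed.

Lemma lorentz_iso1 (S : 'M[R]_k) : lorentz_form S -> forall s u : 'rV[R]_k, s != 0 ->
  bf S s s = 0 -> bf S s u = 0 -> bf S u u = 0 -> exists c, u = c *: s.
Proof.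
move=> [_ [P Pu PE]] s u s0.
have E a b : bf S a b = bf (signature_mx 1 k) (a *m invmx P) (b *m invmx P).
  by rewrite /bf -PE trmx_mul !mulmxA mulmxKV // -(mulmxA _ P^T) -trmx_mul mulVmx // trmx1 mulmx1.
rewrite !E => ss su uu; have [|c /(congr1 (mulmx^~ P))] := @sig1_iso1 (s *m invmx P) (u *m invmx P) _ ss su uu.
  by apply: contraNneq s0 => /(congr1 (mulmx^~ P)); rewrite mulmxKV // mul0mx => ->.
by rewrite /= -scalemxAl !mulmxKV // => ->; exists c.
Qed.

End lorentz_forms.

Section action.
Context {R : realType} {d m : nat} {G : lieGroupType R d} {M : manifoldType R m}.
Variable act : G -> M -> M.
Hypothesis act_smooth : smooth_action act.
Variable c0 : chart R d G.
Hypotheses (ac0 : atlas c0) (c01 : cdom c0 (1%g : G)).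
Local Notation der := (der_at c0 (1%g : G)).
Local Notation lder := (lder c0).
Variable psi : 'I_d -> G -> R.
Hypothesis spsi : forall i, smooth_fun (psi i).
Hypothesis dpsi : forall v i, der_at c0 1%g v (psi i) = v 0 i.
Hypothesis psiE : forall D f, point_derivation (1%g : G) D -> smooth_fun f ->
  D f = der_at c0 1%g (\row_i D (psi i)) f.
Local Notation lbr := (lbr c0 psi).
Local Notation Ad := (Ad c0 psi).
Implicit Types (a b : G) (v w : 'rV[R]_d) (x y : M) (f : M -> R).

Lemma act1 y : act 1%g y = y. Proof. by have [] := act_smooth. Qed.
Lemma actM a b y : act (a * b)%g y = act a (act b y). Proof. by have [] := act_smooth. Qed.

Lemma act_smooth_into (V : normedModType R) (U : set V) (p : V -> G) (q : V -> M) : open U ->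
  smooth_into U p -> smooth_into U q -> smooth_into U (fun z => act (p z) (q z)).
Proof. by move=> oU; apply: smooth_into_map2 => //; have [] := act_smooth. Qed.

Lemma orbit_fun_smooth f y : smooth_fun f -> smooth_fun (fun a => f (act a y)).
Proof.
move=> sf c ac; have oU := @cimg_open _ _ _ c.
apply: (smooth_into_fun oU _ sf).
by apply: act_smooth_into => //; [exact: smooth_into_cinv|exact: smooth_into_cst].
Qed.

Lemma act_fun_smooth f a : smooth_fun f -> smooth_fun (fun y => f (act a y)).
Proof.
move=> sf c ac; have oU := @cimg_open _ _ _ c.
apply: (smooth_into_fun oU _ sf).
by apply: act_smooth_into => //; [exact: smooth_into_cst|exact: smooth_into_cinv].
Qed.

Definition fund v f y : R := der v (fun a => f (act a y)).

Lemma fund_lder v f y a : lder v (fun b => f (act b y)) a = fund v (fun z => f (act a z)) y.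
Proof. by apply: der_ext => b; rewrite actM. Qed.

Lemma fund_lder1 v f y : lder v (fun b => f (act b y)) 1%g = fund v f y.
Proof. by rewrite lder1. Qed.

Lemma fund_point_derivation v y : point_derivation y (fun f => fund v f y).
Proof.
split=> [k f h sf sh|f h sf sh].
  by apply: (der_atD ac0 c01); exact: orbit_fun_smooth.
rewrite /fund (der_atM ac0 c01) ?act1 //; exact: orbit_fun_smooth.
Qed.

Lemma fund_lin k v w f y : smooth_fun f -> fund (k *: v + w) f y = k * fund v f y + fund w f y.
Proof.
by move=> sf; rewrite -!fund_lder1; apply: lder_lin => //; exact: orbit_fun_smooth.
Qed.

Lemma fund_Ad a v f y : smooth_fun f -> fund (Ad a v) f (act a y) = fund v (fun z => f (act a z)) y.
Proof.
move=> sf; rewrite /fund (AdE ac0 c01 psiE); last exact: orbit_fun_smooth.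
by apply: der_ext => b; rewrite -!actM mulgVK.
Qed.

Lemma stabilizer_closed x : closed (stabilizer act x).
Proof.
have -> : stabilizer act x = (fun a => act a x) @^-1` [set x] by [].
apply: closed_comp => [a _|]; last first.
  by apply: accessible_closed_set1; apply: hausdorff_accessible; exact: manifold_hausdorff.
have [_ _ [ca _]] := act_smooth.
apply: (@continuous_pair_comp G G M M id (fun=> x) (fun z => act z.1 z.2)); [exact: id|exact: cst_continuous|exact: ca].
Qed.

Variables (c : chart R m M) (x : M) (phi : 'I_m -> M -> R).
Hypotheses (ac : atlas c) (cx : cdom c x).
Hypothesis sphi : forall i, smooth_fun (phi i).
Hypothesis dphi : forall (v : 'rV[R]_m) i, der_at c x v (phi i) = v 0 i.
Hypothesis phiE : forall D f, point_derivation x D -> smooth_fun f ->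
  D f = der_at c x (\row_i D (phi i)) f.

Definition ftan v : 'rV[R]_m := \row_i fund v (phi i) x.

Lemma ftanE v f : smooth_fun f -> fund v f x = der_at c x (ftan v) f.
Proof. by move=> sf; apply: (phiE (D := fun f => fund v f x)) => //; exact: fund_point_derivation. Qed.

Lemma ftan_is_linear : linear ftan.
Proof. by move=> k v w; apply/rowP => i; rewrite !mxE fund_lin. Qed.

Lemma ftan_fund0 v f : ftan v = 0 -> smooth_fun f -> fund v f x = 0.
Proof. by move=> E sf; rewrite ftanE // E /der_at derive0. Qed.

(** If [ftan u = 0], then [lder u] of the function b |-> f(b x) vanishes at every b and not only at
    1, because f may be replaced by its composite with [act b]. Both iterated derivatives in the
    commutator therefore vanish. *)
Lemma ftan_sub v w : ftan v = 0 -> ftan w = 0 -> ftan (lbr v w) = 0.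
Proof.
move=> v0 w0; apply/rowP => i; rewrite !mxE -fund_lder1.
have so := orbit_fun_smooth x (sphi i).
rewrite (lbrE ac0 c01 psiE v w 1%g so).
have z u : ftan u = 0 -> lder u (fun b => phi i (act b x)) = fun=> 0.
  by move=> u0; apply/funext => b; rewrite fund_lder ftan_fund0 //; exact: act_fun_smooth.
rewrite (z v v0) (z w w0) !lder1.
have z0 u : der u (fun=> 0) = 0 by exact: derive_cst.
by rewrite !z0 subrr.
Qed.

(** By the same replacement of f, the derivative of t |-> f(gamma(t) x) is zero at all times; smooth
    functions separate points. *)
Lemma ftan_stab v gamma : ftan v = 0 -> one_parameter_subgroup (Lop c0 v) gamma ->
  forall t, stabilizer act x (gamma t).
Proof.
move=> v0 [_ gM dg] t; apply: smooth_separates => f sf.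
have so := orbit_fun_smooth x sf.
have dz (s : R) : is_derive (s : R^o) 1 ((fun a => f (act a x)) \o gamma : R^o -> R^o) 0.
  have := dg _ so s; rewrite Lop_smooth // fund_lder ftan_fund0 //; exact: act_fun_smooth.
have /= := @is_derive_0_is_cst R _ t 0 dz.
have -> : gamma 0 = 1%g.
  by have := gM 0 0; rewrite addr0 => /(congr1 (fun z => (gamma 0)^-1 * z)%g); rewrite mulKg mulVg.
by rewrite act1.
Qed.

Lemma stab_ftan v gamma : one_parameter_subgroup (Lop c0 v) gamma ->
  (forall t, stabilizer act x (gamma t)) -> ftan v = 0.
Proof.
move=> [_ gM dg] H; apply/rowP => i; rewrite !mxE -fund_lder1.
have so := orbit_fun_smooth x (sphi i).
have g0 : gamma 0 = 1%g.
  by have := gM 0 0; rewrite addr0 => /(congr1 (fun z => (gamma 0)^-1 * z)%g); rewrite mulKg mulVg.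
have := dg _ so 0; rewrite Lop_smooth // g0.
have -> : (fun a => phi i (act a x)) \o gamma = cst (phi i x).
  by apply/funext => t /=; rewrite (H t).
by move=> [_ <-]; exact: derive_cst.
Qed.

Variable g : gram_field (M := M).
Hypothesis act_isometric : forall a : G, preserves_gram g (act a).
Local Notation S := (g c (cmap c x)).
Local Notation Q := (bf S).

Definition loc a : 'rV[R]_m -> 'rV[R]_m := cmap c \o act a \o cinv c.

Lemma loc_smooth a : smooth_on (cimg c `&` (fun u => act a (cinv c u)) @^-1` cdom c) (loc a).
Proof.
have [_ H] : smooth_into (cimg c) (fun u => act a (cinv c u)).
  apply: act_smooth_into; [exact: cimg_open|exact: smooth_into_cst|exact: smooth_into_cinv].
exact: (H c ac).
Qed.

Lemma loc_open a : open (cimg c `&` (fun u => act a (cinv c u)) @^-1` cdom c).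
Proof.
have H : smooth_into (cimg c) (fun u => act a (cinv c u)).
  apply: act_smooth_into; [exact: cimg_open|exact: smooth_into_cst|exact: smooth_into_cinv].
exact: (smooth_into_open (@cimg_open _ _ _ c) (@cdom_open _ _ _ c) H).
Qed.

Lemma act_der a (v : 'rV[R]_m) f y : cdom c y -> cdom c (act a y) -> smooth_fun f ->
  der_at c y v (fun z => f (act a z)) = der_at c (act a y) (v *m jacobian (loc a) (cmap c y)) f.
Proof.
move=> cy cay sf.
have cyi : cimg c (cmap c y) by exact: cmap_img.
have H : smooth_into (cimg c) (fun u => act a (cinv c u)).
  apply: act_smooth_into; [exact: cimg_open|exact: smooth_into_cst|exact: smooth_into_cinv].
have cz : cdom c (act a (cinv c (cmap c y))) by rewrite cmapK.
have := der_chain v (@cimg_open _ _ _ c) cyi H ac cz sf.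
rewrite cmapK // (mulmx_jacobian v (@loc_open a) _ (@loc_smooth a)); last by split.
move=> <-.
by [].
Qed.

Lemma ftan_Ad a v : stabilizer act x a -> ftan (Ad a v) = ftan v *m jacobian (loc a) (cmap c x).
Proof.
move=> ax; apply/rowP => i; rewrite -[RHS]dphi [LHS]mxE -{1}ax fund_Ad //.
rewrite ftanE; last exact: act_fun_smooth.
by rewrite act_der ?ax.
Qed.

Lemma ftan_isometric a v w : stabilizer act x a ->
  Q (ftan (Ad a v)) (ftan (Ad a w)) = Q (ftan v) (ftan w).
Proof.
move=> ax; rewrite !ftan_Ad // /bf trmx_mul !mulmxA.
have := @act_isometric a _ _ ac ac _ (cmap_img cx); rewrite /= cmapK // ax => /(_ cx).
have -> : cmap c \o act a \o cinv c = loc a by [].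
by move=> E; rewrite -{2}E !mulmxA.
Qed.

Lemma Ad_one_parameter v w gamma : one_parameter_subgroup (Lop c0 v) gamma ->
  is_derive (0 : R^o) 1 (fun t : R^o => Ad (gamma t) w) (lbr v w).
Proof.
move=> [_ gM dg].
have g0 : gamma 0 = 1%g.
  by have := gM 0 0; rewrite addr0 => /(congr1 (fun z => (gamma 0)^-1 * z)%g); rewrite mulKg mulVg.
apply/is_derive_mxP => i j; rewrite ord1.
have sA : smooth_fun (fun a => Ad a w 0 j) by move=> c' ac'; exact: (Ad_smooth ac0 c01 spsi w j ac').
have := dg _ sA 0; rewrite Lop_smooth // g0 lder1 /der_at.
by rewrite (Ad_derive ac0 c01 spsi dpsi psiE).
Qed.

(** gamma stays in the stabilizer, so the product of the tangent vectors of Ad(gamma(t)) w and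
    Ad(gamma(t)) w' is constant in t; the identity is its derivative at 0. *)
Lemma ftan_inv v w w' gamma : one_parameter_subgroup (Lop c0 v) gamma -> ftan v = 0 ->
  Q (ftan (lbr v w)) (ftan w') + Q (ftan w) (ftan (lbr v w')) = 0.
Proof.
move=> og v0.
have H := ftan_stab v0 og.
pose F (t : R) : 'M[R]_1 := ftan (Ad (gamma t) w) *m S *m (ftan (Ad (gamma t) w'))^T.
have FE t : F t = ftan w *m S *m (ftan w')^T.
  apply/matrixP => i j; rewrite !ord1; exact: ftan_isometric.
have d1 u := is_derive_linmx ftan_is_linear (Ad_one_parameter u og).
have dF := is_derive_mulmx (is_derive_mulmxr S (d1 w)) (is_derive_trmx (d1 w')).
have z : is_derive (0 : R^o) 1 (F : R^o -> _) 0.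
  by rewrite (_ : F = cst (ftan w *m S *m (ftan w')^T)); [exact: is_derive_cst|apply/funext].
have g0 : gamma 0 = 1%g.
  have [_ gM _] := og.
  by have := gM 0 0; rewrite addr0 => /(congr1 (fun z => (gamma 0)^-1 * z)%g); rewrite mulKg mulVg.
have := is_derive_unique dF z; rewrite g0 !(Ad1 ac0 c01 spsi dpsi psiE) => /matrixP /(_ 0 0).
by rewrite [LHS]mxE [RHS]mxE => E; exact: E.
Qed.

End action.

(** * Stabilizers of isometric actions *)

Lemma ex_linear (R : pzRingType) (V W : lmodType R) (f : V -> W) : linear f ->
  exists L : {linear V -> W}, forall x, L x = f x.
Proof.
move=> lf; pose mx := GRing.isLinear.Build R V W *:%R f lf.
pose L : {linear V -> W} := HB.pack f mx.
by exists L.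
Qed.

Section dichotomy.
Context {R : realType} {n d m : nat} {G : lieGroupType R d} {M : manifoldType R m}.
Hypothesis n6 : (6 <= n)%N.
Hypothesis G_connected : connected [set: G].
Hypothesis G_finite_center : finite_set (center_set (G := G)).
Local Notation N := (2 + n)%N.
Local Notation J := (signature_mx 2 N : 'M[R]_N).
Local Notation so := (so_set J).
Variable c0 : chart R d G.
Hypotheses (ac0 : atlas c0) (c01 : cdom c0 (1%g : G)).
Variable psi : 'I_d -> G -> R.
Hypothesis spsi : forall i, smooth_fun (psi i).
Hypothesis dpsi : forall v i, der_at c0 1%g v (psi i) = v 0 i.
Hypothesis psiE : forall D f, point_derivation (1%g : G) D -> smooth_fun f ->
  D f = der_at c0 1%g (\row_i D (psi i)) f.
Local Notation lbr := (lbr c0 psi).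
Local Notation Ad := (Ad c0 psi).
Variable om : {linear 'rV[R]_d -> 'M[R]_N}.
Variable omi : {linear 'M[R]_N -> 'rV[R]_d}.
Hypothesis omK : cancel om omi.
Hypothesis om_so : forall v, so (om v).
Hypothesis omiK : forall A, so A -> om (omi A) = A.
Hypothesis om_lbr : forall v w, om (lbr v w) = mx_bracket (om v) (om w).
Hypothesis so_lie_o : forall A, so A -> @lie_o R 2 n A.

Let n0 : (0 < n)%N. Proof. exact: leq_trans n6. Qed.

Lemma ex_one_parameter v : exists gamma : R -> G, one_parameter_subgroup (Lop c0 v) gamma.
Proof.
have [b [e [e0 b0 bM cb [cc db]]]] := one_parameter_lift n0 G_connected G_finite_center
  ac0 c01 spsi dpsi psiE omK om_so omiK om_lbr so_lie_o v.
have [gamma gM gb] := globalize e0 bM.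
have nE : \forall t \near (0 : R), gamma t = b t.
  have H : \forall t \near (0 : R), `|t| < e by exact: nbhs0_lt.
  by apply: filterS H => t; exact: gb.
have nE' : \forall t \near (0 : R), b t = gamma t by apply: filterS nE => t ->.
exists gamma; apply: one_parameter_Lop => //.
- have E0 : gamma 0 = b 0 by apply: gb; rewrite normr0.
  change (gamma @ nbhs (0 : R) --> gamma 0); rewrite E0.
  by apply: cvg_trans cb; exact: near_eq_cvg.
- by apply: filterS2 cc nE => t bt ->.
- by apply: is_derive_near db; apply: filterS nE' => t ->.
Qed.

Variable act : G -> M -> M.
Hypothesis act_smooth : smooth_action act.
Variables (c : chart R m M) (x : M) (phi : 'I_m -> M -> R).
Hypotheses (ac : atlas c) (cx : cdom c x).
Hypothesis sphi : forall i, smooth_fun (phi i).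
Hypothesis dphi : forall (v : 'rV[R]_m) i, der_at c x v (phi i) = v 0 i.
Hypothesis phiE : forall D f, point_derivation x D -> smooth_fun f ->
  D f = der_at c x (\row_i D (phi i)) f.
Variable g : gram_field (M := M).
Hypothesis g_lorentz : lorentz_metric g.
Hypothesis act_isometric : forall a : G, preserves_gram g (act a).
Hypothesis stab_noncompact : ~ compact (stabilizer act x).
Local Notation S := (g c (cmap c x)).
Local Notation Q := (bf S).
Local Notation ftan := (ftan act c0 x phi).

Lemma omi_bracket X Y : so X -> so Y -> omi (mx_bracket X Y) = lbr (omi X) (omi Y).
Proof. by move=> hX hY; rewrite -[RHS]omK om_lbr !omiK. Qed.

Lemma stabilizer_dichotomy : (forall v, ftan v = 0) \/
  exists2 e : 'rV[R]_N, bf J e e < 0 & forall v, ftan v = 0 <-> e *m (om v)^T = 0.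
Proof.
have lf := ftan_is_linear act_smooth ac0 c01 x sphi.
have [tau tauE] : exists tau : {linear 'M[R]_N -> 'rV[R]_m}, forall A, tau A = ftan (omi A).
  by apply: (@ex_linear _ _ _ (fun A => ftan (omi A))) => k A B; rewrite linearP lf.
have lS : lorentz_form S by have [_ _ H _] := g_lorentz; apply: H => //; exact: cmap_img.
have St : S^T = S by have [] := lS.
have sub X Y : so X -> so Y -> tau X = 0 -> tau Y = 0 -> tau (mx_bracket X Y) = 0.
  move=> hX hY; rewrite !tauE omi_bracket //.
  exact: (ftan_sub act_smooth ac0 c01 psiE sphi phiE).
have inv X Y Z : so X -> so Y -> so Z -> tau X = 0 ->
    Q (tau (mx_bracket X Y)) (tau Z) + Q (tau Y) (tau (mx_bracket X Z)) = 0.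
  move=> hX hY hZ; rewrite !tauE !omi_bracket // => v0.
  have [gamma og] := ex_one_parameter (omi X).
  exact: (ftan_inv act_smooth ac0 c01 spsi dpsi psiE ac cx sphi dphi phiE act_isometric _ _ og v0).
have unb (B : R) : exists c, [/\ @Ogrp R n c, B < `|c| &
  forall A A', so A -> so A' -> Q (tau (mconj c A)) (tau (mconj c A')) = Q (tau A) (tau A')].
  have [a [k [Ha kO Ak Bk]]] := noncompact_unbounded n0 G_connected G_finite_center ac0 c01
    spsi dpsi psiE omK om_so omiK om_lbr so_lie_o B (@stabilizer_closed _ _ _ _ _ _ act_smooth x) stab_noncompact.
  exists k; split => // A A' hA hA'.
  have E D : so D -> omi (mconj k D) = Ad a (omi D).
    by move=> hD; rewrite -(AdmE ac0 c01 spsi) Ak nuE omiK.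
  rewrite !tauE (E A hA) (E A' hA').
  exact: (ftan_isometric act_smooth ac0 c01 psiE ac cx sphi dphi phiE act_isometric).
have [C [p [h1 h2 h3 h4 h5]]] := unbounded_limit unb.
have [H|[e e0 H]] := so_classification n6 St (lorentz_iso1 lS) sub inv h1 h2 h3 h4 h5.
  by left => v; rewrite -[v]omK -tauE; exact: H.
by right; exists e => // v; rewrite -{1}[v]omK -tauE; exact: H.
Qed.

End dichotomy.

(** * Lorentz representations of o(2,n) *)

(** If no power of X vanished, X^j would be an eigenvector of the bracket with H for the eigenvalue
    j. An operator on a space of dimension k^2 cannot have k^2 + 1 distinct eigenvalues. *)
Lemma bracket_nilpotent (R : realType) k (H X : 'M[R]_k) : mx_bracket H X = X ->
  exists j, X ^+ j = 0.
Proof.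
move=> HX; apply: contrapT => nX.
have X0 j : X ^+ j != 0 by apply/eqP => E; apply: nX; exists j.
have E j : mx_bracket H (X ^+ j) = j%:R *: X ^+ j.
  elim: j => [|j IH]; first by rewrite scale0r expr0 /mx_bracket mulmx1 mul1mx subrr.
  rewrite exprS -mulmxE.
  have -> : mx_bracket H (X *m X ^+ j) = mx_bracket H X *m X ^+ j + X *m mx_bracket H (X ^+ j).
    by rewrite /mx_bracket mulmxBl mulmxBr !mulmxA addrA subrK.
  by rewrite HX IH -scalemxAr -[X in X + _]scale1r -scalerDl -natr1 addrC.
have [L LE] : exists L : {linear 'M[R]_k -> 'M[R]_k}, forall A, L A = mx_bracket H A.
  exists (mulmx H - mulmxr H)%R => A; by [].
pose rs : seq R := [seq j%:R | j <- iota 0 (k * k).+1].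
have p0 : char_poly (lin_mx L) != 0 by rewrite monic_neq0 // char_poly_monic.
have := max_poly_roots p0 (rs := rs); rewrite size_char_poly size_map size_iota ltnn => H1.
suff : false by [].
apply: H1; last first.
  rewrite map_inj_uniq ?iota_uniq // => a b /eqP; by rewrite eqr_nat => /eqP.
apply/allP => _ /mapP[j _ ->]; rewrite -eigenvalue_root_char; apply/eigenvalueP.
exists (mxvec (X ^+ j)); last by rewrite mxvec_eq0 X0.
by rewrite mul_vec_lin LE E linearZ.
Qed.

Section representation.
Context {R : realType} {n m : nat}.
Hypothesis n6 : (6 <= n)%N.
Local Notation N := (2 + n)%N.
Local Notation J := (signature_mx 2 N : 'M[R]_N).
Local Notation "<< a , b >>" := (bf J a b) (a at level 10, b at level 10).
Local Notation so := (so_set J).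
Variable S : 'M[R]_m.
Hypothesis St : S^T = S.
Local Notation Q := (bf S).
Hypothesis iso1 : forall s u, s != 0 -> Q s s = 0 -> Q s u = 0 -> Q u u = 0 -> exists c, u = c *: s.
Variable s : {linear 'M[R]_N -> 'M[R]_m}.
Hypothesis s_br : forall A B, so A -> so B -> s (mx_bracket A B) = mx_bracket (s A) (s B).
Hypothesis s_skew : forall A, so A -> s A *m S + S *m (s A)^T = 0.
Implicit Types (w k : 'rV[R]_m) (p f : 'rV[R]_N).

Let JJ := @sigJJ R 2 N.
Let Jt := @sigT R 2 N.
Let wso a b : so (wdg J a b). Proof. exact: wdg_so. Qed.

Lemma rep_skew A w w' : so A -> Q (w *m s A) w' = - Q w (w' *m s A).
Proof.
move=> hA; apply/eqP; rewrite -subr_eq0 opprK /bf trmx_mul.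
have := s_skew hA => /(congr1 (fun X => (w *m X *m w'^T) 0 0)).
rewrite mulmx0 mul0mx mulmxDr mulmxDl [LHS]mxE [RHS]mxE => E; apply/eqP.
by rewrite -[RHS]E !mulmxA.
Qed.

Lemma rep_skewX A j w w' : so A -> Q (w *m s A ^+ j) w' = (-1) ^+ j * Q w (w' *m s A ^+ j).
Proof.
move=> hA; elim: j w w' => [|j IH] w w'; first by rewrite !expr0 !mulmx1 mul1r.
have E1 : s A ^+ j.+1 = s A ^+ j *m s A by exact: exprSr.
have E2 : s A ^+ j.+1 = s A *m s A ^+ j by exact: exprS.
rewrite {1}E1 E2 !mulmxA (rep_skew _ _ hA) IH exprS; ring.
Qed.

Lemma rep_nilpotent p f : p != 0 -> << p, p >> = 0 -> << f, p >> = 0 ->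
  exists j, s (wdg J p f) ^+ j = 0.
Proof.
move=> p0 pp fp; have [p' pp' p'p'] := partner p0 pp.
apply: (@bracket_nilpotent R m (s (wdg J p p'))).
rewrite -s_br // bracket_wdg pp (bfC _ _ Jt) pp' (bfC p f Jt) fp !scale0r scale1r !subr0.
have -> : wdg J p p = 0 by rewrite /wdg subrr mul0mx.
by rewrite scaler0 addr0.
Qed.

Lemma orbit_linear w : exists tau : {linear 'M[R]_N -> 'rV[R]_m}, forall A, tau A = w *m s A.
Proof. by exists (mulmx w \o s)%R. Qed.

Lemma rep_comm p f f' : << p, p >> = 0 -> << f, p >> = 0 -> << f', p >> = 0 ->
  s (wdg J p f) *m s (wdg J p f') = s (wdg J p f') *m s (wdg J p f).
Proof.
move=> pp fp f'p; apply/eqP; rewrite -subr_eq0; apply/eqP.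
have := s_br (wso p f) (wso p f'); rewrite /mx_bracket => <-.
rewrite -[X in s X]/(mx_bracket _ _) bracket_wdg pp fp (bfC p f' Jt) f'p !scale0r.
have -> : wdg J p p = 0 by rewrite /wdg subrr mul0mx.
by rewrite scaler0 !subr0 addr0 linear0.
Qed.

(* The classification of subalgebras applies to the orbit map A |-> w s(A). *)
Lemma orbit_sub w (tau : {linear 'M[R]_N -> 'rV[R]_m}) : (forall A, tau A = w *m s A) ->
  forall X Y, so X -> so Y -> tau X = 0 -> tau Y = 0 -> tau (mx_bracket X Y) = 0.
Proof.
move=> tE X Y hX hY; rewrite !tE s_br // /mx_bracket mulmxBr !mulmxA => -> ->.
by rewrite !mul0mx subrr.
Qed.

Lemma orbit_inv w (tau : {linear 'M[R]_N -> 'rV[R]_m}) : (forall A, tau A = w *m s A) ->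
  forall X Y Z, so X -> so Y -> so Z -> tau X = 0 ->
  Q (tau (mx_bracket X Y)) (tau Z) + Q (tau Y) (tau (mx_bracket X Z)) = 0.
Proof.
move=> tE X Y Z hX hY hZ; rewrite !tE !s_br // /mx_bracket !mulmxBr !mulmxA => ->.
rewrite !mul0mx !sub0r bfNl bfNr (rep_skew _ _ hX); ring.
Qed.

(** Values on one isotropic line satisfy the isotropy hypothesis of the classification, so it
    remains to exclude that the kernel of the orbit map is the stabilizer of a negative [v]. For an
    isotropic [q] not orthogonal to [v], the map e |-> w s(q ^ e) takes values in a line, so some
    positive [e] orthogonal to [q] puts q ^ e in the kernel; yet q ^ e does not annihilate [v]. *)
Lemma orbit_line_zero k w : k != 0 -> Q k k = 0 ->
  (forall p f, p != 0 -> << p, p >> = 0 -> << f, p >> = 0 -> exists c, w *m s (wdg J p f) = c *: k) ->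
  forall A, so A -> w *m s A = 0.
Proof.
move=> k0 kk H; have [tau tE] := orbit_linear w.
have [p [p0 pp]] : exists p, p != 0 /\ << p, p >> = 0.
  pose x : 'rV[R]_N := delta_mx 0 (lshift n ord0).
  have xx : << x, x >> < 0 by rewrite bf_delta eqxx /= mulr1 ltrN10.
  have [f fx ff] := pos3 n6 (s := [:: co x]) isT.
  have xf : << x, f >> = 0 by rewrite (bfC _ _ Jt); apply: coE; apply: fx; rewrite mem_head.
  have [al [be [h1 h2 h3]]] := null_pair xx ff xf.
  exists (al *: x + be *: f); split => //; apply: contraTneq isT => E.
  by move: h2; rewrite E bf0l => /eqP; rewrite eq_sym oner_eq0.
have cop f : f *m (co p *m p) = 0 -> << f, p >> = 0.
  rewrite mulmxA => /eqP; rewrite [f *m _]mx11_scalar mul_scalar_mx scaler_eq0 (negbTE p0) orbF => /eqP E.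
  by apply: coE; rewrite [LHS]mx11_scalar E; apply/matrixP => i j; rewrite !mxE mul0rn.
have [|||||h|[v vv h]] := so_classification n6 St iso1 (orbit_sub tE) (orbit_inv tE) (C := co p *m p) (p := p).
- by apply: leq_trans (mxrankM_maxl _ _) (leq_trans (rank_leq_col _) _).
- by [].
- by [].
- exact: cop.
- move=> f f' /cop fp /cop f'p; rewrite /wtau !tE.
  have [a ->] := H p f p0 pp fp; have [b ->] := H p f' p0 pp f'p.
  by rewrite bfZl bfZr kk !mulr0.
- by move=> A hA; rewrite -tE h.
exfalso.
have [f fv ff] := pos3 n6 (s := [:: co v]) isT.
have vf : << v, f >> = 0 by rewrite (bfC _ _ Jt); apply: coE; apply: fv; rewrite mem_head.
have [al [be [h1 h2 h3]]] := null_pair vv ff vf.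
pose q := al *: v + be *: f.
have q0 : q != 0.
  by apply: contraTneq isT => E; move: h2; rewrite -/q E bf0l => /eqP; rewrite eq_sym oner_eq0.
have qv : << q, v >> != 0.
  by rewrite /q !bfE (bfC f v Jt) vf mulr0 addr0 mulf_neq0 // lt_eqF.
have /existsP[j kj] : [exists j, k 0 j != 0].
  apply: contraNT k0; rewrite negb_exists => /forallP hk; apply/eqP/rowP => j.
  by rewrite mxE; apply/eqP; have := hk j; rewrite negbK.
have [e He ee] := pos3 n6 (s := [:: co q; col j (tmx tau q)]) isT.
have eq0 : << e, q >> = 0 by apply: coE; apply: He; rewrite mem_head.
have te : tau (wdg J q e) = 0.
  have [a Ea] := H q e q0 h1 eq0.
  have : e *m col j (tmx tau q) = 0 by apply: He; rewrite !inE eqxx orbT.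
  have -> : e *m col j (tmx tau q) = col j (e *m tmx tau q) by rewrite !colE mulmxA.
  rewrite tmxE /wtau tE Ea => /matrixP /(_ 0 0); rewrite !mxE => /eqP.
  by rewrite mulf_eq0 (negbTE kj) orbF => /eqP ->; rewrite scale0r.
have := (h _ (wso q e)).1 te; rewrite (wdgE Jt) => /eqP; rewrite subr_eq0 => /eqP E.
have : << q, v >> * << e, e >> = 0.
  by rewrite -bfZl -E bfZl (bfC q e Jt) eq0 mulr0.
by move/eqP; rewrite mulf_eq0 (negbTE qv) /= gt_eqF.
Qed.

(** X = s(p ^ f) is nilpotent and skew, so the image of its last nonzero power is totally isotropic,
    hence a line. The matrices of the other p ^ f' commute with X, preserve this line and are
    nilpotent, so they kill it. *)
Lemma ex_null_killed p : p != 0 -> << p, p >> = 0 ->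
  (exists2 f, << f, p >> = 0 & s (wdg J p f) != 0) ->
  exists k, [/\ k != 0, Q k k = 0 & forall f, << f, p >> = 0 -> k *m s (wdg J p f) = 0].
Proof.
move=> p0 pp [f fp Xf]; set X := s _ in Xf.
have [j0 Xj0] := rep_nilpotent p0 pp fp.
have exj : exists j, X ^+ j == 0 by exists j0; apply/eqP.
case: (ex_minnP exj) => -[|[|j]] /eqP Xj minj.
- by case/eqP: Xf; rewrite -[X]mulmx1 -[1%:M]/(X ^+ 0) Xj mulmx0.
- by case/eqP: Xf; rewrite -[X]expr1.
have Xj1 : X ^+ j.+1 != 0 by apply/negP => h; have := minj _ h; rewrite ltnn.
have iso w w' : Q (w *m X ^+ j.+1) (w' *m X ^+ j.+1) = 0.
  rewrite rep_skewX // -mulmxA mulmxE -exprD.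
  by rewrite (_ : (j.+1 + j.+1)%N = (j.+2 + j)%N) ?exprD ?Xj ?mul0r ?mulmx0 ?bf0r ?mulr0 // addSn addnS.
have [w wX] : exists w, w *m X ^+ j.+1 != 0.
  apply: contrapT => h; move: Xj1; rewrite (_ : X ^+ j.+1 = 0) ?eqxx //.
  apply: mulmx_ext => w; rewrite mulmx0; apply: contrapT => /eqP h'; by apply: h; exists w.
exists (w *m X ^+ j.+1); split => // f' f'p; set Y := s _.
have [c E] : exists c, w *m X ^+ j.+1 *m Y = c *: (w *m X ^+ j.+1).
  have cXY i : X ^+ i *m Y = Y *m X ^+ i.
    have h : GRing.comm Y X by apply: rep_comm.
    exact: esym (commrX i h).
  by rewrite -mulmxA cXY mulmxA; apply: iso1.
have [i Yi] := rep_nilpotent p0 pp f'p.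
have Ei l : w *m X ^+ j.+1 *m Y ^+ l = c ^+ l *: (w *m X ^+ j.+1).
  elim: l => [|l IH]; first by rewrite !expr0 scale1r mulmx1.
  have E1 : Y ^+ l.+1 = Y ^+ l *m Y by exact: exprSr.
  by rewrite E1 (mulmxA _ (Y ^+ l)) IH -scalemxAl E scalerA (exprSr c).
have := Ei i; rewrite Yi mulmx0 => /esym/eqP; rewrite scaler_eq0 (negbTE wX) orbF expf_eq0 => /andP[_ /eqP c0].
by rewrite E c0 scale0r.
Qed.

(** Unless all s(p ^ f) vanish for a fixed isotropic [p], there is an isotropic vector [k] killed by
    the whole algebra, and all images are orthogonal to [k] by skewness. Vectors orthogonal to [k]
    are shown to be killed as well. For general w, the vector w X is then isotropic and orthogonal
    to [k], hence on the line of [k], and [orbit_line_zero] finishes. *)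
Lemma rep_trivial A : so A -> s A = 0.
Proof.
have [p [p0 pp]] : exists p, p != 0 /\ << p, p >> = 0.
  pose x : 'rV[R]_N := delta_mx 0 (lshift n ord0).
  have xx : << x, x >> < 0 by rewrite bf_delta eqxx /= mulr1 ltrN10.
  have [f fx ff] := pos3 n6 (s := [:: co x]) isT.
  have xf : << x, f >> = 0 by rewrite (bfC _ _ Jt); apply: coE; apply: fx; rewrite mem_head.
  have [al [be [h1 h2 h3]]] := null_pair xx ff xf.
  exists (al *: x + be *: f); split => //; apply: contraTneq isT => E.
  by move: h2; rewrite E bf0l => /eqP; rewrite eq_sym oner_eq0.
have full w : (forall f, << f, p >> = 0 -> w *m s (wdg J p f) = 0) -> forall A, so A -> w *m s A = 0.
  move=> H {}A hA; have [tau tE] := orbit_linear w.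
  have T := full_of_line n6 St iso1 (orbit_sub tE) (orbit_inv tE) p0 pp.
  rewrite -tE; apply: (so_span_ind JJ Jt (P := fun A => tau A = 0)) hA.
  - exact: linear0.
  - by move=> x X Y; rewrite linearP => -> ->; rewrite scaler0 addr0.
  - move=> i j; by apply: T => f fp; rewrite /wtau tE H.
have [[f fp Xf]|nz] := pselect (exists2 f, << f, p >> = 0 & s (wdg J p f) != 0); last first.
  move=> hA; apply: mulmx_ext => w; rewrite mulmx0; apply: full => // f fp.
  rewrite (_ : s _ = 0) ?mulmx0 //; apply: contrapT => /eqP h; by apply: nz; exists f.
have [k [k0 kk kX]] := ex_null_killed p0 pp (ex_intro2 _ _ f fp Xf).
have ks : forall A, so A -> k *m s A = 0 by exact: full.
have perp w B : so B -> Q (w *m s B) k = 0 by move=> hB; rewrite rep_skew // ks // bf0r oppr0.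
have kp w : Q w k = 0 -> forall A, so A -> w *m s A = 0.
  move=> wk; apply: (orbit_line_zero k0 kk) => q e q0 qq eq0.
  have [j0 Xj0] := rep_nilpotent q0 qq eq0; set X := s _ in Xj0 *.
  (* Descent by halving exponents, starting from 2^j0 where the power of X vanishes. If w X^(2l) is
     a multiple of [k], then w X^l is isotropic because w is orthogonal to [k], and it is orthogonal
     to [k] as an image; it is therefore a multiple of [k] too. *)
  have X2 i : exists c, w *m X ^+ (2 ^ (j0 - i)) = c *: k.
    elim: i => [|i [c IH]].
      exists 0; rewrite subn0 scale0r (_ : (2 ^ j0 = j0 + (2 ^ j0 - j0))%N) ?exprD ?Xj0 ?mul0r ?mulmx0 //.
      by rewrite subnKC // ltnW // ltn_expl.
    have [ij|ij] := ltnP i j0; last first.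
      by exists c; rewrite -IH; congr (_ *m X ^+ (2 ^ _)); apply/eqP; lia.
    have E : (j0 - i = (j0 - i.+1).+1)%N by lia.
    set l := (2 ^ (j0 - i.+1))%N; have El : (2 ^ (j0 - i) = l + l)%N by rewrite E expnS mul2n addnn.
    have [l' ll'] : exists l', l = l'.+1 by exists l.-1; rewrite prednK // expn_gt0.
    apply: iso1 => //.
      by rewrite (bfC _ _ St) ll' exprSr -mulmxE mulmxA; apply: perp.
    rewrite rep_skewX // -mulmxA mulmxE -exprD -El IH bfZr wk.
    by rewrite !mulr0.
  by have := X2 j0; rewrite subnn expn0 expr1.
move=> hA; apply: mulmx_ext => w; rewrite mulmx0.
move: A hA; apply: (orbit_line_zero k0 kk) => q e q0 qq eq0.
apply: iso1 => //; first by rewrite (bfC _ _ St); exact: perp.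
by rewrite rep_skew // kp ?bf0r ?oppr0 //; exact: perp.
Qed.

End representation.

(** * Killing fields *)

Section near_combine.
Context {T : topologicalType}.

Lemma near_forall (I : finType) (P : I -> T -> Prop) (x : T) : (forall i, \forall y \near x, P i y) ->
  \forall y \near x, forall i, P i y.
Proof. by move=> H; apply: filter_forall => i; exact: H. Qed.

Lemma near_and (P P' : T -> Prop) (x : T) : (\forall y \near x, P y) -> (\forall y \near x, P' y) ->
  \forall y \near x, P y /\ P' y.
Proof. by move=> H H'; exact: filterI. Qed.

Lemma near_bounded (R : realType) (I : finType) (f : I -> T -> R) (x : T) :
  (forall i, {for x, continuous (f i)}) ->
  exists2 A, 0 < A & \forall y \near x, forall i, `|f i y| <= A.
Proof.
move=> cf; pose F i := `|f i x| + 1.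
have F0 i : 0 <= F i by rewrite addr_ge0.
exists (\sum_i F i + 1); first by rewrite ltr_wpDl // sumr_ge0.
apply: near_forall => i; apply: filterS (near_dist (cf i) (@ltr01 R)) => y /ltW h.
apply: (@le_trans _ _ (F i)); last first.
  by rewrite (bigD1 i) //= -addrA lerDl addr_ge0 // sumr_ge0.
rewrite -[X in `|X|](subrK (f i x)) addrC; apply: le_trans (ler_normD _ _) _.
by rewrite lerD2l distrC.
Qed.

End near_combine.

Section gronwall.
Context {R : realType} {d : nat} {I : finType}.
Local Notation e_ i := (delta_mx 0 i : 'rV[R]_d).

(** On a small ball the mean value theorem from [u0] turns a common bound of all [F k] into half of
    it. Iteration gives the bounds 2^-j for every j. *)
Lemma gronwall (U : set 'rV[R]_d) (F : I -> 'rV[R]_d -> R) u0 (C : R) : open U -> U u0 ->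
  (forall k, Ck_on 1 U (F k)) -> 0 <= C ->
  (forall y i k, U y -> `|'D_(e_ i) (F k) y| <= C * \sum_l `|F l y|) ->
  (forall k, F k u0 = 0) -> \forall y \near u0, forall k, F k y = 0.
Proof.
move=> oU Uu cF C0 HD F0.
pose K : R := #|I|%:R.
have n1 k : \forall y \near u0, `|F k y| <= 1.
  have cf : {for u0, continuous (F k)} by have [cf _ _] := cF k; exact: cf.
  apply: filterS (near_dist cf (@ltr01 R)) => y.
  by rewrite F0 sub0r normrN => /ltW.
have [r0 r00 Hr0] : exists2 r, 0 < r & forall y, ball u0 r y -> U y /\ forall k, `|F k y| <= 1.
  have : \forall y \near u0, U y /\ forall k, `|F k y| <= 1.
    by apply: near_and; [exact: open_nbhs_nbhs|exact: near_forall].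
  by move=> /nbhs_ballP[r /= r0 H]; exists r.
pose L : R := d%:R * (C * K) + 1.
have L0 : 0 < L by rewrite ltr_wpDl // !mulr_ge0.
(* One pass multiplies the bound by at most r d C K, with K the number of functions; this radius
   makes the factor at most 1/2. *)
pose r := Num.min r0 (2 * L)^-1.
have r_gt0 : 0 < r by rewrite lt_min r00 invr_gt0 mulr_gt0.
have rL : r * (d%:R * (C * K)) <= 2^-1.
  apply: (@le_trans _ _ ((2 * L)^-1 * L)).
    by rewrite ler_pM ?(ltW r_gt0) ?mulr_ge0 // /r ?ge_min ?lexx ?orbT // lerDl.
  by rewrite invfM mulfVK // gt_eqF.
have Hr y : ball u0 r y -> ball u0 r0 y.
  by apply: le_ball; rewrite /r ge_min lexx.
have step j y k : ball u0 r y -> `|F k y| <= (2^-1) ^+ j.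
  elim: j y k => [|j IH] y k yr; first by rewrite expr0; have [_] := Hr0 _ (Hr _ yr); apply.
  have nyr : `|y - u0| < r by rewrite distrC; move: yr; rewrite -ball_normE.
  have line (a : R) : `|a| <= 1 -> ball u0 r (a *: (y - u0) + u0).
    move=> a1; rewrite -ball_normE /ball_ /= opprD addrCA subrr addr0 normrN normrZ.
    by rewrite (le_lt_trans _ nyr) // ler_piMl.
  have [|a a1 E] := @mvt_line _ _ (F k) u0 (y - u0) 1.
    move=> a; rewrite normr1 => /line /Hr /Hr0 [Ua _]; have [_ df _] := cF k; exact: df.
  rewrite normr1 in a1; rewrite scale1r subrK F0 subr0 mul1r in E.
  have [Uz _] := Hr0 _ (Hr _ (line a a1)).
  rewrite E (C1_derive_sum _ oU Uz (cF k)) /lincomb.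
  apply: (@le_trans _ _ (d%:R * (r * (C * (K * (2^-1) ^+ j))))).
    apply: norm_sum_le => i; rewrite normrM ler_pM //.
      by apply: le_trans (rV_norm_coord _ _) (ltW nyr).
    apply: le_trans (HD _ _ _ Uz) _; rewrite ler_wpM2l //.
    rewrite /K mulr_natl -sumr_const ler_sum // => l _.
    by apply: IH; exact: line.
  rewrite exprS; have -> : d%:R * (r * (C * (K * 2^-1 ^+ j))) = (r * (d%:R * (C * K))) * (2^-1) ^+ j by ring.
  by rewrite ler_wpM2r // exprn_ge0 // invr_ge0.
apply: filterS (nbhsx_ballx u0 r r_gt0) => y yr k.
apply/eqP; rewrite -normr_eq0; apply/eqP/le_anti; rewrite normr_ge0 andbT leNgt; apply/negP => e0.
have := archi_boundP (ltW (_ : 0 < `|F k y|^-1)); rewrite invr_gt0 => /(_ e0).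
set j := Num.bound _ => Hj.
have := step j y k yr; rewrite leNgt => /negP; apply.
rewrite exprVn -[ltRHS]invrK ltf_pV2 ?posrE ?invr_gt0 ?exprn_gt0 //.
apply: (lt_trans Hj); rewrite -natrX ltr_nat; exact: ltn_expl.
Qed.

End gronwall.

Section killing.
Context {R : realType} {m : nat}.
Local Notation e_ i := (delta_mx 0 i : 'rV[R]_m).

Lemma derive_sum_mul p (a b : 'I_p -> 'rV[R]_m -> R) u v :
  (forall k, derivable (a k) u v) -> (forall k, derivable (b k) u v) ->
  derivable (fun y => \sum_k a k y * b k y) u v /\
  'D_v (fun y => \sum_k a k y * b k y) u = \sum_k ('D_v (a k) u * b k u + a k u * 'D_v (b k) u).
Proof.
move=> da db; rewrite (_ : (fun y => _) = \sum_k (a k * b k)); last by apply/funext => y; rewrite fct_sumE.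
have dm k : derivable (a k * b k) u v by exact: derivableM.
split; first exact: derivable_sum.
rewrite derive_sum //; apply: eq_bigr => k _; rewrite deriveM //.
by rewrite addrC /GRing.scale /= mulrC.
Qed.

Lemma derive_add3_zero (U : set 'rV[R]_m) (f1 f2 f3 : 'rV[R]_m -> R) d1 d2 d3 u v : open U -> U u ->
  (forall y, U y -> f1 y + f2 y + f3 y = 0) ->
  derivable f1 u v /\ 'D_v f1 u = d1 -> derivable f2 u v /\ 'D_v f2 u = d2 ->
  derivable f3 u v /\ 'D_v f3 u = d3 -> d1 + d2 + d3 = 0.
Proof.
move=> oU Uu H [h1 <-] [h2 <-] [h3 <-].
rewrite -(deriveD h1 h2) -(deriveD (derivableD h1 h2) h3).
have nE : \forall y \near u, cst 0 y = (f1 + f2 + f3) y.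
  by apply: filterS (open_nbhs_nbhs (conj oU Uu)) => y Uy; rewrite /= -(H y Uy).
by rewrite -(near_eq_derive _ nE) derive_cst.
Qed.

Lemma koszul (a b c x y z : R) : a + b = x -> a + c = y -> b + c = z -> 2 * a = x + y - z.
Proof. lra. Qed.

Lemma invertible_lower_bound (g : 'rV[R]_m -> 'M[R]_m) u0 : g u0 \in unitmx ->
  {for u0, continuous g} ->
  exists2 B : R, 0 < B & \forall y \near u0, forall X : 'M[R]_m, `|X| <= B * `|X *m g y|.
Proof.
move=> gu cg; pose h := invmx (g u0).
pose A : R := m%:R * `|h| + 1; pose A' : R := m%:R * A + 1.
have A0 : 0 < A by rewrite ltr_wpDl // mulr_ge0.
have A'0 : 0 < A' by rewrite ltr_wpDl // mulr_ge0 // ltW.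
have e0 : 0 < (2 * A')^-1 by rewrite invr_gt0 mulr_gt0.
exists (2 * A); first by rewrite mulr_gt0.
apply: filterS (near_dist cg e0) => y /ltW Hy X.
have XE : X = X *m g y *m h + X *m (g u0 - g y) *m h.
  by rewrite -mulmxDl -mulmxDr addrC subrK mulmxK.
have b1 : `|X *m g y *m h| <= A * `|X *m g y|.
  apply: le_trans (norm_mulmx _ _) _; rewrite mulrCA mulrC ler_wpM2r //.
  by rewrite lerDl.
have b2 : `|X *m (g u0 - g y) *m h| <= 2^-1 * `|X|.
  apply: le_trans (norm_mulmx _ _) _; rewrite mulrCA mulrC.
  apply: (@le_trans _ _ (A * (m%:R * (`|X| * (2 * A')^-1)))).
    rewrite ler_pM ?mulr_ge0 ?lerDl //; apply: le_trans (norm_mulmx _ _) _.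
    by rewrite ler_wpM2l // ler_wpM2l.
  have -> : A * (m%:R * (`|X| * (2 * A')^-1)) = (2^-1 * `|X|) * (m%:R * A / A').
    rewrite invfM; ring.
  rewrite ler_piMr ?mulr_ge0 ?invr_ge0 // ler_pdivrMr // mul1r lerDl.
  exact: ler01.
have : `|X| <= A * `|X *m g y| + 2^-1 * `|X|.
  by rewrite {1}XE; apply: le_trans (ler_normD _ _) (lerD b1 b2).
by move: (`|X|) (`|X *m g y|) => a b ab; lra.
Qed.

Variables (U : set 'rV[R]_m) (g : 'rV[R]_m -> 'M[R]_m) (Y : 'rV[R]_m -> 'rV[R]_m).
Hypotheses (oU : open U) (sg : smooth_on U g) (sY : smooth_on U Y).
Hypothesis gt : forall u, U u -> (g u)^T = g u.
Hypothesis gunit : forall u, U u -> g u \in unitmx.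
Local Notation D l f := ('D_(e_ l) f).
Local Notation Yk k := (fun u : 'rV[R]_m => Y u 0 k : R).
Local Notation gk i j := (fun u : 'rV[R]_m => g u i j : R).
Hypothesis killing : forall u i j, U u ->
  \sum_k D i (Yk k) u * g u k j + \sum_k g u i k * D j (Yk k) u + \sum_k Y u 0 k * D k (gk i j) u = 0.

Let sYk k : smooth_on U (Yk k).
Proof. by have /(smooth_on_mxP _ oU) := sY; apply. Qed.

Let sgk i j : smooth_on U (gk i j).
Proof. by have /(smooth_on_mxP _ oU) := sg; apply. Qed.

Let dd (f : 'rV[R]_m -> R) u v : U u -> smooth_on U f -> derivable f u v.
Proof. by move=> Uu sf; exact: smooth_on_derivable sf Uu. Qed.

Definition killT l i j u : R := \sum_k D l (D i (Yk k)) u * g u k j.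
(** What is left of the l-th derivative of Killing's equation once the second derivatives of [Y],
    collected in [killT], are set apart. Only the 1-jet of [Y] occurs in it. *)
Definition killE l i j u : R := \sum_k D i (Yk k) u * D l (gk k j) u + \sum_k D l (gk i k) u * D j (Yk k) u
  + \sum_k (D l (Yk k) u * D k (gk i j) u + Y u 0 k * D l (D k (gk i j)) u).

Lemma killing_derivative l i j u : U u -> killT l i j u + killT l j i u = - killE l i j u.
Proof.
move=> Uu.
have D1 := @derive_sum_mul m (fun k => D i (Yk k)) (fun k => gk k j) u (e_ l)
   (fun k => dd Uu (smooth_on_derive _ (sYk k))) (fun k => dd Uu (sgk _ _)).
have D2 := @derive_sum_mul m (fun k => gk i k) (fun k => D j (Yk k)) u (e_ l)
   (fun k => dd Uu (sgk _ _)) (fun k => dd Uu (smooth_on_derive _ (sYk k))).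
have D3 := @derive_sum_mul m (fun k => Yk k) (fun k => D k (gk i j)) u (e_ l)
   (fun k => dd Uu (sYk k)) (fun k => dd Uu (smooth_on_derive _ (sgk _ _))).
have := derive_add3_zero oU Uu (fun y Uy => killing i j Uy) D1 D2 D3.
have ET : \sum_k g u i k * D l (D j (Yk k)) u = killT l j i u.
  apply: eq_bigr => k _; rewrite mulrC.
  have -> : g u i k = g u k i by rewrite -[in LHS](gt Uu) mxE.
  by [].
rewrite /killE [X in X + _ + _]big_split [X in _ + X + _]big_split ET -/(killT l i j u).
clear; move: (killT l i j u) (killT l j i u) (\sum_k _) (\sum_k _) (\sum_k _) => a b x y z /= h.
by apply/eqP; rewrite -subr_eq0 opprK -h; apply/eqP; ring.
Qed.

Lemma killing_sym l i j u : U u -> killT l i j u = killT i l j u.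
Proof.
move=> Uu; apply: eq_bigr => k _.
exact: (congr1 (fun z => z * g u k j) (@schwarz R _ U (Yk k) u (e_ i) (e_ l) oU Uu (sYk k 2%N))).
Qed.

(* Koszul's trick: killT l i j is symmetric in its first two indices and its symmetrization in the last two is
   - killE. *)
Lemma killing_second l i j u : U u -> 2 * killT l i j u = - killE l i j u - killE i l j u + killE j l i u.
Proof.
move=> Uu; have h1 := killing_derivative l i j Uu; have h2 := killing_derivative i l j Uu.
have h3 := killing_derivative j l i Uu.
have s1 := killing_sym l i j Uu; have s2 := killing_sym l j i Uu; have s3 := killing_sym i j l Uu.
rewrite -s1 in h2; rewrite -s2 -s3 in h3.
by have := koszul h1 h2 h3; rewrite opprK.
Qed.

(** [killing_second] bounds the second derivatives of [Y], with an index lowered by [g], by its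
    1-jet; the metric is inverted with a uniform bound near [u0]. The family [F] of components and
    first derivatives of [Y] thus satisfies the inequality of [gronwall]. *)
Lemma killing_zero u0 : U u0 -> Y u0 = 0 -> (forall i k, D i (Yk k) u0 = 0) ->
  \forall y \near u0, Y y = 0.
Proof.
move=> Uu Y0 DY0.
have cgu : {for u0, continuous g} by exact: (sg 0%N).
have [B B0 HB] := invertible_lower_bound (gunit Uu) cgu.
have [A1 A10 HA1] := @near_bounded _ R _ (fun x : 'I_m * 'I_m * 'I_m => D x.1.1 (gk x.1.2 x.2)) u0
  (fun x => smooth_on_derive _ (sgk _ _) 0%N u0 Uu).
have [A2 A20 HA2] := @near_bounded _ R _ (fun x : 'I_m * 'I_m * ('I_m * 'I_m) => D x.1.1 (D x.1.2 (gk x.2.1 x.2.2))) u0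
  (fun x => smooth_on_derive _ (smooth_on_derive _ (sgk _ _)) 0%N u0 Uu).
pose A := A1 + A2; have A0 : 0 < A by rewrite addr_gt0.
have [r r0 Hr] : exists2 r, 0 < r & forall y, ball u0 r y -> [/\ U y,
    forall X : 'M[R]_m, `|X| <= B * `|X *m g y|, forall l i j, `|D l (gk i j) y| <= A &
    forall l k i j, `|D l (D k (gk i j)) y| <= A].
  have := near_and (open_nbhs_nbhs (conj oU Uu)) (near_and HB (near_and HA1 HA2)).
  move=> /nbhs_ballP[r /= r0 H]; exists r => // y /H [h1 [h2 [h3 h4]]]; split => // [l i j|l k i j].
    by apply: le_trans (h3 (l, i, j)) _; rewrite lerDl ltW.
  by apply: le_trans (h4 (l, k, (i, j))) _; rewrite lerDr ltW.
pose F (s : 'I_m + 'I_m * 'I_m) : 'rV[R]_m -> R :=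
  match s with inl k => Yk k | inr ik => D ik.1 (Yk ik.2) end.
have sF s : smooth_on U (F s) by case: s => [k|[i k]]; [exact: sYk|apply: smooth_on_derive; exact: sYk].
(* Each [killE] is at most 4 A h and [killT] is half a signed sum of three of them, whence 6; [B]
   accounts for inverting [g]. The 1 is for derivatives of components of [Y], which are themselves
   members of [F]. *)
pose C : R := 1 + B * (6 * A).
have C0 : 0 <= C by rewrite addr_ge0 // !mulr_ge0 // ltW.
have HD y i k : ball u0 r y -> `|D i (F k) y| <= C * \sum_s `|F s y|.
  move=> /Hr [Uy H1 H2 H3].
  pose h : R := \sum_s `|F s y|.
  have hF s : `|F s y| <= h by rewrite /h (bigD1 s) //= lerDl sumr_ge0.
  have h0 : 0 <= h by exact: sumr_ge0.
  case: k => [k|[p k]] /=.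
    apply: le_trans (hF (inr (i, k))) _; rewrite -/h ler_peMl // lerDl !mulr_ge0 // ltW //.
  have hrow p' : \sum_k `|D p' (Yk k) y| <= h.
    rewrite /h big_sumType /= (le_trans _ (_ : \sum_(ik : 'I_m * 'I_m) `|F (inr ik) y| <= _)) //; last by rewrite lerDr sumr_ge0.
    rewrite -(pair_bigA _ (fun a b => `|F (inr (a, b)) y|)) /= [leRHS](bigD1 p') //= lerDl.
    by apply: sumr_ge0 => ? _; exact: sumr_ge0.
  have hY : \sum_k `|Y y 0 k| <= h by rewrite /h big_sumType /= lerDl sumr_ge0.
  have sb (a b : 'I_m -> R) : (forall k, `|b k| <= A) -> \sum_k `|a k| <= h ->
      `|\sum_k a k * b k| <= A * h.
    move=> hb ha; apply: le_trans (ler_norm_sum _ _ _) _.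
    apply: (@le_trans _ _ (\sum_k A * `|a k|)).
      by apply: ler_sum => k' _; rewrite normrM mulrC ler_wpM2r.
    by rewrite -mulr_sumr ler_wpM2l // ltW.
  have hE l' i' j' : `|killE l' i' j' y| <= 4 * (A * h).
    rewrite /killE big_split /=.
    have b1 := sb (fun k => D i' (Yk k) y) (fun k => D l' (gk k j') y) (fun k => H2 _ _ _) (hrow i').
    have b2 := sb (fun k => D j' (Yk k) y) (fun k => D l' (gk i' k) y) (fun k => H2 _ _ _) (hrow j').
    have b3 := sb (fun k => D l' (Yk k) y) (fun k => D k (gk i' j') y) (fun k => H2 _ _ _) (hrow l').
    have b4 := sb (fun k => Y y 0 k) (fun k => D l' (D k (gk i' j')) y) (fun k => H3 _ _ _ _) hY.
    have e2 : \sum_k D l' (gk i' k) y * D j' (Yk k) y = \sum_k D j' (Yk k) y * D l' (gk i' k) y.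
      by apply: eq_bigr => ? _; rewrite mulrC.
    rewrite e2; move: b1 b2 b3 b4.
    move: (\sum_k _) (\sum_k _) (\sum_k _) (\sum_k _) (A * h) => a1 a2 a3 a4 z b1 b2 b3 b4.
    have := ler_normD (a4 + a3) (a2 + a1); have := ler_normD a4 a3; have := ler_normD a2 a1.
    by move: (`|a4 + a3 + (a2 + a1)|) (`|a4 + a3|) (`|a2 + a1|) => *; lra.
  have hT l' i' j' : `|killT l' i' j' y| <= 6 * (A * h).
    have := killing_second l' i' j' Uy; have := hE l' i' j'; have := hE i' l' j'; have := hE j' l' i'.
    move: (killT _ _ _ _) (killE _ _ _ _) (killE _ _ _ _) (killE _ _ _ _) (A * h) => t a b c z.
    rewrite !ler_norml => /andP[? ?] /andP[? ?] /andP[? ?] ?.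
    by apply/andP; split; lra.
  pose X : 'M[R]_m := \matrix_(p, k) D i (D p (Yk k)) y.
  have XT : `|X *m g y| <= 6 * (A * h).
    apply: mx_norm_le => [|a b]; first by rewrite !mulr_ge0 // ltW.
    rewrite mxE (_ : \sum_j _ = killT i a b y) //.
    by apply: eq_bigr => ? _; rewrite mxE.
  have XB : `|X| <= B * (6 * (A * h)) by apply: le_trans (H1 X) _; rewrite ler_wpM2l // ltW.
  have : `|X p k| <= B * (6 * (A * h)) by apply: le_trans (mx_norm_entry _ _ _) XB.
  rewrite mxE => H4; apply: (le_trans H4).
  have -> : C * \sum_s0 `|F s0 y| = h + B * (6 * (A * h)) by rewrite /C -/h; ring.
  by rewrite lerDr.
have cF k : Ck_on 1 (ball u0 r) (F k) by apply: Ck_on_sub (sF k 1%N) => y /Hr [].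
have F0 k : F k u0 = 0 by case: k => [k|[i k]] /=; rewrite ?Y0 ?mxE ?DY0.
have := gronwall (@ball_open _ _ u0 r) (ballxx _ r0) cF C0 HD F0.
apply: filterS => y Hy; apply/rowP => k; rewrite mxE; exact: (Hy (inl k)).
Qed.

End killing.

(** * Fundamental fields of the action in a chart and Killing's equation *)

Section fields.
Context {R : realType} {d m : nat} {G : lieGroupType R d} {M : manifoldType R m}.
Variable act : G -> M -> M.
Hypothesis act_smooth : smooth_action act.
Variable c0 : chart R d G.
Hypotheses (ac0 : atlas c0) (c01 : cdom c0 (1%g : G)).
Local Notation a0 := (cmap c0 (1%g : G)).
Local Notation der := (der_at c0 (1%g : G)).
Local Notation e_ i := (delta_mx 0 i : 'rV[R]_m).
Local Notation fund := (fund act c0).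
Implicit Types (v : 'rV[R]_d) (u : 'rV[R]_m).

Let a0c : cimg c0 a0. Proof. exact: cmap_img. Qed.
Let ca0 : cinv c0 a0 = (1%g : G). Proof. exact: cmapK. Qed.

Section action_chart.
Variables (c : chart R m M) (cG : chart R d G).
Hypotheses (ac : atlas c) (acG : atlas cG).

Definition actP (w : 'rV[R]_(m + d)) : M := act (cinv cG (rsubmx w)) (cinv c (lsubmx w)).
Definition actW : set 'rV[R]_(m + d) := pair_dom c cG `&` actP @^-1` cdom c.
Definition actK k (w : 'rV[R]_(m + d)) : R := cmap c (actP w) 0 k.

Lemma actP_into : smooth_into (pair_dom c cG) actP.
Proof. by apply: act_smooth_into; [|exact: pair_dom_open|exact: pair_into_r|exact: pair_into_l]. Qed.

Lemma actW_open : open actW.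
Proof. exact: (smooth_into_open (@pair_dom_open _ _ _ _ _ c cG) (@cdom_open _ _ _ c) actP_into). Qed.

Lemma actK_smooth k : smooth_on actW (actK k).
Proof.
have [_ /(_ c ac) H] := actP_into.
by have /(smooth_on_mxP _ actW_open) := H; apply.
Qed.

Lemma actP_row u a : actP (row_mx u a) = act (cinv cG a) (cinv c u).
Proof. by rewrite /actP row_mxKl row_mxKr. Qed.

Lemma actW_row u a : actW (row_mx u a) <->
  [/\ cimg c u, cimg cG a & cdom c (act (cinv cG a) (cinv c u))].
Proof.
by rewrite /actW /pair_dom /= row_mxKl row_mxKr; split=> [[[? ?]]|[? ? ?]]; rewrite /= ?actP_row.
Qed.

Lemma jacobian_loc u a i k : actW (row_mx u a) ->
  jacobian (loc act c (cinv cG a)) u i k = 'D_(e_ i) (fun y => actK k (row_mx y a)) u.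
Proof.
move=> /actW_row [cu ca caa].
have Wu : (cimg c `&` (fun u => act (cinv cG a) (cinv c u)) @^-1` cdom c) u by [].
have sl := @loc_smooth _ _ _ _ _ _ act_smooth _ ac (cinv cG a).
have ol := @loc_open _ _ _ _ _ _ act_smooth _ ac (cinv cG a).
have := mulmx_jacobian (e_ i) ol Wu sl; rewrite -rowE => /(congr1 (fun r : 'rV[R]_m => r 0 k)).
rewrite mxE => ->; rewrite derive_mx ?mxE; last exact: smooth_on_derivable sl Wu.
by apply: derive_ext => y; rewrite /actK actP_row.
Qed.

End action_chart.

Section killing_field.
Variable c : chart R m M.
Hypothesis ac : atlas c.
Local Notation W := (actW c c0).
Local Notation K := (actK c c0).

Definition field v u : 'rV[R]_m := \row_k 'D_v (fun a => K k (row_mx u a)) a0.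

Lemma W1 u : cimg c u -> W (row_mx u a0).
Proof. by move=> cu; apply/actW_row; rewrite ca0 (act1 act_smooth); split => //; exact: cinv_dom. Qed.

Lemma W1_preim : (fun u => row_mx u a0) @^-1` W = cimg c.
Proof. by apply/seteqP; split=> [u /actW_row[]|u /W1]. Qed.

Lemma field_coord_smooth v k : smooth_on (cimg c) (fun u => field v u 0 k).
Proof.
apply: smooth_on_ext (smooth_partial a0 v (actW_open ac ac0) (actK_smooth ac ac0 k)); first exact: W1_preim.
by move=> u; rewrite mxE.
Qed.

Lemma field_smooth v : smooth_on (cimg c) (field v).
Proof.
apply/(smooth_on_mxP _ (@cimg_open _ _ _ c)) => i j; rewrite ord1; exact: field_coord_smooth.
Qed.

Lemma derive_field v i k u : cimg c u ->
  'D_(e_ i) (fun u => field v u 0 k) u = 'D_v (fun a => 'D_(e_ i) (fun y => K k (row_mx y a)) u) a0.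
Proof.
move=> cu; rewrite -(partial_swap _ _ (actW_open ac ac0) (actK_smooth ac ac0 k) (W1 cu)).
by apply: derive_ext => y; rewrite mxE.
Qed.

Lemma fundE v f u : cimg c u -> smooth_fun f -> fund v f (cinv c u) = der_at c (cinv c u) (field v u) f.
Proof.
move=> cu sf; pose p a := act (cinv c0 a) (cinv c u).
have sp : smooth_into (cimg c0) p.
  by apply: act_smooth_into; [|exact: cimg_open|exact: smooth_into_cinv|exact: smooth_into_cst].
have p1 : p a0 = cinv c u by rewrite /p ca0 (act1 act_smooth).
have cp : cdom c (p a0) by rewrite p1; exact: cinv_dom.
have := der_chain v (@cimg_open _ _ _ c0) a0c sp ac cp sf; rewrite p1.
have -> : 'D_v (cmap c \o p) a0 = field v u.
  have [_ /(_ c ac) sc] := sp.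
  rewrite derive_mx; last by apply: smooth_on_derivable sc _; split.
  apply/rowP => k; rewrite !mxE.
  by apply: derive_ext => a; rewrite /actK actP_row.
by move=> <-.
Qed.

Variable g : gram_field (M := M).
Hypothesis g_lorentz : lorentz_metric g.
Hypothesis act_isometric : forall a : G, preserves_gram g (act a).

Lemma gram_smooth : smooth_on (cimg c) (g c).
Proof. by have [_ H _ _] := g_lorentz; exact: H. Qed.

Lemma gram_lorentz u : cimg c u -> lorentz_form (g c u).
Proof. by move=> cu; have [_ _ H _] := g_lorentz; exact: H. Qed.

(** The isometry equation of [act a] is differentiated at a = 1 along the chart line s |-> s v + a0,
    whose tangent is [v]. The Jacobian is the identity at s = 0, with derivative [DY], and the
    moving base point contributes the derivative [G'] of the metric along the field. *)
Lemma field_killing v u : cimg c u ->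
  let DY : 'M[R]_m := \matrix_(i, k) 'D_(e_ i) (fun u => field v u 0 k) u in
  let G' : 'M[R]_m := \matrix_(i, j) 'D_(field v u) (fun u => g c u i j : R) u in
  DY *m g c u + G' + g c u *m DY^T = 0.
Proof.
move=> cu DY G'.
have oW := actW_open ac ac0.
pose al (s : R) := s *: v + a0.
have al0 : al 0 = a0 by rewrite /al scale0r add0r.
have cal : {for (0 : R), continuous (fun s => row_mx u (al s))}.
  have ca : {for (0 : R), continuous al}.
    by apply: continuousD; [exact: scalel_continuous|exact: cst_continuous].
  exact: (@continuous_comp _ _ _ al (fun a => row_mx u a) _ ca (@row_mx_contr _ _ _ u (al 0))).
have nW : \forall s \near (0 : R), W (row_mx u (al s)).
  have h : nbhs (row_mx u (al 0)) W by rewrite al0; apply: open_nbhs_nbhs; split => //; exact: W1.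
  exact: (cal _ h).
have line (K' : 'rV[R]_(m + d) -> R) : smooth_on W K' ->
    is_derive (0 : R^o) 1 (fun s : R^o => K' (row_mx u (al s)) : R^o) ('D_v (fun a => K' (row_mx u a)) a0).
  move=> sK; have dK : derivable (fun a => K' (row_mx u a)) (0 *: v + a0) v.
    rewrite scale0r add0r.
    have sA := smooth_on_affine (@row_mx_linr _ _ _ u) (@row_mx_contr _ _ _ u) sK.
    have Wu : (row_mx u @^-1` W) a0 by exact: W1.
    exact: (smooth_on_derivable sA Wu).
  have := is_derive_line dK; rewrite scale0r add0r.
  by [].
pose Jf (s : R) : 'M[R]_m := \matrix_(i, k) 'D_(row_mx (e_ i) 0) (K k) (row_mx u (al s)).
have JfE s : W (row_mx u (al s)) -> Jf s = jacobian (loc act c (cinv c0 (al s))) u.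
  move=> Ws; apply/matrixP => i k; rewrite jacobian_loc // mxE.
  by rewrite (@derive_affine _ _ _ _ (fun y => row_mx y (al s)) (fun w => row_mx w 0) (K k) u (e_ i) (@row_mx_linl _ _ _ (al s))).
have dJ : is_derive (0 : R^o) 1 (Jf : R^o -> _) DY.
  apply/is_derive_mxP => i k; rewrite mxE derive_field //.
  have sD := smooth_on_derive (row_mx (e_ i) 0) (actK_smooth ac ac0 k).
  have := line _ sD.
  rewrite (_ : 'D_v _ a0 = 'D_v (fun a => 'D_(e_ i) (fun y => K k (row_mx y a)) u) a0); last first.
    apply: derive_ext => a.
    by rewrite (@derive_affine _ _ _ _ (fun y => row_mx y a) (fun w => row_mx w 0) (K k) u (e_ i) (@row_mx_linl _ _ _ a)).
  rewrite (_ : (fun s : R^o => Jf s i k) = (fun s : R^o => ('D_(row_mx (e_ i) 0) (K k)) (row_mx u (al s)))) //.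
  by apply/funext => s; rewrite mxE.
pose F (s : R) : 'rV[R]_m := \row_k K k (row_mx u (al s)).
have FE s : F s = loc act c (cinv c0 (al s)) u.
  by apply/rowP => k; rewrite mxE /actK actP_row.
have F0 : F 0 = u by rewrite FE al0 ca0 /loc /= (act1 act_smooth) cinvK.
have dF : is_derive (0 : R^o) 1 (F : R^o -> _) (field v u).
  apply/is_derive_mxP => i k; rewrite ord1 mxE.
  have := line _ (actK_smooth ac ac0 k).
  rewrite (_ : (fun s : R^o => F s 0 k) = (fun s : R^o => K k (row_mx u (al s)))) //.
  by apply/funext => s; rewrite mxE.
have dG : is_derive (0 : R^o) 1 (fun s : R^o => g c (F s)) G'.
  apply/is_derive_mxP => i j; rewrite mxE.
  have sg : smooth_on (cimg c) (fun u => g c u i j : R).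
    by have /(smooth_on_mxP _ (@cimg_open _ _ _ c)) := gram_smooth; apply.
  have cF0 : cimg c (F 0) by rewrite F0.
  have := is_derive_curve (@cimg_open _ _ _ c) cF0 (sg 1%N) dF.
  by rewrite F0.
have J0 : Jf 0 = 1%:M.
  rewrite JfE; last by rewrite al0; exact: W1.
  rewrite al0 ca0; apply: mulmx_ext => w; rewrite mulmx1.
  have Wu : (cimg c `&` (fun u => act 1%g (cinv c u)) @^-1` cdom c) u.
    by split => //=; rewrite (act1 act_smooth); exact: cinv_dom.
  rewrite (mulmx_jacobian w (@loc_open _ _ _ _ _ _ act_smooth _ ac 1%g) Wu (@loc_smooth _ _ _ _ _ _ act_smooth _ ac 1%g)).
  have nE : \forall y \near u, id y = loc act c 1%g y.
    apply: filterS (open_nbhs_nbhs (conj (@cimg_open _ _ _ c) cu)) => y cy.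
    by rewrite /loc /= (act1 act_smooth) cinvK.
  by rewrite -(near_eq_derive w nE) derive_id.
have iso : \forall s \near (0 : R), cst (g c u) s = Jf s *m g c (F s) *m (Jf s)^T.
  apply: filterS nW => s Ws; rewrite JfE // FE.
  have /actW_row[_ _ cs] := Ws.
  by have /= -> := @act_isometric (cinv c0 (al s)) _ _ ac ac _ cu cs.
have dT := is_derive_near iso (@is_derive_cst _ _ _ (g c u) (0 : R^o) 1).
have := is_derive_unique (is_derive_mulmx (is_derive_mulmx dJ dG) (is_derive_trmx dJ)) dT.
by rewrite J0 F0 !(mul1mx, mulmx1, trmx1).
Qed.

Lemma field_zero_near v u0 : cimg c u0 -> field v u0 = 0 ->
  (forall i k, 'D_(e_ i) (fun u => field v u 0 k) u0 = 0) -> \forall u \near u0, field v u = 0.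
Proof.
move=> cu0 Y0 DY0.
apply: (killing_zero (@cimg_open _ _ _ c) gram_smooth (field_smooth v)) => //.
- by move=> u /gram_lorentz [].
- move=> u /gram_lorentz [_ [P Pu PE]].
  have : P *m g c u *m P^T \in unitmx by rewrite PE sig_unit.
  by rewrite !unitmx_mul => /andP[/andP[]].
move=> u i j cu; have /= /matrixP/(_ i j) := field_killing v cu.
rewrite mxE [X in X + _]mxE !mxE => E; rewrite -[RHS]E addrAC; congr (_ + _ + _).
- by apply: eq_bigr => k _; rewrite mxE.
- by apply: eq_bigr => k _; rewrite !mxE.
have sg : smooth_on (cimg c) (fun u => g c u i j : R).
  by have /(smooth_on_mxP _ (@cimg_open _ _ _ c)) := gram_smooth; apply.
by rewrite (C1_derive_sum _ (@cimg_open _ _ _ c) cu (sg 1%N)).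
Qed.

End killing_field.
End fields.

Lemma continuous_zero_closure (R : realType) (T : topologicalType) (h : T -> R) (A : set T) x :
  {for x, continuous h} -> closure A x -> (\forall y \near x, A y -> h y = 0) -> h x = 0.
Proof.
move=> ch clx nx; apply/eqP; apply: contrapT => /negP hx.
have hx0 : 0 < `|h x| by rewrite normr_gt0.
have [y [Ay [ny dy]]] := clx _ (near_and nx (near_dist ch hx0)).
by move: dy; rewrite (ny Ay) subr0 ltxx.
Qed.

(** * Propagation of the vanishing of all fundamental fields *)

Section null.
Context {R : realType} {d m : nat} {G : lieGroupType R d} {M : manifoldType R m}.
Hypothesis G_connected : connected [set: G].
Variable act : G -> M -> M.
Hypothesis act_smooth : smooth_action act.
Variable c0 : chart R d G.
Hypotheses (ac0 : atlas c0) (c01 : cdom c0 (1%g : G)).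
Local Notation a0 := (cmap c0 (1%g : G)).
Local Notation der := (der_at c0 (1%g : G)).
Local Notation e_ i := (delta_mx 0 i : 'rV[R]_m).
Local Notation d_ i := (delta_mx 0 i : 'rV[R]_d).
Local Notation fund := (fund act c0).
Local Notation field := (field act c0).
Variable g : gram_field (M := M).
Hypothesis g_lorentz : lorentz_metric g.
Hypothesis act_isometric : forall a : G, preserves_gram g (act a).
Implicit Types (v : 'rV[R]_d) (u : 'rV[R]_m) (y z : M).

Definition null_at y := forall v f, smooth_fun f -> fund v f y = 0.

Lemma null_field (c : chart R m M) u : atlas c -> cimg c u ->
  null_at (cinv c u) <-> forall l, field c (d_ l) u = 0.
Proof.
move=> ac cu; split=> [H l|H v f sf].
  have [phi [sphi dphi _]] := ex_coord_fun ac (cinv_dom cu).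
  apply/rowP => i; rewrite -(dphi (field c (d_ l) u)) -(fundE act_smooth ac0 c01 ac _ cu (sphi i)).
  by rewrite H // mxE.
have := der_at_lin ac0 c01 v (orbit_fun_smooth act_smooth (cinv c u) sf).
rewrite -[LHS]/(fund v f (cinv c u)) => ->.
apply: big1 => l _; rewrite [der_at _ _ _ _](_ : _ = fund (d_ l) f (cinv c u)) //.
by rewrite (fundE act_smooth ac0 c01 ac _ cu sf) H /der_at derive0 mulr0.
Qed.

Lemma null_near (c : chart R m M) z : atlas c -> cdom c z -> null_at z ->
  (forall l i k, 'D_(e_ i) (fun u => field c (d_ l) u 0 k) (cmap c z) = 0) ->
  \forall y \near z, null_at y.
Proof.
move=> ac cz nz DY.
have cu := cmap_img cz.
have Y0 : forall l, field c (d_ l) (cmap c z) = 0.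
  by apply/null_field => //; rewrite cmapK.
have H : \forall u \near cmap c z, forall l, field c (d_ l) u = 0.
  apply: near_forall => l.
  exact: (field_zero_near act_smooth ac0 c01 ac g_lorentz act_isometric cu (Y0 l) (DY l)).
have Hz := cmap_cont cz H.
apply: filterS2 (open_nbhs_nbhs (conj (@cdom_open _ _ _ c) cz)) Hz => y cy Hy.
by rewrite -(cmapK cy); apply/null_field => //; exact: cmap_img.
Qed.

(** The interior of the set of common zeros is also closed: the fields and their first derivatives
    vanish on it, hence at points of its closure by continuity, and there [null_near] applies. *)
Lemma null_everywhere (x : M) : connected [set: M] -> (\forall y \near x, null_at y) -> forall y, null_at y.
Proof.
move=> cM nx; pose Om : set M := fun z => \forall y \near z, null_at y.
suff OmT : Om = setT.
  move=> y; have h : Om y by rewrite OmT.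
  exact: (nbhs_singleton h).
apply: connected_clopen => //; first by exists x.
  rewrite openE => z /nbhs_interior h; exact: h.
apply: closed_openC => z clz.
have [c ac cz] := atlas_cover z.
have nc := open_nbhs_nbhs (conj (@cdom_open _ _ _ c) cz).
have near_u y : cdom c y -> Om y -> \forall u \near cmap c y, forall l, field c (d_ l) u = 0.
  move=> cy Oy; have cu := cmap_img cy.
  have Oy' : nbhs (cinv c (cmap c y)) [set y | null_at y] by rewrite cmapK.
  apply: filterS2 (open_nbhs_nbhs (conj (@cimg_open _ _ _ c) cu)) (cinv_cont cu Oy') => u cu' nu.
  by apply/null_field.
have zero (h : 'rV[R]_m -> R) : smooth_on (cimg c) h ->
    (forall u, (\forall u' \near u, forall l, field c (d_ l) u' = 0) -> h u = 0) -> h (cmap c z) = 0.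
  move=> sh Hh.
  have ch : {for z, continuous (h \o cmap c)}.
    by apply: continuous_comp; [exact: cmap_cont|apply: (sh 0%N); exact: cmap_img].
  apply: (continuous_zero_closure ch clz).
  by apply: filterS nc => y cy Oy; apply: Hh; exact: near_u.
have sY l k : smooth_on (cimg c) (fun u => field c (d_ l) u 0 k).
  exact: (field_coord_smooth act_smooth ac0 c01 ac).
apply: (null_near ac cz).
  rewrite -(cmapK cz); apply/null_field => //; first exact: cmap_img.
  move=> l; apply/rowP => k; rewrite [RHS]mxE.
  apply: (zero (fun u => field c (d_ l) u 0 k) (sY l k)) => u nu.
  by rewrite (nbhs_singleton nu) mxE.
move=> l i k; apply: (zero ('D_(e_ i) (fun u => field c (d_ l) u 0 k))); first exact: smooth_on_derive.
move=> u nu.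
have nE : \forall u' \near u, cst 0 u' = field c (d_ l) u' 0 k.
  by apply: filterS nu => u' ->; rewrite mxE.
by rewrite -(near_eq_derive _ nE) derive_cst.
Qed.

(** Vanishing at the single point [y] gives zero derivative of a |-> f(a y) at every z, by replacing
    f with its composite with [act z]. *)
Lemma orbit_cst y : null_at y -> forall a, act a y = y.
Proof.
move=> ny a; rewrite -[RHS](act1 act_smooth).
apply: (@zero_lder_cst R d G c0 ac0 c01 m M (fun a => act a y) G_connected) => [c ac|k z w sk].
  by apply: act_smooth_into => //; [exact: cimg_open|exact: smooth_into_cinv|exact: smooth_into_cst].
apply: etrans (ny w _ (act_fun_smooth act_smooth z sk)).
by apply: der_ext => b; rewrite (actM act_smooth).
Qed.

End null.

(** * The isotropy representation at a fixed point *)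

Section fixed_point.
Context {R : realType} {n d m : nat} {G : lieGroupType R d} {M : manifoldType R m}.
Hypothesis n6 : (6 <= n)%N.
Hypothesis G_connected : connected [set: G].
Local Notation N := (2 + n)%N.
Local Notation J := (signature_mx 2 N : 'M[R]_N).
Local Notation so := (so_set J).
Variable act : G -> M -> M.
Hypothesis act_smooth : smooth_action act.
Variable c0 : chart R d G.
Hypotheses (ac0 : atlas c0) (c01 : cdom c0 (1%g : G)).
Local Notation a0 := (cmap c0 (1%g : G)).
Local Notation der := (der_at c0 (1%g : G)).
Local Notation lder := (lder c0).
Variable psi : 'I_d -> G -> R.
Hypothesis psiE : forall D f, point_derivation (1%g : G) D -> smooth_fun f ->
  D f = der_at c0 1%g (\row_i D (psi i)) f.
Local Notation lbr := (lbr c0 psi).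
Variable om : {linear 'rV[R]_d -> 'M[R]_N}.
Variable omi : {linear 'M[R]_N -> 'rV[R]_d}.
Hypothesis omK : cancel om omi.
Hypothesis om_so : forall v, so (om v).
Hypothesis omiK : forall A, so A -> om (omi A) = A.
Hypothesis om_lbr : forall v w, om (lbr v w) = mx_bracket (om v) (om w).
Variable g : gram_field (M := M).
Hypothesis g_lorentz : lorentz_metric g.
Hypothesis act_isometric : forall a : G, preserves_gram g (act a).
Local Notation e_ i := (delta_mx 0 i : 'rV[R]_m).
Local Notation field := (field act c0).
Variables (c : chart R m M) (x : M).
Hypotheses (ac : atlas c) (cx : cdom c x) (nx : null_at act c0 x).
Local Notation ux := (cmap c x).
(* [rho] is a variable so that simplification of matrix entries does not unfold jacobians. *)
Variable rho : G -> 'M[R]_m.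
Hypothesis rhoE : forall a, rho a = jacobian (loc act c a) ux.
Local Notation S := (g c ux).

Let fixed a : act a x = x. Proof. exact: (orbit_cst G_connected act_smooth ac0 c01 nx a). Qed.
Let cux : cimg c ux. Proof. exact: cmap_img. Qed.

Lemma isotropy_mul a b : rho (a * b)%g = rho b *m rho a.
Proof.
have [phi [sphi dphi _]] := ex_coord_fun ac cx.
have D k v f : smooth_fun f -> der_at c x v (fun z => f (act k z)) = der_at c x (v *m rho k) f.
  by move=> sf; rewrite rhoE (act_der act_smooth ac) ?fixed.
apply: mulmx_ext => v; apply/rowP => i; rewrite mulmxA -[LHS]dphi -[RHS]dphi.
rewrite -(D _ _ _ (sphi i)) -(D _ _ _ (sphi i)) -(D _ _ _ (act_fun_smooth act_smooth a (sphi i))).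
by apply: der_ext => z; rewrite (actM act_smooth).
Qed.

Lemma isotropy_smooth i k : smooth_fun (fun a => rho a i k).
Proof.
move=> cG acG.
have sK := smooth_on_derive (row_mx (e_ i) 0) (actK_smooth act_smooth ac acG k).
have := smooth_on_affine (@row_mx_linr _ _ _ ux) (@row_mx_contr _ _ _ ux) sK.
have Wa a : cimg cG a -> actW act c cG (row_mx ux a).
  by move=> ca; apply/actW_row; rewrite cmapK // fixed.
rewrite (_ : _ @^-1` _ = cimg cG); last first.
  by apply/seteqP; split=> [a /actW_row[]|a /Wa].
apply: smooth_on_eq; first exact: cimg_open.
move=> a /Wa Wx /=; rewrite rhoE (jacobian_loc act_smooth ac _ _ Wx).
by rewrite (@derive_affine _ _ _ _ (fun y => row_mx y a) (fun w => row_mx w 0) _ ux (e_ i) (@row_mx_linl _ _ _ a)).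
Qed.

Definition isot v : 'M[R]_m := \matrix_(i, k) der v (fun a => rho a i k).

Lemma isot_field v i k : 'D_(e_ i) (fun u => field c v u 0 k) ux = isot v i k.
Proof.
rewrite (derive_field act_smooth ac0 c01 ac _ _ _ cux) mxE.
have a0c := cmap_img c01.
apply: near_eq_derive; apply: filterS (open_nbhs_nbhs (conj (@cimg_open _ _ _ c0) a0c)) => a ca /=.
rewrite rhoE (jacobian_loc act_smooth ac) //; apply/actW_row; by rewrite cmapK // fixed.
Qed.

Lemma isot_is_linear : linear isot.
Proof.
move=> k v w; apply/matrixP => i j; rewrite !mxE.
by have := lder_lin ac0 c01 k v w 1%g (isotropy_smooth i j); rewrite !lder1.
Qed.

Lemma isot_lder v i j a : lder v (fun b => rho b i j) a = \sum_k isot v i k * rho a k j.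
Proof.
rewrite lderE (_ : der v _ = der v (fun b => \sum_k rho b i k * rho a k j)); last first.
  by apply: der_ext => b; rewrite isotropy_mul mxE.
have dk k : derivable ((fun b => rho b i k) \o cinv c0) a0 v.
  by apply: (der_at_derivable ac0 c01); exact: isotropy_smooth.
have dc k : derivable (fun _ : 'rV[R]_d => rho a k j) a0 v by exact: derivable_cst.
have [_ E] := derive_sum_mul dk dc.
rewrite /der_at [LHS]E; apply: eq_bigr => k _; rewrite mxE derive_cst mulr0 addr0.
by [].
Qed.

(** The matrices [rho] act on rows and reverse products, so [isot] reverses brackets; minus [isot]
    is the homomorphism to which [rep_trivial] is applied. *)
Lemma isot_lbr v w : isot (lbr v w) = isot w *m isot v - isot v *m isot w.
Proof.
have der_mul u (A : 'M[R]_m) i j :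
    der u (fun a => \sum_k A i k * rho a k j) = (A *m isot u) i j.
  have dk k : derivable ((fun b => rho b k j) \o cinv c0) a0 u.
    by apply: (der_at_derivable ac0 c01); exact: isotropy_smooth.
  have dc k : derivable (fun _ : 'rV[R]_d => A i k) a0 u by exact: derivable_cst.
  have [_ E] := derive_sum_mul dc dk.
  rewrite /der_at [LHS]E mxE; apply: eq_bigr => k _; rewrite mxE derive_cst mul0r add0r.
  by [].
apply/matrixP => i j; rewrite mxE -lder1 (lbrE ac0 c01 psiE); last exact: isotropy_smooth.
rewrite !lder1.
have E u : lder u (fun b => rho b i j) = (fun a => \sum_k isot u i k * rho a k j).
  by apply/funext => a; exact: isot_lder.
by rewrite !E !der_mul; move: (isot w *m isot v) (isot v *m isot w) => P P'; rewrite !mxE.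
Qed.

(** Skewness of [isot] for the form at [x] is Killing's equation there: the term differentiating the
    metric disappears because the field vanishes at [x]. *)
Lemma isot_zero v : isot v = 0.
Proof.
have lS : lorentz_form S by exact: gram_lorentz.
have St : S^T = S by have [] := lS.
have [s sE] : exists s : {linear 'M[R]_N -> 'M[R]_m}, forall A, s A = - isot (omi A).
  apply: (@ex_linear _ _ _ (fun A => - isot (omi A))) => k A B.
  by rewrite linearP isot_is_linear opprD scalerN.
have s_br A B : so A -> so B -> s (mx_bracket A B) = mx_bracket (s A) (s B).
  move=> hA hB; rewrite !sE.
  have -> : omi (mx_bracket A B) = lbr (omi A) (omi B) by rewrite -[RHS]omK om_lbr !omiK.
  rewrite isot_lbr; move: (isot (omi A)) (isot (omi B)) => P P'.
  by rewrite opprB /mx_bracket !mulNmx !mulmxN !opprK.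
have s_skew A : so A -> s A *m S + S *m (s A)^T = 0.
  move=> hA; rewrite sE.
  have Y0 : field c (omi A) ux = 0.
    have [phi [sphi dphi _]] := ex_coord_fun ac cx.
    apply/rowP => i; apply: etrans (esym (dphi _ _)) _.
    have := fundE act_smooth ac0 c01 ac (omi A) cux (sphi i); rewrite cmapK // => <-.
    by rewrite nx // mxE.
  have E : isot (omi A) *m S + 0 + S *m (isot (omi A))^T = 0.
    have := field_killing act_smooth ac0 c01 ac g_lorentz act_isometric (omi A) cux.
    have E1 : \matrix_(i, k) 'D_(e_ i) (fun u => field c (omi A) u 0 k) ux = isot (omi A).
      by apply/matrixP => i k; rewrite [LHS]mxE isot_field.
    have E2 : \matrix_(i, j) 'D_(field c (omi A) ux) (fun u => g c u i j : R) ux = 0 :> 'M[R]_m.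
      by apply/matrixP => i k; rewrite !mxE Y0 derive0.
    by cbv zeta; rewrite E1 E2.
  rewrite addr0 in E; move: E; move: (isot (omi A)) => P E.
  by rewrite [(- _)^T]linearN /= mulNmx mulmxN -opprD E oppr0.
have := rep_trivial n6 St (lorentz_iso1 lS) s_br s_skew (om_so v).
by rewrite sE omK => /eqP; rewrite oppr_eq0 => /eqP.
Qed.

Lemma fixed_point_trivial : connected [set: M] -> forall a y, act a y = y.
Proof.
move=> cM a y; apply: (orbit_cst G_connected act_smooth ac0 c01).
have nnx : \forall z \near x, null_at act c0 z.
  apply: (null_near act_smooth ac0 c01 g_lorentz act_isometric ac cx nx) => l i k.
  by rewrite isot_field isot_zero mxE.
exact: (null_everywhere act_smooth ac0 c01 g_lorentz act_isometric cM nnx y).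
Qed.

End fixed_point.

(** * The stabilizer algebra *)

Section lorentz_block.
Context {R : realType} {n : nat}.
Local Notation N := (1 + (1 + n))%N.
Local Notation J := (signature_mx 2 N : 'M[R]_N).
Local Notation J1 := (signature_mx 1 (1 + n) : 'M[R]_(1 + n)).
Local Notation so := (so_set J).
Local Notation so1 := (so_set J1).
Local Notation e0 := (row_mx 1%:M 0 : 'rV[R]_(1 + (1 + n))).
Implicit Types (B : 'M[R]_(1 + n)).

(** The sizes [2 + n] and [1 + (1 + n)] are convertible; the second form splits off one negative
    direction, whose stabilizer in o(2,n) consists of these block matrices. *)
Definition emb B : 'M[R]_(1 + (1 + n)) := block_mx 0 0 0 B.

Lemma signature_block : signature_mx 2 (1 + (1 + n)) = block_mx (- 1%:M) 0 0 J1 :> 'M[R]_(1 + (1 + n)).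
Proof.
apply/matrixP => i j; case: (split_ordP i) => a ->; case: (split_ordP j) => b ->;
  rewrite ?(block_mxEul, block_mxEur, block_mxEdl, block_mxEdr) !mxE.
- by rewrite !ord1 !eqxx.
- by rewrite eq_lrshift mulr0n.
- by rewrite eq_rlshift mulr0n.
- rewrite eq_rshift; case: eqP => [->|] //=.
Qed.

Lemma emb_so B : so (emb B) <-> so1 B.
Proof.
rewrite /so_set /= signature_block.
rewrite /emb tr_block_mx !mulmx_block !trmx0 !mul0mx !mulmx0 !addr0 !add0r add_block_mx !addr0.
split=> [/(congr1 drsubmx)|->]; last by rewrite block_mx0.
by rewrite block_mxKdr => ->; apply/matrixP => i j; rewrite !mxE.
Qed.

Lemma stab_block (A : 'M[R]_N) : so A -> A *m e0^T = 0 -> A = emb (drsubmx A).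
Proof.
move=> hA Ae.
have e0J : e0 *m J = - e0.
  by rewrite signature_block mul_row_block !mul0mx !mulmx0 !addr0 mul1mx opp_row_mx oppr0.
have eA : e0 *m A = 0.
  have := congr1 (mulmx e0) hA; rewrite mulmxDr mulmx0 !mulmxA e0J.
  have -> : e0 *m A^T = 0 by rewrite -[LHS]trmxK trmx_mul trmxK Ae trmx0.
  by rewrite mul0mx add0r mulNmx => /eqP; rewrite oppr_eq0 => /eqP.
move: Ae eA; rewrite -{1 2}[A]submxK tr_row_mx trmx0 trmx1 mul_block_col mul_row_block.
rewrite !mulmx1 !mulmx0 !mul1mx !mul0mx !addr0 => /eqP; rewrite col_mx_eq0 => /andP[/eqP h1 /eqP h2].
move=> /eqP; rewrite row_mx_eq0 => /andP[_ /eqP h3].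
by rewrite -{1}[A]submxK h1 h2 h3.
Qed.

Lemma bf_e0 : bf J e0 e0 = -1.
Proof.
rewrite /bf signature_block mul_row_block !mul0mx !mulmx0 !addr0 mul1mx tr_row_mx mul_row_col.
by rewrite trmx0 mul0mx addr0 trmx1 mulmx1 !mxE.
Qed.

Lemma emb_e0 B : emb B *m e0^T = 0.
Proof. by rewrite /emb tr_row_mx trmx0 trmx1 mul_block_col !mul0mx !mulmx0 !addr0 col_mx0. Qed.

Lemma emb_br B B' : mx_bracket (emb B) (emb B') = emb (mx_bracket B B').
Proof.
rewrite /mx_bracket /emb !mulmx_block !mul0mx !mulmx0 !addr0 !add0r.
by rewrite opp_block_mx add_block_mx !oppr0 !addr0.
Qed.

Lemma one_parameter_derive p (gamma : R -> 'M[R]_p) (A : 'M[R]_p) (t : R) : (forall s t, gamma (s + t) = gamma s *m gamma t) ->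
  is_derive (0 : R^o) 1 (gamma : R^o -> _) A -> is_derive (t : R^o) 1 (gamma : R^o -> _) (gamma t *m A).
Proof.
move=> gM dg.
have H : is_derive (0 : R^o) 1 (fun h : R^o => gamma (h + t)) (gamma t *m A).
  have := is_derive_mulmxl (gamma t) dg.
  rewrite (_ : (fun s : R^o => gamma t *m gamma s) = (fun h : R^o => gamma (h + t))) //.
  by apply/funext => h; rewrite addrC gM.
exact: (is_derive_translate H).
Qed.

(** The one-parameter group of [emb B] in O(2,n) fixes the first basis vector, because [emb B] kills
    it. By orthogonality it is block diagonal, and its lower block is the required one-parameter
    group in O(1,n). *)
Lemma so1_lie_o B : (forall A, so A -> @lie_o R 2 n A) -> so1 B -> @lie_o R 1 n B.
Proof.
move=> soL hB; have [gamma [g0 gM dg gO]] := soL _ ((emb_so B).2 hB).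
pose ga (t : R) : 'M[R]_N := gamma t.
have ga0 : ga 0 = 1%:M by exact: g0.
have gaM s t : ga (s + t) = ga s *m ga t by exact: gM.
have dga : is_derive (0 : R^o) 1 (ga : R^o -> _) (emb B) by exact: dg.
have ge t : ga t *m e0^T = e0^T.
  have dz s : is_derive (s : R^o) 1 (fun s : R^o => ga s *m e0^T) 0.
    have := is_derive_mulmxr e0^T (one_parameter_derive s gaM dga).
    by rewrite -mulmxA [X in _ *m X]emb_e0 mulmx0.
  apply/matrixP => i j.
  have dij (s : R) : is_derive (s : R^o) 1 (fun s : R^o => (ga s *m e0^T) i j : R^o) 0.
    by have /is_derive_mxP /(_ i j) := dz s; rewrite mxE.
  rewrite (@is_derive_0_is_cst R (fun s => (ga s *m e0^T) i j) t 0 dij).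
  by rewrite ga0 mul1mx.
have JE : J = block_mx (- 1%:M) 0 0 J1 by exact: signature_block.
have gaJ t : (ga t)^T *m J *m ga t = J by exact: gO.
have e0J : e0 *m J = - e0.
  by rewrite JE mul_row_block !mul0mx !mulmx0 !addr0 mul1mx opp_row_mx oppr0.
have eg t : e0 *m ga t = e0.
  have := congr1 (mulmx e0) (gaJ t); rewrite !mulmxA.
  have -> : e0 *m (ga t)^T = e0 by rewrite -[LHS]trmxK trmx_mul trmxK ge trmxK.
  by rewrite e0J mulNmx => /eqP; rewrite eqr_opp => /eqP.
pose de t := drsubmx (ga t).
have gaE t : ga t = block_mx 1%:M 0 0 (de t).
  have := ge t; have := eg t.
  rewrite -{1 2}[ga t]submxK tr_row_mx trmx0 trmx1 mul_block_col mul_row_block.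
  rewrite !mulmx1 !mulmx0 !mul1mx !mul0mx !addr0 => /eq_row_mx[h1 h2] /eq_col_mx[_ h3].
  by rewrite -{1}[ga t]submxK h1 h2 h3.
exists de; split.
- by apply/matrixP => i j; rewrite /de ga0 !mxE eq_rshift.
- move=> s t; have := gaM s t; rewrite !gaE mulmx_block !mul0mx !mulmx0 !addr0 !add0r => /(congr1 drsubmx).
  by rewrite !block_mxKdr.
- have := is_derive_linmx (L := @drsubmx R 1 (1 + n) 1 (1 + n)) _ dga.
  have lin : linear (@drsubmx R 1 (1 + n) 1 (1 + n)) by move=> k X Y; apply/matrixP => i j; rewrite !mxE.
  by move=> /(_ lin); rewrite /emb block_mxKdr.
- move=> t; have := gaJ t; rewrite gaE JE tr_block_mx !mulmx_block !trmx0 !trmx1.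
  rewrite !mul0mx !mulmx0 !addr0 !add0r => /(congr1 drsubmx).
  by rewrite !block_mxKdr.
Qed.

End lorentz_block.

Section householder.
Context {R : realType} {n : nat}.
Local Notation N := (2 + n)%N.
Local Notation J := (signature_mx 2 N : 'M[R]_N).
Local Notation "<< a , b >>" := (bf J a b) (a at level 10, b at level 10).
Implicit Types (a b w : 'rV[R]_N).

Let Jt := @sigT R 2 N.

Definition refl w : 'M[R]_N := 1%:M - (2 / << w, w >>) *: (w^T *m w *m J).

Lemma reflE w a : refl w *m a^T = (a - (2 * << a, w >> / << w, w >>) *: w)^T.
Proof.
rewrite /refl mulmxBl mul1mx linearB /= linearZ /= -scalemxAl; congr (_ - _).
have -> : w^T *m w *m J *m a^T = << w, a >> *: w^T.
  by rewrite -!mulmxA [w *m _]mx11_scalar mul_mx_scalar /bf mulmxA.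
by rewrite scalerA (bfC w a Jt) mulrAC.
Qed.

Lemma refl_O w : << w, w >> != 0 -> Ogrp (refl w).
Proof.
move=> w0; rewrite /Ogrp /indefinite_orthogonal_group /=.
have -> : (refl w)^T = 1%:M - (2 / << w, w >>) *: (J *m (w^T *m w)).
  by rewrite /refl linearB /= linearZ /= trmx1 !trmx_mul trmxK Jt.
rewrite /refl; set k := 2 / _; set P := w^T *m w.
have PJP : P *m J *m P = << w, w >> *: P.
  rewrite /P -!mulmxA (mulmxA w) (mulmxA (w *m J)) [w *m J *m w^T]mx11_scalar.
  by rewrite mul_scalar_mx -scalemxAr.
have E1 : J *m P *m J *m (P *m J) = << w, w >> *: (J *m P *m J).
  have -> : J *m P *m J *m (P *m J) = J *m (P *m J *m P) *m J.
    by clear; clearbody P; rewrite !mulmxA.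
  by rewrite PJP -scalemxAr -scalemxAl.
have kq : k * << w, w >> = 2 by rewrite /k mulfVK.
clearbody P k; rewrite mulmxBl mul1mx mulmxBr mulmx1 -!scalemxAl -!scalemxAr mulmxBl -!scalemxAl.
rewrite E1 mulmxA scalerA kq.
by move: (J *m P *m J) => X; apply/matrixP => i j; rewrite !mxE; ring.
Qed.

(** With r^2 = -<e,e>, the reflections in e - r a and e + r a send [e] to r a and -r a. The squares
    of these two vectors add up to 4 <e,e>, which is not zero, so at least one of them is not
    isotropic. *)
Lemma ex_refl e a : << e, e >> < 0 -> << a, a >> = -1 ->
  exists2 c, @Ogrp R n c & exists2 k, k != 0 & c *m e^T = k *: a^T.
Proof.
move=> ee aa; pose r := Num.sqrt (- << e, e >>).
have r0 : 0 < r by rewrite sqrtr_gt0 oppr_gt0.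
have rr : r * r = - << e, e >> by rewrite -expr2 sqr_sqrtr // oppr_ge0 ltW.
have [w0|w0] := eqVneq << e - r *: a, e - r *: a >> 0; last first.
  exists (refl (e - r *: a)); first exact: refl_O.
  exists r; first by rewrite gt_eqF.
  rewrite reflE.
  have -> : 2 * << e, e - r *: a >> / << e - r *: a, e - r *: a >> = 1.
    rewrite -[RHS](divff w0); congr (_ / _).
    rewrite !bfE aa (bfC a e Jt); have -> : << e, e >> = - (r * r) by rewrite rr opprK.
    by ring.
  by rewrite scale1r opprB addrC subrK linearZ.
have w1 : << e + r *: a, e + r *: a >> != 0.
  move: w0; rewrite !bfE aa (bfC a e Jt) => w0.
  apply: contraTneq ee => w1; rewrite -leNgt.
  have : 4 * << e, e >> = 0.
    have E : << e, e >> = - (r * r) by rewrite rr opprK.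
    by move: w0 w1 E; lra.
  by move/eqP; rewrite mulf_eq0 pnatr_eq0 /= => /eqP ->.
exists (refl (e + r *: a)); first exact: refl_O.
exists (- r); first by rewrite oppr_eq0 gt_eqF.
rewrite reflE.
have -> : 2 * << e, e + r *: a >> / << e + r *: a, e + r *: a >> = 1.
  rewrite -[RHS](divff w1); congr (_ / _).
  rewrite !bfE aa (bfC a e Jt); have -> : << e, e >> = - (r * r) by rewrite rr opprK.
  by ring.
by rewrite scale1r opprD addrA subrr sub0r linearN linearZ scaleNr.
Qed.

End householder.

Section stabilizer_algebra.
Context {R : realType} {n d m : nat} {G : lieGroupType R d} {M : manifoldType R m}.
Hypothesis n6 : (6 <= n)%N.
Hypothesis G_connected : connected [set: G].
Hypothesis G_finite_center : finite_set (center_set (G := G)).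
Local Notation N := (2 + n)%N.
Local Notation J := (signature_mx 2 N : 'M[R]_N).
Local Notation so := (so_set J).
Local Notation so1 := (so_set (signature_mx 1 (1 + n) : 'M[R]_(1 + n))).
Variable c0 : chart R d G.
Hypotheses (ac0 : atlas c0) (c01 : cdom c0 (1%g : G)).
Variable psi : 'I_d -> G -> R.
Hypothesis spsi : forall i, smooth_fun (psi i).
Hypothesis dpsi : forall v i, der_at c0 1%g v (psi i) = v 0 i.
Hypothesis psiE : forall D f, point_derivation (1%g : G) D -> smooth_fun f ->
  D f = der_at c0 1%g (\row_i D (psi i)) f.
Local Notation lbr := (lbr c0 psi).
Variable Phi : ((G -> R^o) -> (G -> R^o)) -> 'M[R]_N.
Variable om : {linear 'rV[R]_d -> 'M[R]_N}.
Variable omi : {linear 'M[R]_N -> 'rV[R]_d}.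
Hypothesis PhiE : forall v, Phi (Lop c0 v) = om v.
Hypothesis omK : cancel om omi.
Hypothesis om_so : forall v, so (om v).
Hypothesis omiK : forall A, so A -> om (omi A) = A.
Hypothesis om_lbr : forall v w, om (lbr v w) = mx_bracket (om v) (om w).
Hypothesis so_lie_o : forall A, so A -> @lie_o R 2 n A.
Variable act : G -> M -> M.
Hypothesis act_smooth : smooth_action act.
Variables (x : M) (e : 'rV[R]_N).
Hypothesis e_neg : bf J e e < 0.
Hypothesis null_e : forall v, (forall f, smooth_fun f -> fund act c0 v f x = 0) <-> e *m (om v)^T = 0.
Local Notation stabL := (subgroup_lie_algebra (stabilizer act x)).

(** A one-parameter subgroup fixes [x] exactly when its generator has zero fundamental field at [x];
    this replaces the quantifier over subgroups by a linear condition on [v]. *)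
Lemma stabilizer_lie_algebraP X : stabL X <-> exists2 v, X = Lop c0 v & e *m (om v)^T = 0.
Proof.
have [c ac cx] := atlas_cover x.
have [phi [sphi dphi phiE]] := ex_coord_fun ac cx.
have nullE v : (forall f, smooth_fun f -> fund act c0 v f x = 0) <-> ftan act c0 x phi v = 0.
  split=> [H|H f sf]; first by apply/rowP => i; rewrite !mxE H.
  exact: (ftan_fund0 act_smooth ac0 c01 phiE H sf).
split=> [[LX [gamma og Hg]]|[v -> ev]].
  have [v E] := lie_algebra_Lop psiE LX; exists v => //.
  apply/null_e/nullE; rewrite E in og.
  exact: (stab_ftan act_smooth sphi og Hg).
split; first exact: Lop_lie_algebra.
have [gamma og] := ex_one_parameter n6 G_connected G_finite_center ac0 c01 spsi dpsi psiE
  omK om_so omiK om_lbr so_lie_o v.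
exists gamma => // t.
have v0 : ftan act c0 x phi v = 0 by apply/nullE/null_e.
exact: (ftan_stab act_smooth ac0 c01 phiE v0 og).
Qed.

Lemma Lop0 : Lop c0 (0 : 'rV[R]_d) = 0 :> ((G -> R^o) -> (G -> R^o)).
Proof.
have := Lop_lin ac0 c01 (-1) (0 : 'rV[R]_d) 0; rewrite scaler0 addr0 => E.
by rewrite {1}E scaleN1r addNr.
Qed.

Lemma stabilizer_lie_subalgebra : lie_subalgebra field_bracket stabL.
Proof.
split.
- apply/stabilizer_lie_algebraP; exists 0; first by rewrite Lop0.
  by rewrite linear0 trmx0 mulmx0.
- move=> a X Y /stabilizer_lie_algebraP[v -> hv] /stabilizer_lie_algebraP[w -> hw].
  apply/stabilizer_lie_algebraP; exists (a *: v + w); first by rewrite Lop_lin.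
  by rewrite linearP linearD linearZ /= mulmxDr -scalemxAr hv hw scaler0 addr0.
- move=> X Y /stabilizer_lie_algebraP[v -> hv] /stabilizer_lie_algebraP[w -> hw].
  apply/stabilizer_lie_algebraP; exists (lbr v w); first by rewrite (Lop_lbr ac0 c01 psiE).
  rewrite om_lbr /mx_bracket linearB /= !trmx_mul mulmxBr !mulmxA hv hw.
  by rewrite !mul0mx subrr.
Qed.

Lemma lie_o1P B : @lie_o R 1 n B <-> so1 B.
Proof.
split; first exact: lie_o_so.
by apply: so1_lie_o => A; exact: so_lie_o.
Qed.

Lemma lie_o1_subalgebra : lie_subalgebra (@mx_bracket R (1 + n)) (@lie_o R 1 n).
Proof.
split.
- by apply/lie_o1P; rewrite /so_set /= trmx0 mul0mx mulmx0 addr0.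
- by move=> a X Y /lie_o1P hX /lie_o1P hY; apply/lie_o1P; exact: so_lin.
- by move=> X Y /lie_o1P hX /lie_o1P hY; apply/lie_o1P; exact: so_br.
Qed.

(** Conjugation by a reflection [c] carrying [e] to a multiple of the first basis vector turns the
    annihilator of [e] into the block matrices [emb B]; the isomorphism takes the lower right
    block. *)
Theorem stabilizer_isomorphic :
  lie_isomorphic field_bracket stabL (@mx_bracket R (1 + n)) (@lie_o R 1 n).
Proof.
pose e0 : 'rV[R]_(1 + (1 + n)) := row_mx 1%:M 0.
have e0e0 : bf J e0 e0 = -1 by exact: bf_e0.
have [c cO [k k0 ce]] := ex_refl e_neg e0e0.
have [cV cV' _] := OP cO.
have VO := OV cO.
have mulK (C X : 'M[R]_N) : c *m C = 1%:M -> c *m (C *m X *m c) *m C = X.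
  by move=> h; rewrite !mulmxA h mul1mx -mulmxA h mulmx1.
pose res (A : 'M[R]_(1 + (1 + n))) := drsubmx A.
have stabE A : so A -> e *m A^T = 0 -> mconj c A = emb (res (mconj c A)).
  move=> hA eA; apply: stab_block; first exact: conj_so.
  have Ae : A *m e^T = 0 by rewrite -[LHS]trmxK trmx_mul trmxK eA trmx0.
  have -> : e0^T = k^-1 *: (c *m e^T) by rewrite ce scalerA mulVf // scale1r.
  rewrite -scalemxAr /mconj -!mulmxA (mulmxA J) (mulmxA (J *m _)) (mulmxA _ c).
  by rewrite cV mul1mx Ae mulmx0 scaler0.
have resP v : e *m (om v)^T = 0 -> so1 (res (mconj c (om v))).
  move=> ev; apply/emb_so; rewrite -stabE //; exact: conj_so.
have res_lin a A B : res (mconj c (a *: A + B)) = a *: res (mconj c A) + res (mconj c B).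
  by rewrite conj_lin; apply/matrixP => i j; rewrite !mxE.
split; first exact: stabilizer_lie_subalgebra.
split; first exact: lie_o1_subalgebra.
exists (fun X => res (mconj c (Phi X))); split; first split.
- by move=> X /stabilizer_lie_algebraP[v -> ev]; rewrite PhiE; apply/lie_o1P; exact: resP.
- move=> X Y; rewrite !inE => /stabilizer_lie_algebraP[v -> ev] /stabilizer_lie_algebraP[w -> ew].
  rewrite !PhiE => E; congr Lop.
  have E2 : mconj c (om v) = mconj c (om w) by rewrite stabE // E -stabE.
  rewrite -[v]omK -[w]omK; congr (omi _).
  have inj A : (J *m c^T *m J) *m mconj c A *m c = A.
    by rewrite /mconj !mulmxA cV mul1mx -!mulmxA (mulmxA J) (mulmxA (J *m _)) cV mulmx1.
  by rewrite -[om v]inj E2 inj.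
- move=> B /lie_o1P hB.
  pose A := (J *m c^T *m J) *m (emb B : 'M[R]_N) *m c.
  have cA : mconj c A = emb B.
    exact: mulK cV'.
  have hA : so A.
    have E : mconj (J *m c^T *m J) (emb B : 'M[R]_N) = A.
      have JJ := @sigJJ R 2 N; have Jt := @sigT R 2 N.
      have Ec : J *m (J *m c^T *m J)^T *m J = c.
        by rewrite !trmx_mul trmxK Jt !mulmxA JJ mul1mx -mulmxA JJ mulmx1.
      by rewrite /mconj Ec.
    by rewrite -E; apply: conj_so => //; apply/emb_so.
  exists (Lop c0 (omi A)); last by rewrite PhiE omiK // cA /res /emb block_mxKdr.
  apply/stabilizer_lie_algebraP; exists (omi A) => //; rewrite omiK //.
  have Ae : A *m e^T = 0.
    rewrite /A -(mulmxA _ c) ce -scalemxAr -(mulmxA _ (emb B : 'M[R]_N)) [X in _ *m X]emb_e0.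
    by rewrite mulmx0 scaler0.
  by rewrite -[LHS]trmxK trmx_mul trmxK Ae trmx0.
- move=> a X Y /stabilizer_lie_algebraP[v -> ev] /stabilizer_lie_algebraP[w -> ew].
  by rewrite -Lop_lin // !PhiE linearP res_lin.
- move=> X Y /stabilizer_lie_algebraP[v -> ev] /stabilizer_lie_algebraP[w -> ew].
  rewrite -(Lop_lbr ac0 c01 psiE) !PhiE om_lbr conj_br // (stabE _ (om_so v) ev) (stabE _ (om_so w) ew).
  by rewrite emb_br /res /emb !block_mxKdr.
Qed.

End stabilizer_algebra.

Theorem theorem1p4 (R : realType) (n : nat) (hn : (6 <= n)%N)
  (d : nat) (G : lieGroupType R d)
  (G_connected : connected [set: G])
  (G_finite_center : finite_set (center_set (G := G)))
  (G_local_iso : locally_isomorphic_to_O G 2 n)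
  (m : nat) (M : manifoldType R m)
  (M_connected : connected [set: M])
  (act : G -> M -> M)
  (act_smooth : smooth_action act)
  (act_nontrivial : exists a x, act a x <> x)
  (g : gram_field (M := M))
  (g_lorentz : lorentz_metric g)
  (act_isometric : forall a : G, preserves_gram g (act a))
  (x : M) (stab_noncompact : ~ compact (stabilizer act x)) :
  lie_isomorphic
    field_bracket (subgroup_lie_algebra (stabilizer act x))
    (@mx_bracket R (1 + n)) (@lie_o R 1 n).
Proof.
have [c0 ac0 c01] := atlas_cover (1%g : G).
have [psi [spsi dpsi psiE]] := ex_coord_fun ac0 c01.
have [_ [[l0 lD _] isoG]] := G_local_iso.
case: isoG => Phi [[Pfun Pinj Psurj] Plin Pbr].
(* [l0] and [lD], extracted from the local isomorphism, say that [lie_o] is a linear subspace; this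
   is what [so_sub_lie_o] requires. *)
have soL A : so_set (signature_mx 2 (2 + n)) A -> @lie_o R 2 n A.
  by apply: so_sub_lie_o => //; exact: leq_trans hn.
have LA v : lie_algebra (Lop c0 v) by exact: Lop_lie_algebra.
have [om omE] : exists om : {linear 'rV[R]_d -> 'M[R]_(2 + n)}, forall v, om v = Phi (Lop c0 v).
  apply: (@ex_linear _ _ _ (fun v => Phi (Lop c0 v))) => k v w.
  by rewrite Lop_lin // Plin.
have om_so v : so_set (signature_mx 2 (2 + n)) (om v).
  by rewrite omE; apply: lie_o_so; exact: Pfun.
have om_inj v w : om v = om w -> v = w.
  rewrite !omE => E; apply: (Lop_inj spsi dpsi).
  by apply: Pinj => //; rewrite inE; exact: LA.
have om_surj A : so_set (signature_mx 2 (2 + n)) A -> exists v, om v = A.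
  move=> /soL /Psurj [X LX <-]; have [v ->] := lie_algebra_Lop psiE LX.
  by exists v.
(* A linear left inverse [omi] of [om] defined on all matrices: [om] is written as a matrix with
   independent rows, and its pseudo-inverse is applied to the vectorised argument. *)
pose Om := rowmx (fun v => mxvec (om v)).
have OmE v : v *m Om = mxvec (om v) by apply: rowmxE => k a b; rewrite !linearP.
have free : row_free Om.
  apply: inj_row_free => v; rewrite OmE => /eqP; rewrite mxvec_eq0 => /eqP ov.
  by apply: om_inj; rewrite ov linear0.
have [omi omiE] : exists omi : {linear 'M[R]_(2 + n) -> 'rV[R]_d}, forall A, omi A = mxvec A *m pinvmx Om.
  by apply: (@ex_linear _ _ _ (fun A => mxvec A *m pinvmx Om)) => k A B; rewrite linearP mulmxDl -scalemxAl.
have omK : cancel om omi by move=> v; rewrite omiE -OmE mulmxKp.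
have omiK A : so_set (signature_mx 2 (2 + n)) A -> om (omi A) = A.
  by move=> /om_surj [v <-]; rewrite omK.
have om_lbr v w : om (lbr c0 psi v w) = mx_bracket (om v) (om w).
  by rewrite !omE (Lop_lbr ac0 c01 psiE) Pbr.
have [c ac cx] := atlas_cover x.
have [phi [sphi dphi phiE]] := ex_coord_fun ac cx.
have nullE v : ftan act c0 x phi v = 0 <-> (forall f, smooth_fun f -> fund act c0 v f x = 0).
  split=> [H f sf|H]; last by apply/rowP => i; rewrite !mxE H.
  exact: (ftan_fund0 act_smooth ac0 c01 phiE H sf).
have [H|[e ee H]] := stabilizer_dichotomy hn G_connected G_finite_center ac0 c01 spsi dpsi psiE
  omK om_so omiK om_lbr soL act_smooth ac cx sphi dphi phiE g_lorentz act_isometric stab_noncompact.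
  exfalso; have [a [y]] := act_nontrivial; apply.
  have nx : null_at act c0 x by move=> v; apply/nullE.
  exact: (fixed_point_trivial hn G_connected act_smooth ac0 c01 psiE omK om_so omiK om_lbr
    g_lorentz act_isometric ac cx nx (fun=> erefl) M_connected a y).
apply: (stabilizer_isomorphic hn G_connected G_finite_center ac0 c01 spsi dpsi psiE
  (fun v => esym (omE v)) omK om_so omiK om_lbr soL act_smooth ee) => v.
by split=> [/nullE /H|/H /nullE].
Qed.
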